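(* For almost every IET $T_0=(\pi,\lambda)$ and every $\omega\in E_{cs}(T_0)\setminus E_s(T_0)$, every AIET $T\in\mathrm{Aff}(\gamma(T_0),\omega)$ is uniquely ergodic. Moreover, its unique invariant probability measure is singular with respect to Lebesgue measure.
   Context: Fix a finite alphabet $\mathcal A$ with $d\ge 2$ letters. An interval exchange transformation (IET) $T_0=(\pi,\lambda)$ is given by an irreducible pair $\pi=(\pi_0,\pi_1)$ of bijections $\mathcal A\to\{1,\dots,d\}$ and a length vector $\lambda\in\mathbb R_{>0}^{\mathcal A}$ with $\sum_\alpha\lambda_\alpha=1$. The map cuts $[0,1)$ into intervals $I_\alpha$, ordered by $\pi_0$, and translates them into the order given by $\pi_1$. Irreducible means that $\pi_1\circ\pi_0^{-1}(\{1,\dots,k\})=\{1,\dots,k\}$ implies $k=d$. ''Almost every IET'' means: for every irreducible $\pi$ and Lebesgue-almost every normalized $\lambda$. An AIET is a bijective, right-continuous, piecewise affine map of $[0,1)$ with $d$ continuity intervals labelled by $\mathcal A$ and positive slopes. Its log-slope vector $\omega$ is defined by requiring that $e^{\omega_\alpha}$ is the slope on the interval labelled $\alpha$. Rauzy–Veech induction, Keane's condition (infinite iterability of the induction) and the combinatorial rotation number $\gamma(\cdot)$ (the infinite path in the Rauzy graph) are the standard notions. $\mathrm{Aff}(\gamma,\omega)$ is the set of normalized AIETs with log-slope vector $\omega$ and combinatorial rotation number $\gamma$. $Z_{m,n}(T_0)$ denotes the product of the Zorich-accelerated height cocycle matrices between steps $m$ and $n$. It satisfies $q^{(n)}=Z_{m,n}q^{(m)}$,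 where $q^{(n)}_\alpha$ are the return times. For AIETs with the same combinatorial rotation number, the induced log-slopes satisfy $\omega^{(n)}=Z_{m,n}\omega^{(m)}$. For almost every $T_0$, $E_s(T_0)\subset E_{cs}(T_0)$ are the Oseledets subspaces of vectors with negative, respectively nonpositive, Lyapunov exponent for this cocycle over the Zorich map. *)

(* Defs.v *)
From HB Require Import structures.
From mathcomp Require Import all_boot all_order all_algebra.
From mathcomp Require Import all_classical all_reals all_analysis.
Set Implicit Arguments. Unset Strict Implicit. Unset Printing Implicit Defensive.
Import Order.TTheory GRing.Theory Num.Theory.
Local Open Scope classical_set_scope.
Local Open Scope ring_scope.

Section IET.
Variables (R : realType) (A : finType).

(* A pair pi = (pi_0, pi_1) is encoded by the two orders of the letters:
   pi.1 = letters listed by increasing pi_0 (domain order),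
   pi.2 = letters listed by increasing pi_1 (image order). *)
Definition is_pair (p : seq A * seq A) : bool :=
  perm_eq p.1 (enum A) && perm_eq p.2 (enum A).

Definition irreducible (p : seq A * seq A) : Prop :=
  forall k : nat, (1 <= k < #|A|)%N -> ~ (take k p.1 =i take k p.2).

(* An AIET (not necessarily normalized, used along the induction):
   domain orders/lengths atop/alen, image order/lengths abot/aimg;
   interval alpha has slope aimg alpha / alen alpha. *)
Record aiet := AIET { atop : seq A; abot : seq A; alen : A -> R; aimg : A -> R }.

Definition valid_aiet (T : aiet) : Prop :=
  is_pair (atop T, abot T) /\ (forall a, 0 < alen T a) /\ (forall a, 0 < aimg T a)
  /\ \sum_(a : A) alen T a = 1 /\ \sum_(a : A) aimg T a = 1.

Definition iet (p : seq A * seq A) (lam : A -> R) : aiet := AIET p.1 p.2 lam lam.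

Definition logslope (T : aiet) (a : A) : R := ln (aimg T a / alen T a).

Definition lpos (s : seq A) (len : A -> R) (a : A) : R :=
  \sum_(b <- take (index a s) s) len b.

Definition aiet_map (T : aiet) (x : R) : R :=
  if (0 <= x) && (x < 1) then
    \sum_(a : A)
      (if (lpos (atop T) (alen T) a <= x) && (x < lpos (atop T) (alen T) a + alen T a)
       then lpos (abot T) (aimg T) a
            + aimg T a / alen T a * (x - lpos (atop T) (alen T) a)
       else 0)
  else x.

Definition ins_after (w l : A) (s : seq A) : seq A :=
  flatten [seq (if x == w then [:: x; l] else [:: x]) | x <- rem l s].

(* (type, winner, loser); type = true for top (domain's last interval longer) *)
Definition rv_info (T : aiet) : option (bool * A * A) :=
  match ohead (rev (atop T)), ohead (rev (abot T)) with
  | Some a0, Some a1 =>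
      Some (if aimg T a1 < alen T a0 then (true, a0, a1) else (false, a1, a0))
  | _, _ => None
  end.

Definition rv_defined (T : aiet) : Prop :=
  match ohead (rev (atop T)), ohead (rev (abot T)) with
  | Some a0, Some a1 => alen T a0 <> aimg T a1
  | _, _ => False
  end.

Definition upd (f : A -> R) (a : A) (r : R) : A -> R :=
  fun b => if b == a then r else f b.

(* one (unnormalized) Rauzy-Veech step: induce on the interval obtained by
   removing the shorter of the last domain / last image interval *)
Definition rv_step (T : aiet) : aiet :=
  match rv_info T with
  | Some (true, a0, a1) =>
      let s0 := aimg T a0 / alen T a0 in
      AIET (atop T) (ins_after a0 a1 (abot T))
        (upd (alen T) a0 (alen T a0 - aimg T a1))
        (upd (upd (aimg T) a0 (aimg T a0 - s0 * aimg T a1)) a1 (s0 * aimg T a1))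
  | Some (false, a1, a0) =>
      let s1 := aimg T a1 / alen T a1 in
      AIET (ins_after a1 a0 (atop T)) (abot T)
        (upd (upd (alen T) a1 (alen T a1 - alen T a0 / s1)) a0 (alen T a0 / s1))
        (upd (aimg T) a1 (aimg T a1 - alen T a0))
  | None => T
  end.

Definition rv_iter (n : nat) (T : aiet) : aiet := iter n rv_step T.

Definition keane (T : aiet) : Prop := forall n, rv_defined (rv_iter n T).

Definition rv_type (T : aiet) (n : nat) : bool :=
  if rv_info (rv_iter n T) is Some (b, _, _) then b else false.

(* combinatorial rotation number: the infinite path in the Rauzy graph,
   i.e. the sequence of (vertex, arrow type) *)
Definition gamma (T : aiet) : nat -> (seq A * seq A) * bool :=
  fun n => ((atop (rv_iter n T), abot (rv_iter n T)), rv_type T n).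

(* height cocycle matrix of the n-th Rauzy step: q_loser += q_winner *)
Definition rv_mat (T : aiet) (n : nat) (v : A -> R) : A -> R :=
  if rv_info (rv_iter n T) is Some (_, w, l) then
    fun a => v a + (if a == l then v w else 0)
  else v.

Fixpoint rv_cocycle (T : aiet) (m : nat) (v : A -> R) : A -> R :=
  if m is m'.+1 then rv_mat T m' (rv_cocycle T m' v) else v.

Definition zorich_next (t : nat -> bool) (n : nat) : nat :=
  match pselect (exists k, (n < k)%N && (t k != t n)) with
  | left h => ex_minn h
  | right _ => n.+1
  end.

Fixpoint zorich_time (T : aiet) (j : nat) : nat :=
  if j is j'.+1 then zorich_next (rv_type T) (zorich_time T j') else 0%N.

Definition zorich_cocycle (T : aiet) (j : nat) (v : A -> R) : A -> R :=
  rv_cocycle T (zorich_time T j) v.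

Definition l1norm (v : A -> R) : R := \sum_(a : A) `|v a|.

(* Oseledets subspaces: negative / nonpositive Lyapunov exponent
   limsup_j (1/j) log |Z_{0,j} v| *)
Definition in_Es (T : aiet) (v : A -> R) : Prop :=
  v = (fun _ => 0) \/
  exists c : R, c < 0 /\
    \forall j \near \oo, ln (l1norm (zorich_cocycle T j v)) / j%:R <= c.

Definition in_Ecs (T : aiet) (v : A -> R) : Prop :=
  forall e : R, 0 < e ->
    \forall j \near \oo, ln (l1norm (zorich_cocycle T j v)) / j%:R <= e.

Definition in_Aff (g : nat -> (seq A * seq A) * bool) (om : A -> R) (T : aiet) : Prop :=
  valid_aiet T /\ (forall a, logslope T a = om a) /\ keane T /\ gamma T = g.

Definition unit_itv : set (measurableTypeR R) := [set x | 0 <= x < 1].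

Definition invariant_prob (T : aiet) (P : probability (measurableTypeR R) R) : Prop :=
  P unit_itv = 1%E /\
  forall B : set (measurableTypeR R), measurable B ->
    P (aiet_map T @^-1` B) = P B.

Definition uniquely_ergodic (T : aiet) : Prop :=
  (exists P, invariant_prob T P) /\
  forall P1 P2, invariant_prob T P1 -> invariant_prob T P2 ->
    forall B : set (measurableTypeR R), measurable B -> P1 B = P2 B.

Definition invariant_measure_singular (T : aiet) : Prop :=
  forall P, invariant_prob T P ->
    exists B : set (measurableTypeR R), measurable B /\ P B = 1%E /\
      lebesgue_measure B = 0%E.

Definition lebesgue_null (S : set (A -> R)) : Prop :=
  forall e : R, 0 < e -> exists a b : nat -> A -> R,
    S `<=` \bigcup_n [set x | forall i, a n i <= x i <= b n i] /\
    forall N, \sum_(n < N) \prod_(i : A) Num.max (b n i - a n i) 0 <= e.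

Definition normalize (lam : A -> R) : A -> R := fun a => lam a / \sum_(b : A) lam b.

Definition good_iet (p : seq A * seq A) (lam : A -> R) : Prop :=
  keane (iet p lam) /\
  forall om : A -> R, in_Ecs (iet p lam) om -> ~ in_Es (iet p lam) om ->
    forall T : aiet, in_Aff (gamma (iet p lam)) om T ->
      uniquely_ergodic T /\ invariant_measure_singular T.

End IET.

(* Main.v *)
(* Let T be an affine exchange with the rotation number of an exchange T0. The lengths of T0 and
   the masses given by an invariant probability of T to the bases of the Rokhlin towers of T obey
   the same backward recursion. Its positive solutions form a single ray as soon as positive
   words recur, so every floor over the letter a has mass lam_a, the induced length of T0. This
   determines the invariant probability, and also provides its distribution function.

   Let H_n be the sum over the floors of level n of sqrt (Leb * mass). It is nonincreasing, and
   if it tends to 0 then the invariant probability is singular. Otherwise consider a stretch of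
   the induction made of many positive words. The loss of H_n there bounds the defects by which
   the ratios of the two lengths fail to be preserved by the moves; as every letter wins often,
   all ratios are nearly equal before and after, so the log-slopes are nearly 0. Quantitatively
   the square of the induced log-slope vector is bounded by the loss of H_n. Hence it is summable
   over the return times to such stretches.

   For almost every T0 a vector that is square summable along the return times decays
   exponentially: for cylinders that are independent up to a constant factor, a maximal
   inequality bounds the set of paths along which the energy of such a vector is often not
   controlled by its first term. Kerckhoff's estimate gives exponential moments for the growth of
   the heights between returns. Together with the exponential growth of the heights in Zorich
   time, the log-slope vector then lies in E_s. *)
Require Import Defs.
From HB Require Import structures.
From mathcomp Require Import all_boot all_order all_algebra.
From mathcomp Require Import all_classical all_reals all_analysis measurable_realfun.
From mathcomp Require Import zify ring lra.
Set Implicit Arguments. Unset Strict Implicit. Unset Printing Implicit Defensive.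
Import Order.TTheory GRing.Theory Num.Theory.

(** * Rauzy moves on pairs of orders *)

Section Combinatorics.
Variables (A : finType) (x0 : A).
Notation pair := (seq A * seq A)%type.
Implicit Types (p : pair) (b : bool) (u : seq bool).

(** The exceptional set of lengths must be fixed before the log-slope vector, which ranges over
    uncountably many values. All genericity is therefore a property of the sequence of types alone,
    and finite dimension makes it uniform over vectors: along a given path the vectors of bounded
    energy form a subspace, so one constant bounds all their energies. No invariant measure for the
    induction is constructed. The weight [wgt], a ratio of products of heights, plays the role of a
    law on paths; a return word ends with a positive word, which makes the heights comparable, and
    this is the source of the near independence of the future from the past. The maximal inequality
    then does the work of an ergodic theorem. Null sets of paths become null sets of lengths through
    cones: the matrices are integral and unimodular, so a truncated cone is covered by grid boxes
    whose total volume is at most a constant, depending on the truncation, times the weight of the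
    word. *)

Definition win p b : A := if b then last x0 p.1 else last x0 p.2.
Definition los p b : A := win p (~~ b).
Arguments win : simpl never.
Arguments los : simpl never.
Definition rz p b : pair :=
  if b then (p.1, ins_after (win p b) (los p b) p.2)
  else (ins_after (win p b) (los p b) p.1, p.2).
Definition rzw p u : pair := foldl rz p u.
Definition swap p : pair := (p.2, p.1).

Lemma rzw_cat p u v : rzw p (u ++ v) = rzw (rzw p u) v.
Proof. by rewrite /rzw foldl_cat. Qed.

Lemma rzw_rcons p u b : rzw p (rcons u b) = rz (rzw p u) b.
Proof. by rewrite -cats1 rzw_cat. Qed.

Lemma rz_swap p b : rz (swap p) b = swap (rz p (~~ b)).
Proof. by case: b. Qed.

Lemma win_swap p b : win (swap p) b = win p (~~ b).
Proof. by case: b. Qed.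

Lemma swapK p : swap (swap p) = p.
Proof. by case: p. Qed.

Lemma is_pair_swap p : is_pair (swap p) = is_pair p.
Proof. by rewrite /is_pair andbC. Qed.

Lemma irreducible_swap p : irreducible p -> irreducible (swap p).
Proof. by move=> h k kd e; apply: (h k kd) => x; rewrite e. Qed.

Lemma rzw_swap p u : rzw (swap p) u = swap (rzw p (map negb u)).
Proof. by elim: u p => //= b u IH p; rewrite rz_swap IH. Qed.

Lemma flatten_single (w l : A) (s : seq A) : w \notin s ->
  flatten [seq (if x == w then [:: x; l] else [:: x]) | x <- s] = s.
Proof.
elim: s => //= x s IH; rewrite inE negb_or eq_sym => /andP[/negPf-> /IH ->].
by [].
Qed.

Lemma ins_afterE (w l : A) (s1 s2 : seq A) :
  uniq (s1 ++ w :: rcons s2 l) ->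
  ins_after w l (s1 ++ w :: rcons s2 l) = s1 ++ w :: l :: s2.
Proof.
move=> us; rewrite /ins_after.
have -> : rem l (s1 ++ w :: rcons s2 l) = s1 ++ w :: s2.
  rewrite rem_filter // (_ : s1 ++ w :: rcons s2 l = rcons (s1 ++ w :: s2) l); last first.
    by rewrite rcons_cat.
  rewrite filter_rcons /= eqxx /=; apply/all_filterP/allP => x xs /=.
  move: us; rewrite (_ : s1 ++ w :: rcons s2 l = rcons (s1 ++ w :: s2) l); last first.
    by rewrite rcons_cat.
  by rewrite rcons_uniq => /andP[+ _]; apply: contra => /eqP <-.
move: us; rewrite cat_uniq => /and3P[_ /hasPn wh /= /andP[w2 _]].
have w1 : w \notin s1 by apply: wh; rewrite inE eqxx.
rewrite map_cat flatten_cat /= eqxx flatten_single //= flatten_single //.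
by move: w2; rewrite mem_rcons inE negb_or => /andP[].
Qed.

Lemma is_pair_uniq p : is_pair p -> uniq p.1 /\ uniq p.2.
Proof.
by case/andP=> /perm_uniq -> /perm_uniq ->; rewrite enum_uniq.
Qed.

Lemma is_pair_mem p : is_pair p -> (forall a, a \in p.1) /\ (forall a, a \in p.2).
Proof.
by case/andP=> h1 h2; split=> a; rewrite ?(perm_mem h1) ?(perm_mem h2) mem_enum.
Qed.

Lemma is_pair_size p : is_pair p -> size p.1 = #|A| /\ size p.2 = #|A|.
Proof. by case/andP=> /perm_size -> /perm_size ->; rewrite -cardE. Qed.

Hypothesis hA : (2 <= #|A|)%N.

Definition okp p : Prop := is_pair p /\ irreducible p.

Lemma okp_swap p : okp p -> okp (swap p).
Proof. by case=> h1 /irreducible_swap h2; split; rewrite ?is_pair_swap. Qed.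

Lemma last_split (s : seq A) : (0 < size s)%N -> exists s', s = rcons s' (last x0 s).
Proof. by case/lastP: s => // s x _; exists s; rewrite last_rcons. Qed.

(** Equal last letters would leave the same first [#|A|.-1] letters in both rows, against
    irreducibility. *)
Lemma last_neq p : okp p -> last x0 p.1 <> last x0 p.2.
Proof.
move=> [hp hi] e.
have [s1 s2] := is_pair_size hp; have [u1 u2] := is_pair_uniq hp.
have [m1 m2] := is_pair_mem hp.
have [t1 e1] : exists t, p.1 = rcons t (last x0 p.1) by apply: last_split; lia.
have [t2 e2] : exists t, p.2 = rcons t (last x0 p.2) by apply: last_split; lia.
apply: (hi #|A|.-1); first by lia.
have z1 : size t1 = #|A|.-1 by move: s1; rewrite e1 size_rcons; lia.
have z2 : size t2 = #|A|.-1 by move: s2; rewrite e2 size_rcons; lia.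
rewrite e1 e2 -!cats1 !take_cat z1 z2 ltnn subnn take0 !cats0.
move=> x; move: (m1 x) (m2 x) u1 u2; rewrite e1 e2 !mem_rcons !inE !rcons_uniq -e.
case: eqP => [-> _ _|_ /= -> ->//].
by case/andP => /negPf -> _ /andP[/negPf -> _].
Qed.

Lemma win_los p b : okp p -> win p b != los p b.
Proof.
move/last_neq => h; apply/eqP; case: b; rewrite /los /win /= //.
by move=> e; apply: h.
Qed.

Lemma rz_top_shape p : okp p -> exists s1 s2,
  p.2 = s1 ++ win p true :: rcons s2 (los p true) /\
  rz p true = (p.1, s1 ++ win p true :: los p true :: s2).
Proof.
move=> ok; have [hp hi] := ok.
have [_ sz2] := is_pair_size hp; have [_ u2] := is_pair_uniq hp.
have [_ m2] := is_pair_mem hp.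
have [t2 e2] : exists t, p.2 = rcons t (last x0 p.2) by apply: last_split; lia.
have wt : win p true \in t2.
  move: (m2 (win p true)); rewrite e2 mem_rcons inE => /orP[/eqP h|//].
  by have /eqP := win_los true ok; rewrite h.
move: u2 e2; case/splitPr: wt => s1 s2 u2 e2.
exists s1, s2; have e : p.2 = s1 ++ win p true :: rcons s2 (los p true).
  by rewrite {1}e2 rcons_cat.
by split => //; rewrite /rz {1}e ins_afterE // -e.
Qed.

Lemma is_pair_rz_top p : okp p -> is_pair (rz p true).
Proof.
move=> ok; have [hp hi] := ok; have [s1 [s2 [e ->]]] := rz_top_shape ok.
rewrite /is_pair /=; case/andP: hp => -> h2 /=; apply: perm_trans h2.
rewrite e perm_cat2l perm_cons perm_sym perm_rcons //.
Qed.

(** A common prefix ending at or before the winner is a common prefix of the old rows. A longer one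
    contains the winner, which is last in the unchanged top row, so it is the whole row. *)
Lemma irreducible_rz_top p : okp p -> irreducible (rz p true).
Proof.
move=> ok; have [hp hi] := ok; have [s1 [s2 [e ->]]] := rz_top_shape ok.
have [sz1 sz2] := is_pair_size hp; have [u1 u2] := is_pair_uniq hp.
move=> k kd /= h.
case: (leqP k (size s1).+1) => ks.
  apply: (hi k kd) => x; rewrite h e !take_cat.
  case: ltnP => // k1; have -> // : take (k - size s1) [:: win p true, los p true & s2] =
    take (k - size s1) (win p true :: rcons s2 (los p true)).
  have : (k - size s1 <= 1)%N by lia.
  by case: (k - size s1)%N => [|[|]] //=; rewrite !take0.
have wk : win p true \in take k (s1 ++ win p true :: los p true :: s2).
  rewrite take_cat ltnNge (_ : (size s1 <= k)%N) /=; last by lia.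
  rewrite mem_cat; apply/orP; right.
  have : (0 < k - size s1)%N by lia.
  by case: (k - size s1)%N => //= n _; rewrite inE eqxx.
move: wk; rewrite -h => wk.
have [t e1] : exists t, p.1 = rcons t (win p true) by apply: last_split; lia.
move: u1 sz1 wk; rewrite e1 rcons_uniq size_rcons => /andP[wt _] szt.
rewrite -cats1 take_cat; case: ltnP => [_ /mem_take|tk]; first by rewrite (negPf wt).
by rewrite (_ : (k - size t = 0)%N) ?cats0 ?(negPf wt) //; lia.
Qed.

Lemma okp_rz p b : okp p -> okp (rz p b).
Proof.
move=> ok; case: b; first by split; [exact: is_pair_rz_top|exact: irreducible_rz_top].
have ok' := okp_swap ok.
have -> : rz p false = swap (rz (swap p) true) by rewrite rz_swap swapK.
by apply: okp_swap; split; [exact: is_pair_rz_top|exact: irreducible_rz_top].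
Qed.

Lemma okp_rzw p u : okp p -> okp (rzw p u).
Proof. by elim: u p => //= b u IH p ok; apply/IH/okp_rz. Qed.

Lemma uniq_cat_inj (w : A) (t1 t2 s1 s2 : seq A) : uniq (t1 ++ w :: t2) ->
  t1 ++ w :: t2 = s1 ++ w :: s2 -> t1 = s1 /\ t2 = s2.
Proof.
move=> uu e; have i1 : index w (t1 ++ w :: t2) = size t1.
  rewrite index_cat ifN /= ?eqxx ?addn0 //.
  by move: uu; rewrite cat_uniq => /and3P[_ /hasPn /(_ _ (mem_head _ _))].
have i2 : index w (t1 ++ w :: t2) = size s1.
  rewrite e index_cat ifN /= ?eqxx ?addn0 //.
  by move: uu; rewrite e cat_uniq => /and3P[_ /hasPn /(_ _ (mem_head _ _))].
by have/eqP := e; rewrite eqseq_cat -?i1 ?i2 // => /andP[/eqP -> /eqP [->]].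
Qed.

(** Top moves keep the winner and rotate cyclically the part of the bottom row to its right, so
    every letter there becomes last in turn. *)
Lemma rotate_bottom p x s1 s2 s3 : okp p ->
  p.2 = s1 ++ win p true :: s2 ++ x :: s3 -> exists k, last x0 (rzw p (nseq k true)).2 = x.
Proof.
elim: {s3}(size s3) {-2}s3 (erefl (size s3)) p s2 => [|n IH] s3 sz p s2 ok e.
  exists 0%N; rewrite /= e; case: s3 sz {e} => // _.
  by rewrite last_cat /= last_cat.
have [t1 [t2 [e2 e3]]] := rz_top_shape ok.
have [t3 e4] : exists t, s3 = rcons t (last x0 s3) by apply: last_split; rewrite sz.
have e5 : rcons (t1 ++ win p true :: t2) (los p true) =
          rcons (s1 ++ win p true :: s2 ++ x :: t3) (last x0 s3).
  rewrite rcons_cat /= -e2 e {1}e4 !rcons_cat /= rcons_cat //.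
have [e6 e7] := rcons_inj e5.
have [_ u2] := is_pair_uniq ok.1.
have e8 : t1 = s1 /\ t2 = s2 ++ x :: t3.
  apply: uniq_cat_inj e6; move: u2; rewrite e2 -rcons_cons -rcons_cat rcons_uniq.
  by case/andP.
case: e8 => e8 e9.
have [|||k hk] := IH t3 _ (rz p true) (los p true :: s2).
- by move: sz; rewrite e4 size_rcons => -[].
- exact: okp_rz.
- by rewrite e3 /= /win /= -/(win p true) e8 e9.
- by exists k.+1.
Qed.

(** * Every letter of an irreducible pair eventually plays *)

Section NeverPlays.
Variables (p : pair) (ok : okp p).

Definition never_plays (p : pair) a := `[< forall u b, a != win (rzw p u) b >].

Definition after_never (s : seq A) a :=
  forall x, never_plays p x -> (index x s < index a s)%N.

(** A never-playing letter to the right of the winner would be brought to the end of the bottom row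
    by [rotate_bottom], and would then play. *)
Lemma winner_after_never u : after_never (rzw p u).2 (win (rzw p u) true).
Proof.
set p' := rzw p u; have ok' : okp p' := okp_rzw u ok.
have [s1 [s2 [e _]]] := rz_top_shape ok'; have [_ u2] := is_pair_uniq ok'.1.
have [_ m2] := is_pair_mem ok'.1.
move=> x /asboolP xX.
have xw : x != win p' true := xX u true.
have w1 : win p' true \notin s1.
  by move: u2; rewrite e cat_uniq => /and3P[_ /hasPn /(_ _ (mem_head _ _))].
rewrite e !index_cat (negPf w1) /= eqxx addn0.
have := m2 x; rewrite e mem_cat; case: ifP => [x1 _|_ /=]; first by rewrite index_mem.
rewrite inE (negPf xw) /= mem_rcons inE => /orP[/eqP xl|].
  by have := xX u false; rewrite xl /los /= eqxx.
move=> x2; have [t1 [t2 e2]] : exists t1 t2, s2 = t1 ++ x :: t2.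
  by case/splitPr: x2 => t1 t2; exists t1, t2.
move: e; rewrite e2 => e.
have [] := @rotate_bottom p' x s1 t1 (rcons t2 (los p' true)) ok'.
  by rewrite e rcons_cat /=.
move=> k hk; have := xX (u ++ nseq k true) false.
by rewrite rzw_cat /win hk eqxx.
Qed.

Lemma loser_after_never u : after_never (rzw p u).2 (win (rzw p u) false).
Proof.
set p' := rzw p u; have ok' : okp p' := okp_rzw u ok.
have [_ u2] := is_pair_uniq ok'.1; have [_ m2] := is_pair_mem ok'.1.
have [_ sz2] := is_pair_size ok'.1.
have [t e] : exists t, p'.2 = rcons t (win p' false) by apply: last_split; lia.
move=> x /asboolP xX; have xw : x != win p' false := xX u false.
move: u2 (m2 x); rewrite e rcons_uniq mem_rcons inE (negPf xw) /= => /andP[wt _] xt.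
by rewrite -cats1 !index_cat xt (negPf wt) /= eqxx addn0 index_mem.
Qed.

(** Never-playing letters lie to the left of the winner and the move only alters the row to its
    right, so comparisons with them do not change. *)
Lemma after_never_rz u b a :
  after_never (rzw p (rcons u b)).2 a <-> after_never (rzw p u).2 a.
Proof.
set p' := rzw p u; have ok' : okp p' := okp_rzw u ok.
rewrite rzw_rcons -/p'; case: b => //.
have wt := @winner_after_never u; rewrite -/p' in wt.
have [s1 [s2 [e ->]]] := rz_top_shape ok'; have [_ u2] := is_pair_uniq ok'.1.
have [_ m2] := is_pair_mem ok'.1.
have w1 : win p' true \notin s1.
  by move: u2; rewrite e cat_uniq => /and3P[_ /hasPn /(_ _ (mem_head _ _))].
suff h x : never_plays p x ->
  (index x (s1 ++ win p' true :: los p' true :: s2) <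
   index a (s1 ++ win p' true :: los p' true :: s2))%N = (index x p'.2 < index a p'.2)%N.
  by split=> H x Xx; move: (H x Xx); rewrite /= h.
move=> Xx; have x1 : x \in s1.
  have := wt x Xx; rewrite e !index_cat (negPf w1) /= eqxx addn0.
  by case: ifP => // _; lia.
rewrite e !index_cat x1; case: ifP => // a1.
move: x1; rewrite -index_mem => x1.
by apply/idP/idP => _; apply: (leq_trans x1); apply: leq_addr.
Qed.

Lemma after_neverE u a : after_never (rzw p u).2 a <-> after_never p.2 a.
Proof.
by elim/last_ind: u => //= u b IH; rewrite after_never_rz.
Qed.

(** A letter that plays is at that moment to the right of all never-playing ones; invariance carries
    this back to the initial row. *)
Lemma plays_after_never a : ~ never_plays p a -> after_never p.2 a.
Proof.
move=> /negP/asboolPn/existsNP[u /existsNP [b /negP]]; rewrite negbK => /eqP ->.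
rewrite -(after_neverE u).
by case: b; [exact: winner_after_never|exact: loser_after_never].
Qed.

End NeverPlays.

Lemma never_plays_swap p a : never_plays (swap p) a = never_plays p a.
Proof.
apply/asboolP/asboolP => h u b.
  by have := h (map negb u) (~~ b); rewrite rzw_swap win_swap negbK mapK //; exact: negbK.
by rewrite rzw_swap win_swap; exact: h.
Qed.

Lemma take_before (X : pred A) (s : seq A) : uniq s -> (forall a, a \in s) ->
  (forall x a, X x -> ~~ X a -> (index x s < index a s)%N) -> take #|X| s =i X.
Proof.
move=> us ms h x.
have sz : size s = #|A|.
  by rewrite cardE; apply: perm_size; apply: uniq_perm => // [|a]; rewrite ?enum_uniq // ms mem_enum.
have tk : forall n, (n <= #|A|)%N -> #|[set y in take n s]| = n.
  by move=> n nA; rewrite cardsE (card_uniqP _) ?take_uniq // size_take sz; case: ltnP => //; lia.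
have it n y : (y \in take n s) = (index y s < n)%N.
  by rewrite in_take // ms.
rewrite it; case Xx: (X x); rewrite [RHS]/in_mem /= Xx.
  have ix : (index x s < #|A|)%N by rewrite -sz index_mem.
  rewrite -(tk (index x s).+1) //; apply: subset_leq_card; apply/fintype.subsetP => y.
  rewrite inE it ltnS => yx; apply: contraLR yx => /= Xy.
  by rewrite -ltnNge; apply: h.
apply/negbTE; rewrite -leqNgt -[leqRHS]tk; last by apply: ltnW; rewrite -sz index_mem.
apply: subset_leq_card; apply/fintype.subsetP => y Xy; rewrite inE it.
by apply: h => //; rewrite Xx.
Qed.

(** Otherwise the never-playing letters form an initial segment of both rows, nonempty by assumption
    and proper because the last letters play, which irreducibility forbids. *)
Lemma every_letter_plays p a : okp p -> exists u b, a = win (rzw p u) b.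
Proof.
move=> ok; apply: contrapT => na.
have Xa : never_plays p a by apply/asboolP => u b; apply/eqP => e; apply: na; exists u, b.
have [hp hi] := ok; have [u1 u2] := is_pair_uniq hp; have [m1 m2] := is_pair_mem hp.
pose X := never_plays p.
apply: (hi #|X|).
  have h1 : (0 < #|X|)%N by apply/card_gt0P; exists a.
  rewrite h1 ltnNge; apply/negP => h2.
  have : X (win p true).
    apply/negPn/negP => nX; move: h2; apply/negP; rewrite -ltnNge.
    apply: (@leq_ltn_trans #|predC1 (win p true)|); last by rewrite cardC1; lia.
    by apply: subset_leq_card; apply/fintype.subsetP => x Xx; rewrite !inE; apply: contraNneq nX => <-.
  by move/asboolP/(_ [::] true); rewrite eqxx.
move=> x; rewrite take_before // ?take_before //.
  by move=> y c Xy /negP /(plays_after_never ok); apply.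
move=> y c Xy Xc.
have /negP := Xc; rewrite /X -never_plays_swap => /(plays_after_never (okp_swap ok)).
by apply; rewrite never_plays_swap.
Qed.

Lemma win_rz p b : win (rz p b) b = win p b.
Proof. by case: b. Qed.

Definition inside (B : {set A}) p := (win p true \in B) && (win p false \in B).

Lemma inside_win (B : {set A}) p b : inside B p -> win p b \in B.
Proof. by case/andP => h1 h2; case: b. Qed.

(** Some letter outside [B] plays eventually; the shortest prefix after which the last letters are
    not both in [B] is taken. Along it only letters of [B] win or lose. *)
Lemma first_exit p (B : {set A}) : okp p -> B != [set: A] ->
  exists u, (forall i, (i < size u)%N -> inside B (rzw p (take i u))) /\
    ~~ inside B (rzw p u).
Proof.
move=> ok BT; have [c cB] : exists c, c \notin B.
  apply: contrapT => h; move/eqP: BT; apply; apply/setP => x; rewrite inE.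
  by apply/negPn/negP => xB; apply: h; exists x.
have [u0 [b e]] := every_letter_plays c ok.
pose P i := ~~ inside B (rzw p (take i u0)).
have exP : exists i, P i.
  exists (size u0); rewrite /P take_size; apply: contra cB => h.
  by rewrite e inside_win.
case: (ex_minnP exP) => i Pi imin.
have iu : (i <= size u0)%N.
  apply: imin; rewrite /P take_size; apply: contra cB => h.
  by rewrite e inside_win.
exists (take i u0); split=> // j.
rewrite size_take_min (minn_idPl iu) => ji.
rewrite take_takel ?(ltnW ji) //; apply/negPn/negP => Pj.
by move: (imin j Pj); rewrite leqNgt ji.
Qed.

(** At the first exit from a set the latest winner is still at the end of its row and in the set, so
    the other last letter is outside. This is applied to [S] or to its complement, whichever
    contains both last letters; for the complement the opposite type is then chosen. *)
Lemma mixed_play p (S : {set A}) : okp p -> S != finset.set0 -> S != [set: A] ->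
  exists u b, win (rzw p u) b \in S /\ los (rzw p u) b \notin S.
Proof.
move=> ok S0 ST.
have key (B : {set A}) : inside B p -> B != [set: A] ->
    exists u b, win (rzw p u) b \in B /\ los (rzw p u) b \notin B.
  move=> ib BT; have [u [h1 h2]] := first_exit ok BT.
  case/lastP: u h1 h2 => [|u b] h1 h2; first by rewrite ib in h2.
  have ub : inside B (rzw p u).
    by have := h1 (size u); rewrite size_rcons -cats1 take_size_cat //; apply.
  have wB : win (rzw p (rcons u b)) b \in B by rewrite rzw_rcons win_rz inside_win.
  exists (rcons u b), b; split=> //; apply: contra h2; rewrite /los /inside.
  by case: b wB {h1} => -> /=; [move=> ->|move=> ->].
have [i1|i1] := boolP (inside S p); first exact: key.
have [i2|i2] := boolP (inside (finset.setC S) p).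
  have [|u [b []]] := key _ i2.
    by apply: contra S0 => /eqP e; rewrite -(finset.setCK S) e finset.setCT.
  by rewrite !inE negbK => h1 h2; exists u, (~~ b); rewrite /los negbK.
move: i1 i2; rewrite /inside !inE !negb_and !negbK.
case h1: (win p true \in S) => /=; case h2 : (win p false \in S) => //= _ _.
  by exists [::], true; rewrite /= h1 /los h2.
by exists [::], false; rewrite /= h2 /los h1.
Qed.

(** Evolution of the support of a nonnegative vector under the height step: the loser receives the
    value of the winner. *)
Definition sstep p b (S : {set A}) : {set A} :=
  if win p b \in S then los p b |: S else S.

Fixpoint sword p u (S : {set A}) : {set A} :=
  if u is b :: u' then sword (rz p b) u' (sstep p b S) else S.

Lemma sword_cat p u v S : sword p (u ++ v) S = sword (rzw p u) v (sword p u S).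
Proof. by elim: u p S => //= b u IH p S; rewrite IH. Qed.

Lemma sstep_sub p b (S : {set A}) : S \subset sstep p b S.
Proof. by rewrite /sstep; case: ifP => // _; apply: finset.subsetUr. Qed.

Lemma sword_sub p u (S : {set A}) : S \subset sword p u S.
Proof.
by elim: u p S => //= b u IH p S; apply: fintype.subset_trans (sstep_sub p b S) (IH _ _).
Qed.

Lemma swordT p u : sword p u [set: A] = [set: A].
Proof. by apply/eqP; rewrite finset.eqEsubset finset.subsetT sword_sub. Qed.

(* The cocycle matrix of [u] has positive entries: every singleton spreads to all letters. *)
Definition posw p u : bool := [forall c, sword p u [set c] == [set: A]].

Lemma posw_catr p u v : posw p u -> posw p (u ++ v).
Proof. by move/forallP => h; apply/forallP => c; rewrite sword_cat (eqP (h c)) swordT. Qed.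

Lemma grow_support p (S : {set A}) : okp p -> S != finset.set0 ->
  exists u, sword p u S = [set: A].
Proof.
elim: {S}#|~: S| {-2}S (leqnn #|~: S|) p => [|n IH] S sz p ok S0.
  exists [::] => /=; move: sz; rewrite leqn0 cards_eq0 => /eqP e.
  by rewrite -(finset.setCK S) e finset.setC0.
have [->|ST] := eqVneq S [set: A]; first by exists [::].
have [u [b [h1 h2]]] := mixed_play ok S0 ST.
have sub : (los (rzw p u) b |: S) \subset sword p (rcons u b) S.
  rewrite -cats1 sword_cat /= /sstep (fintype.subsetP (sword_sub p u S) _ h1).
  by apply: finset.setUS; apply: sword_sub.
have [|||v hv] := IH (sword p (rcons u b) S) _ (rzw p (rcons u b)).
- rewrite -ltnS; apply: leq_trans sz; apply: proper_card; rewrite finset.properEneq finset.setCS sword_sub andbT.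
  apply: contraNneq h2 => e; have := fintype.subsetP sub (los (rzw p u) b).
  by rewrite !inE eqxx /= -[sword _ _ _]finset.setCK e finset.setCK; apply.
- exact: okp_rzw.
- apply: contraNneq S0 => e; rewrite -finset.subset0 -e; exact: sword_sub.
by exists (rcons u b ++ v); rewrite sword_cat.
Qed.

Lemma positive_word p : okp p -> exists u, posw p u.
Proof.
move=> ok; suff [u hu] : exists u, all (fun c => sword p u [set c] == [set: A]) (enum A).
  by exists u; apply/forallP => c; apply: (allP hu); rewrite mem_enum.
elim: (enum A) => [|c s [u hu]]; first by exists [::].
have [|v hv] := @grow_support (rzw p u) (sword p u [set c]) (okp_rzw u ok).
  apply/finset.set0Pn; exists c; apply: (fintype.subsetP (sword_sub p u [set c])).
  by rewrite inE.
exists (u ++ v); rewrite /= sword_cat hv eqxx /=; apply/allP => x /(allP hu) /eqP e.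
by rewrite sword_cat e swordT.
Qed.

(** There are finitely many pairs, all listed by permutations of the alphabet; constants thereby
    become independent of the state. *)
Lemma uniform_bound (Q : pair -> nat -> Prop) :
  (forall p m n, (m <= n)%N -> Q p m -> Q p n) ->
  (forall p, okp p -> exists n, Q p n) -> exists n, forall p, okp p -> Q p n.
Proof.
move=> mono ex.
have [n hn] : exists n, forall p, p \in allpairs (@Datatypes.pair _ _)
    (permutations (enum A)) (permutations (enum A)) -> okp p -> Q p n.
  elim: (allpairs _ _ _) => [|q s [n hn]]; first by exists 0%N.
  have [okq|nq] := EM (okp q); last first.
    exists n => p; rewrite inE => /orP[/eqP -> //|]; exact: hn.
  have [m hm] := ex q okq; exists (maxn m n) => p; rewrite inE => /orP[/eqP -> _|pin okp_].
    exact: mono (leq_maxl _ _) hm.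
  exact: mono (leq_maxr _ _) (hn p pin okp_).
exists n => p ok; apply: hn => //; case: (ok) => /andP[h1 h2] _.
by rewrite [p]surjective_pairing; apply: allpairs_f; rewrite mem_permutations.
Qed.

Lemma uniform_positive : exists n, (0 < n)%N /\
  forall p, okp p -> exists u, size u = n /\ posw p u.
Proof.
have [||n hn] := @uniform_bound (fun p n => exists u, size u = n /\ posw p u).
(* Positivity survives extension, so words can be padded to a common length. *)
- move=> p m n mn [u [su pu]]; exists (u ++ nseq (n - m) true).
  by rewrite size_cat size_nseq su subnKC // posw_catr.
- by move=> p ok; have [u pu] := positive_word ok; exists (size u), u.
exists n.+1; split=> // p /hn [u [su pu]]; exists (rcons u true).
by rewrite size_rcons su -cats1 posw_catr.
Qed.

Lemma uniform_exit : exists n, forall p, okp p -> forall B : {set A}, B != [set: A] ->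
  exists u, (size u <= n)%N /\ (forall i, (i < size u)%N -> inside B (rzw p (take i u))) /\
    ~~ inside B (rzw p u).
Proof.
apply: uniform_bound => [p m n mn h B BT|p ok].
  by have [u [su hu]] := h B BT; exists u; split=> //; apply: leq_trans su mn.
suff [n hn] : exists n, forall B : {set A}, B \in enum {set A} -> B != [set: A] ->
  exists u, (size u <= n)%N /\ (forall i, (i < size u)%N -> inside B (rzw p (take i u))) /\
    ~~ inside B (rzw p u).
  by exists n => B; apply: hn; rewrite mem_enum.
elim: (enum {set A}) => [|B0 s [n hn]]; first by exists 0%N.
have [e|ne] := eqVneq B0 [set: A].
  by exists n => B; rewrite inE e => /orP[-> //|]; exact: hn.
have [u0 hu0] := first_exit ok ne; exists (maxn (size u0) n) => B.
rewrite inE => /orP[/eqP -> _|Bs BT]; first by exists u0; rewrite leq_maxl.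
have [u [su hu]] := hn B Bs BT; exists u; split=> //.
exact: leq_trans su (leq_maxr _ _).
Qed.

Lemma winner_notin p u c : (forall i, (i < size u)%N ->
  win (rzw p (take i u)) (nth true u i) != c) -> sword p u [set c] = [set c].
Proof.
elim: u p => //= b u IH p h.
rewrite {1}/sstep inE (negPf (h 0%N _)) //; apply: IH => i iu; exact: (h i.+1).
Qed.

(** If [c] never wins, its singleton support never spreads. *)
Lemma posw_wins p u c : posw p u ->
  exists2 i, (i < size u)%N & win (rzw p (take i u)) (nth true u i) = c.
Proof.
move=> /forallP /(_ c) /eqP pu; apply: contrapT => h.
suff /setP e : [set c] = [set: A].
  have : [set: A] == [set c] by apply/eqP/setP => x; rewrite e.
  move/eqP/(congr1 (fun S : {set A} => #|S|)); rewrite cardsT cards1; lia.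
rewrite -pu winner_notin // => i iu; apply/eqP => e; apply: h; by exists i.
Qed.

(** A word of a single type has a single winner, whereas every letter wins along a positive word. *)
Lemma posw_both_types p u b : posw p u -> b \in u.
Proof.
move=> pu; apply: contrapT => /negP bu.
have eu : u = nseq (size u) (~~ b).
  apply/all_pred1P/allP => x xu /=; apply/eqP.
  by move: xu bu; case: x b => [] [] // ->.
have w1 c : c = win p (~~ b).
  have [i iu <-] := posw_wins c pu.
  have H : forall n j, (j < n)%N ->
     win (rzw p (take j (nseq n (~~b)))) (nth true (nseq n (~~b)) j) = win p (~~b).
    move=> n j ni; rewrite nth_nseq ni take_nseq ?(ltnW ni) //.
    elim: j {ni} => // j IH; rewrite -addn1 nseqD cats1 rzw_rcons win_rz //.
  by rewrite {1 2}eu; apply: H.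
have : (#|A| <= #|pred1 (win p (~~ b))|)%N.
  by apply: subset_leq_card; apply/fintype.subsetP => x _; rewrite inE; apply/eqP; exact: w1.
rewrite card1; lia.
Qed.

End Combinatorics.
Arguments win : simpl never.
Arguments los : simpl never.

(** * Heights, lengths and volumes of cylinders *)

Local Open Scope ring_scope.

Section Heights.
Variables (R : realType) (A : finType) (x0 : A).
Hypothesis hA : (2 <= #|A|)%N.
Notation pair := (seq A * seq A)%type.
Notation win := (win x0).
Notation los := (los x0).
Notation rz := (rz x0).
Notation rzw := (rzw x0).
Notation sstep := (sstep x0).
Notation sword := (sword x0).
Notation posw := (posw x0).
Notation inside := (inside x0).
Implicit Types (p : pair) (b : bool) (u : seq bool) (q v : A -> R).

(* Heights and log-slopes move forward by [hstep], lengths and masses backward by its transpose. *)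
Definition hstep p b v : A -> R :=
  fun a => v a + (if a == los p b then v (win p b) else 0).
Fixpoint hword p u v : A -> R :=
  if u is b :: u' then hword (rz p b) u' (hstep p b v) else v.
Definition bstep p b v : A -> R :=
  fun a => v a + (if a == win p b then v (los p b) else 0).
Fixpoint bword p u v : A -> R :=
  if u is b :: u' then bstep p b (bword (rz p b) u' v) else v.

Lemma hword_cat p u u' v : hword p (u ++ u') v = hword (rzw p u) u' (hword p u v).
Proof. by elim: u p v => //= b u IH p v; rewrite IH. Qed.

Lemma hword_rcons p u b v : hword p (rcons u b) v = hstep (rzw p u) b (hword p u v).
Proof. by rewrite -cats1 hword_cat. Qed.

Lemma bword_cat p u u' v : bword p (u ++ u') v = bword p u (bword (rzw p u) u' v).
Proof. by elim: u p v => //= b u IH p v; rewrite IH. Qed.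

Lemma sum_upd (f : A -> R) (c : A) (y : R) :
  \sum_a (f a + (if a == c then y else 0)) = \sum_a f a + y.
Proof. by rewrite big_split /= -big_mkcond /= big_pred1_eq. Qed.

Lemma duality_step p b v q :
  \sum_a bstep p b v a * q a = \sum_a v a * hstep p b q a.
Proof.
rewrite /bstep /hstep.
under eq_bigr do rewrite mulrDl (fun_if (fun z => z * _)) mul0r.
under [in RHS]eq_bigr do rewrite mulrDr (fun_if (fun z => _ * z)) mulr0.
rewrite !big_split /=; congr (_ + _).
by rewrite -!big_mkcond /= !big_pred1_eq.
Qed.

Lemma duality p u v q :
  \sum_a bword p u v a * q a = \sum_a v a * hword p u q a.
Proof. by elim: u p q => //= b u IH p q; rewrite duality_step IH. Qed.

Lemma hstep_ge p b v a : (forall c, 0 <= v c) -> v a <= hstep p b v a.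
Proof. by move=> v0; rewrite /hstep lerDl; case: ifP. Qed.

Lemma hstep_ge0 p b v : (forall c, 0 <= v c) -> forall c, 0 <= hstep p b v c.
Proof. by move=> v0 c; apply: le_trans (hstep_ge p b c v0). Qed.

Lemma hword_ge p u v a : (forall c, 0 <= v c) -> v a <= hword p u v a.
Proof.
elim: u p v => //= b u IH p v v0.
exact: le_trans (hstep_ge p b a v0) (IH _ _ (hstep_ge0 p b v0)).
Qed.

Lemma hstep_gt0 p b v : (forall c, 0 < v c) -> forall c, 0 < hstep p b v c.
Proof. by move=> v0 c; apply: lt_le_trans (hstep_ge p b c (fun c => ltW (v0 c))). Qed.

Lemma hword_gt0 p u v : (forall c, 0 < v c) -> forall c, 0 < hword p u v c.
Proof. by move=> v0 c; apply: lt_le_trans (hword_ge p u c (fun c => ltW (v0 c))). Qed.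

Lemma bstep_ge0 p b v : (forall c, 0 <= v c) -> forall c, 0 <= bstep p b v c.
Proof. by move=> v0 c; rewrite /bstep addr_ge0 //; case: ifP. Qed.

Lemma bword_ge0 p u v : (forall c, 0 <= v c) -> forall c, 0 <= bword p u v c.
Proof. by elim: u p v => //= b u IH p v v0; apply/bstep_ge0/IH. Qed.

Lemma hword_scale p u (k : R) v a : hword p u (fun c => k * v c) a = k * hword p u v a.
Proof.
elim: u p v a => //= b u IH p v a; rewrite -IH; congr (hword _ _ _ _).
by apply/funext => c; rewrite /hstep mulrDr; case: ifP; rewrite ?mulr0.
Qed.

Lemma hword_mono p u v v' : (forall c, v c <= v' c) ->
  forall a, hword p u v a <= hword p u v' a.
Proof.
elim: u p v v' => //= b u IH p v v' vv a; apply: IH => c.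
by rewrite /hstep; apply: lerD => //; case: ifP.
Qed.

Lemma hword_sum p u v v' a : hword p u (fun c => v c + v' c) a = hword p u v a + hword p u v' a.
Proof.
elim: u p v v' a => //= b u IH p v v' a; rewrite -IH; congr (hword _ _ _ _).
by apply/funext => c; rewrite /hstep; case: ifP => _; ring.
Qed.

Lemma hword_norm p u v a : `|hword p u v a| <= hword p u (fun c => `|v c|) a.
Proof.
elim: u p v a => //= b u IH p v a; apply: (le_trans (IH _ _ _)).
apply: hword_mono => c; rewrite /hstep; apply: (le_trans (ler_normD _ _)).
by rewrite lerD2l; case: ifP; rewrite ?normr0.
Qed.

Lemma hword_le p u v M : (forall c, 0 <= v c <= M) ->
  forall a, hword p u v a <= 2 ^+ size u * M.
Proof.
elim: u p v M => [|b u IH] p v M vM a /=; first by rewrite mul1r; case/andP: (vM a).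
rewrite exprSr -mulrA; apply: IH => c; have v0 e : 0 <= v e by case/andP: (vM e).
rewrite hstep_ge0 //= /hstep mulrDl mul1r; apply: lerD; first by case/andP: (vM c).
by case: ifP => _; [case/andP: (vM (win p b))|exact: le_trans (v0 x0) (proj2 (andP (vM x0)))].
Qed.

Lemma hword_sword p u v m (S : {set A}) : (forall c, 0 <= v c) ->
  (forall a, a \in S -> m <= v a) -> forall a, a \in sword p u S -> m <= hword p u v a.
Proof.
elim: u p v S => //= b u IH p v S v0 vS; apply: IH; first exact: hstep_ge0.
move=> a; rewrite /sstep; case: ifP => [wS|_ /vS h]; last exact: le_trans h (hstep_ge p b a v0).
rewrite !inE => /orP[/eqP -> |/vS h]; last exact: le_trans h (hstep_ge p b a v0).
by rewrite /hstep eqxx; apply: le_trans (vS _ wS) _; rewrite lerDr.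
Qed.

Lemma posw_hword p u v a c : posw p u -> (forall c, 0 <= v c) -> v c <= hword p u v a.
Proof.
move=> /forallP /(_ c)/eqP pu v0.
apply: (@hword_sword p u v (v c) [set c]) => // [e|]; first by rewrite inE => /eqP ->.
by rewrite pu inE.
Qed.

(** The transpose in terms of the forward matrix; bounds on heights thus transfer to lengths. *)
Lemma bword_delta p u v c :
  bword p u v c = \sum_a v a * hword p u (fun e => (e == c)%:R) a.
Proof.
rewrite -duality; under eq_bigr do rewrite mulrC mulr_natl mulrb.
by rewrite -big_mkcond big_pred1_eq.
Qed.

Lemma bword_le p u v c : (forall e, 0 <= v e) -> bword p u v c <= 2 ^+ size u * \sum_a v a.
Proof.
move=> v0; rewrite bword_delta mulr_sumr; apply: ler_sum => a _.
rewrite mulrC ler_wpM2r // -[leRHS]mulr1; apply: hword_le => e.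
by case: eqP => _; rewrite ?ler01 ?lexx.
Qed.

Lemma posw_bword p u v c : posw p u -> (forall e, 0 <= v e) -> \sum_a v a <= bword p u v c.
Proof.
move=> pu v0; rewrite bword_delta; apply: ler_sum => a _.
rewrite -[leLHS]mulr1 ler_wpM2l //.
have := @posw_hword p u (fun e => (e == c)%:R) a c pu; rewrite eqxx; apply.
by move=> e; case: eqP.
Qed.

Definition vol q := \prod_a q a.
(* The simplex [\sum_a q a * lam a <= 1] has volume [1 / (d`! * vol q)], so [wgt p q u] is the
   proportion of it occupied by the lengths whose first moves are [u]. *)
Definition wgt p q u : R := vol q / vol (hword p u q).

Lemma vol_gt0 q : (forall a, 0 < q a) -> 0 < vol q.
Proof. by move=> q0; apply: prodr_gt0. Qed.

(** Conditional probability of the type [b] given the past: by [vol_hstep] it is the ratio of the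
    relevant volumes before and after the move. *)
Definition pr p q b : R := q (los p b) / (q (los p b) + q (win p b)).

Lemma vol_hstep p q b : (forall a, 0 < q a) ->
  vol q / vol (hstep p b q) = pr p q b.
Proof.
move=> q0; rewrite /vol (bigD1 (los p b)) //= [in X in _ / X](bigD1 (los p b)) //=.
have -> : \prod_(i | i != los p b) hstep p b q i = \prod_(i | i != los p b) q i.
  by apply: eq_bigr => i /negPf; rewrite /hstep => ->; rewrite addr0.
rewrite /pr {1}/hstep eqxx; field.
apply/andP; split; last by apply: lt0r_neq0; apply: prodr_gt0.
by apply: lt0r_neq0; apply: addr_gt0.
Qed.

Lemma wgt0 p q : (forall a, 0 < q a) -> wgt p q [::] = 1.
Proof. by move=> q0; rewrite /wgt divff // lt0r_neq0 // vol_gt0. Qed.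

Lemma wgt_gt0 p q u : (forall a, 0 < q a) -> 0 < wgt p q u.
Proof. by move=> q0; rewrite divr_gt0 // vol_gt0 //; exact: hword_gt0. Qed.

Lemma wgt_cat p q u u' : (forall a, 0 < q a) ->
  wgt p q (u ++ u') = wgt p q u * wgt (rzw p u) (hword p u q) u'.
Proof.
move=> q0; rewrite /wgt hword_cat; field.
have h1 := hword_gt0 p u q0; have h2 := hword_gt0 (rzw p u) u' h1.
by rewrite !lt0r_neq0 // vol_gt0.
Qed.

Lemma pr_ge0 p q b : (forall a, 0 < q a) -> 0 <= pr p q b.
Proof. by move=> q0; rewrite divr_ge0 ?ltW // addr_gt0. Qed.

Lemma pr_sum p q : (forall a, 0 < q a) -> pr p q true + pr p q false = 1.
Proof.
move=> q0; rewrite /pr /los /=; set x := q _; set y := q _.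
have x_gt0 : 0 < x by apply: q0. have y_gt0 : 0 < y by apply: q0.
by field; rewrite !lt0r_neq0 // addr_gt0.
Qed.

Lemma sumq_hstep p b q : \sum_a hstep p b q a = \sum_a q a + q (win p b).
Proof. exact: sum_upd. Qed.

Lemma sumq_le a q : (forall c, 0 <= q c) -> q a <= \sum_c q c.
Proof. by move=> q0; rewrite (bigD1 a) //= lerDl sumr_ge0. Qed.

Lemma sumq_hstep_le p b q : (forall c, 0 <= q c) ->
  \sum_a hstep p b q a <= 2 * \sum_a q a.
Proof. by move=> q0; rewrite sumq_hstep mulrDl mul1r lerD2l sumq_le. Qed.

(* [reach P M p q r]: an adaptive strategy tree from the state [(p, q)] all of
   whose leaves have total height at most [M], and whose leaves satisfying [P]
   have total probability at least [r]. *)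
Inductive reach (P : pair -> (A -> R) -> Prop) (M : R) : pair -> (A -> R) -> R -> Prop :=
| reach_ok p q r : P p q -> \sum_a q a <= M -> r <= 1 -> reach P M p q r
| reach_fail p q r : \sum_a q a <= M -> r <= 0 -> reach P M p q r
| reach_node p q r rt rf :
    reach P M (rz p true) (hstep p true q) rt ->
    reach P M (rz p false) (hstep p false q) rf ->
    r <= pr p q true * rt + pr p q false * rf -> reach P M p q r.

Lemma reach_weaken P M p q r r' : r' <= r -> reach P M p q r -> reach P M p q r'.
Proof.
move=> rr H; case: H rr => {p q r} [p q r Pq qM r1|p q r qM r0|p q r rt rf ht hf hr] rr.
- by apply: reach_ok => //; apply: le_trans rr r1.
- by apply: reach_fail => //; apply: le_trans rr r0.
- by apply: reach_node ht hf _; apply: le_trans rr hr.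
Qed.

(** A second strategy is grafted onto each successful leaf of the first. A failing leaf keeps a
    nonpositive bound after multiplication by [r']. *)
Lemma reach_comp (P P' : pair -> (A -> R) -> Prop) M M' p q r r' :
  M <= M' -> 0 <= r' <= 1 ->
  okp p -> (forall a, 0 < q a) ->
  (forall p q, okp p -> (forall a, 0 < q a) -> P p q -> \sum_a q a <= M -> reach P' M' p q r') ->
  reach P M p q r -> reach P' M' p q (r * r').
Proof.
move=> MM /andP[r'0 r'1] + + H Hr.
elim: Hr => {p q r} [p q r Pq qM r1|p q r qM r0|p q r rt rf ht IHt hf IHf hr] okp q0.
- by apply: reach_weaken (H _ _ okp q0 Pq qM); rewrite -[leRHS]mul1r ler_wpM2r.
- apply: reach_fail; first exact: le_trans qM MM.
  by rewrite mulr_le0_ge0.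
- have ok2 b := okp_rz x0 hA b okp; have q2 b := hstep_gt0 p b q0.
  apply: reach_node (IHt (ok2 _) (q2 _)) (IHf (ok2 _) (q2 _)) _.
  by rewrite !mulrA -mulrDl ler_wpM2r.
Qed.

(** The strategy follows [u] and gives up after any other move. *)
Lemma reach_follow (P : pair -> (A -> R) -> Prop) M u p q (k : R) :
  0 <= k <= 1 -> (forall a, 0 < q a) -> 2 ^+ size u * \sum_a q a <= M ->
  (forall i, (i < size u)%N ->
     k <= pr (rzw p (take i u)) (hword p (take i u) q) (nth true u i)) ->
  P (rzw p u) (hword p u q) -> reach P M p q (k ^+ size u).
Proof.
move=> /andP[k0 k1]; elim: u p q => [|b u IH] p q q0 qM hk Pu /=.
  by apply: reach_ok => //; move: qM; rewrite mul1r.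
have q0' c : 0 <= q c by rewrite ltW.
have qM' : 2 * \sum_a q a <= M.
  apply: le_trans qM; rewrite ler_wpM2r ?sumr_ge0 // exprS ler_peMr //.
  by rewrite exprn_ege1 // ler1n.
have hb : reach P M (rz p b) (hstep p b q) (k ^+ size u).
  apply: IH => //; first exact: hstep_gt0.
    apply: le_trans qM; rewrite exprSr -mulrA ler_pM2l ?exprn_gt0 //.
    exact: sumq_hstep_le.
  by move=> i iu; apply: (hk i.+1).
have hf c : reach P M (rz p c) (hstep p c q) 0.
  by apply: reach_fail => //; apply: le_trans qM'; apply: sumq_hstep_le.
have kb : k <= pr p q b by apply: (hk 0%N).
have := ler_wpM2r (exprn_ge0 (size u) k0) kb.
case: b {hk kb Pu qM} hb => hb hk; rewrite exprS.
  by apply: reach_node hb (hf false) _; rewrite mulr0 addr0.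
by apply: reach_node (hf true) hb _; rewrite mulr0 add0r.
Qed.

Lemma pr_lower p q b m M : 0 < m -> 0 < M -> m <= q (los p b) ->
  0 < q (win p b) <= M -> m / (m + M) <= pr p q b.
Proof.
move=> m0 M0 ml /andP[w0 wM]; rewrite /pr.
have l0 : 0 < q (los p b) by apply: lt_le_trans ml.
rewrite ler_pdivrMr ?addr_gt0 // mulrAC ler_pdivlMr ?addr_gt0 //.
rewrite !mulrDr mulrC lerD2l; exact: ler_pM (ltW m0) (ltW w0) ml wM.
Qed.

(** Only letters of [B] play along [u], so the others keep their heights. *)
Lemma hword_inside (B : {set A}) p u q M :
  (forall i, (i < size u)%N -> inside B (rzw p (take i u))) ->
  (forall a, a \in B -> 0 <= q a <= M) -> forall a,
  (a \in B -> hword p u q a <= 2 ^+ size u * M) /\ (a \notin B -> hword p u q a = q a).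
Proof.
elim: u p q M => [|b u IH] p q M hin hq a /=.
  by split=> // /hq /andP[]; rewrite mul1r.
have ib : inside B p by apply: (hin 0%N).
have wB := inside_win b ib; have lB : los p b \in B by apply: inside_win.
have [w0 wM] := andP (hq _ wB).
have [|c cB|h1 h2] := IH (rz p b) (hstep p b q) (2 * M) _ _ a.
- by move=> i iu; apply: (hin i.+1).
- have /andP[c0 cM] := hq _ cB.
  rewrite /hstep mulrDl mul1r; case: ifP => _; last first.
    by rewrite addr0 c0 /= (le_trans cM) // lerDl (le_trans c0).
  by rewrite addr_ge0 //= lerD.
split=> aB; first by rewrite exprSr -mulrA h1.
rewrite h2 // /hstep; case: eqP => [e|]; last by rewrite addr0.
by rewrite e lB in aB.
Qed.

End Heights.

(** * Kerckhoff's estimate *)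

Section Kerckhoff.
Variables (R : realType) (A : finType) (x0 : A).
Hypothesis hA : (2 <= #|A|)%N.
Notation pair := (seq A * seq A)%type.
Notation win := (win x0).
Notation los := (los x0).
Notation rz := (rz x0).
Notation rzw := (rzw x0).
Notation sstep := (sstep x0).
Notation sword := (sword x0).
Notation posw := (posw x0).
Notation inside := (inside x0).
Notation hstep := (hstep x0).
Notation hword := (hword x0).
Notation reach := (reach x0).
Notation pr := (pr x0).
Implicit Types (p : pair) (b : bool) (u : seq bool) (q v : A -> R).

Lemma sum_constE (c : R) : \sum_(a : A) c = #|A|%:R * c.
Proof. by rewrite sumr_const mulr_natl. Qed.

Lemma exists_pos_lower (q : A -> R) : (forall a, 0 < q a) ->
  exists m, 0 < m /\ forall a, m <= q a.
Proof.
move=> q0; suff [m [m0 hm]] : exists m, 0 < m /\ forall a, a \in enum A -> m <= q a.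
  by exists m; split=> // a; apply: hm; rewrite mem_enum.
elim: (enum A) => [|c s [m [m0 hm]]]; first by exists 1.
exists (Num.min m (q c)); split; first by rewrite lt_min m0 q0.
move=> a; rewrite inE => /orP[/eqP -> |/hm h]; first by rewrite ge_min lexx orbT.
by rewrite ge_min h.
Qed.

Lemma los_in_inside (B : {set A}) p b : ~~ inside B p -> win p b \in B -> los p b \notin B.
Proof. by rewrite /inside /los negb_and; case: b => /= + wB; rewrite wB ?orbF. Qed.

Lemma not_inside_rz (B : {set A}) p b : win p b \notin B -> ~~ inside B (rz p b).
Proof.
move=> wB; rewrite /inside negb_and.
by have := win_rz x0 p b; case: b wB => wB ->; rewrite wB ?orbT.
Qed.

Definition large_outside (B : {set A}) (thr bd : R) (p : pair) (q : A -> R) : Prop :=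
  [/\ exists2 c, c \notin B & thr <= q c, forall a, a \in B -> thr <= q a
    & forall a, q a <= 2 * bd].

Definition tot (q : A -> R) := \sum_a q a.

Lemma small_of_sum (B : {set A}) (thr bd : R) q a : 0 < bd -> thr <= bd -> (forall a, 0 < q a) ->
  (forall a, a \notin B -> q a < thr) -> \sum_(a in B) q a / bd < 1 -> q a < bd.
Proof.
move=> bd0 tb q0 qB g1; have [aB|aB] := boolP (a \in B); last by apply: lt_le_trans tb; apply: qB.
rewrite -[ltRHS]mul1r -ltr_pdivrMr //; apply: le_lt_trans g1.
by rewrite (bigD1 a) //= lerDl sumr_ge0 // => c _; rewrite divr_ge0 ?ltW.
Qed.

(* [\sum_(a in B) q a / bd] is a supermartingale as long as no letter of [B] wins. *)
Lemma reach_outside (B : {set A}) (thr bd m : R) : 0 < m -> 0 < thr -> thr <= bd ->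
  forall n p q, okp p -> (forall a, m <= q a) -> ~~ inside B p ->
  (forall a, a \notin B -> q a < thr) -> (forall a, a \in B -> thr <= q a) ->
  (forall a, q a <= 2 * bd) -> #|A|%:R * bd <= tot q + n%:R * m ->
  reach (large_outside B thr bd) (#|A|%:R * (2 * bd)) p q (1 - \sum_(a in B) q a / bd).
Proof.
move=> m0 thr0 tb; have bd0 : 0 < bd by apply: lt_le_trans tb.
have totM q : (forall a, q a <= 2 * bd) -> \sum_a q a <= #|A|%:R * (2 * bd).
  move=> h; apply: le_trans (ler_sum _ (fun a _ => h a)) _.
  by rewrite sum_constE.
elim=> [|n IH] p q okp mq nin qB Bq q2 totq.
all: have q0 a : 0 < q a by apply: lt_le_trans (mq a).
all: have [g1|g1] := leP 1 (\sum_(a in B) q a / bd);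
  first by apply: reach_fail; [exact: totM|rewrite subr_le0].
all: have qbd : forall a, q a < bd;
  first (by move=> a; apply: (@small_of_sum B thr bd q a bd0 tb q0 qB g1)).
  (* No fuel is left: [n] bounds the number of remaining moves, each adding at least [m] to the
     total, yet every height is still below [bd]. *)
  exfalso; move: totq; rewrite mul0r addr0; apply/negP; rewrite -ltNge.
  rewrite (_ : #|A|%:R * bd = \sum_(a : A) bd); last first.
    by rewrite sum_constE.
  by apply: ltr_sum => //; apply/hasP; exists x0 => //; rewrite mem_index_enum.
set g := \sum_(a in B) q a / bd in g1 *.
have child b : reach (large_outside B thr bd) (#|A|%:R * (2 * bd)) (rz p b) (hstep p b q)
    (if win p b \in B then 1 else 1 - (g + (if los p b \in B then q (win p b) / bd else 0))).
  have q2' a : hstep p b q a <= 2 * bd.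
    rewrite /hstep; case: ifP => _; last by rewrite addr0.
    by rewrite mulrDl mul1r lerD // ltW.
  have Bq' a : a \in B -> thr <= hstep p b q a.
    by move=> aB; apply: le_trans (Bq _ aB) _; apply: hstep_ge => c; rewrite ltW.
  have [wB|wB] := boolP (win p b \in B).
    apply: reach_ok => //; last exact: totM.
    split=> //; exists (los p b); first exact: los_in_inside.
    by rewrite /hstep eqxx (le_trans (Bq _ wB)) // lerDr ltW.
  have hg : \sum_(a in B) hstep p b q a / bd = g + (if los p b \in B then q (win p b) / bd else 0).
    rewrite /g /hstep; under eq_bigr do rewrite mulrDl (fun_if (fun z => z / bd)) mul0r.
    rewrite big_split /=; congr (_ + _); rewrite -big_mkcondr /=.
    case: ifP => lB; last first.
      by rewrite big1 // => a /andP[aB /eqP e]; rewrite e lB in aB.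
    rewrite (bigD1 (los p b)) /= ?lB ?eqxx // big1 ?addr0 //.
    by move=> a /andP[/andP[_ /eqP ->]]; rewrite eqxx.
  have [ex|nex] := EM (exists2 c, c \notin B & thr <= hstep p b q c).
    apply: reach_ok => //; first exact: totM.
    rewrite gerBl addr_ge0 ?sumr_ge0 // => [a _|]; first by rewrite divr_ge0 // ltW.
    by case: ifP => // _; rewrite divr_ge0 // ltW.
  rewrite -hg; apply: IH => //.
  - exact: okp_rz.
  - by move=> a; apply: le_trans (mq a) _; apply: hstep_ge => c; rewrite ltW.
  - exact: not_inside_rz.
  - by move=> a aB; rewrite ltNge; apply/negP => h; apply: nex; exists a.
  - have := mq (win p b); move: totq; rewrite /tot sumq_hstep -natr1 mulrDl mul1r; lra.
apply: reach_node (child true) (child false) _.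
have psum := pr_sum x0 p q0.
have gB a : a \in B -> q a / bd <= g.
  by move=> aB; rewrite /g (bigD1 a) //= lerDl sumr_ge0 // => c _; rewrite divr_ge0 // ltW.
(* Here [x] is the height of the letter in [B] and [y] that of the other one. The type [b] succeeds
   with probability y / (x + y); the opposite type raises [g] by y / bd with probability x / (x +
   y). The balance is y / (x + y) * (g - x / bd), nonnegative because x / bd is one term of [g]. *)
have key b : win p b \in B -> win p (~~ b) \notin B ->
  1 - g <= pr p q b + pr p q (~~ b) * (1 - (g + q (win p (~~ b)) / bd)).
  move=> wB lB; rewrite /pr /los negbK.
  set x := q (win p b); set y := q (win p (~~ b)).
  have x_0 : 0 < x by apply: q0. have y_0 : 0 < y by apply: q0.
  have xg : x / bd <= g by apply: gB.
  have -> : y / (y + x) = 1 - x / (x + y) by field; rewrite lt0r_neq0 // addr_gt0.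
  rewrite -subr_ge0.
  have -> : 1 - x / (x + y) + x / (x + y) * (1 - (g + y / bd)) - (1 - g) =
    y / (x + y) * (g - x / bd) by field; rewrite !lt0r_neq0 // addr_gt0.
  by rewrite mulr_ge0 ?subr_ge0 // divr_ge0 ?ltW // addr_gt0.
rewrite /los /=; move: nin (key true) (key false); rewrite /inside /=.
case h1 : (win p true \in B); case h2 : (win p false \in B) => //= _ k1 k2.
- by rewrite mulr1; apply: k1.
- by rewrite mulr1 [leRHS]addrC; apply: k2.
- by rewrite !addr0 -mulrDl psum mul1r.
Qed.

Definition large_letters (k : nat) (thr bd : R) (p : pair) (q : A -> R) : Prop :=
  (k <= #|[set a | (thr <= q a)%R]|)%N /\ forall a, q a <= bd.

Lemma reach_impl (P P' : pair -> (A -> R) -> Prop) M M' p q r :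
  M <= M' -> okp p -> (forall a, 0 < q a) ->
  (forall p q, okp p -> (forall a, 0 < q a) -> P p q -> P' p q) ->
  reach P M p q r -> reach P' M' p q r.
Proof.
move=> le_MM okp_ q0 H h; rewrite -[r]mulr1.
apply: (reach_comp hA le_MM _ okp_ q0 _ h) => //; first by rewrite ler01 lexx.
by move=> p' q' ok' q'0 Pq qM; apply: reach_ok => //; [exact: H|exact: le_trans qM le_MM].
Qed.

(** With [B] the set of letters already large, [uniform_exit] leads to a state where some last
    letter lies outside [B]. Only letters of [B] play meanwhile, so the heights involved are
    comparable and each move has probability at least [kap]. Then [reach_outside] makes one more
    letter large with probability at least 1/2. *)
Lemma kerckhoff_step (k : nat) (C : R) : (0 < k < #|A|)%N -> 1 <= C ->
  exists C' M r : R, [/\ C <= C', 0 < r <= 1 & forall (S : R) p q, 0 < S -> okp p ->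
    (forall a, 0 < q a) -> large_letters k (S / C) (C * S) p q ->
    reach (large_letters k.+1 (S / C) (C' * S)) (M * S) p q r].
Proof.
move=> /andP[k0 kd] C1; have [L hL] := @uniform_exit A x0 hA.
have C0 : 0 < C by apply: lt_le_trans C1.
have d0 : 0 < #|A|%:R :> R by rewrite ltr0n; lia.
have d1 : 1 <= #|A|%:R :> R by rewrite ler1n; lia.
(* In units of [S], [C1'] bounds the heights after at most [L] moves among letters of [B]; [kap]
   bounds from below the probability of each such move. *)
pose C1' := 2 ^+ L * C; pose kap := C^-1 / (C^-1 + C1').
have C1'C : C <= C1' by rewrite ler_peMl ?(ltW C0) // exprn_ege1 // ler1n.
have C1'0 : 0 < C1' by apply: lt_le_trans C1'C.
have iC : 0 < C^-1 by rewrite invr_gt0.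
have kap0 : 0 < kap by rewrite divr_gt0 // addr_gt0.
have kap1 : kap <= 1 by rewrite ler_pdivrMr ?addr_gt0 // mul1r lerDl ltW.
(* Chosen so that the supermartingale of [reach_outside] starts at a value at most 1/2. *)
pose D := 2 * #|A|%:R * C1'.
have DC : C1' <= D by rewrite /D ler_peMl ?(ltW C1'0) //; lra.
have D0 : 0 < D by apply: lt_le_trans DC.
pose M := #|A|%:R * (2 * D).
have C2D : C <= 2 * D.
  by apply: le_trans C1'C _; apply: le_trans DC _; rewrite ler_peMl ?(ltW D0) // ler1n.
have r1 : kap ^+ L / 2 <= 1.
  by apply: mulr_ile1; rewrite ?exprn_ge0 ?invr_ge0 ?exprn_ile1 ?(ltW kap0) // invf_le1 ?ler1n.
exists (2 * D), M, (kap ^+ L * 2^-1); split.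
- by apply: le_trans C1'C _; apply: le_trans DC _; rewrite ler_peMl ?(ltW D0) // ler1n.
- by rewrite mulr_gt0 ?exprn_gt0 ?invr_gt0 ?ltr0n.
move=> S p q S0 okp_ q0 [hk qC].
have CS : 0 < C * S by rewrite mulr_gt0.
have SC : 0 < S / C by rewrite divr_gt0.
have totq : \sum_a q a <= #|A|%:R * (C * S).
  apply: le_trans (ler_sum _ (fun a _ => qC a)) _.
  by rewrite sum_constE.
pose B : {set A} := [set a | S / C <= q a].
have [kB|kB] := ltnP k #|B|.
  apply: reach_ok => //; first split=> //.
    by move=> a; apply: le_trans (qC a) _; rewrite ler_pM2r.
  by apply: le_trans totq _; rewrite /M -mulrA ler_pM2l // ler_pM2r.
have BT : B != [set: A].
  by apply/eqP => e; move: kB; rewrite e cardsT leqNgt kd.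
have [u [uL [hin hex]]] := hL p okp_ B BT.
have hB a : a \in B -> 0 <= q a <= C * S by move=> _; rewrite qC ltW.
have tk i : (i < size u)%N -> (i <= L)%N by move=> iu; apply: ltnW; apply: leq_trans iu uL.
have w2 (n : nat) : (n <= L)%N -> 2 ^+ n * (C * S) <= C1' * S.
  by move=> nL; rewrite /C1' mulrA ler_pM2r // ler_pM2r // ler_weXn2l // ler1n.
pose P1 p' q' := [/\ ~~ inside B p', forall a, a \notin B -> q' a < S / C,
  forall a, a \in B -> S / C <= q' a & forall a, q' a <= C1' * S].
have Bge n a : a \in B -> S / C <= hword p (take n u) q a.
  rewrite inE => h; apply: le_trans h _; apply: hword_ge => c; exact: ltW.
have f1 : reach P1 (M * S) p q (kap ^+ size u).
  apply: reach_follow => //.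
  - by rewrite (ltW kap0) kap1.
  - apply: (@le_trans _ _ (2 ^+ L * (#|A|%:R * (C * S)))).
      apply: ler_pM => //; first by apply: sumr_ge0 => a _; exact: ltW.
      by rewrite ler_weXn2l // ler1n.
    rewrite mulrCA /M -mulrA ler_pM2l //; apply: le_trans (w2 L (leqnn _)) _.
    by rewrite ler_pM2r //; apply: le_trans DC _; rewrite ler_peMl ?(ltW D0) // ler1n.
  - move=> i iu; have hin' j : (j < size (take i u))%N -> inside B (rzw p (take j (take i u))).
      by rewrite size_take iu => ji; rewrite take_takel ?(ltnW ji) //; apply: hin; apply: ltn_trans iu.
    have ib := hin i iu.
    have hw := inside_win (nth true u i) ib.
    have hl : los (rzw p (take i u)) (nth true u i) \in B by apply: inside_win.
    have -> : kap = (S / C) / (S / C + C1' * S).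
      by rewrite /kap; field; rewrite !lt0r_neq0 // ?addr_gt0 ?mulr_gt0 // addr_gt0.
    apply: pr_lower => //; first by rewrite mulr_gt0.
      exact: Bge.
    rewrite hword_gt0 //=.
    have [h _] := hword_inside hin' hB (win (rzw p (take i u)) (nth true u i)).
    by apply: le_trans (h hw) _; rewrite size_take iu w2 // tk.
  have hh := hword_inside hin hB; split=> //.
  - by move=> a aB; rewrite (proj2 (hh a) aB) ltNge; rewrite inE in aB.
  - by move=> a aB; rewrite -(take_size u) Bge.
  - move=> a; have [aB|aB] := boolP (a \in B).
      by apply: le_trans (proj1 (hh a) aB) _; exact: w2.
    rewrite (proj2 (hh a) aB); apply: le_trans (qC a) _; rewrite ler_pM2r //.
have {}f1 : reach P1 (M * S) p q (kap ^+ L).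
  apply: reach_weaken f1; apply: ler_wiXn2l => //; exact: ltW.
apply: reach_comp f1 => //; first by rewrite invr_ge0 ler0n invf_le1 ?ler1n.
move=> p' q' ok' q'0 [nin q'B Bq' q'C] _.
have [m [m0 hm]] := exists_pos_lower q'0.
have DS : 0 < D * S by rewrite mulr_gt0.
have hb : reach (large_outside B (S / C) (D * S)) (#|A|%:R * (2 * (D * S))) p' q'
    (1 - \sum_(a in B) q' a / (D * S)).
  (* The fuel is large enough for increments of at least [m] to raise the total to
     [#|A|%:R * (D * S)]. *)
  apply: (@reach_outside B (S / C) (D * S) m m0 SC _ (Num.bound (#|A|%:R * (D * S) / m))) => //.
  - rewrite mulrC ler_pM2r //; apply: le_trans (le_trans C1'C DC).
    by apply: (le_trans _ C1); rewrite invf_le1.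
  - move=> a; apply: le_trans (q'C a) _; rewrite mulrA ler_pM2r //.
    by apply: le_trans DC _; rewrite ler_peMl ?(ltW D0) // ler1n.
  - have : #|A|%:R * (D * S) / m < (Num.bound (#|A|%:R * (D * S) / m))%:R.
      by apply: archi_boundP; rewrite divr_ge0 ?mulr_ge0 // ltW.
    rewrite ltr_pdivrMr // => h; apply: le_trans (ltW h) _.
    by rewrite lerDr sumr_ge0 // => a _; exact: ltW.
have half : 2^-1 <= 1 - \sum_(a in B) q' a / (D * S).
  rewrite lerBrDl -lerBrDr (_ : 1 - 2^-1 = #|A|%:R * (C1' * S / (D * S))); last first.
    by rewrite /D; field; rewrite !lt0r_neq0 // ?mulr_gt0.
  apply: (@le_trans _ _ (\sum_(a : A) (C1' * S / (D * S)))).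
    rewrite big_mkcond /=; apply: ler_sum => a _; case: ifP => _.
      by rewrite ler_pM2r ?invr_gt0 // q'C.
    by rewrite divr_ge0 ?ltW // mulr_gt0.
  by rewrite sum_constE.
apply: reach_weaken half _; apply: reach_impl hb => //.
  by rewrite /M !mulrA.
move=> p2 q2 ok2 q20 [[c cB hc] hB2 h2]; split; last by move=> a; rewrite -mulrA.
have sub : c |: B \subset [set a | S / C <= q2 a].
  by apply/fintype.subsetP => a; rewrite !inE => /orP[/eqP -> //|]; move: (hB2 a); rewrite inE.
apply: leq_trans (subset_leq_card sub).
by rewrite cardsU1 cB /= add1n ltnS.
Qed.

(** Induction on the number of large letters. The total at the start remains the unit throughout, so
    that a threshold reached at one stage is kept, up to the larger constant [C'], at the next. *)
Lemma kerckhoff : exists C M r : R, [/\ 1 <= C, 0 < r <= 1 & forall p q, okp p ->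
  (forall a, 0 < q a) ->
  reach (fun _ q' => forall a, tot q / C <= q' a <= C * tot q) (M * tot q) p q r].
Proof.
suff key k : (0 < k <= #|A|)%N -> exists C M r : R, [/\ 1 <= C, 0 < r <= 1 & forall p q,
    okp p -> (forall a, 0 < q a) ->
    reach (large_letters k (tot q / C) (C * tot q)) (M * tot q) p q r].
  have [|C [M [r [C1 r01 h]]]] := key #|A|; first by rewrite leqnn andbT; lia.
  exists C, M, r; split=> // p q okp_ q0; apply: reach_impl (h p q okp_ q0) => //.
  move=> p' q' _ _ [hc hq] a; rewrite hq andbT.
  suff : a \in [set a | tot q / C <= q' a] by rewrite inE.
  suff -> : [set a | tot q / C <= q' a] = [set: A] by rewrite inE.
  by apply/eqP; rewrite finset.eqEcard finset.subsetT cardsT.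
have tot0 q : (forall a, 0 < q a) -> 0 < tot q.
  by move=> q0; apply: lt_le_trans (q0 x0) _; apply: sumq_le => c; exact: ltW.
elim: k => // k IH /andP[_ kd].
have d1 : 1 <= #|A|%:R :> R by rewrite ler1n; lia.
case: k IH kd => [_ _|k IH kd].
  exists #|A|%:R, 1, 1; split=> // [|p q okp_ q0]; first by rewrite ltr01 lexx.
  have q0' a : 0 <= q a by exact: ltW.
  apply: reach_ok => //; last by rewrite mul1r.
  split; last first.
    by move=> a; apply: le_trans (sumq_le a q0') _; rewrite ler_peMl // ltW // tot0.
  (* Some height is at least the average. *)
  rewrite card_gt0; apply/finset.set0Pn; apply: contrapT => h.
  suff : tot q < tot q by rewrite ltxx.
  have {2}-> : tot q = \sum_(a : A) (tot q / #|A|%:R).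
    by rewrite sum_constE mulrCA divff ?mulr1 // lt0r_neq0 // (lt_le_trans _ d1).
  apply: ltr_sum; first by apply/hasP; exists x0 => //; rewrite mem_index_enum.
  by move=> a _; rewrite ltNge; apply/negP => ha; apply: h; exists a; rewrite inE.
have [|C [M [r [C1 r01 h]]]] := IH; first by lia.
have [|C' [M' [r' [CC' r'01 h']]]] := @kerckhoff_step k.+1 C _ C1; first by lia.
have [r0 r1] := andP r01; have [r'0 r'1] := andP r'01.
have C0 : 0 < C by apply: lt_le_trans C1.
exists C', (Num.max M M'), (r * r'); split; first exact: le_trans CC'.
  by rewrite mulr_gt0 // mulr_ile1 // ltW.
move=> p q okp_ q0; have q1 := tot0 q q0.
apply: reach_comp (h p q okp_ q0) => //.
- by rewrite ler_pM2r // le_max lexx.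
- by rewrite (ltW r'0).
move=> p1 q1' ok1 q10 hl _.
apply: reach_impl (h' _ _ _ q1 ok1 q10 hl) => //.
  by rewrite ler_pM2r // le_max lexx orbT.
move=> p2 q2 _ _ [c2 l2]; split=> //.
apply: leq_trans c2 _; apply: subset_leq_card; apply/fintype.subsetP => a.
rewrite !inE; apply: le_trans; rewrite ler_pM2l // lef_pV2 // posrE //.
exact: lt_le_trans CC'.
Qed.

End Kerckhoff.

(** * Return times to strongly positive words *)

Section StoppedSums.
Variables (R : realType) (E : pred (seq bool)) (phi : seq bool -> R).

(** Sum of [phi] over the binary tree of extensions of [h], cut at depth [n] and at the first proper
    extension in [E]. The root is not tested, so the recursion can start at a return. *)
Fixpoint stopped n h : R :=
  if n is n'.+1 then
    (if E (rcons h true) then phi (rcons h true) else stopped n' (rcons h true)) +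
    (if E (rcons h false) then phi (rcons h false) else stopped n' (rcons h false))
  else phi h.

Fixpoint stop_word n h (u : seq bool) : bool :=
  if n is n'.+1 then
    if u is b :: u' then
      if E (rcons h b) then u' == [::] else stop_word n' (rcons h b) u'
    else false
  else u == [::].

Hypothesis phi0 : forall h, 0 <= phi h.

Lemma uniq_nil_sum (F : seq (seq bool)) (f : seq bool -> R) :
  uniq F -> all (fun u => u == [::]) F -> 0 <= f [::] -> \sum_(u <- F) f u <= f [::].
Proof.
case: F => [|u [|v F]] /=; rewrite ?big_nil ?big_seq1 //.
  by rewrite andbT => _ /eqP ->.
move=> /andP[+ _] /and3P[/eqP eu /eqP ev _]; by rewrite eu ev inE eqxx.
Qed.

Lemma big_split_head (F : seq (seq bool)) (f : seq bool -> R) : [::] \notin F ->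
  \sum_(u <- F) f u =
  \sum_(u <- [seq behead v | v <- F & ohead v == Some true]) f (true :: u) +
  \sum_(u <- [seq behead v | v <- F & ohead v == Some false]) f (false :: u).
Proof.
elim: F => [|[|b u] F IH] /=; first by rewrite !big_nil addr0.
  by [].
rewrite inE => /= nF; rewrite big_cons IH //.
have eT : (Some true == Some true :> option bool) = true by [].
by case: b => /=; rewrite ?(eqxx (Some true)) ?(eqxx (Some false)) /= big_cons; ring.
Qed.

Lemma uniq_behead (F : seq (seq bool)) b : uniq F ->
  uniq [seq behead v | v <- F & ohead v == Some b].
Proof.
move=> uF; rewrite map_inj_in_uniq ?filter_uniq //.
move=> [|x u] [|y v]; rewrite !mem_filter //= => /andP[/eqP[->] _] /andP[/eqP[->] _] ->.
by [].
Qed.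

(** The leaves of the tree are distinct words, so [stopped] dominates the sum over any finite family
    of them; only such finite sums are used for the law of return words. *)
Lemma sum_stop_words n h F : uniq F -> all (stop_word n h) F ->
  \sum_(u <- F) phi (h ++ u) <= stopped n h.
Proof.
elim: n h F => [|n IH] h F uF aF /=.
  by have := @uniq_nil_sum F (fun u => phi (h ++ u)) uF aF (phi0 _); rewrite cats0.
have nF : [::] \notin F by apply/negP => /(allP aF).
rewrite (big_split_head _ nF).
have key b : \sum_(u <- [seq behead v | v <- F & ohead v == Some b]) phi (h ++ b :: u) <=
    if E (rcons h b) then phi (rcons h b) else stopped n (rcons h b).
  have aB : all (fun u => if E (rcons h b) then u == [::] else stop_word n (rcons h b) u)
      [seq behead v | v <- F & ohead v == Some b].
    apply/allP => u /mapP[[|c v]]; rewrite mem_filter //= => /andP[/eqP[->] /(allP aF) /=] + ->.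
    by [].
  move: aB; case: ifP => Eb aB.
    have := @uniq_nil_sum _ (fun u => phi (h ++ b :: u)) (uniq_behead b uF) aB.
    by rewrite cats1; apply.
  have := IH (rcons h b) _ (uniq_behead b uF) aB.
  by under eq_bigr do rewrite cat_rcons.
exact: lerD.
Qed.

End StoppedSums.

(** * Exponential moments of the total height at a return *)

Section ReturnTimes.
Variables (R : realType) (A : finType) (x0 : A).
Hypothesis hA : (2 <= #|A|)%N.
Notation pair := (seq A * seq A)%type.
Notation win := (win x0).
Notation los := (los x0).
Notation rz := (rz x0).
Notation rzw := (rzw x0).
Notation posw := (posw x0).
Notation hstep := (hstep x0).
Notation hword := (hword x0).
Notation wgt := (wgt x0).
Notation reach := (reach x0).
Notation pr := (pr x0).
Implicit Types (p : pair) (b : bool) (u h : seq bool) (q v : A -> R).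

Variable l0 : nat.
Hypothesis l0_gt0 : (0 < l0)%N.
Hypothesis l0_pos : forall p, okp p -> exists u, size u = l0 /\ posw p u.

Fixpoint chunks n p u : bool :=
  if n is n'.+1 then posw p (take l0 u) && chunks n' (rzw p (take l0 u)) (drop l0 u)
  else u == [::].

(* The first chunk spreads the affinity to all letters, the last one balances the lengths, and
   each of the [#|A|] chunks in between makes every letter win. *)
Definition nchunks := (#|A| + 2)%N.
Definition strong_len := (nchunks * l0)%N.
Definition strong p u := (size u == strong_len) && chunks nchunks p u.

Definition ends_strong p u : bool := (strong_len <= size u)%N &&
  strong (rzw p (take (size u - strong_len) u)) (drop (size u - strong_len) u).

Lemma exists_chunks n p : okp p -> exists u, size u = (n * l0)%N /\ chunks n p u.
Proof.
elim: n p => [|n IH] p okp_; first by exists [::].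
have [u [su pu]] := l0_pos okp_; have [v [sv cv]] := IH (rzw p u) (okp_rzw x0 hA u okp_).
exists (u ++ v); rewrite size_cat su sv mulSn; split=> //=.
by rewrite -su take_size_cat // drop_size_cat // pu.
Qed.

Lemma ends_strong_cat p h u : strong (rzw p h) u -> ends_strong p (h ++ u).
Proof.
move=> su; have /eqP sz := proj1 (andP su).
by rewrite /ends_strong size_cat sz leq_addl addnK take_size_cat // drop_size_cat.
Qed.

Section Moment.
Variables (p0 : pair) (q0 : A -> R) (th C : R).
Hypothesis ok0 : okp p0.
Hypothesis pos0 : forall a, 0 < q0 a.
Hypothesis th0 : 0 <= th.
Hypothesis C1 : 1 <= C.

Let st h := rzw p0 h.
Let ht h := hword p0 h q0.
Let W h := wgt p0 q0 h.
Let phi h := W h * tot (ht h) `^ th.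
Let E := ends_strong p0.
Let Y := stopped E phi.

Let htpos h a : 0 < ht h a. Proof. exact: hword_gt0. Qed.
Let W0 h : 0 < W h. Proof. exact: wgt_gt0. Qed.
Let WM h M : 0 <= W h * M `^ th. Proof. by rewrite mulr_ge0 ?powR_ge0 // ltW. Qed.
Let strc h b : st (rcons h b) = rz (st h) b. Proof. exact: rzw_rcons. Qed.
Let htrc h b : ht (rcons h b) = hstep (st h) b (ht h). Proof. exact: hword_rcons. Qed.
Let Wrc h b : W (rcons h b) = W h * pr (st h) (ht h) b.
Proof. by rewrite /W -cats1 wgt_cat // -vol_hstep. Qed.
Let tot_ge0 h : 0 <= tot (ht h). Proof. by apply: sumr_ge0 => a _; rewrite ltW. Qed.

Lemma reach_tot_le P M p q r : (forall a, 0 <= q a) -> reach P M p q r ->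
  tot q <= M.
Proof.
move=> + H; elim: H => {p q r} [p q r _ qM _ _|p q r qM _ _|p q r rt rf ht1 IH1 _ _ _ q0'] //.
apply: (le_trans _ (IH1 (hstep_ge0 x0 p true q0'))); apply: ler_sum => a _; exact: hstep_ge.
Qed.

Lemma reach_le1 P M p q r : (forall a, 0 < q a) -> reach P M p q r -> r <= 1.
Proof.
move=> + H; elim: H => {p q r} [//|p q r _ r0 _|p q r rt rf _ IH1 _ IH2 hr qpos].
  exact: le_trans ler01.
apply: le_trans hr _; rewrite -(pr_sum x0 p qpos).
by apply: lerD; rewrite ler_piMr ?pr_ge0 // ?IH1 // ?IH2 //; exact: hstep_gt0.
Qed.

(** The moment bound is proved by induction on the depth of [stopped]; [IHN] is the induction
    hypothesis, available at every word [h]. *)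
Variable N : nat.
Hypothesis IHN : forall m h, (m <= N)%N -> Y m h <= C * phi h.

Let phi_le h M : tot (ht h) <= M -> phi h <= W h * M `^ th.
Proof.
move=> hM; rewrite ler_pM2l //; apply: ge0_ler_powR => //; rewrite nnegrE //.
exact: le_trans hM.
Qed.

Lemma stopped_tree (P : pair -> (A -> R) -> Prop) M k p q r n h : p = st h -> q = ht h ->
  0 <= k <= 1 ->
  (forall n h, P (st h) (ht h) -> tot (ht h) <= M -> (n <= N.+1)%N ->
     Y n h <= W h * M `^ th * (1 + (1 - k) * C)) ->
  ((n <= N)%N \/ n = N.+1 /\ 0 < r) -> reach P M p q r ->
  Y n h <= W h * M `^ th * (1 + (1 - r * k) * C).
Proof.
move=> + + /andP[k0 k1] HP + H.
have C0 : 0 <= C by apply: le_trans C1.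
elim: H n h => {p q r} [p q r Pq qM r1|p q r qM r0|p q r rt rf hrt IH1 hrf IH2 hr] n h ep eq hn.
- apply: le_trans (HP n h _ _ _) _; rewrite -?ep -?eq //.
    by case: hn => [/leqW //|[-> _]].
  apply: ler_wpM2l; first exact: WM.
  by rewrite lerD2l ler_wpM2r // lerD2l lerN2 ler_piMl.
- case: hn => [hn|[_ /lt_le_trans /(_ r0)]]; last by rewrite ltxx.
  apply: le_trans (IHN h hn) _.
  apply: (@le_trans _ _ (C * (W h * M `^ th))).
    by rewrite ler_wpM2l // phi_le // -eq.
  rewrite mulrC ler_wpM2l ?WM //.
  rewrite -[leLHS]add0r lerD // ler_peMl // lerBrDr -[leRHS]addr0 lerD2l.
  by rewrite mulr_le0_ge0.
have q0' a : 0 < q a by rewrite eq.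
have rt1 := reach_le1 (hstep_gt0 x0 p true q0') hrt.
have rf1 := reach_le1 (hstep_gt0 x0 p false q0') hrf.
have tt := reach_tot_le (fun a => ltW (hstep_gt0 x0 p true q0' a)) hrt.
have tf := reach_tot_le (fun a => ltW (hstep_gt0 x0 p false q0' a)) hrf.
have psum := pr_sum x0 p q0'.
have c1 b (rb : R) : rb <= 1 -> 1 <= 1 + (1 - rb * k) * C.
  move=> rb1; rewrite lerDl mulr_ge0 // subr_ge0.
  have [h0|h0] := leP 0 rb; first by rewrite mulr_ile1.
  by apply: le_trans ler01; rewrite mulr_le0_ge0 // ltW.
have rr : r <= 1.
  apply: le_trans hr _; rewrite -psum.
  by apply: lerD; rewrite ler_piMr ?pr_ge0.
have child b n' rb : (n' <= N)%N -> rb <= 1 -> tot (hstep p b q) <= M ->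
    Y n' (rcons h b) <= W (rcons h b) * M `^ th * (1 + (1 - rb * k) * C) ->
    (if E (rcons h b) then phi (rcons h b) else Y n' (rcons h b)) <=
    W (rcons h b) * M `^ th * (1 + (1 - rb * k) * C).
  move=> _ rb1 tb hY; case: ifP => // _.
  apply: (@le_trans _ _ (W (rcons h b) * M `^ th)).
    by apply: phi_le; rewrite htrc -ep -eq.
  by rewrite ler_peMr ?WM // c1.
case: n hn => [|n] hn.
  apply: le_trans (_ : W h * M `^ th <= _).
    apply: phi_le; rewrite -eq; apply: le_trans tt.
    by apply: ler_sum => a _; apply: hstep_ge => c; exact: ltW.
  by rewrite ler_peMr ?WM //; exact: (c1 true).
have nN : (n <= N)%N by case: hn => [/ltnW //|[[->]]].
have e1 b : rz p b = st (rcons h b) by rewrite strc ep.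
have e2 b : hstep p b q = ht (rcons h b) by rewrite htrc ep eq.
have h1 := child true n rt nN rt1 tt (IH1 n (rcons h true) (e1 _) (e2 _) (or_introl nN)).
have h2 := child false n rf nN rf1 tf (IH2 n (rcons h false) (e1 _) (e2 _) (or_introl nN)).
apply: le_trans (lerD h1 h2) _; rewrite !Wrc -ep -eq.
set pt := pr p q true in psum hr *; set pf := pr p q false in psum hr *.
have -> : W h * pt * M `^ th * (1 + (1 - rt * k) * C) + W h * pf * M `^ th * (1 + (1 - rf * k) * C) =
  W h * M `^ th * ((pt + pf) + ((pt + pf) - (pt * rt + pf * rf) * k) * C) by ring.
apply: ler_wpM2l; first exact: WM.
rewrite psum lerD2l ler_wpM2r // lerD2l lerN2 ler_wpM2r //.
Qed.

(** Following [u] to its end produces a return, with conditional probability at least [k ^+ size u];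
    every departure from [u] is paid with the induction hypothesis. *)
Lemma stopped_word (k M : R) u n h : 0 <= k <= 1 -> u != [::] ->
  E (h ++ u) -> 2 ^+ size u * tot (ht h) <= M -> (n <= N.+1)%N ->
  (forall i, (i < size u)%N ->
     k <= pr (st (h ++ take i u)) (ht (h ++ take i u)) (nth true u i)) ->
  Y n h <= W h * M `^ th * (1 + (1 - k ^+ size u) * C).
Proof.
move=> /andP[k0 k1]; have C0 : 0 <= C by apply: le_trans C1.
elim: u n h => // b u IH n h _ Eu hM nN hk.
have kk m : 0 <= k ^+ m <= 1 by rewrite exprn_ge0 // exprn_ile1.
have c1 m : 1 <= 1 + (1 - k ^+ m) * C.
  by rewrite lerDl mulr_ge0 // subr_ge0; case/andP: (kk m).
have tM : 2 * tot (ht h) <= M.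
  apply: le_trans hM; rewrite ler_wpM2r // exprS ler_peMr // exprn_ege1 // ler1n //.
case: n nN => [|n] nN.
  apply: le_trans (_ : W h * M `^ th <= _).
    by apply: phi_le; apply: le_trans tM; rewrite ler_peMl // ler1n.
  by rewrite ler_peMr ?WM //; exact: (c1 (size u).+1).
have totc c : tot (ht (rcons h c)) <= 2 * tot (ht h).
  by rewrite htrc; apply: sumq_hstep_le => a; exact: ltW.
have other c : (if E (rcons h c) then phi (rcons h c) else Y n (rcons h c)) <=
    W (rcons h c) * M `^ th * (1 + C).
  have hp : phi (rcons h c) <= W (rcons h c) * M `^ th.
    by apply: phi_le; apply: le_trans (totc c) tM.
  have C1' : 1 <= 1 + C by rewrite lerDl.
  case: ifP => _; first by apply: le_trans hp _; rewrite ler_peMr ?WM.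
  apply: le_trans (IHN _ nN) _; rewrite mulrC.
  apply: (@le_trans _ _ (W (rcons h c) * M `^ th * C)); first exact: ler_wpM2r.
  by rewrite ler_wpM2l ?WM // lerDr.
have main : (if E (rcons h b) then phi (rcons h b) else Y n (rcons h b)) <=
    W (rcons h b) * M `^ th * (1 + (1 - k ^+ size u) * C).
  case: ifP => [_|nE].
    apply: (@le_trans _ _ (W (rcons h b) * M `^ th)).
      by apply: phi_le; apply: le_trans (totc b) tM.
    by rewrite ler_peMr ?WM // c1.
  apply: IH.
  - by apply: contraFneq nE => e; move: Eu; rewrite e cats1.
  - by rewrite cat_rcons.
  - apply: le_trans hM; rewrite /= exprSr -mulrA ler_pM2l ?exprn_gt0 //.
  - exact: leqW.
  - by move=> i iu; have := hk i.+1 iu; rewrite /= -cat_rcons.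
have kb : k <= pr (st h) (ht h) b by have := hk 0%N isT; rewrite take0 cats0.
have psum := pr_sum x0 (st h) (htpos h).
have fin c : c = ~~ b -> pr (st h) (ht h) b + pr (st h) (ht h) c = 1.
  by move=> ->; case: (b); rewrite //= addrC.
have sum : Y n.+1 h <= W (rcons h b) * M `^ th * (1 + (1 - k ^+ size u) * C) +
     W (rcons h (~~ b)) * M `^ th * (1 + C).
  rewrite /Y /=; case: b main {kb fin hk Eu hM IH} => /= main; first exact: lerD.
  by rewrite addrC; apply: lerD.
apply: le_trans sum _; rewrite !Wrc.
have := fin _ erefl; move: kb; set pb := pr _ _ b; set pc := pr _ _ (~~ b) => kb psum'.
have -> : W h * pb * M `^ th * (1 + (1 - k ^+ size u) * C) + W h * pc * M `^ th * (1 + C) =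
  W h * M `^ th * ((pb + pc) + ((pb + pc) - pb * k ^+ size u) * C) by ring.
apply: ler_wpM2l; first exact: WM.
rewrite psum' lerD2l ler_wpM2r // lerD2l lerN2 /= exprS ler_wpM2r //.
by case/andP: (kk (size u)).
Qed.

End Moment.

Lemma exists_small_power (M r : R) : 1 <= M -> 0 < r ->
  exists th, 0 < th <= 1 /\ M `^ th <= 1 + r.
Proof.
move=> M1 r0; have M0 : 0 < M by apply: lt_le_trans M1.
have l1 : 0 < ln (1 + r) by rewrite ln_gt0 // ltrDl.
have lM : 0 <= ln M by rewrite ln_ge0.
pose th := Num.min 1 (ln (1 + r) / (1 + ln M)).
have th0 : 0 < th by rewrite lt_min ltr01 divr_gt0 // addrC ltr_wpDl.
exists th; split; first by rewrite th0 ge_min lexx.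
rewrite -ler_ln ?posrE ?powR_gt0 ?addr_gt0 // ln_powR.
apply: (@le_trans _ _ (ln (1 + r) / (1 + ln M) * ln M)).
  by rewrite ler_wpM2r // ge_min lexx orbT.
rewrite mulrAC ler_pdivrMr ?ltr_pwDl //.
by rewrite ler_pM2l // lerDr.
Qed.

(** From any word, Kerckhoff's estimate followed by one strong word gives a return with probability
    at least [r], while the total grows at most by the factor [M]. For a small exponent [th] the
    power of [M] is outweighed by the returning mass, and the induction on depth closes. *)
Lemma moment_bound : exists th C : R, [/\ 0 < th <= 1, 1 <= C &
  forall p q, okp p -> (forall a, 0 < q a) -> forall n h,
  stopped (ends_strong p) (fun h => wgt p q h * tot (hword p h q) `^ th) n h <=
  C * (wgt p q h * tot (hword p h q) `^ th)].
Proof.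
have [C1 [M0 [r0 [C11 /andP[r00 r01] hK]]]] := @kerckhoff R A x0 hA.
have C10 : 0 < C1 by apply: lt_le_trans C11.
pose L := strong_len; pose M := 2 ^+ L * Num.max M0 1.
have M1 : 1 <= M by rewrite mulr_ege1 // ?exprn_ege1 ?ler1n // le_max lexx orbT.
have M0' : 0 <= M by apply: le_trans M1.
(* Lower bound for each move of the strong word: heights start within the factor [C1] of the unit
   and at most [L] moves increase them by [2 ^+ L]. *)
pose kap := C1^-1 / (C1^-1 + 2 ^+ L * C1).
have iC : 0 < C1^-1 by rewrite invr_gt0.
have LC : 0 < 2 ^+ L * C1 by rewrite mulr_gt0 ?exprn_gt0.
have kap0 : 0 < kap by rewrite divr_gt0 // addr_gt0.
have kap1 : kap <= 1 by rewrite ler_pdivrMr ?addr_gt0 // mul1r lerDl ltW.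
pose r := r0 * kap ^+ L.
have k01 : 0 <= kap ^+ L <= 1 by rewrite exprn_ge0 ?exprn_ile1 // ltW.
have r_gt0 : 0 < r by rewrite mulr_gt0 ?exprn_gt0.
have r_le1 : r <= 1 by rewrite mulr_ile1 ?exprn_ge0 ?exprn_ile1 // ltW.
have r20 : 0 < r / 2 by rewrite divr_gt0.
have [th [th01 hth]] := exists_small_power M1 r20.
have /andP[th0 th1] := th01.
(* As the power of [M] is at most 1 + r / 2, this choice gives (1 + r / 2) (1 + (1 - r) C) <= C,
   which is what the induction needs. *)
pose C := (1 + r / 2) / (r / 2).
have C_ge1 : 1 <= C by rewrite ler_pdivlMr // mul1r lerDr.
have HC : M `^ th * (1 + (1 - r) * C) <= C.
  apply: (@le_trans _ _ ((1 + r / 2) * (1 + (1 - r) * C))).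
    rewrite ler_wpM2r // addr_ge0 // mulr_ge0 ?subr_ge0 //.
    by apply: le_trans C_ge1.
  have eC : r / 2 * C = 1 + r / 2.
    by rewrite /C; field; rewrite lt0r_neq0 // lt0r_neq0.
  have : 0 <= C by apply: le_trans C_ge1.
  nra.
exists th, C; split=> // p q okp_ q0; elim/ltn_ind => N IH h.
have W0 : 0 < wgt p q h by exact: wgt_gt0.
have tot0 h' : 0 < tot (hword p h' q).
  apply: lt_le_trans (hword_gt0 x0 p h' q0 x0) _; apply: sumq_le => c.
  by rewrite ltW // hword_gt0.
case: N IH => [|N] IH.
  by rewrite /= ler_peMl // mulr_ge0 ?powR_ge0 // ltW.
have IHN m h' : (m <= N)%N -> stopped (ends_strong p)
    (fun h => wgt p q h * tot (hword p h q) `^ th) m h' <=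
    C * (wgt p q h' * tot (hword p h' q) `^ th) by move=> mN; apply: IH.
have okh := okp_rzw x0 hA h okp_; have qh := hword_gt0 x0 p h q0.
have tree := hK _ _ okh qh.
pose T := tot (hword p h q).
apply: le_trans (_ : wgt p q h * (M * T) `^ th * (1 + (1 - r) * C) <= _); last first.
  rewrite powRM // -/T ?(ltW (tot0 h)) //.
  have -> : wgt p q h * (M `^ th * T `^ th) * (1 + (1 - r) * C) =
    (M `^ th * (1 + (1 - r) * C)) * (wgt p q h * T `^ th) by ring.
  by apply: ler_wpM2r => //; rewrite mulr_ge0 ?powR_ge0 // ltW.
have leM : M0 * T <= M * T.
  rewrite ler_pM2r ?tot0 //; apply: (@le_trans _ _ (Num.max M0 1)); first by rewrite le_max lexx.
  by rewrite ler_peMl ?exprn_ege1 ?ler1n // le_max ler01 orbT.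
have tree' : reach (fun _ q' => (forall a, T / C1 <= q' a <= C1 * T) /\ tot q' <= M0 * T) (M * T)
    (rzw p h) (hword p h q) r0.
  rewrite -[r0]mulr1; apply: (reach_comp hA leM _ okh qh _ tree); first by rewrite ler01 lexx.
  by move=> p' q' ok' q'0 hb tM; apply: reach_ok => //; exact: le_trans tM leM.
apply: (stopped_tree q0 (ltW th0) C_ge1 IHN _ _ k01 _ _ tree') => //; last first.
  by right.
move=> n h' [hb tM0] tM nN; have okh' := okp_rzw x0 hA h' okp_.
have [u [su cu]] := exists_chunks nchunks okh'.
have su' : size u = L by exact: su.
rewrite -su'; apply: (stopped_word q0 (ltW th0) C_ge1 IHN) => //.
- by rewrite (ltW kap0).
- by rewrite -size_eq0 su /strong_len /nchunks muln_eq0 addn2 /= -lt0n.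
- by apply: ends_strong_cat; rewrite /strong su eqxx.
- rewrite su' /M -mulrA ler_pM2l ?exprn_gt0 //; apply: le_trans tM0 _.
  by rewrite ler_pM2r ?tot0 // le_max lexx.
move=> i iu; have q'0 := hword_gt0 x0 p h' q0.
have -> : kap = (T / C1) / (T / C1 + 2 ^+ L * C1 * T).
  have T0 : 0 < T := tot0 h; have e2 : 0 < 2 ^+ L :> R by rewrite exprn_gt0.
  by rewrite /kap; field; rewrite !lt0r_neq0 // ?(addr_gt0, mulr_gt0).
rewrite hword_cat rzw_cat; apply: pr_lower.
- by rewrite divr_gt0 ?tot0.
- by rewrite !mulr_gt0 ?exprn_gt0 ?tot0.
- apply: le_trans (hword_ge _ _ _ _ (fun c => ltW (q'0 c))).
  by case/andP: (hb (los (rzw (rzw p h') (take i u)) (nth true u i))).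
rewrite hword_gt0 //=; apply: le_trans (@hword_le _ _ _ _ _ _ (C1 * T) _ _) _.
  by move=> c; rewrite (ltW (q'0 c)) /=; case/andP: (hb c).
rewrite mulrA ler_pM2r ?tot0 // ler_pM2r // ler_weXn2l ?ler1n //.
by rewrite -su' size_take iu ltnW.
Qed.

End ReturnTimes.

(** * Outer measure of sets of paths *)

Import numFieldNormedType.Exports.
Local Open Scope classical_set_scope.

(** Only an inequality is asked of the children, because mass may be lost to paths that never
    return; finite duplicate-free families stand for countable sums. *)
Record tree_weight (R : realType) (W : countType) := TreeWeight {
  tw :> seq W -> R;
  tw_ge0 : forall u, 0 <= tw u;
  tw_sup : forall u F, uniq F -> \sum_(a <- F) tw (rcons u a) <= tw u }.

Section CylinderMeasure.
Variables (R : realType) (W : countType) (y0 : W).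

(** The letter [z] is a phantom parameter: it lets the type of paths carry the default point that a
    pointed type requires. *)
Definition alph_seq (z : W) := nat -> W.
Definition paths := alph_seq y0.
HB.instance Definition _ := gen_eqMixin paths.
HB.instance Definition _ := gen_choiceMixin paths.
HB.instance Definition _ := isPointed.Build paths (fun _ => y0).

Definition cyl (u : seq W) : set paths := [set y | mkseq y (size u) = u].

Variable w : tree_weight R W.
Let w0 := tw_ge0 w.
Let wsup := @tw_sup _ _ w.

(** The total weight of a countable set of words is bounded through its finite subfamilies, so no
    summation over words is needed. *)
Definition cost (U : set (seq W)) (e : \bar R) : Prop :=
  forall F, uniq F -> (forall u, u \in F -> U u) -> ((\sum_(u <- F) w u)%:E <= e)%E.

Definition cmu (S : set paths) : \bar R := ereal_inf
  [set e | exists2 U, S `<=` \bigcup_(u in U) cyl u & cost U e].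

Lemma cost_ge0 U e : cost U e -> (0 <= e)%E.
Proof. by move=> /(_ [::] isT); rewrite big_nil; apply. Qed.

Lemma cmu_ge0 S : (0 <= cmu S)%E.
Proof. by apply: le_ereal_inf_tmp => e [U _ /cost_ge0]. Qed.

Lemma cmu_le S U e : S `<=` \bigcup_(u in U) cyl u -> cost U e -> (cmu S <= e)%E.
Proof. by move=> SU cU; apply: ereal_inf_lbound; exists U. Qed.

Lemma le_cmu : {homo cmu : A B / A `<=` B >-> (A <= B)%E}.
Proof.
move=> S T ST; apply/ereal_inf_le_tmp => e [U TU cU]; exists U => //.
exact: subset_trans TU.
Qed.

Lemma cmu0 : cmu set0 = 0%E.
Proof.
apply/eqP; rewrite eq_le cmu_ge0 andbT; apply: (@cmu_le _ set0) => //.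
move=> F uF h; case: F uF h => [|u F] _ h; first by rewrite big_nil.
by have := h u (mem_head _ _).
Qed.

Lemma cmu_cyl u : (cmu (cyl u) <= (w u)%:E)%E.
Proof.
apply: (@cmu_le _ [set u]); first by move=> y hy; exists u.
move=> [|v F] /= uF h; rewrite ?big_nil ?lee_fin //.
have -> : F = [::].
  case: F uF h => // v' F /= /andP[+ _] h; rewrite inE negb_or => /andP[/eqP + _].
  by rewrite (h v) ?mem_head // (h v') // inE mem_head orbT.
by rewrite big_seq1 (h v) ?mem_head.
Qed.

Lemma cmu_lty S : (cmu S < +oo)%E.
Proof.
apply: (@le_lt_trans _ _ (w [::])%:E); last exact: ltry.
by apply: le_trans (cmu_cyl [::]); apply: le_cmu.
Qed.

Lemma cmu_fin S : cmu S \is a fin_num.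
Proof. by rewrite ge0_fin_numE ?cmu_ge0 // cmu_lty. Qed.

Lemma cmu_adherent S (e : R) : 0 < e ->
  exists U, S `<=` \bigcup_(u in U) cyl u /\ cost U (cmu S + e%:E)%E.
Proof.
move=> e0; have [x [U SU cU] hx] := lb_ereal_inf_adherent e0 (cmu_fin S).
exists U; split=> // F uF FU; apply: le_trans (cU F uF FU) _; exact: ltW.
Qed.

Lemma cost_bigcup (U : nat -> set (seq W)) (e : nat -> \bar R) :
  (forall n, cost (U n) (e n)) -> cost (\bigcup_n U n) (\sum_(n <oo) e n)%E.
Proof.
move=> cU F uF FU.
have e0 n : (0 <= e n)%E by exact: cost_ge0.
have [f hf] : exists f : seq W -> nat, forall u, u \in F -> U (f u) u.
  have : forall u, exists n, u \in F -> U n u.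
    move=> u; case: (boolP (u \in F)) => uF'; last by exists 0%N.
    by have [n _ Un] := FU u uF'; exists n.
  by case/choice => f hf; exists f.
pose N := (\max_(u <- F) f u).+1.
have fN u : u \in F -> (f u < N)%N.
  by move=> uF'; rewrite ltnS; apply: leq_bigmax_seq.
apply: (@le_trans _ _ (\sum_(0 <= n < N) e n)%E); last exact: nneseries_lim_ge.
have -> : \sum_(u <- F) w u = \sum_(0 <= n < N) \sum_(u <- [seq v <- F | f v == n]) w u.
  under [RHS]eq_bigr do rewrite big_filter.
  rewrite (exchange_big_dep xpredT) //=.
  rewrite big_seq [RHS]big_seq; apply: eq_bigr => u /fN uN.
  under eq_bigl do rewrite eq_sym.
  by rewrite big_nat1_eq uN.
rewrite -sumEFin; apply: lee_sum => n _; apply: cU; first exact: filter_uniq.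
by move=> u; rewrite mem_filter => /andP[/eqP <-]; exact: hf.
Qed.

Lemma cmu_sigma_subadditive : sigma_subadditive cmu.
Proof.
move=> S.
suff add2e (e : {posnum R}) :
    (cmu (\bigcup_n S n) <= \sum_(i <oo) cmu (S i) + e%:num%:E)%E.
  by apply/lee_addgt0Pr => _/posnumP[].
rewrite (le_trans _ (epsilon_trick _ _ _))//; last by move=> n; exact: cmu_ge0.
have H n : exists U, S n `<=` \bigcup_(u in U) cyl u /\
    cost U (cmu (S n) + (e%:num / (2 ^ n.+1)%:R)%:E)%E by exact: cmu_adherent.
have [U hU] := choice H.
apply: (@cmu_le _ (\bigcup_n U n)); last by apply: cost_bigcup => n; exact: (hU n).2.
move=> y [n _ /(hU n).1 [u Uu yu]]; exists u => //; by exists n.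
Qed.

HB.instance Definition _ := isOuterMeasure.Build R paths cmu cmu0 cmu_ge0 le_cmu
  cmu_sigma_subadditive.

Lemma cyl_rcons u a y : cyl (rcons u a) y <-> cyl u y /\ y (size u) = a.
Proof.
rewrite /cyl /= size_rcons mkseqS; split=> [/rcons_inj [-> ->] //|[-> ->]] //.
Qed.

Lemma cyl_cat u v y : cyl (u ++ v) y -> cyl u y.
Proof.
elim/last_ind: v => [|v a IH]; first by rewrite cats0.
by rewrite -rcons_cat => /cyl_rcons [/IH].
Qed.

Lemma cyl_prefix u v y : cyl u y -> cyl v y -> (size u <= size v)%N -> exists v', v = u ++ v'.
Proof.
rewrite /cyl /= => <- <-; rewrite !size_mkseq => /subnKC <-.
by exists (mkseq (fun i => y (size u + i)) (size v - size u)); rewrite /mkseq iotaD map_cat add0n -[in iota (size u)](addn0 (size u)) iotaDl -map_comp.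
Qed.

(** Two cylinders are nested or disjoint. When [u] is longer than [v], descend one letter [a] along
    [u]: the children of [v] other than [a] miss [u] and together weigh at most
    [w v - w (rcons v a)]. *)
Lemma cmu_cyl_split u v :
  (cmu (cyl v `&` cyl u) + cmu (cyl v `&` ~` cyl u) <= (w v)%:E)%E.
Proof.
have [uv|vu] := leqP (size u) (size v).
  have [[y [hu hv]]|no] := pselect (exists y, cyl u y /\ cyl v y).
    have [v' e] := cyl_prefix hu hv uv.
    have -> : cyl v `&` ~` cyl u = set0.
      by apply/seteqP; split=> // z [+ nz]; rewrite e => /cyl_cat.
    rewrite cmu0 adde0; apply: le_trans (cmu_cyl v); apply: le_cmu; exact: subIsetl.
  have -> : cyl v `&` cyl u = set0.
    by apply/seteqP; split=> // z [hv hu]; apply: no; exists z.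
  rewrite cmu0 add0e; apply: le_trans (cmu_cyl v); apply: le_cmu; exact: subIsetl.
move: {2}(size u - size v)%N (erefl (size u - size v)%N) => n.
elim: n v vu => [|n IH] v vu en; first by lia.
have [[y [hu hv]]|no] := pselect (exists y, cyl u y /\ cyl v y); last first.
  have -> : cyl v `&` cyl u = set0.
    by apply/seteqP; split=> // z [hv hu]; apply: no; exists z.
  rewrite cmu0 add0e; apply: le_trans (cmu_cyl v); apply: le_cmu; exact: subIsetl.
pose a := y (size v).
have uva z : cyl u z -> cyl v z -> cyl (rcons v a) z.
  move=> huz hvz; apply/cyl_rcons; split=> //; rewrite /a.
  have e : mkseq z (size u) = mkseq y (size u) by rewrite huz hu.
  have := congr1 (fun s => nth y0 s (size v)) e; rewrite !nth_mkseq //.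
have split_a : (cmu (cyl (rcons v a) `&` cyl u) + cmu (cyl (rcons v a) `&` ~` cyl u) <=
    (w (rcons v a))%:E)%E.
  have [e|ne] := eqVneq (size v).+1 (size u); last first.
    by apply: IH; rewrite size_rcons; lia.
  have eu : u = rcons v a.
    have := uva y hu hv; rewrite /cyl /= size_rcons e hu //.
  rewrite -eu setIid setICr cmu0 adde0; exact: cmu_cyl.
have h1 : (cmu (cyl v `&` cyl u) <= cmu (cyl (rcons v a) `&` cyl u))%E.
  by apply: le_cmu => z [hv' hu']; split=> //; apply: uva.
pose U : set (seq W) := [set s | exists2 b, b != a & s = rcons v b].
have h2 : (cmu (cyl v `&` ~` cyl u) <=
   cmu (cyl (rcons v a) `&` ~` cyl u) + (w v - w (rcons v a))%:E)%E.
  apply: (@le_trans _ _ (cmu ((cyl (rcons v a) `&` ~` cyl u) `|` \bigcup_(s in U) cyl s))).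
    apply: le_cmu => z [hvz nuz]; have [ea|ea] := eqVneq (z (size v)) a.
      by left; split=> //; apply/cyl_rcons.
    by right; exists (rcons v (z (size v))); [exists (z (size v))|apply/cyl_rcons].
  apply: le_trans (outer_measureU2 cmu _ _) _; rewrite leeD2l //.
  apply: (@cmu_le _ U) => //= F uF FU.
  have F' : exists2 G, F = [seq rcons v b | b <- G] & a \notin G.
    elim: F uF FU => [|s F IHF] /=; first by exists [::].
    move=> /andP[_ uF] FU; have [|G eG aG] := IHF uF.
      by move=> x xF; apply: FU; rewrite inE xF orbT.
    have [b ba es] := FU s (mem_head _ _); exists (b :: G); first by rewrite eG es.
    by rewrite inE eq_sym negb_or ba.
  have [G eG aG] := F'; rewrite eG big_map lee_fin lerBrDl.
  have uG : uniq (a :: G) by rewrite /= aG; move: uF; rewrite eG => /map_uniq.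
  by have := wsup v uG; rewrite big_cons.
apply: le_trans (leeD h1 h2) _; rewrite addeA.
apply: (@le_trans _ _ ((w (rcons v a))%:E + (w v - w (rcons v a))%:E)%E).
  exact: leeD2r.
by rewrite -EFinD subrKC.
Qed.

Definition cover_at (U : set (seq W)) (k : nat) : option (seq W) :=
  if pickle_inv k is Some v then if `[< U v >] then Some v else None else None.
Definition ocyl (o : option (seq W)) := if o is Some v then cyl v else set0.
Definition ow (o : option (seq W)) := if o is Some v then w v else 0.

Lemma cover_at_sub U : \bigcup_(u in U) cyl u = \bigcup_k ocyl (cover_at U k).
Proof.
apply/seteqP; split=> y.
  move=> [u Uu yu]; exists (pickle u) => //.
  by rewrite /cover_at pickleK_inv; case: asboolP.
move=> [k _]; rewrite /cover_at; case: pickle_inv => //= v; case: asboolP => //= Uv yv.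
by exists v.
Qed.

Lemma cost_series U e : cost U e -> (\sum_(k <oo) (ow (cover_at U k))%:E <= e)%E.
Proof.
move=> cU; apply: lime_le.
  by apply: is_cvg_nneseries => n _ _; rewrite lee_fin; case: (cover_at U n) => /=.
apply: nearW => N; rewrite sumEFin.
have -> : \sum_(0 <= k < N) ow (cover_at U k) =
    \sum_(v <- [seq v <- pmap pickle_inv (iota 0 N) | `[< U v >]]) w v.
  rewrite /index_iota subn0; elim: (iota 0 N) => [|k s IH]; rewrite ?big_nil //= big_cons IH.
  rewrite /cover_at; case: pickle_inv => [v|] /=; last by rewrite add0r.
  by case: asboolP => _; rewrite ?big_cons //= add0r.
apply: cU; last by move=> u; rewrite mem_filter => /andP[/asboolP].
rewrite filter_uniq //; apply: (pmap_uniq (g := pickle)); last exact: iota_uniq.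
exact: pickle_invK.
Qed.

(** Each cylinder of a nearly optimal cover of [X] is split by [cmu_cyl_split]. This yields the
    measure [pmu], used for continuity along decreasing sequences and for integration. *)
Lemma cyl_caratheodory u : (cmu : set paths -> \bar R).-caratheodory (cyl u).
Proof.
apply: le_caratheodory_measurable => X.
apply/lee_addgt0Pr => e e0.
have [U [XU cU]] := cmu_adherent X e0.
rewrite cover_at_sub in XU.
have h (D : set paths) : (cmu (X `&` D) <= \sum_(k <oo) cmu (ocyl (cover_at U k) `&` D))%E.
  apply: le_trans (cmu_sigma_subadditive _); apply: le_cmu => y [/XU [k _ yk] yD].
  by exists k.
apply: le_trans (leeD (h (cyl u)) (h (~` cyl u))) _.
rewrite -nneseriesD; do ?by [move=> *; exact: cmu_ge0].
apply: le_trans (cost_series cU); apply: lee_nneseries.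
  by move=> k _ _; rewrite adde_ge0 ?cmu_ge0.
move=> k _; case: (cover_at U k) => [v|] /=; first exact: cmu_cyl_split.
by rewrite !set0I cmu0 adde0.
Qed.

Definition pmu : set (caratheodory_type cmu) -> \bar R := cmu.
HB.instance Definition _ := isMeasure.Build _ _ _ pmu (@caratheodory_measure0 R paths cmu)
  (@caratheodory_measure_ge0 R paths cmu) (@caratheodory_measure_sigma_additive R paths cmu).

Lemma depth_measurable n (P : seq W -> Prop) :
  measurable ([set y | P (mkseq y n)] : set (caratheodory_type cmu)).
Proof.
have -> : [set y | P (mkseq y n)] = \bigcup_k ocyl (cover_at [set u | P u /\ size u = n] k).
  rewrite -cover_at_sub; apply/seteqP; split=> y /=.
    by move=> Py; exists (mkseq y n); rewrite /cyl /= size_mkseq.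
  by move=> [u [Pu su]]; rewrite /cyl /= su => ->.
apply: bigcupT_measurable => k; case: (cover_at _ k) => [v|] /=; last exact: measurable0.
exact: cyl_caratheodory.
Qed.

End CylinderMeasure.

(** * Finite energy forces exponential decay *)

Lemma sum_sub_uniq (R : numDomainType) (T : eqType) (g : T -> R) (s t : seq T) :
  (forall x, 0 <= g x) -> uniq s -> {subset s <= t} -> \sum_(x <- s) g x <= \sum_(x <- t) g x.
Proof.
move=> g0; elim: s t => [|x s IH] t /=; first by rewrite big_nil sumr_ge0.
move=> /andP[xs us] st; have xt : x \in t by apply: st; rewrite mem_head.
rewrite big_cons (perm_big _ (perm_to_rem xt)) big_cons lerD2l; apply: IH => // z zs.
have zt : z \in t by apply: st; rewrite inE zs orbT.
have := perm_mem (perm_to_rem xt) z; rewrite zt inE => /esym/orP[/eqP e|//].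
by rewrite -e zs in xs.
Qed.

Lemma big_fiber (R : pzSemiRingType) (T I : eqType) (f : T -> I) (g : T -> R) (s : seq T) (r : seq I) :
  uniq r -> {in s, forall x, f x \in r} ->
  \sum_(x <- s) g x = \sum_(i <- r) \sum_(x <- s | f x == i) g x.
Proof.
move=> ur sr; rewrite (exchange_big_dep xpredT) //=.
rewrite big_seq [RHS]big_seq; apply: eq_bigr => x /sr xr.
rewrite big_mkcond (bigD1_seq (f x)) //= eqxx big1 ?addr0 // => i /negPf.
by rewrite eq_sym => ->.
Qed.

Section ShiftBound.
Variables (R : realType) (W : countType) (y0 : W).
Variables (w w' : tree_weight R W) (K : R).
Let w0 := tw_ge0 w.
Let w'0 := tw_ge0 w'.
Let wsup := @tw_sup _ _ w.
Hypothesis K0 : 0 <= K.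
(** One-sided independence up to the factor [K]: [w'] dominates the law of the future whatever the
    past. *)
Hypothesis wK : forall u v, w (u ++ v) <= K * w u * w' v.

Lemma sum_level t H : uniq H -> (forall u, u \in H -> size u = t) ->
  \sum_(u <- H) w u <= w [::].
Proof.
elim: t H => [|t IH] H uH sH.
  apply: le_trans (@sum_sub_uniq _ _ w H [:: [::]] w0 uH _) _; last by rewrite big_seq1.
  by move=> u /sH /size0nil ->; rewrite mem_head.
pose G := undup (map (take t) H).
rewrite (@big_fiber _ _ _ (take t) w H G) ?undup_uniq //; last first.
  by move=> u uu; rewrite mem_undup map_f.
apply: le_trans (IH G _ _); last 2 first.
- exact: undup_uniq.
- move=> u; rewrite mem_undup => /mapP[v /sH sv ->].
  by rewrite size_takel // sv.
apply: ler_sum => g _; rewrite -big_filter.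
set Hg := [seq x <- H | _].
have e : Hg = map (rcons g) (map (last y0) Hg).
  rewrite -map_comp -[LHS]map_id; apply/eq_in_map => u; rewrite mem_filter => /andP[/eqP <- /sH].
  case/lastP: u => // u a; rewrite size_rcons => -[<-] /=.
  by rewrite last_rcons -cats1 take_size_cat // cats1.
rewrite e big_map; apply: wsup.
have : uniq Hg by apply: filter_uniq.
by rewrite {1}e => /map_uniq.
Qed.

Definition pshift t (y : paths y0) : paths y0 := fun n => y (t + n)%N.

Lemma mkseq_shift t y n : mkseq y (t + n) = mkseq y t ++ mkseq (pshift t y) n.
Proof. by rewrite /mkseq iotaD map_cat add0n -[in iota t](addn0 t) iotaDl -map_comp. Qed.

(** A cover of [E] yields a cover of its preimage by words made of [t] letters followed by a word of
    the cover. [wK] separates the two factors, and the words of length [t] weigh at most [w [::]]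
    together. *)
Lemma cmu_shift t (E : set (paths y0)) :
  (cmu w [set y | E (pshift t y)] <= (K * w [::])%:E * cmu w' E)%E.
Proof.
have h0 : 0 <= K * w [::] by rewrite mulr_ge0.
suff H : forall e, 0 < e -> (cmu w [set y | E (pshift t y)] <=
    (K * w [::])%:E * (cmu w' E + e%:E))%E.
  apply/lee_addgt0Pr => e e0.
  have e1 : 0 < e / (1 + K * w [::]) by rewrite divr_gt0 // ltr_pwDl.
  apply: le_trans (H _ e1) _; rewrite muleDr ?fin_num_adde_defl // leeD2l //.
  rewrite lee_fin mulrCA -[leRHS]mulr1 ler_pM2l // ler_pdivrMr ?mul1r ?lerDr //.
  by rewrite addrC ltr_wpDl.
move=> e e0; have [U [EU cU]] := @cmu_adherent R W y0 w' E e e0.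
apply: (@cmu_le _ _ _ _ _ [set h | size (take t h) = t /\ U (drop t h)]).
  move=> y /= /EU [u Uu yu]; exists (mkseq y (t + size u)).
    by rewrite /= mkseq_shift take_size_cat ?drop_size_cat ?size_mkseq // yu.
  by rewrite /cyl /= size_mkseq.
move=> F uF FU.
pose H := undup (map (take t) F); pose V := undup (map (drop t) F).
have hH : \sum_(h <- H) w h <= w [::].
  apply: (@sum_level t); first exact: undup_uniq.
  by move=> u; rewrite mem_undup => /mapP[v /FU [+ _] ->].
have hV : ((\sum_(v <- V) w' v)%:E <= cmu w' E + e%:E)%E.
  apply: cU; first exact: undup_uniq.
  by move=> u; rewrite mem_undup => /mapP[v /FU [_ +] ->].
apply: (@le_trans _ _ (K * (w [::] * \sum_(v <- V) w' v))%:E); last first.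
  by rewrite mulrA EFinM lee_wpmul2l // lee_fin.
rewrite lee_fin.
apply: (@le_trans _ _ (\sum_(p <- [seq (take t f, drop t f) | f <- F]) K * (w p.1 * w' p.2))).
  rewrite big_map; apply: ler_sum => f _ /=.
  by rewrite -{1}(cat_take_drop t f) mulrA wK.
rewrite -mulr_sumr ler_wpM2l //.
apply: (@le_trans _ _ (\sum_(p <- [seq (h, v) | h <- H, v <- V]) w p.1 * w' p.2)).
  apply: sum_sub_uniq => [p|//|p].
  - by rewrite mulr_ge0.
  - rewrite map_inj_uniq // => f f' [e1 e2].
    by rewrite -(cat_take_drop t f) e1 e2 cat_take_drop.
  - by move/mapP => [f fF ->]; apply: allpairs_f; rewrite mem_undup map_f.
rewrite big_allpairs /=; under eq_bigr do rewrite -mulr_sumr.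
by rewrite -mulr_suml ler_wpM2r // sumr_ge0.
Qed.

End ShiftBound.

(** * Energy of a vector along a path *)

Section Cocycle.
Variables (R : realType) (W : countType) (y0 : W) (d : nat) (A : W -> 'M[R]_d).
Implicit Types (y : paths y0) (v : 'rV[R]_d) (u : seq W).

Definition ssq v : R := \sum_i (v ord0 i) ^+ 2.
Definition cprod u : 'M[R]_d := foldl (fun M a => M *m A a) 1%:M u.
Definition energy_word u v : R := \sum_(0 <= k < size u) ssq (v *m cprod (take k u)).
Definition energy n y v : R := \sum_(0 <= k < n) ssq (v *m cprod (mkseq y k)).

Lemma energyE n y v : energy n y v = energy_word (mkseq y n) v.
Proof.
rewrite /energy /energy_word size_mkseq; apply: eq_big_nat => k /andP[_ kn].
congr (ssq (v *m cprod _)); rewrite /mkseq -map_take take_iota.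
by rewrite (minn_idPl (ltnW kn)).
Qed.

Lemma cprod_cat u u' : cprod (u ++ u') = cprod u *m cprod u'.
Proof.
rewrite /cprod foldl_cat; set M := foldl _ _ u; move: M.
elim: u' => [|a u' IH] M /=; first by rewrite mulmx1.
by rewrite IH mul1mx [in RHS]IH mulmxA.
Qed.

Lemma ssq_ge0 v : 0 <= ssq v. Proof. by apply: sumr_ge0 => i _; exact: sqr_ge0. Qed.

Lemma ssqZ c v : ssq (c *: v) = c ^+ 2 * ssq v.
Proof. by rewrite /ssq mulr_sumr; apply: eq_bigr => i _; rewrite mxE exprMn. Qed.

Lemma ssq_eq0 v : ssq v = 0 -> v = 0.
Proof.
move=> h; apply/rowP => i; rewrite mxE; apply/eqP; rewrite -sqrf_eq0.
have := h => /eqP; rewrite psumr_eq0; last by move=> j _; exact: sqr_ge0.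
by move/allP/(_ i); rewrite mem_index_enum => /(_ isT).
Qed.

Lemma energyS n y v : energy n.+1 y v = energy n y v + ssq (v *m cprod (mkseq y n)).
Proof. by rewrite /energy big_nat_recr. Qed.

Lemma energy_ge0 n y v : 0 <= energy n y v.
Proof. by apply: sumr_ge0 => i _; exact: ssq_ge0. Qed.

Lemma le_energy m n y v : (m <= n)%N -> energy m y v <= energy n y v.
Proof.
move/subnKC <-; elim: (n - m)%N => [|k IH]; first by rewrite addn0.
by rewrite addnS energyS; apply: le_trans IH _; rewrite lerDl ssq_ge0.
Qed.

Lemma energyZ n y c v : energy n y (c *: v) = c ^+ 2 * energy n y v.
Proof.
by rewrite /energy mulr_sumr; apply: eq_bigr => k _; rewrite -scalemxAl ssqZ.
Qed.

Lemma energy_shift t n y v :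
  energy (t + n) y v = energy t y v + energy n (pshift t y) (v *m cprod (mkseq y t)).
Proof.
elim: n => [|n IH]; first by rewrite addn0 [energy 0 _ _]big_geq // addr0.
by rewrite addnS !energyS IH -addrA (mkseq_shift y0 t y) cprod_cat mulmxA.
Qed.

(** Quantified over all vectors at once, so that one null set serves every log-slope vector. The
    bound [B] is arbitrary: boundedness is qualitative, while [ssq v], the first term of the energy,
    is the quantity that fails to control it. *)
Definition bad (C : R) : set (paths y0) := [set y | exists v B,
  (forall n, energy n y v <= B) /\ exists n, C * ssq v < energy n y v].

Lemma continuous_sum (T : topologicalType) (I : Type) (s : seq I) (f : I -> T -> R) :
  (forall i, continuous (f i)) -> continuous (fun x => \sum_(i <- s) f i x).
Proof.
move=> cf; elim: s => [|i s IH] x.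
  rewrite (_ : (fun x => _) = cst 0); last by apply/funext => z; rewrite big_nil.
  exact: cvg_cst.
rewrite (_ : (fun x => _) = (fun x => f i x + \sum_(j <- s) f j x)); last first.
  by apply/funext => z; rewrite big_cons.
by apply: cvgD; [exact: cf|exact: IH].
Qed.

Lemma continuous_ssq (M : 'M[R]_d) : continuous (fun v : 'rV[R]_d => ssq (v *m M)).
Proof.
apply: continuous_sum => i x.
rewrite (_ : (fun v => _) = (fun v : 'rV[R]_d => (v *m M) ord0 i * (v *m M) ord0 i)); last first.
  by apply/funext => v; rewrite expr2.
have c : continuous (fun v : 'rV[R]_d => (v *m M) ord0 i).
  rewrite (_ : (fun v => _) = (fun v : 'rV[R]_d => \sum_j v ord0 j * M j i)); last first.
    by apply/funext => v; rewrite mxE.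
  apply: continuous_sum => j z.
  apply: (@cvgM _ _ (nbhs z) _ (fun v : 'rV[R]_d => v ord0 j) (cst (M j i))).
    exact: coord_continuous.
  exact: cvg_cst.
apply: (@cvgM _ _ (nbhs x) _ (fun v : 'rV[R]_d => (v *m M) ord0 i)
  (fun v : 'rV[R]_d => (v *m M) ord0 i)); exact: c.
Qed.

Lemma continuous_energy_word u : continuous (energy_word u).
Proof. by apply: continuous_sum => k; exact: continuous_ssq. Qed.

Definition bad_word (C B e : R) (i : nat) (u : seq W) : Prop :=
  exists v, [/\ ssq v = 1, energy_word u v <= B & C + e <= energy_word (take i u) v].

(** A countable description by finite words, which gives measurability. Conversely, from witnesses
    at every depth, compactness provides one vector valid at all depths; the margin [j.+1%:R^-1]
    keeps the inequality strict in the limit. *)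
Lemma badE C y : 0 <= C -> bad C y <-> exists B i j : nat, forall n : nat,
  bad_word C B%:R (j.+1%:R^-1) i (mkseq y (i + n)).
Proof.
have tk i n : take i (mkseq y (i + n)) = mkseq y i.
  by rewrite /mkseq -map_take take_iota (minn_idPl (leq_addr _ _)).
move=> C0; split.
  move=> [v [B [hB [i hi]]]].
  have v0 : ssq v != 0.
    apply: contraTneq hi => h; rewrite h mulr0 -leNgt (ssq_eq0 h).
    rewrite /energy big1 // => k _; rewrite mul0mx /ssq big1 // => j _.
    by rewrite mxE expr0n.
  have vp : 0 < ssq v by rewrite lt_def v0 ssq_ge0.
  pose c := (Num.sqrt (ssq v))^-1; have c2 : c ^+ 2 = (ssq v)^-1.
    by rewrite /c exprVn sqr_sqrtr // ssq_ge0.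
  have hi' : 0 < energy i y v / ssq v - C by rewrite subr_gt0 ltr_pdivlMr.
  exists (Num.bound (B / ssq v)), i, (Num.bound ((energy i y v / ssq v - C)^-1)) => n.
  exists (c *: v); rewrite tk -!energyE !energyZ ssqZ c2 mulVf //.
  split=> //; rewrite [_^-1 * _]mulrC.
    apply: le_trans (ltW (archi_boundP _)); last first.
      rewrite divr_ge0 ?ssq_ge0 //; apply: le_trans (hB 0%N); exact: energy_ge0.
    by rewrite ler_pM2r ?invr_gt0.
  rewrite -lerBrDl -[leRHS]invrK lef_pV2 ?posrE ?invr_gt0 //.
  apply: ltW; apply: lt_trans (archi_boundP _) _; first by rewrite invr_ge0 ltW.
  by rewrite ltr_nat.
move=> [B [i [j h]]].
have [v hv] := choice h.
pose F := fmap v \oo.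
have Fbox : F [set x : 'rV[R]_d | forall k, `[(-1)%R, 1%R] (x ord0 k)].
  suff : \forall n \near \oo, forall k, `[(-1)%R, 1%R] (v n ord0 k) by [].
  apply: nearW => n k /=; have [h1 _ _] := hv n.
  have : (v n ord0 k) ^+ 2 <= 1.
    by rewrite -h1 /ssq (bigD1 k) //= lerDl sumr_ge0 // => l _; exact: sqr_ge0.
  by rewrite -real_normK ?num_real // expr_le1 // in_itv /= ler_norml.
have FP : ProperFilter F by exact: fmap_proper_filter.
(* A cluster point of the normalized witnesses; inequalities between continuous functions pass to
   it. *)
have [x [_ clx]] := @rV_compact R d (fun=> `[(-1)%R, 1%R]%classic)
    (fun _ => @segment_compact R (-1) 1) F FP Fbox.
have lim_le (f : 'rV[R]_d -> R) b : continuous f -> (\forall n \near \oo, f (v n) <= b) -> f x <= b.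
  move=> cf hf; rewrite leNgt; apply/negP => hx.
  have nb : nbhs x [set z | b < f z].
    apply: (cf x [set t | b < t]); apply: open_nbhs_nbhs; split => //; exact: open_gt.
  have [z [/= z1 z2]] := clx _ _ (hf : F [set z | f z <= b]) nb.
  by move: z2; rewrite ltNge z1.
have lim_ge (f : 'rV[R]_d -> R) b : continuous f -> (\forall n \near \oo, b <= f (v n)) -> b <= f x.
  move=> cf hf; rewrite leNgt; apply/negP => hx.
  have nb : nbhs x [set z | f z < b].
    by apply: (cf x [set t | t < b]); apply: open_nbhs_nbhs; split => //; exact: open_lt.
  have [z [/= z1 z2]] := clx _ _ (hf : F [set z | b <= f z]) nb.
  by move: z2; rewrite ltNge z1.
have cs : continuous (ssq : 'rV[R]_d -> R).
  have := @continuous_ssq 1%:M; rewrite (_ : (fun v => _) = ssq) //.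
  by apply/funext => z; rewrite mulmx1.
exists x, B%:R; split.
  move=> n; rewrite energyE; apply: (lim_le _ _ (@continuous_energy_word _)).
  near=> m; have [_ h2 _] := hv m; apply: le_trans h2; rewrite -!energyE.
  apply: le_energy; apply: leq_trans (leq_addl _ _); near: m; exact: nbhs_infty_ge.
exists i; have x1 : ssq x <= 1.
  by apply: (lim_le _ _ cs); apply: nearW => n; have [-> _ _] := hv n.
apply: (@le_lt_trans _ _ C); first by rewrite ler_piMr.
apply: (@lt_le_trans _ _ (C + j.+1%:R^-1)); first by rewrite ltrDl invr_gt0.
rewrite energyE; apply: (lim_ge _ _ (@continuous_energy_word _)).
by apply: nearW => n; have [_ _] := hv n; rewrite tk.
Unshelve. all: by end_near. Qed.

End Cocycle.

Lemma sqr_sum_le (R : realType) (I : finType) (t : I -> R) :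
  (\sum_i t i) ^+ 2 <= #|I|%:R * \sum_i t i ^+ 2.
Proof.
rewrite expr2 mulr_suml; under eq_bigr do rewrite mulr_sumr.
apply: (@le_trans _ _ (\sum_i \sum_j (t i ^+ 2 / 2 + t j ^+ 2 / 2))).
  apply: ler_sum => i _; apply: ler_sum => j _.
  have := sqr_ge0 (t i - t j); nra.
under eq_bigr do rewrite big_split /=.
rewrite big_split /= [X in X + _]exchange_big /= !sumr_const -!mulr_suml -mulrnDl -splitr.
by rewrite mulr_natl.
Qed.

Lemma finite_max (P : nat -> Prop) (d : nat) : P 0%N -> (forall r, P r -> (r <= d)%N) ->
  exists r, P r /\ forall s, P s -> (s <= r)%N.
Proof.
move=> P0 Pd; have ex : exists r, `[< P r >] by exists 0%N; apply/asboolP.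
have ub r : `[< P r >] -> (r <= d)%N by move/asboolP/Pd.
case: (ex_maxnP ex ub) => r /asboolP Pr hr; exists r; split=> // s Ps.
by apply: hr; apply/asboolP.
Qed.

Section BoundedEnergy.
Variables (R : realType) (W : countType) (y0 : W) (d : nat) (A : W -> 'M[R]_d).
Variable y : paths y0.
Notation energy := (energy A).
Notation cprod := (cprod A).

Definition bounded_energy (v : 'rV[R]_d) := exists B, forall n, energy n y v <= B.

Lemma ssq_comb m (D : 'rV[R]_m) (X : 'M[R]_(m, d)) :
  ssq (D *m X) <= m%:R * \sum_j D ord0 j ^+ 2 * ssq (row j X).
Proof.
rewrite /ssq; apply: (@le_trans _ _ (\sum_i m%:R * \sum_j D ord0 j ^+ 2 * X j i ^+ 2)).
  apply: ler_sum => i _; rewrite mxE; apply: le_trans (sqr_sum_le _) _.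
  by rewrite card_ord; under eq_bigr do rewrite exprMn.
rewrite -mulr_sumr exchange_big /=; apply: ler_wpM2l => //.
apply: ler_sum => j _; rewrite -mulr_sumr; apply: ler_wpM2l; first exact: sqr_ge0.
by under [leRHS]eq_bigr do rewrite mxE.
Qed.

Lemma energy_comb m n (D : 'rV[R]_m) (X : 'M[R]_(m, d)) :
  energy n y (D *m X) <= m%:R * \sum_j D ord0 j ^+ 2 * energy n y (row j X).
Proof.
rewrite /energy; under [in leRHS]eq_bigr do rewrite mulr_sumr.
rewrite [in leRHS]exchange_big /= mulr_sumr; apply: ler_sum => k _.
rewrite -mulmxA; apply: le_trans (ssq_comb _ _) _.
apply: ler_wpM2l => //; apply: ler_sum => j _; by rewrite row_mul.
Qed.

Lemma bounded_comb m (X : 'M[R]_(m, d)) (v : 'rV[R]_d) :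
  (forall i, bounded_energy (row i X)) -> (v <= X)%MS -> bounded_energy v.
Proof.
move=> hX /submxP [D ->]; have [B hB] := choice hX.
exists (m%:R * \sum_j D ord0 j ^+ 2 * B j) => n.
apply: le_trans (energy_comb n D X) _; apply: ler_wpM2l => //.
by apply: ler_sum => j _; apply: ler_wpM2l; rewrite ?sqr_ge0.
Qed.

(** A matrix [U] of maximal rank whose rows have bounded energy spans all such vectors. The energy
    of a combination of its rows is controlled by the coefficients, which a pseudo-inverse bounds in
    terms of the vector. *)
Lemma energy_bound : exists C : R, 0 <= C /\ forall v, bounded_energy v ->
  forall n, energy n y v <= C * ssq v.
Proof.
pose P r := exists U : 'M[R]_d, (forall i, bounded_energy (row i U)) /\ \rank U = r.
have [r [[U [hU rU]] hmax]] : exists r, P r /\ forall s, P s -> (s <= r)%N.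
  apply: (@finite_max _ d) => [|r [U [_ <-]]]; last exact: rank_leq_row.
  exists 0; rewrite mxrank0; split=> // i; exists 0 => n.
  rewrite row0 /energy big1 // => k _; rewrite mul0mx /ssq big1 // => j _.
  by rewrite mxE expr0n.
have span v : bounded_energy v -> (v <= U)%MS.
  move=> hv; pose X := col_mx U v.
  have hX i : bounded_energy (row i X).
    case: (split_ordP i) => j ->; first by rewrite rowKu.
    by rewrite rowKd (_ : row j v = v) //; apply/rowP => k; rewrite mxE (ord1 j).
  have hG i : bounded_energy (row i <<X>>%MS).
    by apply: bounded_comb hX _; rewrite -(genmxE X) row_sub.
  have UX : (U <= <<X>>)%MS by rewrite genmxE -addsmxE addsmxSl.
  have vX : (v <= <<X>>)%MS by rewrite genmxE -addsmxE addsmxSr.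
  have rX : (\rank <<X>>%MS <= \rank U)%N by rewrite rU; apply: hmax; exists <<X>>%MS.
  apply: submx_trans vX _; have := mxrank_leqif_sup UX.
  by move=> [_ <-]; rewrite eqn_leq rX mxrankS.
have [B hB] := choice hU.
have B0 j : 0 <= B j by apply: le_trans (hB j 0%N); exact: energy_ge0.
pose G := pinvmx U; pose g := \sum_j \sum_i G i j ^+ 2.
have g0 : 0 <= g by apply: sumr_ge0 => j _; apply: sumr_ge0 => i _; exact: sqr_ge0.
have sB : 0 <= \sum_j B j by apply: sumr_ge0.
exists (d%:R * (d%:R * g * \sum_j B j)); split; first by rewrite !mulr_ge0.
move=> v hv n; have e : v = (v *m G) *m U by rewrite mulmxKpV // span.
have hD j : (v *m G) ord0 j ^+ 2 <= d%:R * g * ssq v.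
  rewrite mxE; apply: le_trans (sqr_sum_le _) _; rewrite card_ord -mulrA; apply: ler_wpM2l => //.
  rewrite /ssq mulr_sumr; apply: ler_sum => i _.
  rewrite exprMn mulrC; apply: ler_wpM2r; first exact: sqr_ge0.
  rewrite /g (bigD1 j) //= (bigD1 i) //= -addrA lerDl.
  apply: addr_ge0; first by apply: sumr_ge0 => k _; exact: sqr_ge0.
  by apply: sumr_ge0 => k _; apply: sumr_ge0 => l _; exact: sqr_ge0.
rewrite {1}e; apply: le_trans (energy_comb n _ _) _; rewrite -!mulrA; apply: ler_wpM2l => //.
apply: (@le_trans _ _ (\sum_j (d%:R * g * ssq v) * B j)).
  apply: ler_sum => j _; apply: ler_pM => //; rewrite ?sqr_ge0 ?energy_ge0 //.
by rewrite -mulr_sumr -!mulrA ![ssq v * _]mulrC.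
Qed.

End BoundedEnergy.

(** * A discrete maximal inequality *)

Section MaximalCount.
Variable b : nat -> bool.

(** The one-sided maximal function of [b], over windows of length at most [L], exceeds 1/3 at
    [t]. *)
Definition dense_start L t : bool :=
  [exists K : 'I_L.+1, (K < 3 * \sum_(t <= s < t + K) b s)%N].

(** From a dense start, jump over its window, whose length is less than three times its number of
    visits; otherwise advance by one. The extra [L] terms absorb a last window that overshoots. *)
Lemma maximal_count L M a : (\sum_(a <= t < a + M) dense_start L t <=
  3 * \sum_(a <= t < a + M + L) b t)%N.
Proof.
elim/ltn_ind: M a => M IH a.
case: M IH => [|M] IH; first by rewrite addn0 big_geq.
have [/existsP[K hK]|nx] := boolP (dense_start L a); last first.
  rewrite big_ltn; last by lia.
  rewrite (negPf nx) add0n; have := IH M (ltnSn M) a.+1.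
  rewrite addSnnS => h; apply: leq_trans h _; rewrite leq_mul2l /=.
  by rewrite [leqRHS]big_ltn ?leq_addl //; lia.
have K0 : (0 < K)%N by case: (posnP K) hK => // ->; rewrite addn0 big_geq.
have KL : (K <= L)%N by rewrite -ltnS.
have le1 x y : (\sum_(x <= t < y) dense_start L t <= y - x)%N.
  by rewrite -[leqRHS]muln1 -sum_nat_const_nat; apply: leq_sum => t _; case: dense_start.
have [KM|KM] := leqP M.+1 K.
  apply: leq_trans (le1 _ _) _; rewrite addKn; apply: leq_trans KM _.
  apply: leq_trans (ltnW hK) _; rewrite leq_mul2l /=.
  have aK : (a + K <= a + M.+1 + L)%N by lia.
  by rewrite [leqRHS](@big_cat_nat _ _ _ (a + K)%N) ?leq_addr //= leq_addr.
rewrite (@big_cat_nat _ _ _ (a + K)%N) /= ?leq_addr ?leq_add2l ?(ltnW KM) //.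
rewrite [X in (_ <= 3 * X)%N](@big_cat_nat _ _ _ (a + K)%N) /= ?leq_addr //; last by lia.
rewrite mulnDr; apply: leq_add.
  by apply: leq_trans (le1 _ _) _; rewrite addKn ltnW.
have := IH (M.+1 - K)%N _ (a + K)%N; rewrite -addnA subnKC ?(ltnW KM) //; apply; lia.
Qed.

End MaximalCount.

Section SumMeasures.
Context d (T : measurableType d) (R : realType) (mu : {measure set T -> \bar R}).

(** Both counts are integrated against [mu]. *)
Lemma sum_measures_le (c : nat) (G B : nat -> set T) m n :
  (forall t, measurable (G t)) -> (forall t, measurable (B t)) ->
  (forall y, \sum_(0 <= t < m) `[< G t y >] <= c * \sum_(0 <= t < n) `[< B t y >])%N ->
  (\sum_(0 <= t < m) mu (G t) <= c%:R%:E * \sum_(0 <= t < n) mu (B t))%E.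
Proof.
move=> mG mB h.
have I (E : nat -> set T) k : (forall t, measurable (E t)) ->
    (\sum_(0 <= t < k) mu (E t) = \int[mu]_x (\sum_(0 <= t < k) (\1_(E t) x)%:E))%E.
  move=> mE; rewrite ge0_integral_sum //.
  - apply: eq_bigr => t _; rewrite integral_indic // setIT //.
  - by move=> t; apply/measurable_EFinP; exact: measurable_indic.
rewrite !I // -ge0_integralZl //; last 2 first.
- by apply: emeasurable_sum => t; apply/measurable_EFinP; exact: measurable_indic.
- by move=> x _; apply: sume_ge0.
apply: ge0_le_integral => //.
- by move=> x _; apply: sume_ge0.
- by apply: emeasurable_sum => t; apply/measurable_EFinP; exact: measurable_indic.
- apply: measurable_funeM.
  by apply: emeasurable_sum => t; apply/measurable_EFinP; exact: measurable_indic.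
move=> x _; rewrite !sumEFin -EFinM lee_fin.
have e (E : nat -> set T) k : \sum_(0 <= t < k) (\1_(E t) x : R) =
    (\sum_(0 <= t < k) `[< E t x >])%N%:R.
  rewrite natr_sum; apply: eq_bigr => t _; rewrite indicE.
  by congr (_ %:R); congr nat_of_bool; apply/idP/asboolP; rewrite inE.
by rewrite !e -natrM ler_nat.
Qed.

(** Only finitely many times matter for [Q], so the set is a finite union over the patterns of
    membership. *)
Lemma pattern_measurable (B : nat -> set T) (Q : (nat -> bool) -> Prop) k :
  (forall t, measurable (B t)) ->
  (forall f g, (forall t, (t < k)%N -> f t = g t) -> Q f -> Q g) ->
  measurable [set y | Q (fun t => `[< B t y >])].
Proof.
move=> mB Qk.
pose ext (f : {ffun 'I_k -> bool}) t := if insub t is Some i then f i else false.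
pose C f := \bigcap_(t in [set t | (t < k)%N]) (if ext f t then B t else ~` B t).
have -> : [set y | Q (fun t => `[< B t y >])] =
    \bigcup_(f in [set f | Q (ext f)]) C f.
  apply/seteqP; split=> y /=.
    move=> Qy; exists [ffun i : 'I_k => `[< B i y >]] => /=.
      by apply: Qk Qy => t tk; rewrite /ext insubT ffunE.
    by move=> t /= tk; rewrite /ext insubT ffunE /=; case: asboolP.
  move=> [f Qf Cy]; apply: Qk Qf => t tk; have := Cy t tk.
  by case: (ext f t) => h; apply/esym; [apply/asboolP|apply/asboolPn].
apply: fin_bigcup_measurable; first exact: finite_finset.
move=> f _; apply: bigcap_measurableType.
by move=> t _; case: ifP => _ //; exact: measurableC.
Qed.

End SumMeasures.

Lemma sum_const_fin (R : realType) (x : \bar R) n : x \is a fin_num ->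
  (\sum_(0 <= t < n) x = n%:R%:E * x)%E.
Proof. by move=> /fineK <-; rewrite sumEFin sumr_const_nat subn0 -EFinM mulr_natl. Qed.

(** * Decay for almost every path *)

Section ExponentialDecay.
Variables (R : realType) (W : countType) (y0 : W).
Variables (w w' : tree_weight R W) (K : R).
Hypothesis K0 : 0 <= K.
Hypothesis wK : forall u v, w (u ++ v) <= K * w u * w' v.
Variables (d : nat) (A : W -> 'M[R]_d).
Notation paths := (paths y0).
Notation bad := (@bad R W y0 d A).
Notation energy := (energy A).
Notation cprod := (cprod A).
Let T := caratheodory_type (@cmu R W y0 w).
Let T' := caratheodory_type (@cmu R W y0 w').
Let mu : {measure set T -> \bar R} := @pmu R W y0 w.
Let mu' : {measure set T' -> \bar R} := @pmu R W y0 w'.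

Lemma shift_add s t (y : paths) : pshift s (pshift t y) = pshift (t + s) y.
Proof. by apply/funext => n; rewrite /pshift addnA. Qed.

Lemma bad_set_eq C t : 0 <= C -> [set y | bad C (pshift t y)] =
  \bigcup_B \bigcup_i \bigcup_j \bigcap_n
    [set y | (fun u => bad_word A C B%:R (j.+1%:R^-1) i (drop t u)) (mkseq y (t + (i + n)))].
Proof.
move=> C0; apply/seteqP; split=> y /=.
  move/(badE A _ C0) => [B [i [j h]]]; exists B => //; exists i => //; exists j => // n _ /=.
  by rewrite (mkseq_shift y0 t y) drop_size_cat ?size_mkseq.
move=> [B _ [i _ [j _ h]]]; apply/(badE A _ C0); exists B, i, j => n.
by have := h n I; rewrite /= (mkseq_shift y0 t y) drop_size_cat ?size_mkseq.
Qed.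

Lemma bad_measurable (v : tree_weight R W) C t : 0 <= C ->
  measurable ([set y | bad C (pshift t y)] : set (caratheodory_type (@cmu R W y0 v))).
Proof.
move=> C0; rewrite bad_set_eq //.
apply: bigcupT_measurable => B; apply: bigcupT_measurable => i.
apply: bigcupT_measurable => j; apply: bigcapT_measurable => n.
exact: (@depth_measurable R W y0 v (t + (i + n)) (fun u => bad_word A C B%:R (j.+1%:R^-1) i (drop t u))).
Qed.

Lemma bad_shift0 C : bad C = [set y | bad C (pshift 0 y)].
Proof. by apply/seteqP; split => y; rewrite /= (_ : pshift 0 y = y). Qed.

(** The sets decrease, and [energy_bound] leaves no path in all of them. *)
Lemma bad_cvg : (mu' \o (fun n : nat => bad n%:R)) n @[n --> \oo] --> 0%E.
Proof.
have mb n : measurable (bad n%:R : set T').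
  by rewrite bad_shift0; exact: bad_measurable.
have e : \bigcap_n bad n%:R = set0.
  apply/seteqP; split=> // y h.
  have [C [C0 hC]] := energy_bound A y.
  have [v [B [hB [n hn]]]] := h (Num.bound C) I.
  have /(_ n) := hC v (ex_intro _ B hB); rewrite leNgt; apply/negP; rewrite negbK.
  apply: le_lt_trans hn; rewrite ler_wpM2r ?ssq_ge0 // ltW //; exact: archi_boundP.
rewrite -(measure0 mu') -e; apply: nonincreasing_cvg_mu => //.
- exact: cmu_lty.
- by rewrite e; exact: measurable0.
- move=> m n mn; apply/subsetPset => y [v [B [hB [k hk]]]]; exists v, B; split=> //.
  by exists k; apply: le_lt_trans hk; rewrite ler_wpM2r ?ssq_ge0 // ler_nat.
Qed.

Definition visits C (y : paths) n := (\sum_(0 <= s < n) `[< bad C (pshift s y) >])%N.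

Definition often_bad C : set paths :=
  [set y | forall n0, exists n, (n0 <= n)%N /\ (n < 2 * visits C y n)%N].

Definition start_dense C L : set paths :=
  [set y | dense_start (fun s => `[< bad C (pshift s y) >]) L 0].

Lemma start_dense_shift C L t y :
  start_dense C L (pshift t y) <-> dense_start (fun s => `[< bad C (pshift s y) >]) L t.
Proof.
rewrite /start_dense /dense_start /=.
have e (k : nat) : (\sum_(0 <= s < 0 + k) `[< bad C (pshift s (pshift t y)) >] =
    \sum_(t <= s < t + k) `[< bad C (pshift s y) >])%N.
  have -> := (big_addn 0 (t + k) t xpredT (fun s => nat_of_bool `[< bad C (pshift s y) >]) :
    (\sum_(t <= s < t + k) `[< bad C (pshift s y) >])%N = _).
  rewrite addKn add0n; apply: eq_bigr => s _.
  by rewrite shift_add addnC.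
by split=> /existsP[k hk]; apply/existsP; exists k; move: hk; rewrite e.
Qed.

Lemma often_bad_shift C t y : often_bad C y -> exists L, start_dense C L (pshift t y).
Proof.
(* Beyond [5 * t], a proportion of bad times above 1/2 stays above 1/3 after the first [t] times are
   discarded. *)
move=> /(_ (t + 4 * t).+1) [n [tn hn]]; exists (n - t)%N; apply/start_dense_shift.
apply/existsP; exists (Ordinal (ltnSn (n - t))) => /=.
rewrite subnKC; last by lia.
move: hn; rewrite /visits (@big_cat_nat _ _ _ t) //=; last by lia.
have : (\sum_(0 <= s < t) `[< bad C (pshift s y) >] <= t)%N.
  rewrite -[leqRHS](subn0) -[leqRHS]muln1 -sum_nat_const_nat.
  by apply: leq_sum => s _; case: asbool.
set a := (\sum_(0 <= s < t) _)%N; set b := (\sum_(t <= s < n) _)%N; lia.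
Qed.

Lemma dense_startS b L L' t : (L <= L')%N -> dense_start b L t -> dense_start b L' t.
Proof.
move=> LL /existsP[k hk]; apply/existsP.
by exists (widen_ord (leq_ltn_trans LL (ltnSn L') : (L.+1 <= L'.+1)%N) k).
Qed.

Lemma start_dense_measurable (v : tree_weight R W) C L t : 0 <= C ->
  measurable ([set y | start_dense C L (pshift t y)] : set (caratheodory_type (@cmu R W y0 v))).
Proof.
move=> C0.
have -> : [set y | start_dense C L (pshift t y)] = [set y |
    (fun b : nat -> bool => dense_start b L t) (fun s => `[< [set z | bad C (pshift s z)] y >])].
  by apply/seteqP; split=> y /= /start_dense_shift.
apply: (@pattern_measurable _ _ _ (fun b => dense_start b L t) (t + L.+1)).
  by move=> s; exact: bad_measurable.
move=> f g fg /existsP[k hk]; apply/existsP; exists k.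
have -> // : (\sum_(t <= s < t + k) g s = \sum_(t <= s < t + k) f s)%N.
apply: eq_big_nat => s /andP[_ sk].
by rewrite fg //; apply: leq_trans sk _; rewrite leq_add2l ltnW.
Qed.

(** An often bad path has a dense start after every shift [t]; it is seen at scale [L] up to the
    error [Xoo] minus [X L]. Averaging over [t < L], [maximal_count] bounds the dense starts by
    three times the bad times below [2 * L], and each shifted bad set costs the factor [K]: hence
    [6 * K]. The error tends to 0 with growing [L]. *)
Lemma often_bad_le (C : R) : 0 <= C -> w [::] <= 1 ->
  (cmu w (often_bad C) <= (6 * K)%:E * cmu w' (bad C))%E.
Proof.
move=> C0 w1.
pose X L := start_dense C L; pose Xoo := \bigcup_L X L.
have mX L : measurable (X L : set T').
  have := @start_dense_measurable w' C L 0 C0.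
  by rewrite (_ : [set y | _] = X L).
have mXoo : measurable (Xoo : set T') by apply: bigcupT_measurable.
have cv : (mu' \o (fun L => Xoo `\` X L)) n @[n --> \oo] --> 0%E.
  rewrite -(measure0 mu') -(_ : \bigcap_n (Xoo `\` X n) = set0); last first.
    by apply/seteqP; split=> // y h; have [[L _ XL] _] := h 0%N I; have [_] := h L I.
  apply: nonincreasing_cvg_mu => //.
  - exact: cmu_lty.
  - by move=> n; apply: measurableD.
  - by apply: bigcapT_measurable => n; apply: measurableD.
  - move=> m n mn; apply/subsetPset => y [Xy nX]; split=> // Xm; apply: nX.
    exact: dense_startS Xm.
have shiftw t (E : set paths) : (cmu w [set y | E (pshift t y)] <= K%:E * cmu w' E)%E.
  apply: le_trans (cmu_shift K0 wK t E) _.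
  by rewrite lee_wpmul2r ?cmu_ge0 // lee_fin ler_piMr.
have key L : (0 < L)%N ->
    (cmu w (often_bad C) <= (6 * K)%:E * cmu w' (bad C) + K%:E * cmu w' (Xoo `\` X L))%E.
  move=> L0; set a := cmu w (often_bad C); set b := cmu w' (bad C); set c := cmu w' _.
  have h1 t : (a <= cmu w [set y | X L (pshift t y)] + K%:E * c)%E.
    apply: le_trans (_ : _ <= cmu w ([set y | X L (pshift t y)] `|` [set y | (Xoo `\` X L) (pshift t y)]))%E _.
      apply: le_cmu => y /(often_bad_shift t) [L' hL'].
      by have [h|h] := pselect (X L (pshift t y)); [left|right; split=> //; exists L'].
    apply: le_trans (outer_measureU2 _ _ _) _; apply: leeD2l; exact: shiftw.
  have h2 : (\sum_(0 <= t < L) cmu w [set y | X L (pshift t y)] <=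
      3%:R%:E * \sum_(0 <= t < L + L) cmu w [set y | bad C (pshift t y)])%E.
    apply: (@sum_measures_le _ T R mu 3 (fun t => [set y | X L (pshift t y)])
      (fun t => [set y | bad C (pshift t y)])).
    - by move=> t; exact: start_dense_measurable.
    - by move=> t; exact: bad_measurable.
    move=> y; have := maximal_count (fun s => `[< bad C (pshift s y) >]) L L 0.
    rewrite add0n => h; apply: leq_trans h; apply: leq_sum => t _.
    by apply/eq_leq; congr nat_of_bool; apply/asboolP/idP => h; have [h1' h2'] := start_dense_shift C L t y; [exact: h1'|exact: h2'].
  have fa : a \is a fin_num by exact: cmu_fin.
  have fb : b \is a fin_num by exact: cmu_fin.
  have fc : c \is a fin_num by exact: cmu_fin.
  have fKb : (K%:E * b)%E \is a fin_num by rewrite fin_numM.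
  have fKc : (K%:E * c)%E \is a fin_num by rewrite fin_numM.
  have h3 : (\sum_(0 <= t < L + L) cmu w [set y | bad C (pshift t y)] <= (L + L)%:R%:E * (K%:E * b))%E.
    rewrite -sum_const_fin //; apply: lee_sum => t _; exact: shiftw.
  have h4 : (L%:R%:E * a <= 3%:R%:E * ((L + L)%:R%:E * (K%:E * b)) + L%:R%:E * (K%:E * c))%E.
    apply: (@le_trans _ _ (\sum_(0 <= t < L) (cmu w [set y | X L (pshift t y)] + K%:E * c))%E).
      by rewrite -sum_const_fin //; apply: lee_sum => t _.
    rewrite big_split /= sum_const_fin // leeD2r //.
    by apply: le_trans h2 _; rewrite lee_wpmul2l.
  move: h4; rewrite -(fineK fa) -(fineK fb) -(fineK fc) -!EFinM -!EFinD !lee_fin.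
  have L1 : (0 : R) < L%:R by rewrite ltr0n.
  rewrite natrD => h4; rewrite -(ler_pM2l L1); apply: le_trans h4 _; rewrite le_eqVlt; apply/orP; left.
  by apply/eqP; ring.
have cv2 : ((6 * K)%:E * cmu w' (bad C) + K%:E * cmu w' (Xoo `\` X L))%E @[L --> \oo] -->
    ((6 * K)%:E * cmu w' (bad C) + K%:E * 0)%E.
  apply: cvgeD; last 2 first.
  - exact: cvg_cst.
  - by apply: cvgeZl.
  by rewrite mule0 fin_num_adde_defl.
rewrite mule0 adde0 in cv2; rewrite -(cvg_lim _ cv2) //.
apply: lime_ge; first by apply/cvg_ex; eexists; exact: cv2.
by near=> L; apply: key; near: L; exact: nbhs_infty_gt.
Unshelve. all: by end_near. Qed.

Definition always_often_bad : set paths := \bigcap_n often_bad n%:R.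

Lemma always_often_bad_null : w [::] <= 1 -> cmu w always_often_bad = 0%E.
Proof.
move=> w1; apply/eqP; rewrite eq_le cmu_ge0 andbT.
have cv : ((6 * K)%:E * cmu w' (bad n%:R))%E @[n --> \oo] --> ((6 * K)%:E * 0)%E.
  by apply: cvgeZl => //; exact: bad_cvg.
rewrite mule0 in cv; rewrite -(cvg_lim _ cv) //.
apply: lime_ge; first by apply/cvg_ex; eexists; exact: cv.
apply: nearW => n; apply: le_trans (often_bad_le _ w1); last by [].
by apply: le_cmu => y; apply.
Qed.

(** At a time that is not bad, the energy still to come, current term included, is at most [C] times
    the current term, so the remainder [S - E n] shrinks by the factor [rho]. Eventually at least
    half of the times are of this kind. *)
Lemma exp_decay y v : ~ always_often_bad y -> (exists B, forall n, energy n y v <= B) ->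
  exists c : R, 0 < c /\ \forall n \near \oo, ssq (v *m cprod (mkseq y n)) <= expR (- c * n%:R).
Proof.
move=> /existsNP [C0 /not_implyP [_ /existsNP [n0 hn0]]] [B hB].
have [n1 hn1] : exists n1, forall n, (n1 <= n)%N -> (2 * visits C0%:R y n <= n)%N.
  exists n0 => n n0n; rewrite leqNgt; apply/negP => h; apply: hn0.
  by exists n.
(* Raised by 1 so that [rho] is nonnegative. The value [rho = 0] occurs for [C0] equal to 0 and is
   treated apart, as it has no logarithm. *)
pose C : R := C0%:R + 1; have C1 : 1 <= C by rewrite lerDr.
have Cp : 0 < C by apply: lt_le_trans C1.
pose E n := energy n y v.
have hs : has_sup (range E).
  by split; [exists (E 0%N), 0%N|exists B => _ [n _ <-]; exact: hB].
pose S := sup (range E).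
have ES n : E n <= S by apply: sup_upper_bound => //; exists n.
pose rho := 1 - C^-1.
have rho01 : 0 <= rho < 1.
  by rewrite subr_ge0 invf_le1 // C1 /= ltrBlDr ltrDl invr_gt0.
have [r0 r1] := andP rho01.
have good n : ~ bad C0%:R (pshift n y) -> S - E n.+1 <= rho * (S - E n).
  move=> nb; have hb m : energy m (pshift n y) (v *m cprod (mkseq y n)) <=
      C * ssq (v *m cprod (mkseq y n)).
    rewrite leNgt; apply/negP => h; apply: nb; exists (v *m cprod (mkseq y n)), B; split.
      move=> k; apply: le_trans (hB (n + k)%N); rewrite (energy_shift A n k y) lerDr.
      exact: energy_ge0.
    by exists m; apply: le_lt_trans h; rewrite ler_wpM2r ?ssq_ge0 // lerDl.
  have hS : S <= E n + C * ssq (v *m cprod (mkseq y n)).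
    apply: ge_sup; first by exists (E 0%N), 0%N.
    move=> _ [m _ <-]; apply: (@le_trans _ _ (E (n + m)%N)); first exact: le_energy (leq_addl _ _).
    by rewrite /E (energy_shift A n m y) lerD2l.
  have e : E n.+1 = E n + ssq (v *m cprod (mkseq y n)) by exact: energyS.
  rewrite e /rho mulrBl mul1r opprD addrA lerD2l lerN2 mulrC ler_pdivrMr //.
  by rewrite lerBlDl mulrC.
have mono n : S - E n.+1 <= S - E n.
  by rewrite lerD2l lerN2; exact: le_energy.
pose g n := (n - visits C0%:R y n)%N.
have vn n : (visits C0%:R y n <= n)%N.
  rewrite /visits -[leqRHS](subn0) -[leqRHS]muln1 -sum_nat_const_nat.
  by apply: leq_sum => s _; case: asbool.
have decay n : S - E n <= rho ^+ g n * S.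
  elim: n => [|n IH].
    by rewrite /g /visits big_geq // expr0 mul1r /E /energy big_geq // subr0.
  have vS : visits C0%:R y n.+1 = (visits C0%:R y n + `[< bad C0%:R (pshift n y) >])%N.
    by rewrite /visits big_nat_recr.
  rewrite /g vS; case: asboolP => [b|nb].
    by rewrite addn1 subSS; apply: le_trans (mono n) IH.
  rewrite addn0 subSn // exprS -mulrA; apply: le_trans (good n nb) _.
  exact: ler_wpM2l.
have S0 : 0 <= S by apply: le_trans (ES 0%N); exact: energy_ge0.
have [rp|rz] := ltP 0 rho; last first.
  have rho0 : rho = 0 by apply/eqP; rewrite eq_le rz.
  exists 1; split=> //; near=> n.
  have nn1 : (n1 <= n)%N by near: n; exact: nbhs_infty_ge.
  have np : (0 < n)%N by near: n; exact: nbhs_infty_gt.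
  have gp : (0 < g n)%N by have := hn1 n nn1; rewrite /g; lia.
  apply: le_trans (_ : _ <= 0) _; last exact: expR_ge0.
  have := decay n; rewrite rho0 expr0n eqn0Ngt gp mul0r => h.
  have e : E n.+1 = E n + ssq (v *m cprod (mkseq y n)) by exact: energyS.
  by have := ES n.+1; rewrite e; move: h; lra.
have [c c0 rhoE] : exists2 c, 0 < c & rho = expR (- c).
  exists (- ln rho); first by rewrite oppr_gt0 ln_lt0 // rp.
  by rewrite opprK lnK.
(* The bad half of the times leaves the rate [c / 2]; half of that is spent on absorbing the
   constant [S]. *)
exists (c / 4); split; first by rewrite divr_gt0.
near=> n.
have nn1 : (n1 <= n)%N by near: n; exact: nbhs_infty_ge.
have h1 : ssq (v *m cprod (mkseq y n)) <= S - E n.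
  have e : E n.+1 = E n + ssq (v *m cprod (mkseq y n)) by exact: energyS.
  by have := ES n.+1; rewrite e; lra.
apply: le_trans h1 _; apply: le_trans (decay n) _.
have gn : n%:R / 2 <= (g n)%:R :> R.
  rewrite ler_pdivrMr // -natrM ler_nat; have := hn1 n nn1; rewrite /g; lia.
rewrite rhoE -expRM_natr.
apply: (@le_trans _ _ (expR (- c * (n%:R / 2)) * S)).
  by rewrite ler_wpM2r // ler_expR !mulNr lerN2 ler_pM2l.
rewrite (_ : - c * (n%:R / 2) = - (c / 4) * n%:R + - (c / 4) * n%:R); last by field.
rewrite expRD -mulrA ger_pMr ?expR_gt0 // mulNr expRN mulrC ler_pdivrMr ?expR_gt0 // mul1r.
have hn : S * 4 / c <= n%:R.
  apply: (@le_trans _ _ (Num.bound (S * 4 / c))%:R).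
    by apply: ltW; apply: archi_boundP; rewrite divr_ge0 ?mulr_ge0 // ltW.
  by rewrite ler_nat; near: n; exact: nbhs_infty_ge.
apply: (@le_trans _ _ (c / 4 * n%:R)).
  move: hn; rewrite ler_pdivrMr // => hn; rewrite mulrAC ler_pdivlMr // mulrC [c * _]mulrC //.
  by rewrite [4 * S]mulrC.
by apply: le_trans (expR_ge1Dx _); rewrite lerDr.
Unshelve. all: by end_near. Qed.

End ExponentialDecay.

(** * From cones to Lebesgue null sets *)

Section BoxCovers.
Variables (R : realType) (A : finType) (x0 : A).
Notation step := (A * A)%type.
Implicit Types (e : seq (A * A)) (v lam : A -> R).

(** Steps are bare pairs (winner, loser), detached from the rows, because [small_tie] uses sequences
    that need not be paths of the induction. *)
Definition eheight (s : A * A) v : A -> R := fun a => v a + (if a == s.2 then v s.1 else 0).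
Definition eback (s : A * A) v : A -> R := fun a => v a + (if a == s.1 then v s.2 else 0).
Definition efwd (s : A * A) v : A -> R := fun a => v a - (if a == s.1 then v s.2 else 0).
Definition eheights e v := foldl (fun q s => eheight s q) v e.
Definition ebacks e v := foldr eback v e.
Definition efwds e v := foldl (fun q s => efwd s q) v e.
Definition proper_steps e := all (fun s => s.1 != s.2) e.
Definition evol e : R := \prod_a eheights e (fun=> 1) a.
Definition econe e : set (A -> R) := [set lam | exists v, (forall a, 0 <= v a) /\ lam = ebacks e v].

Lemma eback_fwd s v : s.1 != s.2 -> eback s (efwd s v) = v.
Proof.
move=> ne; apply/funext => a; rewrite /eback /efwd.
case: (eqVneq a s.1) => [->|_]; last by rewrite subr0 addr0.
by rewrite eq_sym (negPf ne) subr0 subrK.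
Qed.

Lemma efwd_back s v : s.1 != s.2 -> efwd s (eback s v) = v.
Proof.
move=> ne; apply/funext => a; rewrite /eback /efwd.
case: (eqVneq a s.1) => [->|_]; last by rewrite subr0 addr0.
by rewrite eq_sym (negPf ne) addr0 addrK.
Qed.

Lemma ebacks_fwds e v : proper_steps e -> ebacks e (efwds e v) = v.
Proof. by elim: e v => //= s e IH v /andP[ne pe]; rewrite IH // eback_fwd. Qed.

Lemma efwds_backs e v : proper_steps e -> efwds e (ebacks e v) = v.
Proof. by elim: e v => //= s e IH v /andP[ne pe]; rewrite efwd_back // IH. Qed.

Lemma eduality e q v : \sum_a q a * ebacks e v a = \sum_a eheights e q a * v a.
Proof.
elim: e q v => //= s e IH q v; rewrite -IH; move: (ebacks e v) => x.
rewrite /eback /eheight.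
under eq_bigr do rewrite mulrDr (fun_if (fun z => _ * z)) mulr0.
under [in RHS]eq_bigr do rewrite mulrDl (fun_if (fun z => z * _)) mul0r.
rewrite !big_split /=; congr (_ + _).
by rewrite -!big_mkcond /= !big_pred1_eq.
Qed.

Lemma eheights_ge e q a : (forall c, 0 <= q c) -> q a <= eheights e q a.
Proof.
elim: e q => //= s e IH q q0; apply: le_trans (IH (eheight s q) _).
  by rewrite /eheight lerDl; case: ifP.
by move=> c; rewrite /eheight addr_ge0 //; case: ifP.
Qed.

Lemma eheights_gt0 e a : 0 < eheights e (fun=> 1) a :> R.
Proof. by apply: lt_le_trans (ltr01) _; apply: (eheights_ge e a (q := fun=> 1)). Qed.

Lemma efwds_sub e v v' a : efwds e (fun c => v c - v' c) a = efwds e v a - efwds e v' a.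
Proof.
elim: e v v' => //= s e IH v v'; rewrite -IH; congr (efwds e _ _).
by apply/funext => c; rewrite /efwd; case: ifP => _; ring.
Qed.

Lemma efwds_norm e v M : (forall c, `|v c| <= M) -> forall a, `|efwds e v a| <= 2 ^+ size e * M.
Proof.
elim: e v M => [|s e IH] v M hv a /=; first by rewrite mul1r.
rewrite exprSr -mulrA; apply: IH => c; rewrite /efwd mulrDl mul1r.
apply: le_trans (ler_normB _ _) _; apply: lerD => //.
by case: ifP => _ //; rewrite normr0; exact: le_trans (hv c).
Qed.

Lemma efwds_int e v : (forall c, v c \is a Num.int) -> forall a, efwds e v a \is a Num.int.
Proof.
elim: e v => //= s e IH v hv; apply: IH => c; rewrite /efwd rpredB //.
by case: ifP => _; [exact: hv|exact: rpred0].
Qed.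

Definition box := ((A -> R) * (A -> R))%type.
Definition in_box (b : box) : set (A -> R) := [set x | forall i, b.1 i <= x i <= b.2 i].
Definition box_vol (b : box) : R := \prod_(i : A) Num.max (b.2 i - b.1 i) 0.

Lemma box_vol_ge0 b : 0 <= box_vol b.
Proof. by apply: prodr_ge0 => i _; rewrite le_max lexx orbT. Qed.

(** Lattice counting. A vector is rounded down to a grid of mesh 1 / M; the inverse matrix is
    integral, so the grid points that occur correspond to integer vectors, confined by one bound per
    coordinate. The product of these bounds times the volume of one box gives the estimate, the
    factor 2 absorbing the rounding. *)
Lemma simplex_boxes e (K : R) : 0 < K -> proper_steps e -> exists L : seq box,
  (forall lam, econe e lam -> \sum_a lam a <= K -> exists2 b, b \in L & in_box b lam) /\
  \sum_(b <- L) box_vol b <= (2 * K) ^+ #|A| / evol e.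
Proof.
move=> K0 pe; pose q a := eheights e (fun=> 1) a : R.
have q0 a : 0 < q a by exact: eheights_gt0.
(* By [efwds_norm], the inverse matrix sends a rounding error of size at most 1 to a vector of size
   at most [c]. *)
pose c : R := 2 ^+ size e; have c0 : 0 <= c by exact: exprn_ge0.
pose S := \sum_a q a.
have qS a : q a <= S by rewrite /S (bigD1 a) //= lerDl sumr_ge0 // => i _; rewrite ltW.
have S0 : 0 < S by apply: lt_le_trans (q0 x0) (qS x0).
(* The mesh is fine enough for the errors [c * S] and [S] to be at most [K * M%:R] together. *)
pose M := (Num.bound (S * (c + 1) / K)).+1.
have M0 : 0 < M%:R :> R by rewrite ltr0n.
have hM : c * S + S <= K * M%:R.
  rewrite -[c * S + S](_ : (c + 1) * S = _); last by rewrite mulrDl mul1r.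
  rewrite mulrC -ler_pdivrMl // [_^-1 * _]mulrC; apply: le_trans (ltW (archi_boundP _)) _.
    by rewrite divr_ge0 ?mulr_ge0 ?addr_ge0 // ltW.
  by rewrite ler_nat /M leqnSn.
pose bd a := (M%:R * K + c * S) / q a.
have bd0 a : 0 <= bd a by rewrite divr_ge0 ?addr_ge0 ?mulr_ge0 // ltW.
pose B a := Num.truncn (bd a); pose N := (\sum_a B a).+1.
have BN a : (B a < N)%N by rewrite /N ltnS (bigD1 a) //= leq_addr.
(* Shifting by [c] makes the integer coordinates nonnegative, so that they are indexed by ['I_N];
   [corner] undoes the shift. *)
pose corner (g : {ffun A -> 'I_N}) : A -> R := ebacks e (fun a => (g a)%:R - c).
pose bx g : box := ((fun a => corner g a / M%:R), (fun a => (corner g a + 1) / M%:R)).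
exists (map bx (seq.filter (fun g : {ffun A -> 'I_N} => [forall a, (g a <= B a)%N]) (enum {: {ffun A -> 'I_N}}))); split.
  move=> lam [v [v0 elam]] lamK.
  have lam0 a : 0 <= lam a.
    rewrite elam; elim: (e) a => //= s e' IH a; rewrite /eback addr_ge0 //; case: ifP => //.
  pose z a : R := (Num.truncn (M%:R * lam a))%:R.
  pose t a := M%:R * lam a - z a.
  have ht a : 0 <= t a <= 1.
    have /andP[h1 h2] := truncn_itv (mulr_ge0 (ltW M0) (lam0 a)).
    rewrite /t subr_ge0 h1 /= lerBlDl; apply: ltW.
    by rewrite /z natr1.
  have zE a : efwds e z a = M%:R * v a - efwds e t a.
    have -> : z = (fun a => M%:R * lam a - t a) by apply/funext => b; rewrite /t; ring.
    rewrite efwds_sub; congr (_ - _).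
    rewrite (_ : M%:R * v a = efwds e (ebacks e (fun a => M%:R * v a)) a); last by rewrite efwds_backs.
    congr (efwds e _ a).
    apply/funext => b; rewrite elam; elim: (e) b => //= s e' IH b.
    by rewrite /eback -!IH mulrDr; case: ifP; rewrite ?mulr0.
  have tc a : `|efwds e t a| <= c.
    rewrite -[c]mulr1; apply: efwds_norm => b; have /andP[h1 h2] := ht b.
    by rewrite ger0_norm.
  have w0 a : 0 <= efwds e z a + c.
    rewrite zE; have := tc a; rewrite ler_norml => /andP[_ h].
    have : 0 <= M%:R * v a by rewrite mulr_ge0 // ltW.
    lra.
  have wint a : efwds e z a + c \is a Num.nat.
    rewrite natrEint w0 andbT rpredD //; first by apply: efwds_int => b; rewrite natr_int.
    by rewrite /c rpredX // natr_int.
  have wbd a : efwds e z a + c <= bd a.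
    rewrite /bd ler_pdivlMr // mulrC.
    apply: (@le_trans _ _ (\sum_b q b * (efwds e z b + c))).
      by rewrite [leRHS](bigD1 a) //= lerDl sumr_ge0 // => b _; rewrite mulr_ge0 // ltW.
    under eq_bigr do rewrite mulrDr.
    rewrite big_split /= -mulr_suml [c * S]mulrC; apply: lerD => //.
    rewrite -(eduality e (fun=> 1)) ebacks_fwds //.
    apply: (@le_trans _ _ (\sum_b M%:R * lam b)).
      by apply: ler_sum => b _; rewrite mul1r; have /andP[] := ht b; rewrite /t; lra.
    by rewrite -mulr_sumr ler_pM2l.
  have [g hg] : exists g : {ffun A -> 'I_N}, forall a, (g a)%:R = efwds e z a + c /\ (g a <= B a)%N.
    have H a : {k : 'I_N | k%:R = efwds e z a + c /\ (k <= B a)%N}.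
      pose k := Num.truncn (efwds e z a + c).
      have ek : k%:R = efwds e z a + c by exact: truncnK.
      have kB : (k <= B a)%N by rewrite /B truncn_ge_nat ?ek.
      by exists (Ordinal (leq_ltn_trans kB (BN a))).
    exists [ffun a => sval (H a)] => a; rewrite ffunE; exact: (svalP (H a)).
  have cg : corner g = z.
    rewrite /corner -[RHS](ebacks_fwds z pe); congr ebacks; apply/funext => a.
    by rewrite (hg a).1 addrK.
  exists (bx g).
    apply/mapP; exists g => //; rewrite mem_filter mem_enum andbT.
    by apply/forallP => a; rewrite (hg a).2.
  move=> a /=; rewrite cg ler_pdivrMr // ler_pdivlMr // [lam a * _]mulrC.
  by have /andP[] := ht a; rewrite /t; lra.
rewrite big_map big_filter.
have vb g : box_vol (bx g) = \prod_(a : A) (M%:R)^-1.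
  apply: eq_bigr => a _ /=; rewrite -mulrBl addrAC subrr add0r mul1r.
  by apply/max_idPl; rewrite invr_ge0 ler0n.
under eq_bigr do rewrite vb.
apply: (@le_trans _ _ (\prod_a \sum_(i < N) (if (i <= B a)%N then M%:R^-1 else 0))).
  rewrite bigA_distr_bigA /= big_enum_cond /= big_mkcond; apply: ler_sum => g _.
  case: ifP => [/forallP h|_].
    by rewrite le_eqVlt; apply/orP; left; apply/eqP; apply: eq_bigr => a _; rewrite h.
  by apply: prodr_ge0 => a _; case: ifP; rewrite ?invr_ge0.
apply: (@le_trans _ _ (\prod_a (2 * K / q a))); last first.
  by rewrite big_split /= prodr_const -[in leRHS]prodfV.
apply: ler_prod => a _; apply/andP; split.
  by apply: sumr_ge0 => i _; case: ifP; rewrite ?invr_ge0.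
rewrite -big_mkcond /=.
have -> : \sum_(i < N | (i <= B a)%N) (M%:R^-1 : R) = (B a).+1%:R / M%:R.
  rewrite (eq_bigl (fun i : 'I_N => (i < (B a).+1)%N)) //.
  by rewrite -(big_ord_widen N (fun=> (M%:R^-1 : R)) (BN a)) sumr_const card_ord mulr_natl.
rewrite ler_pdivrMr // -natr1.
have h1 : (B a)%:R <= bd a by have /andP[] := truncn_itv (bd0 a).
apply: (@le_trans _ _ (bd a + 1)); first by rewrite lerD2r.
rewrite [leRHS](_ : _ = 2 * K * M%:R / q a); last by rewrite mulrAC.
rewrite ler_pdivlMr // mulrDl /bd divfK ?gt_eqF // mul1r; have := qS a; lra.
Qed.

Definition cone_cover (S : set (A -> R)) (eps : R) (U : set (seq (A * A))) :=
  [/\ (forall e, U e -> proper_steps e),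
      (forall lam, S lam -> exists2 e, U e & econe e lam) &
      forall F, uniq F -> (forall e, e \in F -> U e) -> \sum_(e <- F) (evol e)^-1 <= eps].

(** Nullity measured by cones: the cost of a cone is the proportion of the simplex that it occupies,
    which does not depend on scale. Countable unions and rescaling are immediate here, and only
    [small_null] passes to boxes. *)
Definition small S := forall eps : R, 0 < eps -> exists U, cone_cover S eps U.

Lemma evol_gt0 e : 0 < evol e.
Proof. by apply: prodr_gt0 => a _; exact: eheights_gt0. Qed.

Lemma small_sub S S' : S `<=` S' -> small S' -> small S.
Proof.
move=> SS h eps eps0; have [U [pU cU sU]] := h eps eps0.
by exists U; split=> // lam /SS; exact: cU.
Qed.

Lemma sum_halves (eps : R) N : 0 < eps -> \sum_(0 <= k < N) eps / 2 ^+ k.+1 <= eps.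
Proof.
move=> eps0; suff -> : \sum_(0 <= k < N) eps / 2 ^+ k.+1 = eps - eps / 2 ^+ N.
  by rewrite gerBl divr_ge0 // ltW.
elim: N => [|N IH]; first by rewrite big_geq // expr0 divr1 subrr.
by rewrite big_nat_recr //= IH exprS invfM; field.
Qed.

Lemma small_bigcup (S : nat -> set (A -> R)) : (forall n, small (S n)) -> small (\bigcup_n S n).
Proof.
move=> hS eps eps0.
have [U hU] : exists U : nat -> set (seq (A * A)), forall n, cone_cover (S n) (eps / 2 ^+ n.+1) (U n).
  suff : forall n, exists U, cone_cover (S n) (eps / 2 ^+ n.+1) U by case/choice => U; exists U.
  by move=> n; apply: hS; rewrite divr_gt0 // exprn_gt0.
exists (\bigcup_n U n); split.
- by move=> e [n _ Ue]; have [+ _ _] := hU n; apply.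
- by move=> lam [n _ Sn]; have [_ + _] := hU n => /(_ _ Sn) [e Ue ce]; exists e => //; exists n.
move=> F uF hF.
have [f hf] : exists f : seq (A * A) -> nat, forall e, e \in F -> U (f e) e.
  suff : forall e, exists n, e \in F -> U n e by case/choice => f; exists f.
  move=> e.
  case: (boolP (e \in F)) => eF; last by exists 0%N.
  by have [n _ Un] := hF e eF; exists n.
have fN : {in F, forall e, f e \in index_iota 0 (\max_(e <- F) f e).+1}.
  by move=> e eF; rewrite mem_index_iota /= ltnS; exact: leq_bigmax_seq.
rewrite (big_fiber _ (iota_uniq _ _) fN).
apply: le_trans (sum_halves (\max_(e <- F) f e).+1 eps0).
apply: ler_sum => n _; rewrite -big_filter.
have [_ _ hn] := hU n; apply: hn; first exact: filter_uniq.
by move=> e; rewrite mem_filter => /andP[/eqP <-]; exact: hf.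
Qed.

Lemma small_setU S S' : small S -> small S' -> small (S `|` S').
Proof.
move=> h h'; apply: (@small_sub _ (\bigcup_n (if n == 0%N then S else S'))).
  by move=> lam [?|?]; [exists 0%N | exists 1%N].
by apply: small_bigcup => n; case: ifP.
Qed.

(** Lengths are truncated by the size of their sum. At truncation [k] the boxes cost the factor
    [w k], so cones of total weight [eps / 2 ^+ k.+1 / w k] are taken; triples made of a truncation,
    a cone and the index of a box are enumerated through [pickle]. *)
Lemma small_null S : small S -> lebesgue_null S.
Proof.
move=> hS eps eps0; pose D := #|A|.
pose b0 : box := ((fun=> 0), (fun=> 0)).
have D0 : (0 < D)%N by apply/card_gt0P; exists x0.
have vb0 : box_vol b0 = 0.
  by rewrite /box_vol /= (eq_bigr (fun=> 0)) ?prodr_const ?expr0n ?gtn_eqF // => i _; rewrite subrr maxxx.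
pose w (k : nat) : R := (2 * k.+1%:R) ^+ D.
have w0 k : 0 < w k by rewrite exprn_gt0 // mulr_gt0 // ltr0n.
have [U hU] : exists U : nat -> set (seq (A * A)), forall n, cone_cover S (eps / 2 ^+ n.+1 / w n) (U n).
  suff : forall n, exists U, cone_cover S (eps / 2 ^+ n.+1 / w n) U by case/choice => U; exists U.
  by move=> n; apply: hS; rewrite divr_gt0 // divr_gt0 // exprn_gt0.
pose good ke (L : seq box) := (forall lam, econe ke.2 lam -> \sum_a lam a <= ke.1.+1%:R ->
    exists2 b, b \in L & in_box b lam) /\ \sum_(b <- L) box_vol b <= w ke.1 / evol ke.2.
have [L hL] : exists L : nat * seq (A * A) -> seq box, forall ke, U ke.1 ke.2 -> good ke (L ke).
  suff : forall ke, exists L, U ke.1 ke.2 -> good ke L by case/choice => L; exists L.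
  move=> [k e] /=; have [Ue|nU] := pselect (U k e); last by exists [::].
  have [+ _ _] := hU k => /(_ e Ue) pe.
  by have [L hL] := @simplex_boxes e k.+1%:R (ltr0Sn _ _) pe; exists L.
pose L' ke := if asbool (U ke.1 ke.2) then L ke else [::].
pose g (t : nat * seq (A * A) * nat) : box := nth b0 (L' t.1) t.2.
pose bs n := oapp g b0 (pickle_inv n).
exists (fun n => (bs n).1), (fun n => (bs n).2); split.
  move=> lam Sl.
  pose k := Num.bound `|\sum_a lam a|.
  have [_ + _] := hU k => /(_ lam Sl) [e Ue ce].
  have [+ _] := hL (k, e) Ue => /(_ lam ce) [|b bL blam].
    apply: le_trans (ler_norm _) _; apply: ltW; apply: lt_le_trans (archi_boundP (normr_ge0 _)) _.
    by rewrite ler_nat /k leqnSn.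
  exists (pickle (k, e, index b (L (k, e)))) => //.
  rewrite /bs pickleK_inv /g /L' /= asboolT //= nth_index //; exact: blam.
move=> N; rewrite -/(box_vol _).
have g0 t : 0 <= box_vol (g t) by exact: box_vol_ge0.
pose F := pmap (@pickle_inv (nat * seq (A * A) * nat)%type) (iota 0 N).
have uF : uniq F.
  apply: (pmap_uniq (g := pickle)); last exact: iota_uniq.
  exact: pickle_invK.
apply: (@le_trans _ _ (\sum_(t <- F) box_vol (g t))).
  rewrite /F -(big_mkord xpredT (fun n => box_vol (bs n))) /index_iota subn0.
  elim: (iota 0 N) => [|n s IH]; first by rewrite !big_nil.
  rewrite big_cons /= /bs; case: (pickle_inv n) => [t|] /=; last by rewrite vb0 add0r.
  by rewrite big_cons lerD2l.
pose K := (\max_(t <- F) t.1.1).+1; pose E := undup [seq t.1.2 | t <- F].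
pose J := (\max_(t <- F) t.2).+1.
pose G := [seq (ke, j) | ke <- [seq (k, e) | k <- iota 0 K, e <- E], j <- iota 0 J].
apply: (@le_trans _ _ (\sum_(t <- G) box_vol (g t))).
  apply: sum_sub_uniq => // -[[k e] j] tF.
  have kK : k \in iota 0 K.
    by rewrite mem_iota add0n ltnS; exact: (leq_bigmax_seq (F := fun t : nat * seq (A * A) * nat => t.1.1) _ tF).
  have jJ : j \in iota 0 J.
    by rewrite mem_iota add0n ltnS; exact: (leq_bigmax_seq (F := fun t : nat * seq (A * A) * nat => t.2) _ tF).
  have eE : e \in E by rewrite mem_undup; apply/mapP; exists (k, e, j).
  by apply: allpairs_f => //; exact: allpairs_f.
rewrite big_allpairs big_allpairs.
apply: le_trans (sum_halves K eps0); rewrite /index_iota subn0; apply: ler_sum => k _.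
apply: (@le_trans _ _ (\sum_(e <- [seq e <- E | asbool (U k e)]) w k / evol e)).
  rewrite big_filter [leRHS]big_mkcond; apply: ler_sum => e _.
  have hb (s : seq box) : \sum_(j <- iota 0 J) box_vol (nth b0 s j) <= \sum_(b <- s) box_vol b.
    rewrite (big_nth b0) -{1}[J]subn0 -/(index_iota 0 J).
    have [sJ|Js] := leqP (size s) J.
      rewrite (@big_cat_nat _ _ _ (size s)) //= -[leRHS]addr0 lerD2l big_nat_cond.
      by apply: sumr_le0 => i /andP[/andP[si _] _]; rewrite nth_default ?vb0.
    have -> := @big_cat_nat _ _ _ J 0%N (size s) xpredT (fun j => box_vol (nth b0 s j)) (leq0n J) (ltnW Js).
    by rewrite /= lerDl; apply: sumr_ge0 => i _; exact: box_vol_ge0.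
  apply: le_trans (hb (L' (k, e))) _; rewrite /L' /=.
  case: asboolP => [Ue|_]; last by rewrite big_nil.
  by have [] := hL (k, e) Ue.
rewrite -mulr_sumr mulrC -ler_pdivlMr //.
have [_ _ hk] := hU k; apply: hk; first by rewrite filter_uniq // undup_uniq.
by move=> e; rewrite mem_filter => /andP[/asboolP].
Qed.

End BoxCovers.

(** * Coding by return words *)

Section LimsupNull.
Variables (R : realType) (W : countType) (y0 : W) (w : tree_weight R W).

Lemma geometric_tail (r : R) m n : 0 <= r < 1 -> \sum_(m <= k < n) r ^+ k <= r ^+ m / (1 - r).
Proof.
move=> /andP[r0 r1]; have d0 : 0 < 1 - r by rewrite subr_gt0.
have [mn|nm] := leqP m n; last first.
  by rewrite (big_geq (ltnW nm)); apply: divr_ge0; [exact: exprn_ge0|exact: ltW].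
rewrite ler_pdivlMr //.
suff -> : (\sum_(m <= k < n) r ^+ k) * (1 - r) = r ^+ m - r ^+ n by rewrite gerBl exprn_ge0.
elim: n mn => [|n IH]; first by rewrite leqn0 => /eqP ->; rewrite big_geq // subrr mul0r.
rewrite leq_eqVlt => /orP[/eqP <-|mn]; first by rewrite big_geq // subrr mul0r.
by rewrite big_nat_recr //= mulrDl IH // exprS; ring.
Qed.

(** Borel-Cantelli, with a geometric bound at each level. *)
Lemma limsup_null (P : seq W -> Prop) (a r : R) : 0 <= r < 1 -> 0 <= a ->
  (forall k F, uniq F -> (forall u, u \in F -> size u = k /\ P u) -> \sum_(u <- F) w u <= a * r ^+ k) ->
  cmu w [set y : paths y0 | forall m, exists2 k, (m <= k)%N & P (mkseq y k)] = 0%E.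
Proof.
move=> r01 a0 hP; set S := [set y | _].
have d0 : 0 < 1 - r by rewrite subr_gt0; case/andP: r01.
have key m : (cmu w S <= (a / (1 - r) * r ^+ m)%:E)%E.
  apply: (@cmu_le _ _ _ _ _ [set u | (m <= size u)%N /\ P u]).
    by move=> y /(_ m) [k mk Pk]; exists (mkseq y k) => /=; rewrite ?/cyl /= size_mkseq.
  move=> F uF FU; rewrite lee_fin.
  have sF : {in F, forall u, size u \in index_iota m (\max_(u <- F) size u).+1}.
    move=> u uu; rewrite mem_index_iota ltnS (leq_bigmax_seq (F := size)) // andbT.
    by have [] := FU u uu.
  rewrite (big_fiber _ (iota_uniq _ _) sF).
  apply: (@le_trans _ _ (\sum_(m <= k < (\max_(u <- F) size u).+1) a * r ^+ k)).
    apply: ler_sum => k _; rewrite -big_filter; apply: hP; first exact: filter_uniq.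
    by move=> u; rewrite mem_filter => /andP[/eqP -> /FU []].
  rewrite -mulr_sumr -mulrA ler_wpM2l // mulrC; exact: geometric_tail.
apply/eqP; rewrite eq_le cmu_ge0 andbT.
have cv : (a / (1 - r) * r ^+ m)%:E @[m --> \oo] --> 0%:E.
  apply: cvg_EFin; first by near=> m.
  rewrite -[X in _ --> X](mulr0 (a / (1 - r))); apply: cvgMr; apply: cvg_expr.
  by case/andP: r01 => r0 r1; rewrite ger0_norm.
rewrite -[leRHS](cvg_lim _ cv) //; apply: lime_ge; first by apply/cvg_ex; exists 0%:E.
by near=> m; exact: key.
Unshelve. all: by end_near.
Qed.

Lemma cmu0_bigcup (S : nat -> set (paths y0)) : (forall n, cmu w (S n) = 0%E) ->
  cmu w (\bigcup_n S n) = 0%E.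
Proof.
move=> h; apply/eqP; rewrite eq_le cmu_ge0 andbT.
apply: le_trans (cmu_sigma_subadditive _ _) _.
by rewrite eseries0 // => n _ _; exact: h.
Qed.

Lemma cmu0_setU (S S' : set (paths y0)) : cmu w S = 0%E -> cmu w S' = 0%E -> cmu w (S `|` S') = 0%E.
Proof.
move=> h h'; rewrite -bigcup2E; apply: cmu0_bigcup => -[|[|n]] //=; exact: cmu0.
Qed.

End LimsupNull.

(** * Weights on sequences of return words *)

Section ReturnWords.
Variables (R : realType) (A : finType) (x0 : A).
Hypothesis hA : (2 <= #|A|)%N.
Notation pair := (seq A * seq A)%type.
Notation win := (win x0).
Notation los := (los x0).
Notation rz := (rz x0).
Notation rzw := (rzw x0).
Notation posw := (posw x0).
Notation hstep := (hstep x0).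
Notation hword := (hword x0).
Notation wgt := (wgt x0).
Notation pr := (pr x0).
Variable l0 : nat.
Hypothesis l0_gt0 : (0 < l0)%N.
Hypothesis l0_pos : forall p, okp p -> exists u, size u = l0 /\ posw p u.
Notation ends_strong := (ends_strong x0 l0).
Notation W := (pair * seq bool)%type.
Implicit Types (p : pair) (b h : seq bool) (q v : A -> R) (u : seq W).
Notation ones := ((fun=> 1) : A -> R).

(* A letter of the coding is a state together with a return word from it, so that its cocycle
   matrix depends on the letter alone. *)
Definition ret p b := ends_strong p b && all (fun i => ~~ ends_strong p (take i b)) (iota 0 (size b)).

Lemma stop_word_first (E : pred (seq bool)) n h b : b != [::] -> (size b <= n)%N -> E (h ++ b) ->
  (forall i, (i < size b)%N -> ~~ E (h ++ take i b)) -> stop_word E n h b.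
Proof.
elim: n h b => [|n IH] h [|c b] //= _ sb Eb nE.
case: ifP => Ec.
  case: b sb Eb nE => //= d b sb Eb /(_ 1%N isT) /=.
  by rewrite cats1 Ec.
apply: IH; rewrite ?cat_rcons //.
  by apply: contraTneq Eb => ->; rewrite cats1 Ec.
by move=> i ib; rewrite cat_rcons; exact: (nE i.+1).
Qed.

Lemma strong_len_gt0 : (0 < strong_len A l0)%N.
Proof. by rewrite /strong_len /nchunks muln_gt0 l0_gt0 addn2. Qed.

Lemma ends_strong_nil p : ends_strong p [::] = false.
Proof. by rewrite /ends_strong leqNgt strong_len_gt0. Qed.

Lemma ret_stop_word p b n : (size b <= n)%N -> ret p b -> stop_word (ends_strong p) n [::] b.
Proof.
move=> bn /andP[Eb /allP nE]; apply: stop_word_first => //.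
  by apply: contraTneq Eb => ->; rewrite ends_strong_nil.
by move=> i ib; apply: nE; rewrite mem_iota.
Qed.

Lemma wgt_rcons p q h c : (forall a, 0 < q a) ->
  wgt p q (rcons h c) = wgt p q h * pr (rzw p h) (hword p h q) c.
Proof.
move=> q0; rewrite -cats1 wgt_cat // -vol_hstep //; exact: hword_gt0.
Qed.

Lemma stopped_wgt p q (E : pred (seq bool)) n h : (forall a, 0 < q a) ->
  stopped E (wgt p q) n h <= wgt p q h.
Proof.
move=> q0; elim: n h => [|n IH] h //=.
have hq := hword_gt0 x0 p h q0.
apply: (@le_trans _ _ (wgt p q (rcons h true) + wgt p q (rcons h false))).
  by apply: lerD; case: ifP.
by rewrite !wgt_rcons // -mulrDr pr_sum // mulr1.
Qed.

Lemma ret_sum p q F : (forall a, 0 < q a) -> uniq F -> all (ret p) F ->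
  \sum_(b <- F) wgt p q b <= 1.
Proof.
move=> q0 uF aF; pose n := \max_(b <- F) size b.
apply: (@le_trans _ _ (stopped (ends_strong p) (wgt p q) n [::])); last first.
  by apply: le_trans (stopped_wgt _ _ _ _ q0) _; rewrite wgt0.
apply: sum_stop_words => //; first by move=> h; rewrite ltW // wgt_gt0.
apply/allP => b bF; apply: ret_stop_word; last exact: (allP aF).
exact: leq_bigmax_seq.
Qed.

Variables (th C : R).
Hypothesis th01 : 0 < th <= 1.
Hypothesis C1 : 1 <= C.
Hypothesis moment : forall p q, okp p -> (forall a, 0 < q a) -> forall n h,
  stopped (ends_strong p) (fun h => wgt p q h * tot (hword p h q) `^ th) n h <=
  C * (wgt p q h * tot (hword p h q) `^ th).

Lemma ret_moment p q F : okp p -> (forall a, 0 < q a) -> uniq F -> all (ret p) F ->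
  \sum_(b <- F) wgt p q b * tot (hword p b q) `^ th <= C * tot q `^ th.
Proof.
move=> okp_ q0 uF aF; pose n := \max_(b <- F) size b.
apply: (@le_trans _ _ (stopped (ends_strong p) (fun h => wgt p q h * tot (hword p h q) `^ th) n [::])); last first.
  by apply: le_trans (moment okp_ q0 n [::]) _; rewrite wgt0 // mul1r.
apply: (@sum_stop_words R (ends_strong p) (fun h => wgt p q h * tot (hword p h q) `^ th) _ n [::] F) => //.
  by move=> h; rewrite mulr_ge0 ?powR_ge0 // ltW // wgt_gt0.
apply/allP => b bF; apply: ret_stop_word; last exact: (allP aF).
exact: leq_bigmax_seq.
Qed.

Fixpoint valid p u : bool :=
  if u is a :: u' then [&& a.1 == p, ret p a.2 & valid (rzw p a.2) u'] else true.
Definition flat u : seq bool := flatten (map snd u).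

Lemma flat_cat u u' : flat (u ++ u') = flat u ++ flat u'.
Proof. by rewrite /flat map_cat flatten_cat. Qed.

Lemma flat_rcons u a : flat (rcons u a) = flat u ++ a.2.
Proof. by rewrite -cats1 flat_cat /flat /= cats0. Qed.

Lemma valid_cat p u u' : valid p (u ++ u') = valid p u && valid (rzw p (flat u)) u'.
Proof.
elim: u p => //= a u IH p; rewrite IH.
by rewrite /flat /= rzw_cat !andbA.
Qed.

Lemma valid_rcons p u a :
  valid p (rcons u a) = [&& valid p u, a.1 == rzw p (flat u) & ret (rzw p (flat u)) a.2].
Proof. by rewrite -cats1 valid_cat /= andbT. Qed.

Lemma sum_valid_rcons p u F (f : seq bool -> R) (c : R) : uniq F -> 0 <= c ->
  (valid p u -> forall G, uniq G -> all (ret (rzw p (flat u))) G -> \sum_(b <- G) f (flat u ++ b) <= c) ->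
  \sum_(a <- F) (if valid p (rcons u a) then f (flat (rcons u a)) else 0) <=
  if valid p u then c else 0.
Proof.
move=> uF c0 h; rewrite -big_mkcond /=; under eq_bigl do rewrite valid_rcons.
case: ifP => [vu|_]; last by rewrite big_pred0.
rewrite -big_filter; under eq_bigr do rewrite flat_rcons.
set F' := [seq _ <- F | _]; rewrite -(big_map snd xpredT (fun b => f (flat u ++ b))).
apply: h => //.
  rewrite map_inj_in_uniq ?filter_uniq // => -[p1 b1] [p2 b2].
  by rewrite !mem_filter /= => /andP[/andP[/eqP -> _] _] /andP[/andP[/eqP -> _] _] ->.
by apply/allP => b /mapP[a]; rewrite mem_filter => /andP[/andP[_ /andP[_ ra]] _] ->.
Qed.

Lemma ones_gt0 (a : A) : 0 < ones a. Proof. exact: ltr01. Qed.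

(** Inconsistent sequences get weight 0, so that one alphabet serves all starting states. *)
Definition rweight p u : R := if valid p u then wgt p ones (flat u) else 0.

Lemma rweight_ge0 p u : 0 <= rweight p u.
Proof. by rewrite /rweight; case: ifP => // _; rewrite ltW // wgt_gt0. Qed.

Lemma rweight_sup p u F : uniq F -> \sum_(a <- F) rweight p (rcons u a) <= rweight p u.
Proof.
move=> uF; apply: sum_valid_rcons => //; first by rewrite ltW // wgt_gt0.
move=> vu G uG aG; under eq_bigr do rewrite wgt_cat //.
rewrite -mulr_sumr ler_piMr //; first by rewrite ltW // wgt_gt0.
by apply: ret_sum => //; exact: hword_gt0.
Qed.

Definition rtree p : tree_weight R W := TreeWeight (rweight_ge0 p) (rweight_sup p).

(** Dividing by [C ^+ size u] turns the moment bound into the inequality of a tree weight; the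
    moments at each level are then bounded by [sum_level]. *)
Definition mweight p u : R := (if valid p u then
  wgt p ones (flat u) * tot (hword p (flat u) ones) `^ th else 0) / C ^+ size u.

Lemma C_gt0 : 0 < C. Proof. exact: lt_le_trans C1. Qed.

Lemma mweight_ge0 p u : 0 <= mweight p u.
Proof.
rewrite /mweight mulr_ge0 ?invr_ge0 ?exprn_ge0 ?(ltW C_gt0) //.
by case: ifP => // _; rewrite mulr_ge0 ?powR_ge0 // ltW // wgt_gt0.
Qed.

Lemma mweight_sup p u F : okp p -> uniq F -> \sum_(a <- F) mweight p (rcons u a) <= mweight p u.
Proof.
move=> okp_ uF; rewrite /mweight; under eq_bigr do rewrite size_rcons.
have Ck : 0 < C ^+ size u by rewrite exprn_gt0 // C_gt0.
rewrite -mulr_suml ler_pdivrMr; last by rewrite exprn_gt0 // C_gt0.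
rewrite exprSr mulrA divfK ?gt_eqF // (fun_if (fun z => z * C)) mul0r.
apply: (@sum_valid_rcons p u F (fun h => wgt p ones h * tot (hword p h ones) `^ th)) => //.
  by rewrite mulr_ge0 ?(ltW C_gt0) // mulr_ge0 ?powR_ge0 // ltW // wgt_gt0.
move=> vu G uG aG; under eq_bigr do rewrite wgt_cat // hword_cat -mulrA.
rewrite -mulr_sumr -mulrA ler_pM2l ?wgt_gt0 // [_ * C]mulrC.
apply: ret_moment => //; [exact: okp_rzw|exact: hword_gt0].
Qed.

Definition mtree p (ok : okp p) : tree_weight R W :=
  TreeWeight (mweight_ge0 p) (fun u F uF => mweight_sup u ok uF).

Lemma chunk_at n p b i : chunks x0 l0 n p b -> (i < n)%N ->
  posw (rzw p (take (i * l0) b)) (take l0 (drop (i * l0) b)).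
Proof.
elim: n p b i => // n IH p b [|i] /= /andP[pb cb]; first by rewrite mul0n take0 drop0.
rewrite ltnS => /(IH _ _ _ cb); rewrite drop_drop mulSn addnC => h.
by rewrite takeD rzw_cat.
Qed.

Lemma ends_strong_last p b : ends_strong p b -> exists b1 b2,
  [/\ b = b1 ++ b2, size b2 = l0 & posw (rzw p b1) b2].
Proof.
move=> /andP[sb /andP[/eqP se ce]].
set m := (size b - strong_len A l0)%N in se ce.
set k := (#|A|.+1 * l0)%N.
have eL : strong_len A l0 = (k + l0)%N by rewrite /strong_len /nchunks addn2 mulSn addnC.
have sz : size b = (m + (k + l0))%N by rewrite -eL subnK.
have h : posw (rzw (rzw p (take m b)) (take k (drop m b))) (take l0 (drop k (drop m b))).
  by apply: chunk_at ce _; rewrite /nchunks addn2.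
exists (take (m + k) b), (drop (m + k) b); rewrite cat_take_drop; split=> //.
  by rewrite size_drop sz addnA addKn.
move: h; rewrite -rzw_cat -takeD drop_drop [(k + m)%N]addnC [X in posw _ X]take_oversize //.
by rewrite size_drop sz addnA addKn.
Qed.

(** The last return word ends with a positive word of length [l0]: afterwards every height is at
    least the largest height before that word, and at most [2 ^+ l0] times as large. *)
Lemma flat_balanced p u a c : u != [::] -> valid p u ->
  hword p (flat u) ones c <= 2 ^+ l0 * hword p (flat u) ones a.
Proof.
case/lastP: u => // u [p' b] _; rewrite valid_rcons /= => /and3P[_ _ /andP[]].
move=> /ends_strong_last [b1 [b2 [-> s2 pb]]] _.
rewrite flat_rcons /= catA hword_cat.
have q0 e : 0 < hword p (flat u ++ b1) ones e by exact: hword_gt0.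
have q0' e : 0 <= hword p (flat u ++ b1) ones e by exact: ltW.
rewrite -rzw_cat in pb; set q := hword _ _ ones in q0 q0' *.
have [e hM] : exists e, forall f, q f <= q e.
  by exists [arg max_(e > a) q e]%O => f; case: arg_maxP => // i _; apply.
apply: le_trans (@hword_le _ _ _ _ _ _ (q e) _ _) _; first by move=> f; rewrite q0' hM.
by rewrite s2 ler_pM2l ?exprn_gt0 //; exact: posw_hword.
Qed.

Lemma wgt_balanced p q b (m M : R) : 0 < m -> (forall a, m <= q a <= M) ->
  wgt p q b <= (M / m) ^+ #|A| * wgt p ones b.
Proof.
move=> m0 qb; have q0 a : 0 < q a by case/andP: (qb a) => h _; exact: lt_le_trans h.
have h0 := hword_gt0 x0 p b ones_gt0; have h1 := hword_gt0 x0 p b q0.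
have v0 := vol_gt0 h0; have v1 := vol_gt0 h1.
have e1 : vol ones = 1 by rewrite /vol prodr_const expr1n.
have volM : vol q <= M ^+ #|A|.
  rewrite /vol -prodr_const; apply: ler_prod => a _; by case/andP: (qb a) => _ ->; rewrite ltW.
have volm : m ^+ #|A| * vol (hword p b ones) <= vol (hword p b q).
  rewrite /vol -prodr_const -big_split /=; apply: ler_prod => a _.
  rewrite mulr_ge0 ?(ltW m0) ?(ltW (h0 _)) //= -hword_scale.
  by apply: (@hword_mono _ _ x0 p b) => c; rewrite mulr1; case/andP: (qb c).
have mA : 0 < m ^+ #|A| by rewrite exprn_gt0.
rewrite /wgt e1 expr_div_n div1r.
rewrite (_ : _ / _ / _ = M ^+ #|A| / (m ^+ #|A| * vol (hword p b ones))); last by rewrite invfM mulrA.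
rewrite ler_pM // ?invr_ge0 ?(ltW v1) ?(ltW (vol_gt0 q0)) //.
by rewrite lef_pV2 // posrE // mulr_gt0.
Qed.

Definition all_pairs : seq pair := [seq (s, t) | s <- permutations (enum A), t <- permutations (enum A)].

(** The state reached by the past varies with it; summing over all states gives a single weight that
    dominates the future in every case. *)
Definition sweight u : R := \sum_(p <- all_pairs) rweight p u.

Lemma sweight_ge0 u : 0 <= sweight u.
Proof. by apply: sumr_ge0 => p _; exact: rweight_ge0. Qed.

Lemma sweight_sup u F : uniq F -> \sum_(a <- F) sweight (rcons u a) <= sweight u.
Proof. by move=> uF; rewrite exchange_big; apply: ler_sum => p _; exact: rweight_sup. Qed.

Definition stree : tree_weight R W := TreeWeight sweight_ge0 sweight_sup.

(** Balanced heights have ratios at most [2 ^+ l0], and the weight has one factor per letter. *)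
Definition bernoulli_const : R := (2 ^+ l0) ^+ #|A|.

Lemma bernoulli_const_ge0 : 0 <= bernoulli_const.
Proof. by rewrite /bernoulli_const !exprn_ge0. Qed.

Lemma rweight_cat p u u' : okp p -> rtree p (u ++ u') <= bernoulli_const * rtree p u * stree u'.
Proof.
move=> okp_ /=; rewrite {1 2}/rweight valid_cat; case: (boolP (valid p u)) => //= vu; last by rewrite mulr0 mul0r.
have wu : 0 < wgt p ones (flat u) by exact: wgt_gt0.
have K0 := bernoulli_const_ge0.
case: ifP => [vu'|_]; last by rewrite mulr_ge0 ?sweight_ge0 // mulr_ge0 // ltW.
rewrite flat_cat wgt_cat // (_ : _ * _ * sweight u' = wgt p ones (flat u) * (bernoulli_const * sweight u')); last by ring.
apply: ler_wpM2l; first exact: ltW.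
have q0 e := hword_gt0 x0 p (flat u) ones_gt0 e.
have [e hm] : exists e, forall f, hword p (flat u) ones e <= hword p (flat u) ones f.
  by exists [arg min_(e < x0) hword p (flat u) ones e]%O => f; case: arg_minP => // i _; apply.
apply: (@le_trans _ _ (bernoulli_const * wgt (rzw p (flat u)) ones (flat u'))).
  apply: le_trans (@wgt_balanced _ _ _ _ (2 ^+ l0 * hword p (flat u) ones e) (q0 e) _) _.
    move=> c; rewrite hm /=; have [->|nu] := eqVneq u [::].
      by rewrite /flat /= mulr1 exprn_ege1 // ler1n.
    exact: flat_balanced.
  by rewrite mulfK ?gt_eqF.
rewrite ler_wpM2l // /sweight.
have [[/andP[/= p1 p2] _]] := okp_rzw x0 hA (flat u) okp_.
have pin : rzw p (flat u) \in all_pairs.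
  by rewrite [rzw _ _]surjective_pairing; apply: allpairs_f; rewrite mem_permutations.
rewrite (perm_big _ (perm_to_rem pin)) big_cons {1}/rweight vu' lerDl.
by apply: sumr_ge0 => p' _; exact: rweight_ge0.
Qed.

Lemma level_sum p (f : seq W -> R) k F : (forall u G, uniq G -> \sum_(a <- G) f (rcons u a) <= C * rweight p u) ->
  uniq F -> (forall u, u \in F -> size u = k.+1) -> \sum_(u <- F) f u <= C.
Proof.
move=> hf uF sF; pose G := undup (map (take k) F).
rewrite (@big_fiber _ _ _ (take k) f F G) ?undup_uniq //; last first.
  by move=> u uu; rewrite mem_undup map_f.
apply: (@le_trans _ _ (\sum_(h <- G) C * rweight p h)).
  apply: ler_sum => h _; rewrite -big_filter.
  set Fh := [seq x <- F | _].
  pose y0 : W := (([::], [::]), [::]).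
  have e : Fh = map (rcons h) (map (last y0) Fh).
    rewrite -map_comp -[LHS]map_id; apply/eq_in_map => u; rewrite mem_filter => /andP[/eqP <- /sF].
    case/lastP: u => // u a; rewrite size_rcons => -[<-] /=.
    by rewrite last_rcons -cats1 take_size_cat // cats1.
  rewrite e big_map; apply: hf.
  have : uniq Fh by apply: filter_uniq.
  by rewrite {1}e => /map_uniq.
rewrite -mulr_sumr ler_piMr ?(ltW C_gt0) //.
apply: le_trans (@sum_level R W (([::], [::]), [::]) (rtree p) k G _ _) _.
- exact: undup_uniq.
- by move=> u; rewrite mem_undup => /mapP[v /sF sv ->]; rewrite size_takel // sv.
by rewrite /= /rweight /= wgt0.
Qed.

Definition ltot p u : R := tot (hword p (flat u) ones) `^ th.

Lemma tot_ones_gt0 p b : 0 < tot (hword p b ones).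
Proof.
apply: lt_le_trans (hword_gt0 x0 p b ones_gt0 x0) _; apply: sumq_le => c.
by rewrite ltW // hword_gt0.
Qed.

Lemma ltot_gt0 p u : 0 < ltot p u.
Proof. by rewrite powR_gt0 // tot_ones_gt0. Qed.

Lemma rweight_increment p u G : okp p -> uniq G ->
  \sum_(a <- G) rweight p (rcons u a) * (ltot p (rcons u a) / ltot p u) <= C * rweight p u.
Proof.
move=> okp_ uG.
rewrite {2}/rweight (fun_if (fun z => C * z)) mulr0.
under eq_bigr do rewrite /rweight (fun_if (fun z => z * _)) mul0r /ltot.
apply: (@sum_valid_rcons p u G (fun h => wgt p ones h * (tot (hword p h ones) `^ th / ltot p u))) => //.
  by rewrite mulr_ge0 ?(ltW C_gt0) // ltW // wgt_gt0.
move=> vu F uF aF; under eq_bigr do rewrite wgt_cat // hword_cat -mulrA.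
rewrite -mulr_sumr mulrC ler_pM2r ?wgt_gt0 //; under eq_bigr do rewrite mulrA.
rewrite -mulr_suml ler_pdivrMr ?ltot_gt0 //.
apply: ret_moment => //; [exact: okp_rzw|exact: hword_gt0].
Qed.

Notation y0 := ((([::], [::]), [::]) : W).

(** Markov's inequality for the moment of order [th], which grows at most like [C ^+ k]; the rate
    [ln (2 * C) / th] makes the weights decay like 2^-k. *)
Lemma growth_null p : okp p -> exists D : R, cmu (rtree p)
  [set y : paths y0 | forall m, exists2 k, (m <= k)%N & expR (D * k%:R) < tot (hword p (flat (mkseq y k)) ones)] = 0%E.
Proof.
move=> okp_; have /andP[th0 th1] := th01.
have C2 : 0 < 2 * C by rewrite mulr_gt0 // C_gt0.
exists (ln (2 * C) / th).
pose P (u : seq W) := expR (ln (2 * C) / th * (size u)%:R) < tot (hword p (flat u) ones).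
rewrite (_ : [set y | _] = [set y : paths y0 | forall m, exists2 k, (m <= k)%N & P (mkseq y k)]); last first.
  by apply/seteqP; split=> y /= h m; have [k mk hk] := h m; exists k => //; move: hk; rewrite /P size_mkseq.
apply: (@limsup_null R W _ (rtree p) P (#|A|%:R `^ th) 2^-1).
- by rewrite invr_ge0 ler0n /= invf_lt1 // ltr1n.
- exact: powR_ge0.
move=> k F uF hF.
have hm : \sum_(u <- F) mweight p u <= #|A|%:R `^ th.
  apply: le_trans (@sum_level R W y0 (mtree okp_) k F uF _) _; first by move=> u /hF[].
  rewrite /= /mweight /= wgt0 // mul1r expr0 divr1.
  by rewrite /tot sumr_const.
rewrite exprVn ler_pdivlMr ?exprn_gt0 // mulr_suml.
apply: le_trans hm; rewrite big_seq [leRHS]big_seq; apply: ler_sum => u uF'.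
have [su Pu] := hF u uF'.
rewrite /= /rweight /mweight; case: ifP => _; last by rewrite !mul0r.
rewrite -mulrA ler_pM2l ?wgt_gt0 // su ler_pdivlMr ?exprn_gt0 ?C_gt0 //.
rewrite -exprMn_comm; last exact: mulrC.
have -> : (2 * C) ^+ k = expR (ln (2 * C) / th * (size u)%:R) `^ th.
  rewrite /powR gt_eqF ?expR_gt0 // expRK su.
  rewrite (_ : th * _ = ln (2 * C) * k%:R); last by field; rewrite gt_eqF.
  by rewrite expRM_natr lnK.
apply: ge0_ler_powR; rewrite ?nnegrE ?expR_ge0 ?(ltW th0) ?(ltW (tot_ones_gt0 _ _)) //.
exact: ltW.
Qed.

(** Given the past, the ratio of consecutive totals has a moment of order [th] at most [C], so
    exceeding [expR (e * k%:R)] has weight of order [expR (- (e * th) * k%:R)]. *)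
Lemma increment_null p (e : R) : okp p -> 0 < e -> cmu (rtree p)
  [set y : paths y0 | forall m, exists2 k, (m <= k)%N &
     expR (e * k%:R) * tot (hword p (flat (mkseq y k)) ones) < tot (hword p (flat (mkseq y k.+1)) ones)] = 0%E.
Proof.
move=> okp_ e0; have /andP[th0 th1] := th01.
(* The event at index [k] compares two levels and is read off the word of length [k.+1] together
   with its predecessor. *)
pose pre (u : seq W) := take (size u).-1 u.
pose P (u : seq W) := (0 < size u)%N /\
   expR (e * (size u).-1%:R) * tot (hword p (flat (pre u)) ones) < tot (hword p (flat u) ones).
have r01 : 0 <= expR (- (e * th)) < 1 by rewrite expR_ge0 expR_lt1 oppr_lt0 mulr_gt0.
apply/eqP; rewrite eq_le cmu_ge0 andbT.
rewrite -(@limsup_null R W y0 (rtree p) P (C * expR (e * th)) (expR (- (e * th))) r01).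
- apply: le_cmu => y /= h m; have [k mk hk] := h m; exists k.+1; first exact: leqW.
  by rewrite /P /pre size_mkseq /= -[mkseq y k.+1]/(mkseq y k.+1) mkseqS -cats1 take_size_cat ?size_mkseq // cats1 -mkseqS.
- by rewrite mulr_ge0 ?expR_ge0 // (ltW C_gt0).
move=> [|k] F uF hF.
  rewrite big_seq big1 => [|u /hF [/size0nil -> [] //]].
  by rewrite mulr_ge0 ?exprn_ge0 ?expR_ge0 // mulr_ge0 ?expR_ge0 // (ltW C_gt0).
have hl : \sum_(u <- F) rweight p u * (ltot p u / ltot p (pre u)) <= C.
  apply: (@level_sum p _ k) => //; last by move=> u /hF [].
  move=> u G uG; rewrite (eq_bigr (fun a => rweight p (rcons u a) * (ltot p (rcons u a) / ltot p u))).
    exact: rweight_increment.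
  by move=> a _; rewrite /pre size_rcons /= -cats1 take_size_cat.
rewrite -mulrA -expRM_natr -expRD.
have -> : e * th + - (e * th) * k.+1%:R = - (e * k%:R * th) by rewrite -[k.+1%:R]natr1; ring.
rewrite expRN ler_pdivlMr ?expR_gt0 // mulr_suml.
apply: le_trans hl; rewrite big_seq [leRHS]big_seq; apply: ler_sum => u uF'.
have [su [_ Pu]] := hF u uF'; rewrite su /= in Pu.
apply: ler_wpM2l; first exact: rweight_ge0.
rewrite ler_pdivlMr ?ltot_gt0 // /ltot.
have -> : expR (e * k%:R * th) = expR (e * k%:R) `^ th by rewrite /powR gt_eqF ?expR_gt0 // expRK mulrC.
rewrite -powRM ?expR_ge0 ?(ltW (tot_ones_gt0 _ _)) //.
apply: ge0_ler_powR; rewrite ?nnegrE ?mulr_ge0 ?expR_ge0 ?(ltW th0) ?(ltW (tot_ones_gt0 _ _)) //.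
exact: ltW.
Qed.

Lemma wgt_le1 p h : wgt p ones h <= 1.
Proof.
rewrite /wgt ler_pdivrMr ?mul1r; last by apply: vol_gt0; exact: hword_gt0.
by apply: ler_prod => a _; rewrite ler01 /=; exact: hword_ge.
Qed.

Lemma bweight_sup p h (F : seq bool) : uniq F -> \sum_(c <- F) wgt p ones (rcons h c) <= wgt p ones h.
Proof.
move=> uF; apply: (@le_trans _ _ (\sum_(c <- [:: true; false]) wgt p ones (rcons h c))).
  by apply: sum_sub_uniq => // [c|[]]; rewrite ?inE // ltW // wgt_gt0.
rewrite big_cons big_seq1 !wgt_rcons // -mulrDr pr_sum ?mulr1 //; exact: hword_gt0.
Qed.

Definition btree p : tree_weight R bool :=
  TreeWeight (fun h => ltW (wgt_gt0 x0 p h ones_gt0)) (bweight_sup p).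

Lemma tot_growth p q b : (forall a, 1 <= q a) -> (size b)%:R <= tot (hword p b q).
Proof.
suff : forall n, (forall a, 1 <= q a) -> n%:R <= tot q -> (n + size b)%:R <= tot (hword p b q).
  by move=> h q1; apply: (h 0%N q1); apply: sumr_ge0 => a _; apply: le_trans (q1 a).
elim: b p q => [|c b IH] p q n q1 nq /=; first by rewrite addn0.
rewrite addnS -addSn; apply: IH => [a|].
  by apply: le_trans (q1 a) _; apply: hstep_ge => e; apply: le_trans (q1 e).
by rewrite /tot sumq_hstep -natr1 lerD.
Qed.

Lemma stop_word_alive (E : pred (seq bool)) h b :
  (forall i, (0 < i <= size b)%N -> ~~ E (h ++ take i b)) -> stop_word E (size b) h b.
Proof.
elim: b h => //= c b IH h nE.
have := nE 1%N isT; rewrite /= take0 cats1 => /negPf ->; apply: IH => i ib.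
by rewrite cat_rcons; apply: (nE i.+1); case/andP: ib.
Qed.

Definition never_returns p (h : seq bool) : set (paths true) :=
  [set ty | cyl h ty /\ forall n, ~~ ends_strong (rzw p h) (mkseq (pshift (size h) ty) n)].

(** Every move adds at least 1 to the total height. After [n] moves without return the total is thus
    at least [n], and the moment bound leaves mass at most [D] divided by the power [th] of [n]. *)
Lemma never_returns_null p h : okp p -> cmu (btree p) (never_returns p h) = 0%E.
Proof.
move=> okp_; have /andP[th0 th1] := th01.
pose q := hword p h ones; pose D := C * tot q `^ th.
have D0 : 0 < D by rewrite mulr_gt0 ?C_gt0 // powR_gt0 // tot_ones_gt0.
have q1 a : 1 <= q a by exact: hword_ge.
have q0 a : 0 < q a by exact: lt_le_trans (q1 a).
have key n : (0 < n)%N -> (cmu (btree p) (never_returns p h) <= (D / n%:R `^ th)%:E)%E.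
  move=> n0; have nth0 : 0 < (n%:R : R) `^ th by rewrite powR_gt0 // ltr0n.
  pose alive b := size b = n /\ forall i, ~~ ends_strong (rzw p h) (take i b).
  apply: (@cmu_le _ _ _ _ _ [set b | take (size h) b = h /\ alive (drop (size h) b)]).
    move=> ty [hty al]; exists (mkseq ty (size h + n)) => /=; last by rewrite /cyl /= size_mkseq.
    rewrite (@mkseq_shift _ true); move: (hty); rewrite /cyl /= => e; rewrite e.
    rewrite take_size_cat // drop_size_cat //; split=> //; split; first by rewrite size_mkseq.
    move=> i; have [ni|ni] := leqP n i; first by rewrite take_oversize ?size_mkseq.
    by rewrite /mkseq -map_take take_iota (minn_idPl (ltnW ni)); exact: al.
  move=> F uF FU; rewrite lee_fin.
  pose G := map (drop (size h)) F.
  have eF : F = map (cat h) G.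
    rewrite -map_comp -[LHS]map_id; apply/eq_in_map => b /FU [e _] /=.
    by rewrite -[in LHS](cat_take_drop (size h) b) e.
  have uG : uniq G by move: uF; rewrite {1}eF => /map_uniq.
  have aG b : b \in G -> alive b by move=> /mapP[b' /FU [_ al] ->].
  rewrite eF big_map /=; under eq_bigr do rewrite wgt_cat //.
  rewrite -mulr_sumr ler_pdivlMr // -mulrA.
  apply: (@le_trans _ _ (wgt p ones h * D)); last first.
    by rewrite ler_piMl ?(ltW D0) // wgt_le1.
  apply: ler_wpM2l; first by rewrite ltW // wgt_gt0.
  rewrite mulr_suml; apply: (@le_trans _ _ (\sum_(b <- G) wgt (rzw p h) q b * tot (hword (rzw p h) b q) `^ th)).
    rewrite big_seq [leRHS]big_seq; apply: ler_sum => b /aG [sb _].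
    rewrite ler_wpM2l ?(ltW (wgt_gt0 _ _ _ _)) //; apply: ge0_ler_powR; rewrite ?nnegrE ?(ltW th0) ?ler0n //.
      by apply: sumr_ge0 => a _; rewrite ltW // hword_gt0.
    by rewrite -sb; exact: tot_growth.
  have := moment (okp_rzw x0 hA h okp_) q0 n [::]; rewrite wgt0 // mul1r; apply: le_trans.
  apply: (@sum_stop_words R (ends_strong (rzw p h)) (fun b => wgt (rzw p h) q b * tot (hword (rzw p h) b q) `^ th) _ n [::] G) => //.
    by move=> b; rewrite mulr_ge0 ?powR_ge0 // ltW // wgt_gt0.
  apply/allP => b /aG [sb al]; rewrite -sb; apply: stop_word_alive => i _; exact: al.
apply/eqP; rewrite eq_le cmu_ge0 andbT; apply/lee_addgt0Pr => e e0; rewrite add0e.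
pose n := (Num.bound ((D / e) `^ th^-1)).+1.
apply: le_trans (key n _) _ => //; rewrite lee_fin ler_pdivrMr ?powR_gt0 ?ltr0n // mulrC -ler_pdivrMr //.
have -> : D / e = ((D / e) `^ th^-1) `^ th.
  by rewrite -powRrM mulVf ?gt_eqF // powRr1 // divr_ge0 // ltW.
apply: ge0_ler_powR; rewrite ?nnegrE ?powR_ge0 ?(ltW th0) ?ler0n //.
apply: ltW; apply: lt_le_trans (archi_boundP (powR_ge0 _ _)) _; by rewrite ler_nat /n leqnSn.
Qed.

(** Flattening preserves weights, hence turns covers by coded words into covers by binary words of
    the same cost. *)
Lemma code_null p (E : set (paths y0)) : cmu (rtree p) E = 0%E -> cmu (btree p)
  [set ty : paths true | exists y : paths y0, [/\ E y, forall k, valid p (mkseq y k) &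
    forall k, mkseq ty (size (flat (mkseq y k))) = flat (mkseq y k)]] = 0%E.
Proof.
move=> E0; apply/eqP; rewrite eq_le cmu_ge0 andbT; apply/lee_addgt0Pr => e e0; rewrite add0e.
have [U [EU cU]] := @cmu_adherent R W y0 (rtree p) E e e0; rewrite E0 add0e in cU.
apply: (@cmu_le _ _ _ _ _ [set flat u | u in [set u | U u /\ valid p u]]).
  move=> ty [y [/EU [u Uu yu] vy ey]]; exists (flat u).
    by exists u => //; split=> //; rewrite -yu.
  by rewrite /cyl /= -yu ey.
move=> F uF FU.
have [g hg] : exists g : seq bool -> seq W, forall b, b \in F -> [/\ U (g b), valid p (g b) & flat (g b) = b].
  suff : forall b, exists u, b \in F -> [/\ U u, valid p u & flat u = b] by case/choice => g; exists g.
  move=> b; case: (boolP (b \in F)) => bF; last by exists [::].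
  by have [u [Uu vu] eu] := FU b bF; exists u.
rewrite (_ : \sum_(b <- F) _ = \sum_(u <- map g F) rtree p u); last first.
  rewrite big_map big_seq [RHS]big_seq; apply: eq_bigr => b /hg [_ vb eb].
  by rewrite /= /rweight vb eb.
apply: cU.
  rewrite map_inj_in_uniq // => b b' /hg [_ _ eb] /hg [_ _ eb'] e'.
  by rewrite -eb -eb' e'.
by move=> u /mapP[b /hg[Ub _ _] ->].
Qed.

Definition vec v : 'rV[R]_#|A| := \row_i v (enum_val i).
(** Row convention: row [i] is the image of a basis vector, so that products along a path follow the
    order of time. *)
Definition symmx (a : W) : 'M[R]_#|A| :=
  \matrix_(i, j) hword a.1 a.2 (fun c => if c == enum_val i then 1 else 0) (enum_val j).

Lemma ssq_vec v : ssq (vec v) = \sum_a v a ^+ 2.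
Proof.
rewrite /ssq /vec (reindex (@enum_rank A)) /=; last first.
  by exists (@enum_val A predT) => i _; rewrite ?enum_rankK ?enum_valK.
by apply: eq_bigr => a _; rewrite mxE enum_rankK.
Qed.

Lemma hword_lin p b v a : hword p b v a = \sum_c v c * hword p b (fun e => if e == c then 1 else 0) a.
Proof.
suff H : forall s : seq A, hword p b (fun e => \sum_(c <- s) v c * (if e == c then 1 else 0)) a =
   \sum_(c <- s) v c * hword p b (fun e => if e == c then 1 else 0) a.
  rewrite -H; congr (hword _ _ _ _); apply/funext => e.
  by rewrite (bigD1 e) //= eqxx mulr1 big1 ?addr0 // => c /negPf; rewrite eq_sym => ->; rewrite mulr0.
elim=> [|c s IH].
  rewrite big_nil; transitivity (hword p b (fun e => 0 * v e) a); last by rewrite hword_scale mul0r.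
  by congr (hword _ _ _ _); apply/funext => e; rewrite big_nil mul0r.
rewrite big_cons -IH -hword_scale -hword_sum; congr (hword _ _ _ _); apply/funext => e.
by rewrite big_cons.
Qed.

Lemma vec_symmx v a : vec v *m symmx a = vec (hword a.1 a.2 v).
Proof.
apply/rowP => j; rewrite !mxE hword_lin (reindex (@enum_val A predT)) /=; last first.
  by exists (@enum_rank A) => i _; rewrite ?enum_rankK ?enum_valK.
by apply: eq_bigr => i _; rewrite !mxE.
Qed.

Lemma vec_cprod p u v : valid p u -> vec v *m cprod symmx u = vec (hword p (flat u) v).
Proof.
elim/last_ind: u => [|u a IH] vu; first by rewrite /cprod /= mulmx1.
move: vu; rewrite valid_rcons => /and3P[vu /eqP ea _].
by rewrite /cprod -cats1 foldl_cat /= mulmxA IH // vec_symmx flat_cat hword_cat ea /flat /= cats0.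
Qed.

Lemma exists_code p (ty : paths true) : (forall h, ~ never_returns p h ty) ->
  exists y : paths y0, (forall k, valid p (mkseq y k)) /\
    forall k, mkseq ty (size (flat (mkseq y k))) = flat (mkseq y k).
Proof.
move=> hret.
have H m : exists n, ends_strong (rzw p (mkseq ty m)) (mkseq (pshift m ty) n).
  have /not_andP[|/existsNP[n /negP]] := hret (mkseq ty m).
    by rewrite /cyl /= size_mkseq.
  by rewrite size_mkseq negbK; exists n.
pose nx m := ex_minn (H m).
pose t k := iter k (fun m => m + nx m)%N 0%N.
pose y : paths y0 := fun k => (rzw p (mkseq ty (t k)), mkseq (pshift (t k) ty) (nx (t k))).
have fl k : flat (mkseq y k) = mkseq ty (t k).
  elim: k => [|k IH] //; rewrite mkseqS flat_rcons IH /=.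
  by rewrite (@mkseq_shift _ true).
exists y; split=> k; last by rewrite fl size_mkseq.
elim: k => // k IH; rewrite mkseqS valid_rcons IH fl /= eqxx /=.
rewrite /ret /nx; case: ex_minnP => n En nmin; rewrite En /=.
apply/allP => i; rewrite mem_iota size_mkseq /= => ni; apply/negP => Ei.
move: (ni); rewrite ltnNge; case/negP; apply: nmin; move: Ei.
by rewrite /mkseq -map_take take_iota (minn_idPl (ltnW ni)).
Qed.

(** The exceptional set is a countable union of null sets chosen before [v]; for the increments the
    countably many rates [i.+1%:R^-1] suffice. *)
Theorem generic_types p : okp p -> exists E : set (paths true), cmu (btree p) E = 0%E /\
  forall ty, ~ E ty -> exists y : nat -> W,
  [/\ forall k, valid p (mkseq y k), forall k, mkseq ty (size (flat (mkseq y k))) = flat (mkseq y k),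
     forall v, (exists B, forall n, \sum_(0 <= k < n) \sum_a hword p (flat (mkseq y k)) v a ^+ 2 <= B) ->
       exists c, 0 < c /\ \forall k \near \oo,
         \sum_a hword p (flat (mkseq y k)) v a ^+ 2 <= expR (- c * k%:R),
     exists D, \forall k \near \oo, tot (hword p (flat (mkseq y k)) ones) <= expR (D * k%:R) &
     forall e, 0 < e -> \forall k \near \oo, tot (hword p (flat (mkseq y k.+1)) ones) <=
        expR (e * k%:R) * tot (hword p (flat (mkseq y k)) ones)].
Proof.
move=> okp_.
have [D hD] := growth_null okp_.
pose ED : set (paths y0) := [set y | forall m, exists2 k, (m <= k)%N & expR (D * k%:R) < tot (hword p (flat (mkseq y k)) ones)].
pose EI i : set (paths y0) := [set y : paths y0 | forall m, exists2 k, (m <= k)%N &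
     expR (i.+1%:R^-1 * k%:R) * tot (hword p (flat (mkseq y k)) ones) < tot (hword p (flat (mkseq y k.+1)) ones)].
pose EB : set (paths y0) := always_often_bad symmx.
pose EW := (EB `|` ED) `|` \bigcup_i EI i.
have EW0 : cmu (rtree p) EW = 0%E.
  apply: cmu0_setU; last by apply: cmu0_bigcup => i; apply: increment_null; rewrite ?invr_gt0 ?ltr0n.
  apply: cmu0_setU; last exact: hD.
  apply: (@always_often_bad_null R W y0 (rtree p) stree bernoulli_const bernoulli_const_ge0).
    by move=> u u'; exact: rweight_cat.
  by rewrite /= /rweight /= wgt0.
exists ((\bigcup_(h : seq bool) never_returns p h) `|` [set ty : paths true | exists y : paths y0, [/\ EW y, forall k, valid p (mkseq y k) &
    forall k, mkseq ty (size (flat (mkseq y k))) = flat (mkseq y k)]]); split.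
  apply: cmu0_setU; last exact: code_null.
  rewrite (_ : \bigcup_h _ = \bigcup_n (oapp (never_returns p) set0 (@unpickle (seq bool) n))).
    apply: (@cmu0_bigcup R bool true (btree p)) => n.
    case: (@unpickle (seq bool) n) => [h|] /=; [exact: never_returns_null|exact: cmu0].
  apply/seteqP; split=> ty [n _]; first by move=> hn; exists (pickle n) => //; rewrite pickleK.
  by case: (@unpickle (seq bool) n) => //= h hn; exists h.
move=> ty /not_orP [hn hE].
have [|y [vy ey]] := @exists_code p ty; first by move=> h hh; apply: hn; exists h.
have nE : ~ EW y by move=> Ey; apply: hE; exists y.
exists y; split=> //.
- move=> v [B hB].
  have [] := @exp_decay R W y0 0 (lexx 0) _ symmx y (vec v).
  + by move=> Ey; apply: nE; left; left.
  + exists B => n; apply: le_trans (hB n); rewrite /energy le_eqVlt; apply/orP; left; apply/eqP.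
    by apply: eq_bigr => k _; rewrite (vec_cprod _ (vy k)) ssq_vec.
  move=> c [c0 hc]; exists c; split=> //; near=> k.
  rewrite -ssq_vec -(vec_cprod _ (vy k)); near: k; exact: hc.
- exists D; apply: contrapT => hc; apply: nE; left; right => m.
  apply: contrapT => hm; apply: hc; exists m => // k /= mk; rewrite leNgt; apply/negP => hk.
  by apply: hm; exists k.
- move=> e e0; pose i := Num.bound e^-1.
  have ie : i.+1%:R^-1 <= e.
    rewrite invf_ple ?posrE ?ltr0n //; apply: ltW; apply: lt_le_trans (archi_boundP _) _.
      by rewrite invr_ge0 ltW.
    by rewrite ler_nat /i leqnSn.
  apply: contrapT => hc; apply: nE; right; exists i => // m.
  apply: contrapT => hm; apply: hc; exists m => // k /= mk; rewrite leNgt; apply/negP => hk.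
  apply: hm; exists k => //; apply: le_lt_trans hk.
  by rewrite ler_pM2r ?tot_ones_gt0 // ler_expR ler_wpM2r.
Unshelve. all: by end_near.
Qed.

End ReturnWords.

(** * Rauzy induction on affine exchanges *)

Section Induction.
Variables (R : realType) (A : finType) (x0 : A).
Hypothesis hA : (2 <= #|A|)%N.
Notation pair := (seq A * seq A)%type.
Notation win := (win x0).
Notation los := (los x0).
Notation rz := (rz x0).
Notation rzw := (rzw x0).
Notation hstep := (hstep x0).
Notation hword := (hword x0).
Notation bstep := (bstep x0).
Notation bword := (bword x0).
Notation wgt := (wgt x0).
Notation ones := ((fun=> 1) : A -> R).
Implicit Types (T : aiet R A) (p : pair) (b : bool) (u : seq bool) (v lam : A -> R).

Definition rows T : pair := (atop T, abot T).
Definition slope T a : R := aimg T a / alen T a.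
Definition positive_aiet T := (forall a, 0 < alen T a) /\ (forall a, 0 < aimg T a).
Definition top_wins T : bool := aimg T (win (rows T) false) < alen T (win (rows T) true).

Lemma ohead_rev_last (s : seq A) : (0 < size s)%N -> ohead (rev s) = Some (last x0 s).
Proof. by case/lastP: s => // s a _; rewrite rev_rcons last_rcons. Qed.

Lemma rv_infoE T : okp (rows T) -> rv_info T = Some (top_wins T, win (rows T) (top_wins T), los (rows T) (top_wins T)).
Proof.
move=> [hp _]; have [s1 s2] := is_pair_size hp; rewrite /= in s1 s2.
rewrite /rv_info !ohead_rev_last ?s1 ?s2; try by apply: leq_trans hA.
by rewrite /top_wins /win /los /=; case: ifP.
Qed.

Lemma rv_definedE T : okp (rows T) ->
  rv_defined T <-> alen T (win (rows T) true) <> aimg T (win (rows T) false).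
Proof.
move=> [hp _]; have [s1 s2] := is_pair_size hp; rewrite /= in s1 s2.
by rewrite /rv_defined !ohead_rev_last ?s1 ?s2; try by apply: leq_trans hA.
Qed.

Lemma rv_step_top T : okp (rows T) -> top_wins T -> let w := win (rows T) true in let l := los (rows T) true in
  rv_step T = AIET (atop T) (ins_after w l (abot T))
    (upd (alen T) w (alen T w - aimg T l))
    (upd (upd (aimg T) w (aimg T w - slope T w * aimg T l)) l (slope T w * aimg T l)).
Proof. by move=> ok tw w l; rewrite /rv_step rv_infoE // tw. Qed.

Lemma rv_step_bottom T : okp (rows T) -> top_wins T = false -> let w := win (rows T) false in let l := los (rows T) false in
  rv_step T = AIET (ins_after w l (atop T)) (abot T)
    (upd (upd (alen T) w (alen T w - alen T l / slope T w)) l (alen T l / slope T w))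
    (upd (aimg T) w (aimg T w - alen T l)).
Proof. by move=> ok tw w l; rewrite /rv_step rv_infoE // tw. Qed.

Lemma rows_step T : okp (rows T) -> rows (rv_step T) = rz (rows T) (top_wins T).
Proof.
move=> ok; case e: (top_wins T); first by rewrite rv_step_top // /rows /= /rz.
by rewrite rv_step_bottom // /rows /= /rz.
Qed.

Lemma slope_gt0 T a : positive_aiet T -> 0 < slope T a.
Proof. by move=> [h1 h2]; rewrite divr_gt0. Qed.

Lemma positive_step T : okp (rows T) -> positive_aiet T -> rv_defined T -> positive_aiet (rv_step T).
Proof.
move=> ok pos /rv_definedE -/(_ ok) /eqP ne; have [al ai] := pos.
have [e|e] := boolP (top_wins T).
  rewrite rv_step_top //; set w := win _ _; set l := los _ _.
  have h : 0 < alen T w - aimg T l by rewrite subr_gt0.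
  split=> a /=; rewrite /upd; case: ifP => // _; first by rewrite mulr_gt0 // slope_gt0.
  case: ifP => // _; rewrite -[X in 0 < X - _](@divfK _ (alen T w)) ?gt_eqF // -/(slope T w) -mulrBr mulr_gt0 //.
  exact: slope_gt0.
rewrite rv_step_bottom ?(negPf e) //; set w := win _ _; set l := los _ _.
have h : 0 < aimg T w - alen T l.
  by rewrite subr_gt0 lt_neqAle ne /= leNgt.
have s0 : 0 < slope T w by exact: slope_gt0.
split=> a /=; rewrite /upd; case: ifP => // _; first by rewrite divr_gt0.
case: ifP => // _; have -> : alen T w = aimg T w / slope T w.
  by rewrite /slope invfM invrK mulrA divff ?mul1r // gt_eqF.
by rewrite -mulrBl divr_gt0.
Qed.

(** On the loser's new interval the first return map composes two branches; the other letters keep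
    theirs. *)
Lemma slope_step T a : okp (rows T) -> positive_aiet T -> rv_defined T ->
  slope (rv_step T) a = slope T a * (if a == los (rows T) (top_wins T) then slope T (win (rows T) (top_wins T)) else 1).
Proof.
move=> ok pos df; have [al ai] := pos; have [al' ai'] := positive_step ok pos df.
have wl := win_los x0 hA (top_wins T) ok.
have [e|/negPf e] := boolP (top_wins T); rewrite e in wl.
  have := al' (win (rows T) true); rewrite /slope rv_step_top //= /upd eqxx.
  move: wl; set w := win _ _; set l := los _ _ => wl dw.
  have [->|nl] := eqVneq a l; first by rewrite [l == w]eq_sym (negPf wl) /slope; field; rewrite !gt_eqF.
  rewrite mulr1; have [->|nw] := eqVneq a w => //; rewrite /slope; field.
  by rewrite !gt_eqF.
have := ai' (win (rows T) false); rewrite /slope rv_step_bottom //= /upd eqxx.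
move: wl; set w := win _ _; set l := los _ _ => wl dw.
have s0 : 0 < slope T w by exact: slope_gt0.
have [->|nl] := eqVneq a l; first by rewrite eq_sym (negPf wl) /slope; field; rewrite !gt_eqF.
rewrite mulr1; have [->|nw] := eqVneq a w => //.
have -> : alen T w - alen T l / slope T w = (aimg T w - alen T l) / slope T w.
  by rewrite /slope; field; rewrite !gt_eqF.
by rewrite invfM invrK mulrA divff ?mul1r // gt_eqF.
Qed.

Definition admissible T := okp (rows T) /\ positive_aiet T.

Lemma admissible_step T : admissible T -> rv_defined T -> admissible (rv_step T).
Proof.
move=> [ok pos] df; split; last exact: positive_step.
by rewrite rows_step //; exact: okp_rz.
Qed.

Lemma admissible_iter T n : admissible T -> (forall i, (i < n)%N -> rv_defined (rv_iter i T)) ->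
  admissible (rv_iter n T).
Proof.
move=> aT; elim: n => // n IH df; apply: admissible_step; last exact: df.
by apply: IH => i /ltnW; exact: df.
Qed.

Lemma keane_admissible T n : admissible T -> keane T -> admissible (rv_iter n T).
Proof. by move=> aT kT; apply: admissible_iter => // i _; exact: kT. Qed.

Lemma rv_typeE T n : okp (rows (rv_iter n T)) -> rv_type T n = top_wins (rv_iter n T).
Proof. by move=> ok; rewrite /rv_type rv_infoE. Qed.

Lemma okp_iter T n : okp (rows T) -> okp (rows (rv_iter n T)).
Proof. by move=> ok; elim: n => //= n IH; rewrite rows_step //; exact: okp_rz. Qed.

Lemma rows_iter T n : okp (rows T) -> rows (rv_iter n T) = rzw (rows T) (mkseq (rv_type T) n).
Proof.
move=> ok; elim: n => // n IH; rewrite mkseqS rzw_rcons -IH /= rows_step ?rv_typeE //; exact: okp_iter.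
Qed.

Lemma rv_cocycleE T n v : okp (rows T) -> rv_cocycle T n v = hword (rows T) (mkseq (rv_type T) n) v.
Proof.
move=> ok; elim: n => // n IH; rewrite mkseqS hword_rcons /= /rv_mat rv_infoE; last exact: okp_iter.
rewrite IH -rows_iter // rv_typeE //; exact: okp_iter.
Qed.

Lemma logslope_step T : admissible T -> rv_defined T ->
  logslope (rv_step T) = hstep (rows T) (top_wins T) (logslope T).
Proof.
move=> [ok pos] df; apply/funext => a; rewrite /hstep /logslope -/(slope _ _) slope_step //.
have s0 c : 0 < slope T c by exact: slope_gt0.
by case: ifP => _; rewrite ?mulr1 ?addr0 // lnM ?posrE.
Qed.

Lemma logslope_iter T n : admissible T -> keane T ->
  logslope (rv_iter n T) = hword (rows T) (mkseq (rv_type T) n) (logslope T).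
Proof.
move=> aT kT; have [ok _] := aT; elim: n => // n IH; rewrite mkseqS hword_rcons -IH -rows_iter //=.
by rewrite logslope_step ?rv_typeE //; [exact: okp_iter|exact: keane_admissible].
Qed.

Lemma iet_step p lam : okp p -> (forall a, 0 < lam a) -> rv_defined (iet p lam) ->
  let b := top_wins (iet p lam) in
  exists lam', [/\ (forall a, 0 < lam' a), lam = bstep p b lam' & rv_step (iet p lam) = iet (rz p b) lam'].
Proof.
move=> ok l0 df b; have ok' : okp (rows (iet p lam)) by case: p ok {df b} => p1 p2.
have eT : rv_step (iet p lam) = iet (rz p b) (upd lam (win p b) (lam (win p b) - lam (los p b))).
  have lw a : lam a / lam a = 1 by rewrite divff // gt_eqF.
  rewrite /b; case: (boolP (top_wins _)) => [e|/negPf e].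
    rewrite rv_step_top //= /rz /iet /slope /= -/(rows _); congr AIET.
    rewrite lw !mul1r; apply/funext => a; rewrite /upd.
    have := win_los x0 hA true ok'; rewrite /= => wl.
    have [->|] := eqVneq a (los (rows (iet p lam)) true) => //.
    by rewrite eq_sym (negPf wl).
  rewrite rv_step_bottom //= /rz /iet /slope /=; congr AIET.
  rewrite lw !divr1; apply/funext => a; rewrite /upd.
  have := win_los x0 hA false ok'; rewrite /= => wl.
  have [->|] := eqVneq a (los (rows (iet p lam)) false) => //.
  by rewrite eq_sym (negPf wl).
exists (upd lam (win p b) (lam (win p b) - lam (los p b))); split=> //.
  have [//|pos' _] := @positive_step (iet p lam) ok' _ df.
  by move=> a; have := pos' a; rewrite eT.
apply/funext => a; rewrite /bstep /upd.
have := win_los x0 hA b ok; rewrite eq_sym => /negPf ->.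
by have [->|_] := eqVneq a (win p b); rewrite ?subrK ?addr0.
Qed.

Lemma iet_iter p lam n : okp p -> (forall a, 0 < lam a) ->
  (forall i, (i < n)%N -> rv_defined (rv_iter i (iet p lam))) ->
  let u := mkseq (rv_type (iet p lam)) n in
  exists lam', [/\ (forall a, 0 < lam' a), lam = bword p u lam' & rv_iter n (iet p lam) = iet (rzw p u) lam'].
Proof.
move=> ok l0; elim: n => [|n IH] df u; first by exists lam; split=> //; case: (p).
have [|lam' [l'0 el eT]] := IH; first by move=> i /ltnW; exact: df.
rewrite /u mkseqS; set u' := mkseq _ n in el eT *.
have ok' : okp (rzw p u') by exact: okp_rzw.
have [|lam'' [l''0 el' eT']] := @iet_step (rzw p u') lam' ok' l'0; first by rewrite -eT; exact: df.
have eb : rv_type (iet p lam) n = top_wins (iet (rzw p u') lam').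
  by rewrite rv_typeE eT //; case: (rzw p u') ok'.
exists lam''; split=> //.
  by rewrite eb -cats1 bword_cat /= -el'.
by rewrite eb rzw_rcons -eT' /= -eT.
Qed.

Fixpoint code p u : seq (A * A) :=
  if u is b :: u' then (win p b, los p b) :: code (rz p b) u' else [::].

Lemma code_proper p u : okp p -> proper_steps (code p u).
Proof.
by elim: u p => //= b u IH p ok; rewrite win_los //= IH //; exact: okp_rz.
Qed.

Lemma ebacks_code p u v : ebacks (code p u) v = bword p u v.
Proof. by elim: u p => //= b u IH p; rewrite IH. Qed.

Lemma eheights_code p u v : eheights (code p u) v = hword p u v.
Proof. by elim: u p v => //= b u IH p v; rewrite -IH. Qed.

Lemma evol_code p u : (evol R (code p u))^-1 = wgt p ones u.
Proof. by rewrite /evol /wgt eheights_code /vol prodr_const expr1n mul1r. Qed.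

(** Lengths with first moves [u] lie in the cone of [code p u], whose cost is the weight of [u]. A
    cover of [E] by cylinders is thus a cover by cones of the same total. *)
Lemma small_types p (E : set (paths true)) (S : set (A -> R)) : okp p -> cmu (btree R x0 p) E = 0%E ->
  (forall lam, S lam -> exists ty, E ty /\ forall n, exists v, (forall a, 0 <= v a) /\ lam = bword p (mkseq ty n) v) ->
  small S.
Proof.
move=> ok E0 hS eps eps0.
have [U [EU cU]] := @cmu_adherent R _ true (btree R x0 p) E eps eps0; rewrite E0 add0e in cU.
exists [set code p u | u in U]; split.
- by move=> e [u _ <-]; exact: code_proper.
- move=> lam /hS [ty [/EU [u Uu yu] h]]; have [v [v0 e]] := h (size u).
  exists (code p u); first by exists u.
  by exists v; split=> //; rewrite ebacks_code e yu.
move=> F uF FU.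
have [g hg] : exists g : seq (A * A) -> seq bool, forall e, e \in F -> U (g e) /\ code p (g e) = e.
  suff : forall e, exists u, e \in F -> U u /\ code p u = e by case/choice => g; exists g.
  move=> e; case: (boolP (e \in F)) => eF; last by exists [::].
  by have [u Uu eu] := FU e eF; exists u.
rewrite (_ : \sum_(e <- F) _ = \sum_(u <- map g F) btree R x0 p u); last first.
  by rewrite big_map big_seq [RHS]big_seq; apply: eq_bigr => e /hg [_ {1}<-]; rewrite evol_code.
rewrite -lee_fin; apply: cU.
  by rewrite map_inj_in_uniq // => e e' /hg [_ h] /hg [_ h'] ee; rewrite -h -h' ee.
by move=> u /mapP[e /hg[Ue _] ->].
Qed.

Lemma eheights_cat e e' v : eheights (e ++ e') v = eheights e' (eheights e v).
Proof. by rewrite /eheights foldl_cat. Qed.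

Lemma ebacks_cat e e' v : ebacks (e ++ e') v = ebacks e (ebacks e' v).
Proof. by rewrite /ebacks foldr_cat. Qed.

(** A vector with equal coordinates at [a] and [b] is the image under the step [(a, b)] of one
    vanishing at [a], which the steps [(b, a)] fix. It therefore lies in the cones of arbitrarily
    many such steps, along which the height of [a] is unbounded and the cost tends to 0. *)
Lemma small_tie p u : okp p -> small [set lam | exists v : A -> R, [/\ forall a, 0 <= v a,
  v (win (rzw p u) true) = v (win (rzw p u) false) & lam = bword p u v]].
Proof.
move=> ok eps eps0; have ok' := okp_rzw x0 hA u ok.
set a := win (rzw p u) true; set b := win (rzw p u) false.
have ab : a != b by exact: (win_los x0 hA true ok').
pose m := (Num.bound eps^-1).+1.
pose e := code p u ++ (a, b) :: nseq m (b, a).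
have pe : proper_steps e.
  have := code_proper u ok; rewrite /proper_steps all_cat => -> /=; by rewrite ab all_nseq /= [b == a]eq_sym ab orbT.
have ba : (b == a) = false by rewrite eq_sym (negPf ab).
exists [set e]; split=> [_ -> //|lam [v [v0 vab ->]]|F uF FU].
  exists e => //; exists (fun c => if c == a then 0 else v c); split; first by move=> c; case: ifP.
  rewrite ebacks_cat ebacks_code; congr (bword p u _).
  rewrite -[ebacks _ _]/(eback (a, b) (ebacks (nseq m (b, a)) _)).
  have -> : ebacks (nseq m (b, a)) (fun c => if c == a then 0 else v c) = (fun c => if c == a then 0 else v c).
    elim: (m) => //= k ->; apply/funext => c; rewrite /eback /= eqxx.
    by case: (c == b); rewrite addr0.
  apply/funext => c; rewrite /eback /= ba.
  by have [->|_] := eqVneq c a; rewrite ?add0r ?addr0.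
have e1 : (evol R e)^-1 <= eps.
  have ep : 0 < eps^-1 by rewrite invr_gt0.
  rewrite invf_ple ?posrE ?evol_gt0 //.
  apply: (@le_trans _ _ m%:R); first by rewrite ltW // (lt_le_trans (archi_boundP (ltW ep))) // ler_nat /m leqnSn.
  have h1 c : 1 <= eheights (code p u) ones c by exact: (eheights_ge _ _ (q := ones)).
  have hk k : [/\ 1 <= eheights (code p u ++ (a, b) :: nseq k (b, a)) ones b &
     k%:R <= eheights (code p u ++ (a, b) :: nseq k (b, a)) ones a].
    rewrite eheights_cat /=; move: (eheights _ ones) h1 => q h1.
    have hb : 1 <= eheight (a, b) q b by rewrite /eheight eqxx -[1]addr0 lerD // (le_trans ler01).
    have ha : 0 <= eheight (a, b) q a by rewrite /eheight /= (negPf ab) addr0 (le_trans ler01).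
    suff : forall n, 1 <= eheight (a, b) q b -> n%:R <= eheight (a, b) q a ->
       1 <= eheights (nseq k (b, a)) (eheight (a, b) q) b /\ (n + k)%:R <= eheights (nseq k (b, a)) (eheight (a, b) q) a.
      by move=> /(_ 0%N hb ha) [].
    move: (eheight _ q) => {hb ha}q'; elim: k q' => [|k IH] q' n hb ha /=; first by rewrite addn0.
    rewrite addnS -addSn; apply: IH => //; rewrite /eheight /= ?ba ?addr0 // eqxx -natr1.
    exact: lerD.
  have [_ hm] := hk m; apply: le_trans hm _.
  rewrite /evol -/e (bigD1 a) //= ler_peMr ?(ltW (eheights_gt0 _ _ _)) //.
  have ge1 c : 1 <= eheights e ones c by exact: (eheights_ge _ _ (q := ones)).
  have : \prod_(c | c != a) 1 <= \prod_(c | c != a) eheights e ones c.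
    by apply: ler_prod => c _; rewrite ler01 ge1.
  by rewrite prodr_const expr1n.
case: F uF FU => [|f [|f' F]]; first by rewrite big_nil ltW.
  by move=> _ /(_ f (mem_head _ _)) ->; rewrite big_seq1.
move=> /= /andP[+ _] h; by rewrite (h f) ?mem_head // (h f') ?inE ?eqxx ?orbT.
Qed.

(** The first undefined step is a tie after one of countably many words. *)
Lemma small_not_keane p : okp p -> small [set lam : A -> R | (forall a, 0 < lam a) /\ ~ keane (iet p lam)].
Proof.
move=> ok; pose S (u : seq bool) := [set lam | exists v : A -> R, [/\ forall a, 0 <= v a,
  v (win (rzw p u) true) = v (win (rzw p u) false) & lam = bword p u v]].
apply: (@small_sub _ _ _ (\bigcup_n (oapp S set0 (@unpickle (seq bool) n)))); last first.
  apply: small_bigcup => n; case: (@unpickle (seq bool) n) => [u|] /=; first exact: small_tie.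
  by apply: small_sub (@small_tie p [::] ok) => //.
move=> lam [l0 /existsNP [n0 hn0]].
have ex : exists n, `[< ~ rv_defined (rv_iter n (iet p lam)) >] by exists n0; apply/asboolP.
case: (ex_minnP ex) => n /asboolP nd nmin.
have df i : (i < n)%N -> rv_defined (rv_iter i (iet p lam)).
  by move=> iN; apply: contrapT => h; move: iN; rewrite ltnNge nmin //; apply/asboolP.
have [v [v0 el eT]] := iet_iter ok l0 df.
exists (pickle (mkseq (rv_type (iet p lam)) n)) => //; rewrite pickleK /=.
exists v; split=> //; first by move=> a; exact: ltW.
move: nd; rewrite eT rv_definedE /=; last first.
  by have := okp_rzw x0 hA (mkseq (rv_type (iet p lam)) n) ok; case: (rzw _ _).
by move/contrapT; case: (rzw p _).
Qed.

End Induction.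

(** * Rokhlin towers *)

Section Positions.
Variables (R : realType) (A : finType).
Implicit Types (s : seq A) (f g : A -> R).

Lemma lpos_cat s1 a s2 f : a \notin s1 -> lpos (s1 ++ a :: s2) f a = \sum_(b <- s1) f b.
Proof.
move=> ns; rewrite /lpos index_cat (negPf ns) /= eqxx addn0 take_size_cat //.
Qed.

Lemma lpos_catl s1 s2 f a : a \in s1 -> lpos (s1 ++ s2) f a = lpos s1 f a.
Proof.
move=> h; rewrite /lpos index_cat h take_cat index_mem h //.
Qed.

Lemma lpos_catr s1 s2 f a : a \notin s1 -> lpos (s1 ++ s2) f a = \sum_(b <- s1) f b + lpos s2 f a.
Proof.
move=> /negPf h; rewrite /lpos index_cat h take_cat ltnNge leq_addr /= addKn big_cat.
by [].
Qed.

Lemma lpos_cons b s f a : lpos (b :: s) f a = if b == a then 0 else f b + lpos s f a.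
Proof. by rewrite /lpos /=; case: eqP => _; rewrite ?big_nil ?big_cons. Qed.

Lemma eq_lpos s f g a : uniq s -> (forall b, b \in take (index a s) s -> f b = g b) -> lpos s f a = lpos s g a.
Proof. by move=> us h; rewrite /lpos; apply: eq_big_seq. Qed.

(** The interval of [l] is carved from the right end of that of [w], so no other left end moves. *)
Lemma lpos_ins s1 w s2 l f g a : uniq (s1 ++ w :: rcons s2 l) ->
  (forall b, b != w -> b != l -> f b = g b) -> g w + g l = f w -> a != l -> a \in s1 ++ w :: rcons s2 l ->
  lpos (s1 ++ w :: l :: s2) g a = lpos (s1 ++ w :: rcons s2 l) f a.
Proof.
rewrite cat_uniq /= has_rcons mem_rcons rcons_uniq inE !negb_or.
move=> /and3P[u1 /and3P[w1 l1 n1] /and3P[/andP[wl w2] l2 u2]] fg gwl al ain.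
have e1 b : b \in s1 -> g b = f b.
  by move=> b1; rewrite fg //; [apply: contraNneq w1 => <-|apply: contraNneq l1 => <-].
have e2 b : b \in s2 -> g b = f b.
  by move=> b2; rewrite fg //; [apply: contraNneq w2 => <-|apply: contraNneq l2 => <-].
have [as1|as1] := boolP (a \in s1).
  rewrite !lpos_catl //; apply: eq_lpos => // b /mem_take; exact: e1.
rewrite !lpos_catr // (eq_big_seq f) //; congr (_ + _).
rewrite !lpos_cons; case: (eqVneq w a) => // wa; rewrite eq_sym (negPf al) addrA gwl; congr (_ + _).
have as2 : a \in s2 by move: ain; rewrite mem_cat (negPf as1) inE mem_rcons inE (negPf al) /= eq_sym (negPf wa).
rewrite -cats1 lpos_catl //; apply: eq_lpos => // b /mem_take; exact: e2.
Qed.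

Lemma lpos_ins_new s1 w s2 l g : uniq (s1 ++ w :: rcons s2 l) ->
  lpos (s1 ++ w :: l :: s2) g l = lpos (s1 ++ w :: rcons s2 l) g w + g w.
Proof.
rewrite cat_uniq /= has_rcons mem_rcons rcons_uniq inE !negb_or.
move=> /and3P[u1 /and3P[w1 l1 n1] /and3P[/andP[wl w2] l2 u2]].
by rewrite !lpos_catr // !lpos_cons !eqxx (negPf wl) !addr0.
Qed.

Lemma lpos_rcons s w f g a : uniq (rcons s w) -> (forall b, b != w -> f b = g b) -> a \in rcons s w ->
  lpos (rcons s w) f a = lpos (rcons s w) g a.
Proof.
rewrite rcons_uniq => /andP[ws us] fg; rewrite mem_rcons inE => ha.
have e b : b \in s -> f b = g b by move=> bs; apply: fg; apply: contraNneq ws => <-.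
have [as_|as_] := boolP (a \in s).
  rewrite -cats1 !lpos_catl //; apply: eq_lpos => // b /mem_take; exact: e.
move: ha; rewrite (negPf as_) orbF => /eqP ->.
by rewrite -cats1 !lpos_cat //; apply: eq_big_seq.
Qed.

Lemma lpos_last s w f : uniq (rcons s w) -> lpos (rcons s w) f w + f w = \sum_(b <- rcons s w) f b.
Proof. by rewrite rcons_uniq => /andP[ws us]; rewrite -cats1 lpos_cat // big_cat big_seq1. Qed.

(** Telescoping for an arbitrary additive function of intervals, so that indicators and measures are
    treated alike. *)
Lemma sum_row s f (g : R -> R -> R) : uniq s -> (forall b, 0 <= f b) ->
  (forall x y z, x <= y -> y <= z -> g x y + g y z = g x z) -> (forall x, g x x = 0) ->
  \sum_(a <- s) g (lpos s f a) (lpos s f a + f a) = g 0 (\sum_(a <- s) f a).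
Proof.
move=> us f0 ga g0; elim/last_ind: s us => [|s w IH] us; first by rewrite !big_nil g0.
have := us; rewrite rcons_uniq => /andP[ws us'].
rewrite -cats1 !big_cat !big_seq1 -(ga 0 (\sum_(a <- s) f a)) ?sumr_ge0 ?lerDl // -IH // lpos_cat //.
congr (_ + _); apply: eq_big_seq => a as_; by rewrite lpos_catl.
Qed.

End Positions.

(** * Cutting and stacking *)

Section Towers.
Variables (R : realType) (A : finType) (x0 : A).
Hypothesis hA : (2 <= #|A|)%N.
Notation pair := (seq A * seq A)%type.
Notation win := (win x0).
Notation los := (los x0).
Notation rz := (rz x0).
Notation rzw := (rzw x0).
Notation hstep := (hstep x0).
Notation hword := (hword x0).
Notation top_wins := (top_wins x0).

Definition winner (T : aiet R A) := win (rows T) (top_wins T).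
Definition loser (T : aiet R A) := los (rows T) (top_wins T).

Definition reparam (c k : R) (f : R * R) : R * R := (f.1 + f.2 * c, f.2 * k).

(** When the top letter wins, the loser's tower is followed by the part of the winner's tower over
    the removed end of its base, where the loser's image lands; hence the loser's slope as scale.
    Otherwise the corresponding part of the winner's tower comes first, and the loser's tower
    follows, rescaled by the winner's slope. *)
Definition tower_step (T : aiet R A) (tw : A -> seq (R * R)) (a : A) : seq (R * R) :=
  let w := winner T in let l := loser T in
  if a == l then
    if top_wins T then tw l ++ map (reparam (alen (rv_step T) w) (slope T l)) (tw w)
    else map (reparam (alen (rv_step T) w) 1) (tw w) ++ map (reparam 0 (slope T w)) (tw l)
  else tw a.

(* A floor [(x, s)] stands for the affine parametrization [u |-> x + s * u] of [x, x + s * len). *)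
Fixpoint climbs (m : R -> R) (len : R) (s : seq (R * R)) (g : R * R) : Prop :=
  if s is f :: s' then
    (forall u, 0 <= u < len -> m (f.1 + f.2 * u) = (head g s').1 + (head g s').2 * u) /\
    climbs m len s' g
  else True.

Lemma climbs_cat m len s s' g : climbs m len s (head g s') -> climbs m len s' g -> climbs m len (s ++ s') g.
Proof.
elim: s => //= f s IH [h hs] hs'; split; last exact: IH.
by case: s h {hs IH} => //=; case: s' {hs'}.
Qed.

Lemma climbs_reparam m len len' c k s g : 0 <= c -> 0 <= k ->
  (forall u, 0 <= u < len' -> c + k * u < len) ->
  climbs m len s g -> climbs m len' (map (reparam c k) s) (reparam c k g).
Proof.
move=> c0 k0 h; elim: s => //= f s IH [hf hs]; split; last exact: IH.
move=> u /andP[u0 ul]; rewrite -addrA -mulrA -mulrDr hf; last first.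
  by rewrite addr_ge0 ?mulr_ge0 // h // u0.
have -> : head (reparam c k g) (map (reparam c k) s) = reparam c k (head g s) by case: s {hf hs IH}.
by rewrite /reparam /= mulrDr mulrA addrA.
Qed.

Definition base (T : aiet R A) a : R * R := (lpos (atop T) (alen T) a, 1).
Definition image (T : aiet R A) a : R * R := (lpos (abot T) (aimg T) a, slope T a).

Definition tower_spec (m : R -> R) (T : aiet R A) (tw : A -> seq (R * R)) :=
  forall a, [/\ exists s, tw a = base T a :: s, all (fun f => 0 < f.2) (tw a) &
    climbs m (alen T a) (tw a) (image T a)].

Section Step.
Variable T : aiet R A.
Hypothesis aT : admissible T.
Hypothesis dT : rv_defined T.
Hypothesis sT : \sum_a alen T a = \sum_a aimg T a.
Let T' := rv_step T.
Let w := winner T.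
Let l := loser T.
Let ok : okp (rows T). Proof. by case: aT. Qed.
Let pos : positive_aiet T. Proof. by case: aT. Qed.
Let pos' : positive_aiet T'. Proof. by case: (admissible_step x0 hA aT dT). Qed.

Lemma winner_loser : w != l.
Proof. exact: win_los. Qed.

Lemma alen_step a : a != w -> a != l -> alen T' a = alen T a.
Proof.
rewrite /T' /w /l /winner /loser; case: (boolP (top_wins T)) => [e|/negPf e] aw al.
  by rewrite (rv_step_top hA ok e) /= /upd (negPf aw).
by rewrite (rv_step_bottom hA ok e) /= /upd (negPf aw) (negPf al).
Qed.

Lemma aimg_step a : a != w -> a != l -> aimg T' a = aimg T a.
Proof.
rewrite /T' /w /l /winner /loser; case: (boolP (top_wins T)) => [e|/negPf e] aw al.
  by rewrite (rv_step_top hA ok e) /= /upd (negPf aw) (negPf al).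
by rewrite (rv_step_bottom hA ok e) /= /upd (negPf aw).
Qed.

Lemma slope_winner : slope T' w = slope T w.
Proof. by rewrite /T' (slope_step x0 hA) // ifN ?mulr1 //; exact: winner_loser. Qed.

Lemma slope_other a : a != l -> slope T' a = slope T a.
Proof. by move=> al; rewrite /T' (slope_step x0 hA) // ifN ?mulr1. Qed.

Lemma slope_loser : slope T' l = slope T l * slope T w.
Proof. by rewrite /T' (slope_step x0 hA) // eqxx. Qed.

Lemma alen_top : top_wins T -> alen T' l = alen T l /\ alen T w = alen T' w + slope T l * alen T l.
Proof.
move=> e; have wl := winner_loser; rewrite /T' /w /l /winner /loser e in wl *.
rewrite (rv_step_top hA ok e) /= /upd eqxx eq_sym (negPf wl); split=> //.
by rewrite /slope divfK ?subrK // gt_eqF //; case: pos.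
Qed.

Lemma alen_bottom : top_wins T = false ->
  alen T l = slope T w * alen T' l /\ alen T w = alen T' w + alen T' l.
Proof.
move=> e; have wl := winner_loser; rewrite /T' /w /l /winner /loser e in wl *.
rewrite (rv_step_bottom hA ok e) /= /upd !eqxx (negPf wl); split; last by rewrite subrK.
by rewrite mulrC divfK // gt_eqF //; exact: slope_gt0.
Qed.

Lemma aimg_bottom : top_wins T = false -> aimg T' l = aimg T l /\ aimg T w = aimg T' w + alen T l.
Proof.
move=> e; have wl := winner_loser; rewrite /T' /w /l /winner /loser e in wl *.
rewrite (rv_step_bottom hA ok e) /= /upd !eqxx eq_sym (negPf wl); split => //; by rewrite subrK.
Qed.

Lemma aimg_top : top_wins T -> aimg T w = aimg T' w + aimg T' l.
Proof.
move=> e; have wl := winner_loser; rewrite /T' /w /l /winner /loser e in wl *.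
by rewrite (rv_step_top hA ok e) /= /upd !eqxx (negPf wl) subrK.
Qed.

Lemma alen_winner : alen T w = alen T' w + (if top_wins T then slope T l * alen T l else alen T' l).
Proof. by case: ifP => e; [case: (alen_top e)|case: (alen_bottom e)]. Qed.

(** Each floor over the winner is cut in two, the second piece passing to the loser; all other
    floors are the same sets, possibly reparametrized. The free function [phi] lets this serve for
    indicators, measures and masses. *)
Lemma sum_floors_step (tw : A -> seq (R * R)) (phi : A -> R -> R -> R) :
  \sum_a \sum_(f <- tower_step T tw a) phi a f.1 (f.1 + f.2 * alen T' a) =
  \sum_a \sum_(f <- tw a) (if a == w then phi w f.1 (f.1 + f.2 * alen T' w) +
     phi l (f.1 + f.2 * alen T' w) (f.1 + f.2 * alen T w) else phi a f.1 (f.1 + f.2 * alen T a)).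
Proof.
have wl := winner_loser; have lw : l != w by rewrite eq_sym.
have sl c : 0 < slope T c by exact: slope_gt0.
rewrite (bigD1 w) // [RHS](bigD1 w) //= eqxx (bigD1 l) //= [in X in _ = _ + X](bigD1 l) //=.
rewrite (negPf lw) /tower_step -/w -/l eqxx (negPf wl) big_split /= -[RHS]addrA; congr (_ + _).
rewrite [in RHS]addrA; congr (_ + _); last first.
  by apply: eq_bigr => a /andP[aw al]; rewrite (negPf al) (negPf aw) alen_step.
case: ifP => e.
  have [e1 e2] := alen_top e; rewrite big_cat big_map /= addrC e1; congr (_ + _).
  by apply: eq_bigr => f _ /=; rewrite -addrA -mulrA -mulrDr -e2.
have [e1 e2] := alen_bottom e; rewrite big_cat !big_map /=; congr (_ + _).
  by apply: eq_bigr => f _ /=; rewrite mulr1 -addrA -mulrDr -e2.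
by apply: eq_bigr => f _ /=; rewrite mulr0 addr0 -mulrA -e1.
Qed.

Lemma sum_two (f g : A -> R) : (forall a, a != w -> a != l -> f a = g a) ->
  \sum_a f a + g w + g l = \sum_a g a + f w + f l.
Proof.
move=> fg; have lw : l != w by rewrite eq_sym winner_loser.
rewrite (bigD1 w) //= (bigD1 l) //= [in RHS](bigD1 w) //= [in RHS](bigD1 l) //=.
rewrite (eq_bigr g); first by ring.
by move=> a /andP[aw al]; exact: fg.
Qed.

Lemma aimg_loser : slope T l * alen T l = aimg T l.
Proof. by rewrite /slope divfK // gt_eqF //; case: pos. Qed.

Lemma aimg_winner' : slope T w * alen T' w = aimg T' w.
Proof. by rewrite -slope_winner /slope divfK // gt_eqF //; case: pos'. Qed.

Lemma sum_step : \sum_a alen T' a = \sum_a aimg T' a.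
Proof.
have h1 := sum_two alen_step; have h2 := sum_two aimg_step.
have := sT; case: (boolP (top_wins T)) => [e|/negPf e].
  have [e1 e2] := alen_top e; have e3 := aimg_top e; have e4 := aimg_loser; lra.
have [e1 e2] := alen_bottom e; have [e3 e4] := aimg_bottom e; lra.
Qed.

Lemma rz_bottom_shape p : okp p -> exists s1 s2,
  p.1 = s1 ++ win p false :: rcons s2 (los p false) /\
  rz p false = (s1 ++ win p false :: los p false :: s2, p.2).
Proof.
move=> okp_; have [s1 [s2 [e1 e2]]] := rz_top_shape x0 hA (okp_swap okp_).
exists s1, s2; split; first exact: e1.
by have := rz_swap x0 p true; rewrite e2 => /(congr1 (@swap A)); rewrite swapK => <-.
Qed.

Let rowsT' : rows T' = rz (rows T) (top_wins T). Proof. exact: rows_step. Qed.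

Lemma row_last (s : seq A) : size s = #|A| -> exists s0, s = rcons s0 (last x0 s).
Proof. by case/lastP: s => [|s a] sz; [move: hA; rewrite -sz|exists s; rewrite last_rcons]. Qed.

Lemma base_step a : a != l -> lpos (atop T') (alen T') a = lpos (atop T) (alen T) a.
Proof.
move=> al; have [/andP[p1 p2] _] := ok; have [sz1 sz2] := is_pair_size (proj1 ok).
have [u1 u2] := is_pair_uniq (proj1 ok); have [m1 m2] := is_pair_mem (proj1 ok); rewrite /= in u1 u2 m1 m2 sz1 sz2.
have fg b : b != w -> b != l -> alen T b = alen T' b by move=> bw bl; rewrite alen_step.
case: (boolP (top_wins T)) => [e|/negPf e].
  have -> : atop T' = atop T by rewrite -[LHS]/(rows T').1 rowsT' e.
  have [s0 es] := row_last sz1; have ew : w = last x0 (atop T) by rewrite /w /winner e.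
  have [e1 _] := alen_top e; rewrite es -ew; apply: lpos_rcons; rewrite -?ew -?es //; last by rewrite ew -es m1.
    by rewrite ew -es.
  by move=> b bw; case: (eqVneq b l) => [->//|bl]; rewrite fg.
have [s1 [s2 [e1 e2]]] := rz_bottom_shape ok.
have -> : atop T' = s1 ++ w :: l :: s2 by rewrite -[LHS]/(rows T').1 rowsT' e e2 /w /winner /l /loser e.
rewrite /= in e1; have et : atop T = s1 ++ w :: rcons s2 l by rewrite e1 /w /winner /l /loser e.
rewrite et; apply: lpos_ins => //; rewrite -?et //.
by have [_ ->] := alen_bottom e.
Qed.

Lemma base_loser_top : top_wins T -> lpos (atop T') (alen T') l = lpos (atop T) (alen T) l.
Proof.
move=> e; have [sz1 sz2] := is_pair_size (proj1 ok); have [u1 u2] := is_pair_uniq (proj1 ok).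
have [m1 m2] := is_pair_mem (proj1 ok); rewrite /= in u1 u2 m1 m2 sz1 sz2.
have -> : atop T' = atop T by rewrite -[LHS]/(rows T').1 rowsT' e.
have [s0 es] := row_last sz1; have ew : w = last x0 (atop T) by rewrite /w /winner e.
have [e1 _] := alen_top e; rewrite es -ew; apply: lpos_rcons; last by rewrite ew -es m1.
  by rewrite ew -es.
by move=> b bw; case: (eqVneq b l) => [->//|bl]; rewrite alen_step.
Qed.

Lemma base_loser_bottom : top_wins T = false -> lpos (atop T') (alen T') l = lpos (atop T) (alen T) w + alen T' w.
Proof.
move=> e; have [u1 u2] := is_pair_uniq (proj1 ok).
have wl := winner_loser.
have [s1 [s2 [e1 e2]]] := rz_bottom_shape ok.
have -> : atop T' = s1 ++ w :: l :: s2 by rewrite -[LHS]/(rows T').1 rowsT' e e2 /w /winner /l /loser e.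
rewrite /= in e1 u1; have et : atop T = s1 ++ w :: rcons s2 l by rewrite e1 /w /winner /l /loser e.
rewrite lpos_ins_new -?et //; congr (_ + _).
have := u1; rewrite et cat_uniq /= => /and3P[_ /norP[w1 h] _].
rewrite !lpos_cat //; apply: eq_big_seq => b bs; apply: alen_step.
  by apply: contraNneq w1 => <-.
by apply: contraNneq h => <-; apply/hasP; exists b; rewrite ?mem_rcons ?mem_head.
Qed.

Lemma image_step a : a != l -> lpos (abot T') (aimg T') a = lpos (abot T) (aimg T) a.
Proof.
move=> al; have [sz1 sz2] := is_pair_size (proj1 ok).
have [u1 u2] := is_pair_uniq (proj1 ok); have [m1 m2] := is_pair_mem (proj1 ok); rewrite /= in u1 u2 m1 m2 sz1 sz2.
have fg b : b != w -> b != l -> aimg T b = aimg T' b by move=> bw bl; rewrite aimg_step.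
case: (boolP (top_wins T)) => [e|/negPf e].
  have [s1 [s2 [e1 e2]]] := rz_top_shape x0 hA ok.
  have -> : abot T' = s1 ++ w :: l :: s2 by rewrite -[LHS]/(rows T').2 rowsT' e e2 /w /winner /l /loser e.
  rewrite /= in e1; have et : abot T = s1 ++ w :: rcons s2 l by rewrite e1 /w /winner /l /loser e.
  rewrite et; apply: lpos_ins => //; rewrite -?et //.
  by rewrite (aimg_top e).
have -> : abot T' = abot T by rewrite -[LHS]/(rows T').2 rowsT' e.
have [s0 es] := row_last sz2; have ew : w = last x0 (abot T) by rewrite /w /winner e.
have [e1 _] := aimg_bottom e; rewrite es -ew; apply: lpos_rcons; last by rewrite ew -es m2.
  by rewrite ew -es.
by move=> b bw; case: (eqVneq b l) => [->//|bl]; rewrite fg.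
Qed.

Lemma image_loser_bottom : top_wins T = false -> lpos (abot T') (aimg T') l = lpos (abot T) (aimg T) l.
Proof.
move=> e; have [sz1 sz2] := is_pair_size (proj1 ok); have [u1 u2] := is_pair_uniq (proj1 ok).
have [m1 m2] := is_pair_mem (proj1 ok); rewrite /= in u1 u2 m1 m2 sz1 sz2.
have -> : abot T' = abot T by rewrite -[LHS]/(rows T').2 rowsT' e.
have [s0 es] := row_last sz2; have ew : w = last x0 (abot T) by rewrite /w /winner e.
have [e1 _] := aimg_bottom e; rewrite es -ew; apply: lpos_rcons; last by rewrite ew -es m2.
  by rewrite ew -es.
by move=> b bw; case: (eqVneq b l) => [->//|bl]; rewrite aimg_step.
Qed.

Lemma image_loser_top : top_wins T -> lpos (abot T') (aimg T') l = lpos (abot T) (aimg T) w + aimg T' w.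
Proof.
move=> e; have [u1 u2] := is_pair_uniq (proj1 ok).
have [s1 [s2 [e1 e2]]] := rz_top_shape x0 hA ok.
have -> : abot T' = s1 ++ w :: l :: s2 by rewrite -[LHS]/(rows T').2 rowsT' e e2 /w /winner /l /loser e.
rewrite /= in e1 u2; have et : abot T = s1 ++ w :: rcons s2 l by rewrite e1 /w /winner /l /loser e.
rewrite lpos_ins_new -?et //; congr (_ + _).
have := u2; rewrite et cat_uniq /= => /and3P[_ /norP[w1 h] _].
rewrite !lpos_cat //; apply: eq_big_seq => b bs; apply: aimg_step.
  by apply: contraNneq w1 => <-.
by apply: contraNneq h => <-; apply/hasP; exists b; rewrite ?mem_rcons ?mem_head.
Qed.

Lemma lpos_top_last : lpos (atop T) (alen T) (win (rows T) true) + alen T (win (rows T) true) = \sum_a alen T a.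
Proof.
have [/andP[p1 p2] _] := ok; have [sz1 sz2] := is_pair_size (proj1 ok); rewrite /= in sz1.
have [u1 u2] := is_pair_uniq (proj1 ok); rewrite /= in u1.
have [s0 es] := row_last sz1; rewrite /win /= es last_rcons lpos_last -?es //.
by rewrite (perm_big _ p1) big_enum.
Qed.

Lemma lpos_bot_last : lpos (abot T) (aimg T) (win (rows T) false) + aimg T (win (rows T) false) = \sum_a aimg T a.
Proof.
have [/andP[p1 p2] _] := ok; have [sz1 sz2] := is_pair_size (proj1 ok); rewrite /= in sz2.
have [u1 u2] := is_pair_uniq (proj1 ok); rewrite /= in u2.
have [s0 es] := row_last sz2; rewrite /win /= es last_rcons lpos_last -?es //.
by rewrite (perm_big _ p2) big_enum.
Qed.

Lemma climbs_sub m len len' s g : len' <= len -> climbs m len s g -> climbs m len' s g.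
Proof.
move=> ll; elim: s => //= f s IH [hf hs]; split; last exact: IH.
by move=> u /andP[u0 ul]; apply: hf; rewrite u0 /=; exact: lt_le_trans ll.
Qed.

Lemma tower_spec_step m tw : tower_spec m T tw -> tower_spec m T' (tower_step T tw).
Proof.
move=> H a; have wl := winner_loser; have sl c : 0 < slope T c by exact: slope_gt0.
have [al' _] := pos'; have [al _] := pos.
(* Domain and image intervals end at the same point; this locates the junction of the two stacked
   towers. *)
have ltl : lpos (atop T) (alen T) (win (rows T) true) + alen T (win (rows T) true) =
   lpos (abot T) (aimg T) (win (rows T) false) + aimg T (win (rows T) false).
  by rewrite lpos_top_last lpos_bot_last.
have [al0|al0] := eqVneq a l; last first.
  rewrite /tower_step -/w -/l (negPf al0); have [[s es] sp cl] := H a.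
  have eb : base T' a = base T a by rewrite /base base_step.
  have ei : image T' a = image T a by rewrite /image image_step // slope_other.
  split; [by exists s; rewrite eb|by []|].
  rewrite ei; apply: climbs_sub cl; have [->|aw] := eqVneq a w; last by rewrite alen_step.
  by rewrite alen_winner lerDl; case: ifP => _; [exact: (mulr_ge0 (ltW (sl _)) (ltW (al _)))|exact: (ltW (al' _))].
rewrite al0 /tower_step -/w -/l eqxx.
have [[sw ew] spw clw] := H w; have [[sl' el] spl cll] := H l.
have spm c k (s : seq (R * R)) : 0 < k -> all (fun f => 0 < f.2) s -> all (fun f => 0 < f.2) (map (reparam c k) s).
  by move=> k0; rewrite all_map; apply: sub_all => f /= f0; rewrite mulr_gt0.
case: ifP => e.
  have [e1 e2] := alen_top e; have e3 := aimg_loser; have e4 := aimg_winner'.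
  have h : lpos (abot T) (aimg T) l = lpos (atop T) (alen T) w + alen T' w.
    move: ltl e2 e3; rewrite /w /l /winner /loser /los e /=; lra.
  have ew' : base T' l = base T l by rewrite /base base_loser_top.
  split.
  - by rewrite el; exists (sl' ++ map (reparam (alen T' w) (slope T l)) (tw w)); rewrite ew'.
  - by rewrite all_cat spl spm.
  have eg : image T' l = reparam (alen T' w) (slope T l) (image T w).
    by rewrite /image /reparam /= image_loser_top // slope_loser [slope T l * _]mulrC e4.
  apply: climbs_cat.
    by rewrite e1 ew /= /reparam /base /= !mul1r -h; exact: cll.
  rewrite eg; apply: climbs_reparam clw; rewrite ?ltW // => u /andP[u0 ul].
  by rewrite e2 ltrD2l ltr_pM2l // -e1.
have [e1 e2] := alen_bottom e; have [e3 e5] := aimg_bottom e; have e4 := aimg_winner'.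
have h : lpos (abot T) (aimg T) w + aimg T' w = lpos (atop T) (alen T) l.
  move: ltl e5; rewrite /w /l /winner /loser /los e /=; lra.
split.
- by rewrite ew; eexists; rewrite /= /base /reparam /= !mul1r base_loser_bottom.
- by rewrite all_cat !spm.
apply: climbs_cat.
  have -> : head (image T' l) (map (reparam 0 (slope T w)) (tw l)) = reparam (alen T' w) 1 (image T w).
    by rewrite el /= /reparam /base /image /= mulr0 addr0 mul1r mulr1 e4 h.
  apply: climbs_reparam clw; rewrite ?ler01 ?ltW // => u /andP[u0 ul].
  by rewrite mul1r e2 ltrD2l.
have -> : image T' l = reparam 0 (slope T w) (image T l).
  by rewrite /image /reparam /= mulr0 addr0 slope_loser image_loser_bottom.
apply: climbs_reparam cll; rewrite ?lexx ?(ltW (sl _)) // => u /andP[u0 ul].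
by rewrite add0r e1 ltr_pM2l.
Qed.

End Step.
End Towers.

Section HalfOpen.
Variable R : realType.

Definition ico (a b : R) : set R := [set x | a <= x < b].

Lemma measurable_ico a b : measurable (ico a b : set (measurableTypeR R)).
Proof.
have -> : ico a b = [set` `[a, b[%R] by apply/seteqP; split=> x /=; rewrite in_itv.
exact: measurable_itv.
Qed.

(** An indicator written as a function of the endpoints, the form in which [sum_row] and
    [sum_floors] apply to it. *)
Definition ind (x lo hi : R) : R := (lo <= x < hi)%R%:R.

Lemma ind_additive x : forall lo mid hi, lo <= mid -> mid <= hi -> ind x lo mid + ind x mid hi = ind x lo hi.
Proof.
move=> lo mid hi lm mh; rewrite /ind; have [xm|mx] := ltP x mid.
  by rewrite (lt_le_trans xm mh) !andbT addr0.
by rewrite andbF add0r (le_trans lm mx).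
Qed.

Lemma additive_diag (g : R -> R -> R) : (forall x y z, x <= y -> y <= z -> g x y + g y z = g x z) ->
  forall x, g x x = 0.
Proof. by move=> ga x; have := ga x x x (lexx _) (lexx _); move/eqP; rewrite -subr_eq0 addrK => /eqP. Qed.

End HalfOpen.

(** * Floors of the towers and invariant probabilities *)

Section Dynamics.
Variables (R : realType) (A : finType) (x0 : A).
Hypothesis hA : (2 <= #|A|)%N.
Variable T : aiet R A.
Hypothesis aT : admissible T.
Hypothesis kT : keane T.
Hypothesis s1 : \sum_a alen T a = 1.
Hypothesis s2 : \sum_a aimg T a = 1.
Notation Tn n := (rv_iter n T).
Notation winner := (winner x0).
Notation loser := (loser x0).

Fixpoint tower n : A -> seq (R * R) :=
  if n is n'.+1 then tower_step x0 (Tn n') (tower n') else fun a => [:: base T a].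

Let aTn n : admissible (Tn n). Proof. exact: keane_admissible. Qed.
Let ok : okp (rows T). Proof. by case: aT. Qed.
Let pos : positive_aiet T. Proof. by case: aT. Qed.
Let al n a : 0 < alen (Tn n) a. Proof. by have [_ []] := aTn n. Qed.

Lemma sum_iter n : \sum_a alen (Tn n) a = \sum_a aimg (Tn n) a.
Proof. elim: n => [|n IH]; first by rewrite s1 s2. by apply: (sum_step x0 hA (aTn n) IH). Qed.

Section Rows.
Variables (s : seq A) (f : A -> R).
Hypothesis sp : perm_eq s (enum A).
Hypothesis f0 : forall a, 0 < f a.
Hypothesis f1 : \sum_a f a = 1.

Lemma sum_row_all (g : R -> R -> R) : (forall x y z, x <= y -> y <= z -> g x y + g y z = g x z) ->
  \sum_a g (lpos s f a) (lpos s f a + f a) = g 0 1.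
Proof.
move=> ga; rewrite -big_enum -(perm_big _ sp) /= sum_row //.
- by rewrite (perm_big _ sp) /= big_enum f1.
- by rewrite (perm_uniq sp) enum_uniq.
- by move=> b; rewrite ltW.
- exact: additive_diag.
Qed.

(** The indicators of the intervals of a row sum to at most 1 at [x]. *)
Lemma row_disjoint x a b : lpos s f a <= x < lpos s f a + f a -> lpos s f b <= x < lpos s f b + f b -> a = b.
Proof.
move=> ha hb; apply/eqP; apply: contraT => ab.
have := sum_row_all (@ind_additive R x); rewrite (bigD1 a) //= (bigD1 b) 1?eq_sym //= {1 2 4}/ind ha hb.
move=> h; have : 0 <= \sum_(i | (i != a) && (i != b)) ind x (lpos s f i) (lpos s f i + f i).
  by apply: sumr_ge0 => i _; rewrite ler0n.
have : (0 <= x < 1)%R%:R <= 1 :> R by case: (_ && _).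
rewrite -h /=; lra.
Qed.

Lemma row_unit x a : lpos s f a <= x < lpos s f a + f a -> 0 <= x < 1.
Proof.
move=> ha; apply: contraT => /negPf hx.
have := sum_row_all (@ind_additive R x); rewrite (bigD1 a) //= {1 3}/ind ha hx.
move=> h; have : 0 <= \sum_(i | i != a) ind x (lpos s f i) (lpos s f i + f i).
  by apply: sumr_ge0 => i _; rewrite ler0n.
by rewrite /= in h; lra.
Qed.

Lemma row_cover x : 0 <= x < 1 -> exists a, lpos s f a <= x < lpos s f a + f a.
Proof.
move=> hx; apply: contrapT => /forallNP hn.
have := sum_row_all (@ind_additive R x); rewrite big1 => [|a _]; last first.
  by rewrite /ind; have /negP/negPf -> := hn a.
by rewrite /ind hx => /eqP; rewrite eq_sym oner_eq0.
Qed.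

End Rows.

Let top_perm : perm_eq (atop T) (enum A). Proof. by have [/andP[]] := ok. Qed.
Let bot_perm : perm_eq (abot T) (enum A). Proof. by have [/andP[]] := ok. Qed.

Lemma aiet_mapE a u : 0 <= u < alen T a ->
  aiet_map T (lpos (atop T) (alen T) a + u) = lpos (abot T) (aimg T) a + slope T a * u.
Proof.
move=> /andP[u0 ul]; set x := _ + u.
have ha : lpos (atop T) (alen T) a <= x < lpos (atop T) (alen T) a + alen T a by rewrite lerDl u0 ltrD2l.
have [apos _] := pos.
rewrite /aiet_map (row_unit top_perm apos s1 ha) (bigD1 a) //= ha addrC big1 ?add0r => [|b ba].
  by rewrite /x addrAC subrr add0r.
case: ifP => // hb; move: ba; rewrite (row_disjoint top_perm apos s1 ha hb) eqxx //.
Qed.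

Lemma tower_specP n : tower_spec (aiet_map T) (Tn n) (tower n).
Proof.
elim: n => [|n IH]; last exact: (tower_spec_step x0 hA (aTn n) (kT n) (sum_iter n) IH).
move=> a; split=> /=; rewrite ?ltr01 //; first by exists [::].
by split=> // u hu; rewrite mul1r aiet_mapE.
Qed.

Lemma unit_base x : 0 <= x < 1 -> exists a u, 0 <= u < alen T a /\ x = lpos (atop T) (alen T) a + u.
Proof.
have [apos _] := pos; move=> /(row_cover top_perm apos s1) [a /andP[h1 h2]].
exists a, (x - lpos (atop T) (alen T) a); split; last by rewrite addrC subrK.
by rewrite subr_ge0 h1 /= ltrBlDl.
Qed.

Lemma aiet_map_image a u : 0 <= u < alen T a ->
  lpos (abot T) (aimg T) a <= lpos (abot T) (aimg T) a + slope T a * u < lpos (abot T) (aimg T) a + aimg T a.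
Proof.
move=> /andP[u0 ul]; rewrite lerDl ltrD2l mulr_ge0 ?(ltW (slope_gt0 _ pos)) //=.
have -> : aimg T a = slope T a * alen T a by rewrite /slope divfK // gt_eqF //; case: pos.
by rewrite ltr_pM2l //; exact: slope_gt0.
Qed.

Lemma aiet_map_unit x : 0 <= x < 1 -> 0 <= aiet_map T x < 1.
Proof.
move=> /unit_base [a [u [hu ->]]]; rewrite aiet_mapE //.
by have [_ ipos] := pos; apply: (row_unit bot_perm ipos s2); exact: aiet_map_image.
Qed.

Lemma aiet_map_out x : ~~ (0 <= x < 1) -> aiet_map T x = x.
Proof. by rewrite /aiet_map => /negPf ->. Qed.

Lemma aiet_map_inj : injective (aiet_map T).
Proof.
move=> x y e; have [hx|hx] := boolP (0 <= x < 1); have [hy|hy] := boolP (0 <= y < 1).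
- have [a [u [hu ex]]] := unit_base hx; have [b [v [hv ey]]] := unit_base hy.
  move: e; rewrite ex ey !aiet_mapE // => e.
  have := aiet_map_image hv; rewrite -e => h.
  have [_ ipos] := pos; have ab := row_disjoint bot_perm ipos s2 (aiet_map_image hu) h.
  rewrite ab in e *; congr (_ + _).
  by apply: (mulfI (lt0r_neq0 (slope_gt0 b pos))); apply: (addrI _ e).
- by have := aiet_map_unit hx; rewrite e (aiet_map_out hy) (negPf hy).
- by have := aiet_map_unit hy; rewrite -e (aiet_map_out hx) (negPf hx).
- by rewrite -(aiet_map_out hx) -(aiet_map_out hy).
Qed.

Lemma measurable_aiet_map : measurable_fun setT (aiet_map T).
Proof.
have mico a b : measurable_fun setT (fun x : R => (a <= x) && (x < b)).
  by apply: measurable_and; [apply: measurable_fun_ler|apply: measurable_fun_ltr].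
rewrite /aiet_map; apply: measurable_fun_ifT => //.
apply: measurable_sum => a; apply: measurable_fun_ifT => //.
by apply: measurable_funD => //; apply: measurable_funM => //; exact: measurable_funB.
Qed.

Definition flo n a (f : R * R) : set R := ico f.1 (f.1 + f.2 * alen (Tn n) a).

(** The partition of the unit interval into floors, in the form of a sum: covering, inclusion in the
    unit interval and total mass are instances. *)
Lemma sum_floors n (g : R -> R -> R) : (forall x y z, x <= y -> y <= z -> g x y + g y z = g x z) ->
  \sum_a \sum_(f <- tower n a) g f.1 (f.1 + f.2 * alen (Tn n) a) = g 0 1.
Proof.
move=> ga; have [apos _] := pos; elim: n => [|n IH].
  rewrite /= -(sum_row_all top_perm apos s1 ga); apply: eq_bigr => a _.
  by rewrite big_seq1 /= mul1r.
rewrite /= (sum_floors_step x0 hA (aTn n) (tower n) (fun _ lo hi => g lo hi)) -IH.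
apply: eq_bigr => a _; apply: eq_big_seq => f fa.
case: eqP => // ->; have [_ /allP /(_ f fa) f2 _] := tower_specP n a.
have al' := al n.+1 (winner (Tn n)).
apply: ga; first by rewrite lerDl mulr_ge0 // ltW.
rewrite lerD2l ler_pM2l // (alen_winner x0 hA (aTn n)) lerDl.
by case: ifP => _; [rewrite mulr_ge0 ?(ltW (al _ _)) // ltW // slope_gt0 //; case: (aTn n)|rewrite ltW // (al n.+1)].
Qed.

Lemma floor_slope n a f : f \in tower n a -> 0 < f.2.
Proof. by have [_ /allP h _] := tower_specP n a => /h. Qed.

Lemma flo_lo n a f : f \in tower n a -> flo n a f f.1.
Proof. by move=> /floor_slope f2; rewrite /flo /ico /= lexx ltrDl mulr_gt0. Qed.

Lemma le_sum_mem (I : eqType) (s : seq I) (g : I -> R) i : (forall j, 0 <= g j) -> i \in s ->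
  g i <= \sum_(j <- s) g j.
Proof. by move=> g0 h; rewrite (perm_big _ (perm_to_rem h)) big_cons lerDl sumr_ge0. Qed.

Lemma le_sum_floor n a f (g : A -> R * R -> R) : (forall b h, 0 <= g b h) -> f \in tower n a ->
  g a f <= \sum_b \sum_(h <- tower n b) g b h.
Proof.
move=> g0 fa; rewrite (bigD1 a) //=; apply: le_trans (le_sum_mem (g0 a) fa) _.
by rewrite lerDl; apply: sumr_ge0 => b _; apply: sumr_ge0.
Qed.

Lemma floor_unit n a f x : f \in tower n a -> flo n a f x -> 0 <= x < 1.
Proof.
move=> fa fx; apply: contraT => /negPf hx.
have := @le_sum_floor n a f (fun b h => ind x h.1 (h.1 + h.2 * alen (Tn n) b)) (fun _ _ => ler0n _ _) fa.
rewrite (sum_floors n (@ind_additive R x)) {1}/ind; move: fx; rewrite /flo /ico /= => ->.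
by rewrite /ind hx lern0.
Qed.

Lemma floor_cover n x : 0 <= x < 1 -> exists a f, f \in tower n a /\ flo n a f x.
Proof.
move=> hx; apply: contrapT => hn.
have := sum_floors n (@ind_additive R x); rewrite {2}/ind hx big1 => [/eqP|a _].
  by rewrite eq_sym oner_eq0.
apply: big1_seq => f /= fa; rewrite /ind; case: (boolP (f.1 <= x < _)) => // h.
by case: hn; exists a, f.
Qed.

Lemma floor_hi n a f : f \in tower n a -> f.1 + f.2 * alen (Tn n) a <= 1.
Proof.
move=> fa; rewrite leNgt; apply/negP => h.
have /andP[h0 h1] := floor_unit fa (flo_lo fa).
have : flo n a f 1 by rewrite /flo /ico /= (ltW h1).
by move/(floor_unit fa); rewrite ltxx andbF.
Qed.

Lemma floor_lo_ge0 n a f : f \in tower n a -> 0 <= f.1.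
Proof. by move=> fa; have /andP[] := floor_unit fa (flo_lo fa). Qed.

Lemma preimage_floor len f g : (forall u, 0 <= u < len -> aiet_map T (f.1 + f.2 * u) = g.1 + g.2 * u) ->
  0 < f.2 -> 0 < g.2 ->
  aiet_map T @^-1` ico g.1 (g.1 + g.2 * len) = ico f.1 (f.1 + f.2 * len).
Proof.
move=> h f0 g0; apply/seteqP; split=> x /=; rewrite /ico /= => /andP[x1 x2].
  have hu : 0 <= (aiet_map T x - g.1) / g.2 < len.
    by rewrite divr_ge0 ?subr_ge0 ?(ltW g0) //= ltr_pdivrMr // ltrBlDl mulrC.
  have := h _ hu; rewrite [g.2 * _]mulrC divfK ?gt_eqF // [RHS]addrC subrK => /aiet_map_inj <-.
  case/andP: hu => u0 ul; by rewrite lerDl mulr_ge0 ?(ltW f0) //= ltrD2l ltr_pM2l.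
have hu : 0 <= (x - f.1) / f.2 < len.
  by rewrite divr_ge0 ?subr_ge0 ?(ltW f0) //= ltr_pdivrMr // ltrBlDl mulrC.
have := h _ hu; rewrite [f.2 * _]mulrC divfK ?gt_eqF // [f.1 + _]addrC subrK => ->.
case/andP: hu => u0 ul; by rewrite lerDl mulr_ge0 ?(ltW g0) //= ltrD2l ltr_pM2l.
Qed.

Section Invariant.
Variable P : probability (measurableTypeR R) R.
Hypothesis hP : invariant_prob T P.

Lemma climbs_measure len s g f h : climbs (aiet_map T) len s g -> all (fun f => 0 < f.2) s ->
  f \in s -> h \in s -> P (ico f.1 (f.1 + f.2 * len)) = P (ico h.1 (h.1 + h.2 * len)).
Proof.
have [_ inv] := hP.
suff H : forall f0 s, climbs (aiet_map T) len (f0 :: s) g -> all (fun f => 0 < f.2) (f0 :: s) ->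
    forall f, f \in f0 :: s -> P (ico f.1 (f.1 + f.2 * len)) = P (ico f0.1 (f0.1 + f0.2 * len)).
  case: s => // f0 s cl sp fs hs; by rewrite (H _ _ cl sp f fs) (H _ _ cl sp h hs).
move=> {s f h} f0 s; elim: s f0 => [|f1 s IH] f0 cl sp f; first by rewrite inE => /eqP ->.
rewrite inE => /orP[/eqP -> //|fs].
case: cl => h cl; case/andP: sp => p0 sp; have /andP[p1 _] := sp.
rewrite (IH f1 cl sp f fs) -(preimage_floor h p0 p1) inv //; exact: measurable_ico.
Qed.

Lemma floor_measure_base n a f : f \in tower n a -> P (flo n a f) = P (flo n a (base (Tn n) a)).
Proof.
move=> fa; have [[s es] sp cl] := tower_specP n a.
by apply: (climbs_measure cl sp) => //; rewrite es mem_head.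
Qed.

Definition zmass n a : R := fine (P (flo n a (base (Tn n) a))).

Lemma zmass_ge0 n a : 0 <= zmass n a.
Proof. by apply: fine_ge0; exact: measure_ge0. Qed.

Lemma fine_ico a b c : a <= b -> b <= c -> fine (P (ico a b)) + fine (P (ico b c)) = fine (P (ico a c)).
Proof.
move=> ab bc; rewrite -fineD ?fin_num_measure //; try exact: measurable_ico.
rewrite -measureU; try exact: measurable_ico.
  congr (fine (P _)); apply/seteqP; split=> x /=; rewrite /ico /=.
    by case=> /andP[h1 h2]; [rewrite h1 (lt_le_trans h2 bc)|rewrite (le_trans ab h1) h2].
  by move=> /andP[h1 h2]; case: (ltP (x : R) b) => xb; [left|right]; apply/andP; split.
apply/seteqP; split=> // x []; rewrite /ico /= => /andP[_ h] /andP[h' _].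
by move: h; rewrite ltNge h'.
Qed.

Lemma tower_zmass n a f : f \in tower n a -> fine (P (ico f.1 (f.1 + f.2 * alen (Tn n) a))) = zmass n a.
Proof. by move=> fa; rewrite /zmass -(floor_measure_base fa). Qed.

Lemma base_mem n a : base (Tn n) a \in tower n a.
Proof. by have [[s ->] _ _] := tower_specP n a; rewrite mem_head. Qed.

(** Slopes do not enter: invariance makes all floors of a tower equally heavy, so cutting the
    winner's base splits its mass just as lengths split for an isometric exchange. *)
Lemma zmass_step n : zmass n = bstep x0 (rows (Tn n)) (rv_type T n) (zmass n.+1).
Proof.
have [okn posn] := aTn n; have aw := alen_winner x0 hA (aTn n).
have tyE : rv_type T n = top_wins x0 (Tn n) by rewrite (rv_typeE x0 hA).
apply/funext => a; rewrite /bstep tyE -/(winner (Tn n)) -/(loser (Tn n)).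
have wl := winner_loser x0 hA (aTn n).
have [->|aw0] := eqVneq a (winner (Tn n)); last first.
  rewrite addr0; have [al0|al0] := eqVneq a (loser (Tn n)); last first.
    rewrite -(@tower_zmass n.+1 a (base (Tn n) a)) /= ?(alen_step hA (aTn n) aw0 al0) //.
    by rewrite /tower_step (negPf al0) base_mem.
  rewrite al0 {1}/zmass /flo; case e : (top_wins x0 (Tn n)).
    rewrite -(@tower_zmass n.+1 _ (base (Tn n) (loser (Tn n)))) /=.
      by have [-> _] := alen_top hA (aTn n) e.
    by rewrite /tower_step eqxx e mem_cat base_mem.
  rewrite -(@tower_zmass n.+1 _ (reparam 0 (slope (Tn n) (winner (Tn n))) (base (Tn n) (loser (Tn n))))) /=.
    by have [-> _] := alen_bottom hA (aTn n) e; rewrite mulr0 addr0 !mul1r.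
  by rewrite /tower_step eqxx e mem_cat map_f ?orbT ?base_mem.
set w := winner _; set l := loser _.
pose b := base (Tn n) w; pose k := if top_wins x0 (Tn n) then slope (Tn n) l else 1.
have e1 : zmass n.+1 w = fine (P (ico b.1 (b.1 + alen (Tn n.+1) w))).
  rewrite -(@tower_zmass n.+1 w b) /=; first by rewrite mul1r.
  by rewrite /tower_step -/l (negPf wl) base_mem.
have e2 : zmass n.+1 l = fine (P (ico (b.1 + alen (Tn n.+1) w) (b.1 + alen (Tn n) w))).
  rewrite -(@tower_zmass n.+1 l (reparam (alen (Tn n.+1) w) k b)) /=.
    rewrite !mul1r; congr (fine (P (ico _ _))); rewrite -addrA; congr (_ + _).
    rewrite aw -/w -/l /k; congr (_ + _); case: ifP => e; last by rewrite mul1r.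
    by have [-> _] := alen_top hA (aTn n) e.
  rewrite /tower_step eqxx -/w -/l /k; case: ifP => e; rewrite mem_cat map_f ?orbT ?base_mem //.
rewrite e1 e2 fine_ico ?lerDl ?(ltW (al n.+1 w)) //.
  by rewrite /zmass /flo /= mul1r.
rewrite lerD2l aw lerDl; case: ifP => _; last by rewrite ltW // (al n.+1).
by rewrite mulr_ge0 ?(ltW (al _ _)) // ltW // slope_gt0.
Qed.

Lemma sum_zmass0 : \sum_a zmass 0 a = 1.
Proof.
have := sum_floors 0 fine_ico; have [P1 _] := hP; rewrite -[ico 0 1]/(@unit_itv R) P1 /= => <-.
by apply: eq_bigr => a _; rewrite big_seq1.
Qed.

End Invariant.

End Dynamics.

(** * Unique ergodicity *)

Section Ray.
Variables (R : realType) (A : finType) (x0 : A).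
Notation pair := (seq A * seq A)%type.
Notation hword := (hword x0).
Notation bstep := (bstep x0).
Notation bword := (bword x0).
Notation rz := (rz x0).
Notation rzw := (rzw x0).
Notation posw := (posw x0).
Notation ones := ((fun=> 1) : A -> R).

Variables (p0 : pair) (ty : nat -> bool).
Definition pair_at n := rzw p0 (mkseq ty n).
Definition height_at n : A -> R := hword p0 (mkseq ty n) ones.
Definition window m k : seq bool := mkseq (fun i => ty (m + i)%N) k.

Lemma mkseq_window m k : mkseq ty (m + k) = mkseq ty m ++ window m k.
Proof. exact: (@mkseq_shift _ true m ty k). Qed.

Definition backward (v : nat -> A -> R) := forall n, v n = bstep (pair_at n) (ty n) (v n.+1).

Lemma backward_window v n k : backward v -> v n = bword (pair_at n) (window n k) (v (n + k)%N).
Proof.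
move=> hv; elim: k => [|k IH]; first by rewrite addn0.
rewrite IH {1}hv /window mkseqS -cats1 bword_cat /= addnS; congr (bword _ _ _).
by rewrite /pair_at mkseq_window rzw_cat.
Qed.

Lemma backward_mass v n : backward v -> \sum_a v n a * height_at n a = \sum_a v 0%N a.
Proof.
move=> hv; rewrite /height_at -duality.
have := backward_window 0 n hv; rewrite add0n /window /= -[pair_at 0]/p0 => <-.
by apply: eq_bigr => a _; rewrite mulr1.
Qed.

Lemma height_gt0 n a : 0 < height_at n a.
Proof. exact: hword_gt0. Qed.

Lemma height_window n k : height_at (n + k) = hword (pair_at n) (window n k) (height_at n).
Proof. by rewrite /height_at mkseq_window hword_cat. Qed.

Lemma height_mono n k a : height_at n a <= height_at (n + k) a.
Proof. by rewrite height_window; apply: hword_ge => c; rewrite ltW // height_gt0. Qed.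

Variable l0 : nat.
Hypothesis recurrent : forall N, exists2 m, (N <= m)%N & posw (pair_at m) (window m l0).

(** All entries of the matrix of the window lie between 1 and [2 ^+ l0]. *)
Lemma backward_balanced v m a c : backward v -> (forall n e, 0 <= v n e) ->
  posw (pair_at m) (window m l0) -> v m c <= 2 ^+ l0 * v m a.
Proof.
move=> hv v0 pm; rewrite (backward_window m l0 hv).
apply: (le_trans (bword_le _ _ _ _ (v0 _))); rewrite size_mkseq ler_pM2l ?exprn_gt0 //.
exact: posw_bword.
Qed.

Variable lam : nat -> A -> R.
Hypothesis lam_back : backward lam.
Hypothesis lam_gt0 : forall n a, 0 < lam n a.
Hypothesis lam_sum : \sum_a lam 0%N a = 1.

(** The total height at time [m] is at least [m], so some height is large, and a positive word
    passes it on to every letter. *)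
Lemma height_infty (M : R) : exists n0, forall n a, (n0 <= n)%N -> M <= height_at n a.
Proof.
have [m hm pm] := recurrent (Num.bound (#|A|%:R * `|M|)); exists (m + l0)%N => n a hn.
rewrite -(subnKC hn); apply: le_trans (height_mono _ _ _); rewrite height_window.
have h0 e : 0 <= height_at m e by rewrite ltW // height_gt0.
have [c hc] : exists c, forall e, height_at m e <= height_at m c.
  by exists [arg max_(c > a) height_at m c]%O => f; case: arg_maxP => // i _; apply.
apply: le_trans (posw_hword _ c pm h0).
have A0 : 0 < #|A|%:R :> R by rewrite ltr0n; apply/card_gt0P; exists a.
apply: le_trans (ler_norm _) _; rewrite -(ler_pM2l A0).
apply: (@le_trans _ _ m%:R); last first.
  apply: (@le_trans _ _ (tot (height_at m))).
    by have := @tot_growth R A x0 p0 ones (mkseq ty m) (fun=> lexx _); rewrite size_mkseq.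
  rewrite /tot mulr_natl -sumr_const; apply: ler_sum => e _; exact: hc.
apply: ltW; apply: lt_le_trans (archi_boundP _) _; first by rewrite mulr_ge0 // ltW.
by rewrite ler_nat.
Qed.

Lemma backward_small (e : R) : 0 < e -> exists n0, forall n a, (n0 <= n)%N -> lam n a <= e.
Proof.
move=> e0; have [n0 h] := height_infty e^-1; exists n0 => n a /(h n a) hn.
have : lam n a * height_at n a <= 1.
  rewrite -lam_sum -(backward_mass n lam_back) (bigD1 a) //= lerDl; apply: sumr_ge0 => b _.
  by rewrite mulr_ge0 // ltW // height_gt0.
rewrite -ler_pdivlMr ?height_gt0 // div1r => /le_trans; apply.
by rewrite invf_ple // posrE height_gt0.
Qed.

(** Subtract from [z] the largest multiple of [lam] below it. If the remainder had positive mass,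
    then at a recurrence of a positive word both solutions would have comparable coordinates, so
    that a further multiple of [lam] would fit below at that time and, the recursion being positive,
    at all earlier times. *)
Lemma backward_unique z : backward z -> (forall n a, 0 <= z n a) -> \sum_a z 0%N a = 1 -> z = lam.
Proof.
move=> zb z0 z1.
pose E := [set t : R | forall n a, t * lam n a <= z n a].
have E0 : E 0 by move=> n a; rewrite mul0r.
have ub t : E t -> t <= 1.
  move=> Et; rewrite -z1 -[t]mulr1 -lam_sum mulr_sumr; apply: ler_sum => a _; exact: Et.
have hsE : has_sup E by split; [exists 0|exists 1 => t; exact: ub].
pose rho := sup E.
have rhoE : E rho.
  move=> n a; rewrite -ler_pdivlMr //; apply: ge_sup; first by exists 0.
  by move=> t Et; rewrite ler_pdivlMr.
pose y n a := z n a - rho * lam n a.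
have y0 n a : 0 <= y n a by rewrite subr_ge0; exact: rhoE.
have yb : backward y.
  move=> n; apply/funext => a; rewrite /y {1}zb {1}lam_back /bstep.
  by case: ifP => _; ring.
pose kap := 1 - rho.
have ysum n : \sum_a y n a * height_at n a = kap.
  rewrite (backward_mass n yb) /y sumrB -mulr_sumr z1 lam_sum mulr1 //.
have kap0 : kap <= 0.
  rewrite leNgt; apply/negP => kgt0.
  (* One factor comes from the balance of [y], the other from that of [lam]. *)
  pose c := (2 ^+ l0)^-1 * (2 ^+ l0)^-1 * kap.
  have p0' : 0 < 2 ^+ l0 :> R by rewrite exprn_gt0.
  have c0 : 0 < c by rewrite !mulr_gt0 ?invr_gt0.
  suff Ec : E (rho + c) by have := ub_le_sup (proj2 hsE) Ec; rewrite -/rho gerDl leNgt c0.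
  move=> n; have [m nm pm] := recurrent n.
  have ym a : c * lam m a <= y m a.
    (* The sums against the heights are conserved, so some coordinate of [y] is at least [kap] times
       that of [lam]. *)
    have [b hb] : exists b, kap * lam m b <= y m b.
      apply: contrapT => /forallNP hn.
      have : \sum_a y m a * height_at m a < \sum_a (kap * lam m a) * height_at m a.
        apply: ltr_sum; first by apply/hasP; exists x0; rewrite ?mem_index_enum.
        by move=> a' _; rewrite ltr_pM2r ?height_gt0 // ltNge; apply/negP; exact: hn.
      rewrite ysum; under eq_bigr do rewrite -mulrA.
      by rewrite -mulr_sumr (backward_mass m lam_back) lam_sum mulr1 ltxx.
    have h1 := backward_balanced a b yb y0 pm.
    have h2 := backward_balanced b a lam_back (fun n e => ltW (lam_gt0 n e)) pm.
    rewrite /c -!mulrA ler_pdivrMl //; apply: le_trans h1; apply: le_trans hb.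
    by rewrite mulrCA ler_pM2l // ler_pdivrMl.
  move=> a; rewrite mulrDl -lerBrDl -/(y n a).
  pose v n a := y n a - c * lam n a.
  have vb : backward v.
    by move=> k; apply/funext => b; rewrite /v {1}yb {1}lam_back /bstep; case: ifP => _; ring.
  have := bword_ge0 x0 (pair_at n) (window n (m - n)) (v := v m) _ a.
  have := backward_window n (m - n) vb; rewrite subnKC // => <-.
  rewrite /v subr_ge0; apply=> b.
  by rewrite subr_ge0 ym.
have kap_ge0 : 0 <= kap.
  by rewrite -(ysum 0%N); apply: sumr_ge0 => a _; rewrite mulr_ge0 // ltW // height_gt0.
have k0 : kap = 0 by apply: le_anti; rewrite kap0.
have r1 : rho = 1 by move: k0; rewrite /kap => /eqP; rewrite subr_eq0 => /eqP.
apply/funext => n; apply/funext => a; apply/eqP; rewrite -subr_eq0 -[lam n a]mul1r -r1 -/(y n a).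
have := ysum n; rewrite k0 => /eqP; rewrite psumr_eq0 => [/allP /(_ a (mem_index_enum _))|b _].
  by rewrite mulf_eq0 (gt_eqF (height_gt0 _ _)) orbF.
by rewrite mulr_ge0 // ltW // height_gt0.
Qed.

End Ray.

(** * Probabilities on the unit interval determined by initial intervals *)

Section MeasureUnique.
Variable R : realType.

(** Rays generate the Borel sets, while the towers control only their traces on the unit
    interval. *)
Lemma unit_ray (P : probability (measurableTypeR R) R) (t : R) : P (@unit_itv R) = 1%E ->
  P [set` `]-oo, t[%R] = P (ico 0 t `&` @unit_itv R).
Proof.
move=> P1; have mU : measurable (@unit_itv R) := @measurable_ico R 0 1.
have mr : measurable ([set` `]-oo, t[%R] : set (measurableTypeR R)) by exact: measurable_itv.
have PC : P (~` @unit_itv R) = 0%E by rewrite probability_setC // P1 subee.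
have -> : ico 0 t `&` @unit_itv R = [set` `]-oo, t[%R] `&` @unit_itv R.
  apply/seteqP; split=> x /=; rewrite /ico /unit_itv /= in_itv /=.
    by move=> [/andP[_ ->]].
  by move=> [-> /andP[-> ->]].
apply/eqP; rewrite eq_le; apply/andP; split; last first.
  by apply: le_measure; rewrite ?inE //; exact: measurableI.
rewrite -[X in (P X <= _)%E]setIT -(setUv (@unit_itv R)) setIUr.
apply: le_trans (measureU2 _ _ _) _; [exact: measurableI|by apply: measurableI => //; exact: measurableC|].
rewrite [X in (_ + X)%E](_ : _ = 0%E) ?adde0 //.
by apply: (subset_measure0 _ _ _ PC) => //; [apply: measurableI => //|]; exact: measurableC.
Qed.

Lemma probability_unique (P1 P2 : probability (measurableTypeR R) R) :
  P1 (@unit_itv R) = 1%E -> P2 (@unit_itv R) = 1%E ->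
  (forall t, P1 (ico 0 t `&` @unit_itv R) = P2 (ico 0 t `&` @unit_itv R)) ->
  forall B, measurable B -> P1 B = P2 B.
Proof.
move=> h1 h2 h B mB.
pose G : set (set (measurableTypeR R)) := @RGenInftyO.G R.
pose H := [set X | G X /\ X `<=` setT].
have HG : H = G by apply/seteqP; split=> X; [case|split].
have Hm : H `<=` measurable by rewrite HG => X [x ->]; exact: measurable_itv.
have HI : setI_closed H.
  rewrite HG => X Y [x ->] [y ->]; exists (Num.min x y).
  by apply/seteqP; split=> z /=; rewrite !in_itv /= lt_min => /andP.
have PT : P1 setT = P2 setT by rewrite !probability_setT.
have PG X : H X -> P1 X = P2 X by rewrite HG => -[x ->]; rewrite !unit_ray.
have Poo : (P1 setT < +oo)%E by rewrite probability_setT ltry.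
apply: (g_sigma_algebra_measure_unique_trace G setT measurableT Hm HI _ _ PT PG Poo) => //.
rewrite -[[set X | _]]/H HG; move: mB; rewrite -[X in X -> _]/(R.-ocitv.-measurable.-sigma.-measurable B).
by rewrite RGenInftyO.measurableE.
Qed.

End MeasureUnique.

Section StepFunctions.
Variable R : realType.

Lemma left_constant (x : R) (s : seq R) : exists2 d, 0 < d & forall y, x - d < y <= x -> {in s, forall z, (z < y) = (z < x)}.
Proof.
elim: s => [|z s [d d0 IH]]; first by exists 1.
have [zx|xz] := ltP z x; last first.
  exists d => // y hy t; rewrite inE => /orP[/eqP ->|ts]; last exact: IH.
  by case/andP: hy => _ yx; rewrite ![z < _]ltNge xz (le_trans yx xz).
exists (Num.min d (x - z)); first by rewrite lt_min d0 subr_gt0.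
move=> y /andP[h1 h2] t; rewrite inE => /orP[/eqP ->|ts].
  rewrite zx; apply: le_lt_trans h1; rewrite lerBrDr -lerBrDl.
  by rewrite ge_min lexx orbT.
apply: IH => //; rewrite h2 andbT; apply: le_lt_trans h1.
by rewrite lerD2l lerN2 ge_min lexx.
Qed.

Lemma right_constant (x : R) (s : seq R) : exists2 d, 0 < d & forall y, x <= y < x + d -> {in s, forall z, (z <= y) = (z <= x)}.
Proof.
elim: s => [|z s [d d0 IH]]; first by exists 1.
have [zx|xz] := leP z x.
  exists d => // y hy t; rewrite inE => /orP[/eqP ->|ts]; last exact: IH.
  by case/andP: hy => xy _; rewrite zx (le_trans zx xy).
exists (Num.min d (z - x)); first by rewrite lt_min d0 subr_gt0.
move=> y /andP[h1 h2] t; rewrite inE => /orP[/eqP ->|ts].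
  rewrite ![z <= _]leNgt xz; apply/negbF; apply: lt_le_trans h2 _.
  by rewrite -lerBrDl ge_min lexx orbT.
apply: IH => //; rewrite h1 /=; apply: lt_le_trans h2 _.
by rewrite lerD2l ge_min lexx.
Qed.

End StepFunctions.

(** * Floors determine the invariant probability *)

Section UniqueErgodicity.
Variables (R : realType) (A : finType) (x0 : A).
Hypothesis hA : (2 <= #|A|)%N.
Variable T : aiet R A.
Hypothesis aT : admissible T.
Hypothesis kT : keane T.
Hypothesis s1 : \sum_a alen T a = 1.
Hypothesis s2 : \sum_a aimg T a = 1.
Notation Tn n := (rv_iter n T).
Notation tower := (tower x0 T).
Notation flo := (flo T).

(** The indicators of all floors sum to 1 at [x], so every other floor misses [x]. *)
Lemma sum_at n x a f (phi : A -> R * R -> R) : f \in tower n a -> flo n a f x ->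
  \sum_b \sum_(h <- tower n b) (if h.1 <= x < h.1 + h.2 * alen (Tn n) b then phi b h else 0) = phi a f.
Proof.
move=> fa fx; have hx := floor_unit hA aT kT s1 s2 fa fx.
have := sum_floors x0 hA aT kT s1 s2 n (ind_additive x); rewrite {2}/ind hx (bigD1 a) //= [X in _ = X -> _]/=.
rewrite (perm_big _ (perm_to_rem fa)) /= big_cons {1}/ind; move: (fx); rewrite /flo /ico /= => fx'; rewrite fx'.
set S1 := \sum_(_ <- _) _; set S2 := \sum_(_ | _) _ => h.
have i0 b h' : 0 <= ind x h'.1 (h'.1 + h'.2 * alen (Tn n) b) by rewrite ler0n.
have S10 : 0 <= S1 by apply: sumr_ge0.
have S20 : 0 <= S2 by apply: sumr_ge0 => b _; apply: sumr_ge0.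
have {S10 S20 h} [e1 e2] : S1 = 0 /\ S2 = 0 by move: h; rewrite /=; lra.
have off b h' : ind x h'.1 (h'.1 + h'.2 * alen (Tn n) b) = 0 ->
   (if h'.1 <= x < h'.1 + h'.2 * alen (Tn n) b then phi b h' else 0) = 0.
  by rewrite /ind; case: ifP => // _ /eqP; rewrite oner_eq0.
rewrite (bigD1 a) //= (perm_big _ (perm_to_rem fa)) /= big_cons fx'.
rewrite [X in _ + X + _]big1_seq ?addr0 => [|h' /= hm]; last first.
  apply: off; move/eqP: e1; rewrite /S1 psumr_eq0 // => /allP /(_ h' hm) /=; by move/eqP.
rewrite big1 ?addr0 // => b ba; apply: big1_seq => h' /= hm; apply: off.
move/eqP: e2; rewrite /S2 psumr_eq0 => [/allP /(_ b (mem_index_enum _))|c _]; last exact: sumr_ge0.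
by rewrite ba /= psumr_eq0 // => /allP /(_ h' hm) /=; move/eqP.
Qed.

Lemma floor_eq n x a f b h : f \in tower n a -> flo n a f x -> h \in tower n b -> flo n b h x ->
  a = b /\ f = h.
Proof.
move=> fa fx hb hx.
have := sum_at (fun c k => ((c, k) == (a, f))%:R) fa fx; rewrite (sum_at _ hb hx) eqxx.
case: eqP => [[-> ->] //|_] /eqP.
by rewrite eq_sym oner_eq0.
Qed.

(** Inside the unit interval, [ico 0 t] consists of whole floors except for the floor containing
    [t], and equality is known except on bases. Each of the two exceptions contributes at most
    [e]. *)
Lemma floors_le (P1 P2 : probability (measurableTypeR R) R) (n : nat) (e t : R) : 0 <= e ->
  (forall a f, f \in behead (tower n a) -> P1 (flo n a f) = P2 (flo n a f) /\ fine (P1 (flo n a f)) <= e) ->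
  \sum_a fine (P1 (flo n a (base (Tn n) a))) <= e ->
  fine (P1 (ico 0 t `&` @unit_itv R)) <= fine (P2 (ico 0 t `&` @unit_itv R)) + 2 * e.
Proof.
move=> e0 hf hb.
have mI lo hi : measurable (ico lo hi `&` ico 0 t : set (measurableTypeR R)).
  by apply: measurableI; exact: measurable_ico.
pose g (P : probability (measurableTypeR R) R) lo hi := fine (P (ico lo hi `&` ico 0 t)).
have ga P x y z : x <= y -> y <= z -> g P x y + g P y z = g P x z.
  move=> xy yz; rewrite /g -fineD ?fin_num_measure // -measureU //.
    congr (fine (P _)); rewrite -setIUl; congr (_ `&` _); apply/seteqP; split=> u /=; rewrite /ico /=.
      by case=> /andP[h1 h2]; [rewrite h1 (lt_le_trans h2 yz)|rewrite (le_trans xy h1) h2].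
    by move=> /andP[h1 h2]; case: (ltP (u : R) y) => uy; [left|right]; apply/andP; split.
  apply/seteqP; split=> // u [[/andP[_ h] _] [/andP[h' _] _]].
  by move: h; rewrite ltNge h'.
have g0 P lo hi : 0 <= g P lo hi by apply: fine_ge0; exact: measure_ge0.
have gle P lo hi : g P lo hi <= fine (P (ico lo hi)).
  apply: fine_le; rewrite ?fin_num_measure //; try exact: measurable_ico.
  by apply: le_measure; rewrite ?inE //; exact: measurable_ico.
have gT (P : probability (measurableTypeR R) R) : fine (P (ico 0 t `&` @unit_itv R)) = g P 0 1 by rewrite /g setIC.
rewrite !gT -!(sum_floors x0 hA aT kT s1 s2 n (ga _)).
have tE a : tower n a = base (Tn n) a :: behead (tower n a).
  by have [[s ->] _ _] := tower_specP x0 hA aT kT s1 s2 n a.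
have tot1 : \sum_a \sum_(f <- tower n a) ind t f.1 (f.1 + f.2 * alen (Tn n) a) <= 1.
  by rewrite (sum_floors x0 hA aT kT s1 s2 n (ind_additive t)) /ind; case: (_ && _).
apply: (@le_trans _ _ (\sum_a (fine (P1 (flo n a (base (Tn n) a))) + \sum_(f <- tower n a)
    (g P2 f.1 (f.1 + f.2 * alen (Tn n) a) + e * ind t f.1 (f.1 + f.2 * alen (Tn n) a))))).
  apply: ler_sum => a _; rewrite [in leLHS]tE big_cons; apply: lerD; first exact: gle.
  rewrite [in leRHS]tE big_cons -[leLHS]add0r; apply: lerD; first by rewrite addr_ge0 // mulr_ge0 // ler0n.
  rewrite big_seq [leRHS]big_seq; apply: ler_sum => f fa; have [P12 Pe] := hf a f fa.
  have ft : f \in tower n a by rewrite tE inE fa orbT.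
  have f0 := floor_lo_ge0 hA aT kT s1 s2 ft.
  set hi := f.1 + _ in P12 Pe *.
  have [hit|thi] := leP hi t.
    have -> : g P1 f.1 hi = g P2 f.1 hi.
      rewrite /g; have -> : ico f.1 hi `&` ico 0 t = flo n a f; last by rewrite P12.
      apply/seteqP; split=> u /=; rewrite /flo /ico /=; first by case.
      by move=> /andP[h1 h2]; rewrite h1 h2 (le_trans f0 h1) (lt_le_trans h2 hit).
    by rewrite lerDl mulr_ge0 // ler0n.
  have [ft1|tf1] := leP f.1 t.
    by rewrite /ind ft1 thi mulr1 (le_trans (gle _ _ _)) // (le_trans Pe) // lerDr.
  have -> : g P1 f.1 hi = 0.
    rewrite /g (_ : _ `&` _ = set0) ?measure0 //; apply/seteqP; split=> // u [/andP[h1 _] /andP[_ h2]].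
    by have := lt_trans (le_lt_trans h1 h2) tf1; rewrite ltxx.
  by rewrite addr_ge0 // mulr_ge0 // ler0n.
rewrite big_split /=; under [X in _ + X]eq_bigr do rewrite big_split /= -mulr_sumr.
rewrite big_split /= -mulr_sumr addrC -addrA lerD2l addrC.
have : e * (\sum_a \sum_(f <- tower n a) ind t f.1 (f.1 + f.2 * alen (Tn n) a)) <= e by rewrite ler_piMr.
lra.
Qed.

(** Bases are exempted from equality because the preimage of a base need not be a floor; the
    criterion can thus be applied to an image measure, to test invariance. *)
Lemma floors_determine (P1 P2 : probability (measurableTypeR R) R) :
  P1 (@unit_itv R) = 1%E -> P2 (@unit_itv R) = 1%E ->
  (forall e : R, 0 < e -> exists n, [/\ (forall a f, f \in behead (tower n a) -> P1 (flo n a f) = P2 (flo n a f) /\ fine (P1 (flo n a f)) <= e),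
     \sum_a fine (P1 (flo n a (base (Tn n) a))) <= e & \sum_a fine (P2 (flo n a (base (Tn n) a))) <= e]) ->
  forall B, measurable B -> P1 B = P2 B.
Proof.
move=> u1 u2 h; apply: probability_unique => // t.
have mI : measurable (ico 0 t `&` @unit_itv R : set (measurableTypeR R)).
  by apply: measurableI; exact: measurable_ico.
rewrite -[LHS]fineK ?fin_num_measure // -[RHS]fineK ?fin_num_measure //; congr EFin.
have key (Q1 Q2 : probability (measurableTypeR R) R) : (forall e : R, 0 < e -> exists n, 
   (forall a f, f \in behead (tower n a) -> Q1 (flo n a f) = Q2 (flo n a f) /\ fine (Q1 (flo n a f)) <= e) /\
     \sum_a fine (Q1 (flo n a (base (Tn n) a))) <= e) ->
   fine (Q1 (ico 0 t `&` @unit_itv R)) <= fine (Q2 (ico 0 t `&` @unit_itv R)).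
  move=> hQ; apply/ler_addgt0Pr => e e0; have e2 : 0 < e / 2 by rewrite divr_gt0.
  have [n [hn1 hn2]] := hQ _ e2.
  have := @floors_le Q1 Q2 n (e / 2) t (ltW e2) hn1 hn2.
  by rewrite mulrC divfK.
apply/eqP; rewrite eq_le !key // => e /h [n [h1 h2 h3]]; exists n; split=> // a f /h1 [e1 e2].
by rewrite -e1.
Qed.

Variables (l0 : nat) (lam : nat -> A -> R).
Hypothesis recurrent : forall N, exists2 m, (N <= m)%N &
  posw x0 (pair_at x0 (rows T) (rv_type T) m) (window (rv_type T) m l0).
Hypothesis lam_back : backward x0 (rows T) (rv_type T) lam.
Hypothesis lam_gt0 : forall n a, 0 < lam n a.
Hypothesis lam_sum : \sum_a lam 0%N a = 1.

Let pairE n : pair_at x0 (rows T) (rv_type T) n = rows (Tn n).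
Proof. by rewrite /pair_at (rows_iter x0 hA) //; case: aT. Qed.

Lemma invariant_floor (P : probability (measurableTypeR R) R) n a f : invariant_prob T P ->
  f \in tower n a -> fine (P (flo n a f)) = lam n a.
Proof.
move=> hP fa; rewrite (floor_measure_base hA aT kT s1 s2 hP fa) -/(zmass T P n a).
have -> : zmass T P = lam; last by [].
apply: (@backward_unique R A x0 (rows T) (rv_type T) l0 recurrent lam lam_back lam_gt0 lam_sum).
- by move=> k; rewrite pairE; exact: (zmass_step x0 hA aT kT s1 s2 hP).
- by move=> k b; exact: zmass_ge0.
- exact: (sum_zmass0 x0 hA aT kT s1 s2 hP).
Qed.

Lemma small_lam (e : R) : 0 < e -> exists n, \sum_a lam n a <= e.
Proof.
move=> e0; have A0 : 0 < #|A|%:R :> R by rewrite ltr0n; apply/card_gt0P; exists x0.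
have [n hn] := @backward_small R A x0 (rows T) (rv_type T) l0 recurrent lam lam_back lam_gt0 lam_sum
  (e / #|A|%:R) (divr_gt0 e0 A0).
exists n; apply: (@le_trans _ _ (\sum_(a : A) e / #|A|%:R)); first by apply: ler_sum => a _; exact: hn.
by rewrite sumr_const -[_ *+ _]mulr_natr divfK // gt_eqF.
Qed.

Lemma invariant_unique (P1 P2 : probability (measurableTypeR R) R) : invariant_prob T P1 -> invariant_prob T P2 ->
  forall B, measurable B -> P1 B = P2 B.
Proof.
move=> h1 h2; apply: floors_determine; [by case: h1|by case: h2|] => e e0.
have [n hn] := small_lam e0; exists n.
have sub a f : f \in behead (tower n a) -> f \in tower n a by exact: mem_behead.
have bm a : base (Tn n) a \in tower n a := base_mem x0 hA aT kT s1 s2 n a.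
split; last 2 first.
- by under eq_bigr do rewrite invariant_floor //.
- by under eq_bigr do rewrite invariant_floor //.
move=> a f /sub fa; rewrite invariant_floor //; split.
  rewrite -[LHS]fineK ?fin_num_measure //; try exact: measurable_ico.
  by rewrite invariant_floor // -(invariant_floor h2 fa) fineK ?fin_num_measure //; exact: measurable_ico.
apply: le_trans hn; rewrite (bigD1 a) //= lerDl; apply: sumr_ge0 => b _; exact: ltW.
Qed.

(** * The invariant probability from its distribution function *)

Section Existence.

(** Floors are selected by a condition on their endpoints. The conditions [below] on one side,
    [upto] and [before] on the other, give lower and upper approximations of the distribution
    function, monotone in [n]. *)
Definition mass n (c : R -> R -> bool) : R :=
  \sum_a \sum_(f <- tower n a) (if c f.1 (f.1 + f.2 * alen (Tn n) a) then lam n a else 0).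

Lemma mass_step n c : mass n.+1 c = \sum_a \sum_(f <- tower n a)
  (if a == winner x0 (Tn n) then
     (if c f.1 (f.1 + f.2 * alen (Tn n.+1) a) then lam n.+1 a else 0) +
     (if c (f.1 + f.2 * alen (Tn n.+1) a) (f.1 + f.2 * alen (Tn n) a) then lam n.+1 (loser x0 (Tn n)) else 0)
   else (if c f.1 (f.1 + f.2 * alen (Tn n) a) then lam n.+1 a else 0)).
Proof.
rewrite /mass /= (sum_floors_step x0 hA (keane_admissible x0 hA n aT kT) (tower n)
  (fun a lo hi => if c lo hi then lam n.+1 a else 0)).
by apply: eq_bigr => a _; apply: eq_bigr => f _; case: eqP => // ->.
Qed.

Lemma lam_split n a : lam n a = lam n.+1 a + (if a == winner x0 (Tn n) then lam n.+1 (loser x0 (Tn n)) else 0).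
Proof.
have okn : okp (rows (Tn n)) by case: (keane_admissible x0 hA n aT kT).
by rewrite lam_back pairE /bstep (rv_typeE x0 hA okn).
Qed.

Lemma lam_ge0 n a : 0 <= lam n a. Proof. exact: ltW. Qed.

Definition below x (lo hi : R) := hi <= x.
Definition upto x (lo hi : R) := lo <= x.
Definition before x (lo hi : R) := lo < x.

Lemma split_bounds n a f : f \in tower n a -> a = winner x0 (Tn n) ->
  f.1 < f.1 + f.2 * alen (Tn n.+1) a /\ f.1 + f.2 * alen (Tn n.+1) a < f.1 + f.2 * alen (Tn n) a.
Proof.
move=> fa ea; have f2 := floor_slope hA aT kT s1 s2 fa.
have [okn [an im]] := keane_admissible x0 hA n aT kT; have [_ [an' _]] := keane_admissible x0 hA n.+1 aT kT.
split; first by rewrite ltrDl mulr_gt0.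
rewrite ltrD2l ltr_pM2l // ea [ltRHS](alen_winner x0 hA (keane_admissible x0 hA n aT kT)) ltrDl.
by case: ifP => _; [apply: mulr_gt0 => //; apply: slope_gt0|exact: (an' _)].
Qed.

Lemma mass_le n n' (c c' : R -> R -> bool) : (forall lo hi : R, lo < hi -> c lo hi -> c' lo hi) -> n = n' -> mass n c <= mass n' c'.
Proof.
move=> h <-; apply: ler_sum => a _; rewrite big_seq [leRHS]big_seq; apply: ler_sum => f fa.
have [_ [an _]] := keane_admissible x0 hA n aT kT.
case: ifP => [ci|_]; last by case: ifP; rewrite ?lam_ge0.
by rewrite h // ltrDl mulr_gt0 // (floor_slope hA aT kT s1 s2 fa).
Qed.

Lemma below_step n x : mass n (below x) <= mass n.+1 (below x).
Proof.
rewrite mass_step; apply: ler_sum => a _; rewrite big_seq [leRHS]big_seq; apply: ler_sum => f fa.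
rewrite (lam_split n a); case: eqP => [ea|_]; last by rewrite addr0.
have [h1 h2] := split_bounds fa ea; rewrite /below.
have [hx|hx] := leP (f.1 + f.2 * alen (Tn n) a) x; first by rewrite (ltW (lt_le_trans h2 hx)).
by case: ifP; rewrite ?addr0 ?lam_ge0.
Qed.

Lemma upto_step n x : mass n.+1 (upto x) <= mass n (upto x).
Proof.
rewrite mass_step; apply: ler_sum => a _; rewrite big_seq [leRHS]big_seq; apply: ler_sum => f fa.
rewrite (lam_split n a); case: eqP => [ea|_]; rewrite ?addr0 //.
have [h1 h2] := split_bounds fa ea; rewrite /upto.
have [hx|hx] := leP f.1 x; first by rewrite lerD2l; case: ifP; rewrite ?lam_ge0.
by rewrite add0r; case: ifP => // hm; have := lt_trans hx h1; rewrite ltNge hm.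
Qed.

Lemma before_step n x : mass n.+1 (before x) <= mass n (before x).
Proof.
rewrite mass_step; apply: ler_sum => a _; rewrite big_seq [leRHS]big_seq; apply: ler_sum => f fa.
rewrite (lam_split n a); case: eqP => [ea|_]; rewrite ?addr0 //.
have [h1 h2] := split_bounds fa ea; rewrite /before.
have [hx|hx] := ltP f.1 x; first by rewrite lerD2l; case: ifP; rewrite ?lam_ge0.
by rewrite add0r; case: ifP => // hm; have := lt_trans (le_lt_trans hx h1) hm; rewrite ltxx.
Qed.

Lemma below_mono m n x : (m <= n)%N -> mass m (below x) <= mass n (below x).
Proof.
move=> /subnKC <-; elim: (n - m)%N => [|k IH]; first by rewrite addn0.
by rewrite addnS; exact: le_trans IH (below_step _ _).
Qed.

Lemma upto_mono m n x : (m <= n)%N -> mass n (upto x) <= mass m (upto x).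
Proof.
move=> /subnKC <-; elim: (n - m)%N => [|k IH]; first by rewrite addn0.
by rewrite addnS; exact: le_trans (upto_step _ _) IH.
Qed.

Lemma before_mono m n x : (m <= n)%N -> mass n (before x) <= mass m (before x).
Proof.
move=> /subnKC <-; elim: (n - m)%N => [|k IH]; first by rewrite addn0.
by rewrite addnS; exact: le_trans (before_step _ _) IH.
Qed.

Lemma below_upto m n x : mass m (below x) <= mass n (upto x).
Proof.
apply: le_trans (below_mono x (leq_maxl m n)) _; apply: le_trans _ (upto_mono x (leq_maxr m n)).
by apply: mass_le => // lo hi lh; rewrite /below /upto => /(le_trans (ltW lh)).
Qed.

Lemma mass_total n : mass n (fun _ _ => true) = 1.
Proof.
elim: n => [|n <-].
  by rewrite -lam_sum; apply: eq_bigr => a _; rewrite big_seq1.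
rewrite mass_step; apply: eq_bigr => a _; apply: eq_bigr => f _; rewrite /= (lam_split n a).
by case: ifP; rewrite ?addr0.
Qed.

(** Only the floor containing [x] is counted on one side and not on the other. *)
Lemma upto_below_gap n x (e : R) : 0 <= e -> (forall a, lam n a <= e) -> mass n (upto x) <= mass n (below x) + e.
Proof.
move=> e0 le; apply: (@le_trans _ _ (\sum_a \sum_(f <- tower n a)
  ((if below x f.1 (f.1 + f.2 * alen (Tn n) a) then lam n a else 0) + e * ind x f.1 (f.1 + f.2 * alen (Tn n) a)))).
  apply: ler_sum => a _; apply: ler_sum => f _; rewrite /upto /below /ind.
  have [h1|h1] := leP f.1 x; last by case: ifP; rewrite ?mulr0 ?addr0 ?lam_ge0.
  by have [h2|h2] := leP; rewrite /= ?mulr0 ?addr0 ?mulr1 ?add0r.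
under eq_bigr do rewrite big_split /= -mulr_sumr.
rewrite big_split /= -mulr_sumr lerD2l (sum_floors x0 hA aT kT s1 s2 n (ind_additive x)).
by rewrite ler_piMr // /ind; case: (_ && _).
Qed.

Lemma small_letter (e : R) : 0 < e -> exists n0, forall n a, (n0 <= n)%N -> lam n a <= e.
Proof.
exact: (@backward_small R A x0 (rows T) (rv_type T) l0 recurrent lam lam_back lam_gt0 lam_sum).
Qed.

Definition dist_fun (x : R) : R := sup [set mass n (below x) | n in setT].

Lemma dist_has_sup x : has_sup [set mass n (below x) | n in setT].
Proof.
split; first by exists (mass 0 (below x)), 0%N.
by exists (mass 0 (upto x)) => _ [n _ <-]; exact: below_upto.
Qed.

Lemma dist_ge n x : mass n (below x) <= dist_fun x.
Proof. by apply: ub_le_sup; [exact: (proj2 (dist_has_sup x))|exists n]. Qed.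

Lemma dist_le_upto n x : dist_fun x <= mass n (upto x).
Proof. by apply: ge_sup; [exact: (proj1 (dist_has_sup x))|move=> _ [m _ <-]; exact: below_upto]. Qed.

(** The strict version of [dist_le_upto], possible because floors become light; it gives left
    continuity and so excludes atoms. *)
Lemma dist_le_before n x : dist_fun x <= mass n (before x).
Proof.
apply/ler_addgt0Pr => e e0; have [n0 hn0] := small_letter e0.
apply: le_trans (dist_le_upto (maxn n n0) x) _.
apply: le_trans (@upto_below_gap _ x e (ltW e0) (fun a => hn0 _ a (leq_maxr _ _))) _.
rewrite lerD2r; apply: le_trans _ (before_mono x (leq_maxl n n0)).
by apply: mass_le => // lo hi lh; rewrite /below /before => /(lt_le_trans lh).
Qed.

Lemma dist_nd : {homo dist_fun : x y / x <= y}.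
Proof.
move=> x y xy; apply: ge_sup; first exact: (proj1 (dist_has_sup x)).
move=> _ [n _ <-]; apply: le_trans (dist_ge n y).
by apply: mass_le => // lo hi lh; rewrite /below => h; exact: le_trans xy.
Qed.

Lemma dist0 x : x < 0 -> dist_fun x = 0.
Proof.
move=> x_lt; apply/eqP; rewrite eq_le; apply/andP; split.
  apply: le_trans (dist_le_upto 0 x) _; apply: sumr_le0 => a _.
  rewrite big_seq; apply: sumr_le0 => f fa; rewrite /upto; case: ifP => // fx.
  by have := lt_le_trans x_lt (floor_lo_ge0 hA aT kT s1 s2 fa); rewrite ltNge fx.
apply: le_trans (dist_ge 0 x); apply: sumr_ge0 => a _; apply: sumr_ge0 => f _.
by case: ifP; rewrite ?lam_ge0.
Qed.

Lemma dist1 x : 1 <= x -> dist_fun x = 1.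
Proof.
move=> x_ge; apply/eqP; rewrite eq_le; apply/andP; split.
  apply: le_trans (dist_le_upto 0 x) _; rewrite -(mass_total 0); exact: mass_le.
apply: le_trans (dist_ge 0 x); rewrite -(mass_total 0); apply: ler_sum => a _.
rewrite big_seq [leRHS]big_seq; apply: ler_sum => f fa.
by rewrite /below (le_trans (floor_hi hA aT kT s1 s2 fa) x_ge).
Qed.

Definition floor_los n : seq R := flatten [seq [seq f.1 | f <- tower n a] | a <- enum A].

Lemma floor_losP n a f : f \in tower n a -> f.1 \in floor_los n.
Proof.
move=> fa; apply/flattenP; exists [seq f.1 | f <- tower n a]; last exact: map_f.
by apply/mapP; exists a; rewrite ?mem_enum.
Qed.

Lemma dist_right x (e : R) : 0 < e -> exists2 d, 0 < d & forall y, x <= y < x + d -> dist_fun y <= dist_fun x + e.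
Proof.
(* No left end of a floor of level [n] is crossed within [d] to the right of [x]. *)
move=> e0; have [n hn] := small_letter e0; have [d d0 hd] := right_constant x (floor_los n).
exists d => // y hy; apply: le_trans (dist_le_upto n y) _.
have -> : mass n (upto y) = mass n (upto x).
  apply: eq_bigr => a _; apply: eq_big_seq => f fa; by rewrite /upto (hd y hy _ (floor_losP fa)).
apply: le_trans (upto_below_gap x (ltW e0) (fun a => hn n a (leqnn _))) _.
by rewrite lerD2r dist_ge.
Qed.

Lemma dist_left x (e : R) : 0 < e -> exists2 d, 0 < d & forall y, x - d < y <= x -> dist_fun x <= dist_fun y + e.
Proof.
move=> e0; have [n hn] := small_letter e0; have [d d0 hd] := left_constant x (floor_los n).
exists d => // y hy; apply: le_trans (dist_le_before n x) _.
have -> : mass n (before x) = mass n (before y).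
  apply: eq_bigr => a _; apply: eq_big_seq => f fa; by rewrite /before (hd y hy _ (floor_losP fa)).
apply: le_trans (_ : mass n (upto y) <= _).
  by apply: mass_le => // lo hi lh; rewrite /before /upto => /ltW.
apply: le_trans (upto_below_gap y (ltW e0) (fun a => hn n a (leqnn _))) _.
by rewrite lerD2r dist_ge.
Qed.

Lemma dist_rc : right_continuous dist_fun.
Proof.
move=> x; apply/cvgrPdist_le => e e0; have [d d0 hd] := dist_right x e0.
near=> y; have xy : x <= y by near: y; exact: nbhs_right_ge.
rewrite ler0_norm ?subr_le0 ?dist_nd // opprB lerBlDl; apply: hd; rewrite xy /=.
by near: y; apply: nbhs_right_lt; rewrite ltrDl.
Unshelve. all: by end_near.
Qed.

Lemma dist_Ny : dist_fun @ -oo --> (0 : R).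
Proof.
apply: cvg_near_cst; near=> x; apply: dist0.
by near: x; exact: nbhs_ninfty_lt.
Unshelve. all: by end_near.
Qed.

Lemma dist_y : dist_fun @ +oo --> (1 : R).
Proof.
apply: cvg_near_cst; near=> x; apply: dist1.
by near: x; exact: nbhs_pinfty_ge.
Unshelve. all: by end_near.
Qed.

#[local] HB.instance Definition _ := isCumulative.Build R _ R dist_fun dist_nd dist_rc.
#[local] HB.instance Definition _ := isCumulativeBounded.Build R 0 1 dist_fun dist_Ny dist_y.

Definition tower_measure : probability (measurableTypeR R) R := lebesgue_stieltjes_measure dist_fun.
Local Notation P := tower_measure.

Lemma tower_measure_ray x : P [set` `]-oo, x]%R] = (dist_fun x)%:E.
Proof. exact: (cdf_lebesgue_stieltjes_id dist_fun x). Qed.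

Lemma tower_measure_open_ray x : P [set` `]-oo, x[%R] = (dist_fun x)%:E.
Proof.
have mo : measurable ([set` `]-oo, x[%R] : set (measurableTypeR R)) by exact: measurable_itv.
have mc y : measurable ([set` `]-oo, y]%R] : set (measurableTypeR R)) by exact: measurable_itv.
apply/eqP; rewrite eq_le; apply/andP; split.
  rewrite -tower_measure_ray; apply: le_measure; rewrite ?inE //.
  by move=> y /=; rewrite !in_itv /=; exact: ltW.
rewrite -[leRHS]fineK ?fin_num_measure // lee_fin; apply/ler_addgt0Pr => e e0.
have [d d0 hd] := dist_left x e0; pose y := x - d / 2.
have d2 : 0 < d / 2 by rewrite divr_gt0.
apply: le_trans (hd y _) _.
  rewrite /y lerBlDr lerDl (ltW d2) andbT ltrD2l ltrN2 ltr_pdivrMr // ltr_pMr // ltr1n //.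
rewrite lerD2r -lee_fin fineK ?fin_num_measure // -tower_measure_ray.
apply: le_measure; rewrite ?inE //.
move=> z /=; rewrite !in_itv /= => zy; apply: le_lt_trans zy _.
by rewrite /y ltrBlDr ltrDl.
Qed.

Lemma tower_measure_ico a b : a <= b -> P (ico a b) = (dist_fun b - dist_fun a)%:E.
Proof.
move=> ab; have -> : ico a b = [set` `]-oo, b[%R] `\` [set` `]-oo, a[%R].
  apply/seteqP; split=> x /=; rewrite /ico !in_itv /=.
    by move=> /andP[h1 h2]; split=> //; apply/negP; rewrite -leNgt.
  by move=> [h1 /negP]; rewrite -leNgt => ->.
rewrite measureD; try exact: measurable_itv; last by rewrite -ge0_fin_numE // fin_num_measure //; exact: measurable_itv.
rewrite setIidr => [|x /=]; last by rewrite !in_itv /= => /lt_le_trans; apply.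
by rewrite EFinB; congr (_ - _)%E; exact: tower_measure_open_ray.
Qed.

Lemma tower_measure_unit : P (@unit_itv R) = 1%E.
Proof.
have -> : @unit_itv R = ico 0 1 by [].
rewrite tower_measure_ico // dist1 //.
have -> : dist_fun 0 = 0; last by rewrite subr0.
apply/eqP; rewrite eq_le; apply/andP; split; last first.
  by have := dist_nd (lerN10 R); rewrite dist0 // ltrN10.
apply: le_trans (dist_le_before 0 0) _; apply: sumr_le0 => a _.
rewrite big_seq; apply: sumr_le0 => f fa; rewrite /before; case: ifP => // fx.
by have := floor_lo_ge0 hA aT kT s1 s2 fa; rewrite leNgt fx.
Qed.

(** When no floor of level [n] straddles [y], the lower and upper approximations already agree at
    that level. *)
Lemma dist_endpoint n y : (forall a f, f \in tower n a -> f.1 < y -> f.1 + f.2 * alen (Tn n) a <= y) ->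
  dist_fun y = mass n (before y).
Proof.
move=> h; apply/eqP; rewrite eq_le dist_le_before /=; apply: le_trans (dist_ge n y).
apply: ler_sum => a _; rewrite big_seq [leRHS]big_seq; apply: ler_sum => f fa.
rewrite /before /below; case: ifP => [fy|_]; first by rewrite (h _ _ fa fy).
by case: ifP; rewrite ?lam_ge0.
Qed.

Lemma tower_measure_floor n a f : f \in tower n a -> P (flo n a f) = (lam n a)%:E.
Proof.
move=> fa; have f2 := floor_slope hA aT kT s1 s2 fa.
have [_ [an _]] := keane_admissible x0 hA n aT kT.
set hi := f.1 + f.2 * alen (Tn n) a; have lohi : f.1 < hi by rewrite ltrDl mulr_gt0.
have inf x : f.1 <= x < hi -> flo n a f x by [].
rewrite /flo -/hi tower_measure_ico ?(ltW lohi) //; congr EFin.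
rewrite (@dist_endpoint n hi); last first.
  move=> b g gb gh; rewrite leNgt; apply/negP => hg.
  pose x := Num.max f.1 g.1.
  have xf : flo n a f x by rewrite /flo /ico /= -/hi le_max lexx gt_max lohi gh.
  have xg : flo n b g x.
    by rewrite /flo /ico /= le_max lexx orbT gt_max (lt_trans lohi hg) (lt_trans gh hg).
  have [ab fg] := floor_eq fa xf gb xg; move: hg; rewrite -ab -fg -/hi ltxx //.
rewrite (@dist_endpoint n f.1); last first.
  move=> b g gb gh; rewrite leNgt; apply/negP => hg.
  have xg : flo n b g f.1 by rewrite /flo /ico /= (ltW gh).
  have [ab fg] := floor_eq fa (flo_lo hA aT kT s1 s2 fa) gb xg; move: gh; rewrite -fg ltxx //.
rewrite -(sum_at (fun b _ => lam n b) fa (flo_lo hA aT kT s1 s2 fa)) /mass -sumrB.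
apply: eq_bigr => b _; rewrite -sumrB; apply: eq_big_seq => g gb; rewrite /before.
have [gf|fg] := ltP g.1 f.1.
  rewrite (lt_trans gf lohi) subrr (ltW gf) /=; case: ifP => // hg.
  have xg : flo n b g f.1 by rewrite /flo /ico /= (ltW gf).
  by have [_ e] := floor_eq fa (flo_lo hA aT kT s1 s2 fa) gb xg; move: gf; rewrite -e ltxx.
rewrite subr0; have [gh|hg] := ltP g.1 hi.
  have hg : f.1 <= g.1 < hi by rewrite fg gh.
  have [ab e] := floor_eq fa (inf g.1 hg) gb (flo_lo hA aT kT s1 s2 gb).
  by rewrite -e -ab lexx lohi.
by rewrite leNgt (lt_le_trans lohi hg).
Qed.

Definition map_of : measurableTypeR R -> measurableTypeR R := aiet_map T.

#[local] HB.instance Definition _ := @isMeasurableFun.Build _ _ (measurableTypeR R) (measurableTypeR R) map_of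
  (@measurable_aiet_map R A T).

Definition pushed_measure : probability (measurableTypeR R) R := distribution P map_of.

Lemma pushed_measureE B : pushed_measure B = P (aiet_map T @^-1` B).
Proof. by []. Qed.

Lemma preimage_unit : aiet_map T @^-1` @unit_itv R = @unit_itv R.
Proof.
apply/seteqP; split=> x /=; last exact: (aiet_map_unit aT s1 s2).
by rewrite /unit_itv /= => hx; apply: contraT => nx; move: hx; rewrite aiet_map_out // (negPf nx).
Qed.

Lemma climbs_pred m len f0 (s : seq (R * R)) g f : climbs m len (f0 :: s) g -> f \in s -> exists2 f', f' \in f0 :: s &
  forall u, 0 <= u < len -> m (f'.1 + f'.2 * u) = f.1 + f.2 * u.
Proof.
elim: s f0 => // f1 s IH f0 [h cl]; rewrite inE => /orP[/eqP ->|fs].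
  by exists f0; rewrite ?mem_head.
by have [f' hf' e] := IH _ cl fs; exists f' => //; rewrite inE hf' orbT.
Qed.

(** Tested on floors by [floors_determine]: a floor above the base has the floor below it as
    preimage, and both carry the mass [lam n a]. *)
Lemma tower_measure_invariant : invariant_prob T P.
Proof.
split; first exact: tower_measure_unit.
move=> B mB; rewrite -pushed_measureE; apply: floors_determine B mB.
- by rewrite pushed_measureE preimage_unit; exact: tower_measure_unit.
- exact: tower_measure_unit.
move=> e e0; have [n hn] := small_lam e0; exists n.
have hp a f : f \in behead (tower n a) -> pushed_measure (flo n a f) = (lam n a)%:E.
  have [[s es] /allP sp cl] := tower_specP x0 hA aT kT s1 s2 n a; rewrite es /= => fs.
  have fa : f \in tower n a by rewrite es inE fs orbT.
  have [f' hf' h] : exists2 f', f' \in tower n a & forall u, 0 <= u < alen (Tn n) a -> aiet_map T (f'.1 + f'.2 * u) = f.1 + f.2 * u.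
    by rewrite es; apply: climbs_pred fs; move: cl; rewrite es; exact.
  rewrite -[LHS]/(P (aiet_map T @^-1` flo n a f)) /flo (preimage_floor aT s1 s2 h (sp _ hf') (sp _ fa)).
  exact: tower_measure_floor.
have bm a : base (Tn n) a \in tower n a := base_mem x0 hA aT kT s1 s2 n a.
have le1 a : lam n a <= e.
  by apply: le_trans hn; rewrite (bigD1 a) //= lerDl; apply: sumr_ge0 => b _; exact: lam_ge0.
have pb : \sum_a fine (P (flo n a (base (Tn n) a))) <= e.
  by under eq_bigr do rewrite tower_measure_floor //=.
split=> //.
  by move=> a f fb; rewrite (hp _ _ fb) (tower_measure_floor (mem_behead fb)); split=> //=; exact: le1.
apply: le_trans pb; rewrite le_eqVlt; apply/orP; left; apply/eqP.
have tE a : tower n a = base (Tn n) a :: behead (tower n a).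
  by have [[s ->] _ _] := tower_specP x0 hA aT kT s1 s2 n a.
(* Bases are treated together: for either measure their total is 1 minus the mass of the other
   floors. *)
have h1 (Q : probability (measurableTypeR R) R) : Q (@unit_itv R) = 1%E ->
   (forall a f, f \in behead (tower n a) -> Q (flo n a f) = (lam n a)%:E) ->
   \sum_a fine (Q (flo n a (base (Tn n) a))) = 1 - \sum_a \sum_(f <- behead (tower n a)) lam n a.
  move=> Q1 hQ; apply/eqP; rewrite eq_sym subr_eq -big_split /=.
  have <- : fine (Q (ico 0 1)) = 1 by rewrite -[ico 0 1]/(@unit_itv R) Q1.
  rewrite -(sum_floors x0 hA aT kT s1 s2 n (@fine_ico _ Q)); apply/eqP; apply: eq_bigr => a _.
  rewrite [in LHS]tE big_cons; congr (_ + _); apply: eq_big_seq => f fb.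
  by have := hQ a f fb; rewrite /flo => ->.
rewrite !h1 //; last by rewrite pushed_measureE preimage_unit; exact: tower_measure_unit.
- exact: tower_measure_unit.
- by move=> a f fb; apply: tower_measure_floor; exact: mem_behead.
Qed.

End Existence.

Theorem aiet_uniquely_ergodic : uniquely_ergodic T.
Proof.
split; first by exists tower_measure; exact: tower_measure_invariant.
exact: invariant_unique.
Qed.

End UniqueErgodicity.

(** * Rigidity of nearly constant length ratios *)

Lemma neq_negb (x y : bool) : x != y -> ~~ x = y.
Proof. by case: x; case: y. Qed.

Section Rigidity.
Variables (R : realType) (A : finType) (x0 : A).
Hypothesis hA : (2 <= #|A|)%N.
Notation pair := (seq A * seq A)%type.
Notation win := (win x0).
Notation los := (los x0).
Notation rz := (rz x0).
Variables (p : nat -> pair) (b : nat -> bool) (L : nat) (d : nat -> R).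
Hypothesis okp_ : forall n, okp (p n).
Hypothesis pS : forall n, p n.+1 = rz (p n) (b n).
Hypothesis d0 : forall n, 0 <= d n.
Let w n := win (p n) (b n).
Let l n := los (p n) (b n).
Let wl n : w n != l n. Proof. exact: win_los. Qed.

Hypothesis many_wins : forall x, (#|A| <= \sum_(0 <= n < L) (w n == x))%N.

(* A letter whose value is far from [c] is never last on side [s]; each of its wins then makes
   the loser's value far from [c] as well, so it wins fewer than [#|A|] times. *)
Lemma spread (s : bool) (phi : nat -> A -> R) (c D : R) :
  (forall n a, (n < L)%N -> a != w n -> a != l n -> phi n.+1 a = phi n a) ->
  (forall n, (n < L)%N -> `|phi n.+1 (w n) - phi n (w n)| <= d n) ->
  (forall n, (n < L)%N -> b n = s -> phi n.+1 (l n) = phi n (l n)) ->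
  (forall n, (n < L)%N -> b n <> s -> `|phi n.+1 (l n) - phi n (w n)| <= d n) ->
  (forall n, (n < L)%N -> `|phi n (win (p n) s) - c| <= D) ->
  forall x, `|phi 0%N x - c| <= D + \sum_(0 <= i < L) d i.
Proof.
move=> H1 H2 H3 H4 H5 x; rewrite leNgt; apply/negP => hx.
(* The tolerance decreases by [d n] at each step, so that a letter far from [c] stays far despite
   the errors. *)
pose th n := D + \sum_(n <= i < L) d i.
pose B n : {set A} := [set y | th n < `|phi n y - c|]%SET.
have thS n : (n < L)%N -> th n = d n + th n.+1.
  by move=> nL; rewrite /th big_ltn // addrCA.
have thD n : D <= th n by rewrite /th lerDl sumr_ge0.
have notin n : (n < L)%N -> win (p n) s \notin B n.
  by move=> nL; rewrite inE -leNgt; apply: le_trans (H5 n nL) (thD n).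
have near_ n (u v : R) : (n < L)%N -> `|u - v| <= d n -> th n < `|v - c| -> th n.+1 < `|u - c|.
  move=> nL uv hv; have := ler_normD (v - u) (u - c); rewrite addrA subrK (distrC v u) => h.
  by move: hv; rewrite (thS n nL) => hv; lra.
have stay n y : (n < L)%N -> y \in B n -> y \in B n.+1.
  move=> nL yB; have := yB; rewrite !inE => hy.
  have th_le : th n.+1 <= th n by rewrite (thS n nL) lerDr.
  have [yw|yw] := eqVneq y (w n).
    by rewrite yw in hy *; apply: (near_ n _ _ nL (H2 n nL) hy).
  have [yl|yl] := eqVneq y (l n); last by rewrite H1 //; exact: le_lt_trans th_le hy.
  case: (eqVneq (b n) s) => bs; first by rewrite yl H3 // -yl; exact: le_lt_trans th_le hy.
  move: (notin n nL); rewrite (_ : win (p n) s = y) ?yB // yl /l /los.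
  by rewrite (neq_negb bs).
have x0B : x \in B 0%N by rewrite inE.
have xB n : (n <= L)%N -> x \in B n.
  by elim: n => // n IH nL; apply: stay => //; apply: IH; exact: ltnW.
have grow n : (n < L)%N -> (#|B n| + (w n == x) <= #|B n.+1|)%N.
  move=> nL; have sub : (B n \subset B n.+1)%SET by apply/fintype.subsetP => y; exact: stay.
  case: eqVneq => [wx|_]; last by rewrite addn0 subset_leq_card.
  rewrite addn1; apply: proper_card; rewrite properE sub /=.
  apply/negP => /fintype.subsetP h; have wB : w n \in B n by rewrite wx xB // ltnW.
  have bs : b n <> s by move=> bs; move: (notin n nL); rewrite -bs wB.
  have ls : l n = win (p n) s by rewrite /l /los; congr (win _ _); apply: neq_negb; apply/eqP.
  move: (notin n nL); rewrite -ls h // inE; apply: (near_ n _ _ nL (H4 n nL bs)).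
  by move: wB; rewrite inE.
have count n : (n <= L)%N -> (\sum_(0 <= i < n) (w i == x) < #|B n|)%N.
  elim: n => [|n IH] nL; first by rewrite big_geq //; apply/card_gt0P; exists x.
  rewrite big_nat_recr //=; apply: leq_trans (grow n nL); rewrite -addSn leq_add2r.
  by apply: IH; exact: ltnW.
have := leq_ltn_trans (many_wins x) (count L (leqnn L)).
by rewrite ltnNge max_card.
Qed.

Variables (rho om : nat -> A -> R).
Hypothesis omS : forall n, om n.+1 = hstep x0 (p n) (b n) (om n).
Hypothesis rho_other : forall n a, (n < L)%N -> a != w n -> a != l n -> rho n.+1 a = rho n a.
Hypothesis rho_w : forall n, (n < L)%N -> `|rho n.+1 (w n) - rho n (w n)| <= d n.
Hypothesis rho_top : forall n, (n < L)%N -> b n = true ->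
  rho n.+1 (l n) = rho n (l n) /\ `|rho n (l n) + om n (l n) - rho n (w n)| <= d n.
Hypothesis rho_bot : forall n, (n < L)%N -> b n = false ->
  rho n.+1 (l n) = rho n (l n) - om n (w n) /\ `|rho n.+1 (l n) - rho n (w n)| <= d n.

(** In the application [rho] is the logarithm of the ratio of the two lengths and [om] that of the
    slope, so [sig] is the logarithm of the ratio for images. At each step [rho] at the last top
    letter is close to [sig] at the last bottom letter, and this common value drifts little.
    [spread] carries it to all letters for [rho] and for [sig], whose difference is [om]. *)
Lemma rigidity x : (0 < L)%N -> `|om 0%N x| <= 10 * \sum_(0 <= i < L) d i.
Proof.
move=> L0; set D := \sum_(_ <= _ < _) _.
have dD n : \sum_(0 <= i < n) d i <= D \/ (L < n)%N.
  have [nL|] := leqP n L; [left|by right].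
  rewrite (_ : D = \sum_(0 <= i < n) d i + \sum_(n <= i < L) d i); last exact: big_cat_nat.
  by rewrite lerDl sumr_ge0.
have D0 : 0 <= D by apply: sumr_ge0.
pose sig n a := rho n a + om n a.
have omw n : om n.+1 (w n) = om n (w n) by rewrite omS /hstep -/(w n) (negPf (wl n)) addr0.
have oml n : om n.+1 (l n) = om n (l n) + om n (w n) by rewrite omS /hstep -/(l n) -/(w n) eqxx.
have omo n a : a != l n -> om n.+1 a = om n a by rewrite omS /hstep -/(l n) => /negPf ->; rewrite addr0.
have sw n : (n < L)%N -> `|sig n.+1 (w n) - sig n (w n)| <= d n.
  by move=> nL; rewrite /sig omw opprD addrACA subrr addr0; exact: rho_w.
pose al n := win (p n) true; pose be n := win (p n) false.
have close n : (n < L)%N -> `|rho n (al n) - sig n (be n)| <= d n.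
  move=> nL; case e : (b n).
    have [_ h] := rho_top nL e; rewrite distrC; move: h.
    by rewrite /w /l /los /al /be /sig e.
  have [h1 h] := rho_bot nL e; move: h; rewrite h1 /w /l /los /al /be /sig e /= => h.
  by rewrite opprD addrA addrAC.
have step n : (n.+1 < L)%N -> `|rho n.+1 (al n.+1) - rho n (al n)| <= 2 * d n + d n.+1.
  move=> nL; have nL' := ltnW nL; case e : (b n).
    have -> : al n.+1 = w n by rewrite /al pS /w e win_rz.
    have -> : al n = w n by rewrite /w e.
    have := rho_w nL'; have := d0 n; have := d0 n.+1; lra.
  have h1 := close _ nL; have h2 := close _ nL'; have h3 := sw _ nL'.
  have e1 : be n.+1 = w n by rewrite /be pS /w e win_rz.
  have e2 : be n = w n by rewrite /w e.
  rewrite e1 in h1; rewrite e2 in h2.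
  move: h1 h2 h3; rewrite !ler_norml; lra.
have cn n : (n < L)%N -> `|rho n (al n) - rho 0%N (al 0%N)| <= 2 * \sum_(0 <= i < n) d i + \sum_(0 <= i < n.+1) d i.
  elim: n => [|n IH] nL; first by rewrite subrr normr0 big_geq // mulr0 add0r big_nat1.
  have := IH (ltnW nL); have := step n nL.
  rewrite [\sum_(0 <= i < n.+2) _]big_nat_recr //= [\sum_(0 <= i < n.+1) _]big_nat_recr //=.
  by rewrite !ler_norml; lra.
have c3 n : (n < L)%N -> `|rho n (al n) - rho 0%N (al 0%N)| <= 3 * D.
  move=> nL; apply: le_trans (cn n nL) _.
  have [h1|h1] := dD n; last by lia.
  have [h2|h2] := dD n.+1; last by lia.
  lra.
have dn n : (n < L)%N -> d n <= D.
  move=> nL; have [h|] := dD n.+1; last by lia.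
  by apply: le_trans h; rewrite big_nat_recr //= lerDr sumr_ge0.
have c4 n : (n < L)%N -> `|sig n (be n) - rho 0%N (al 0%N)| <= 4 * D.
  by move=> nL; have := c3 n nL; have := close n nL; have := dn n nL; rewrite !ler_norml; lra.
(* The constants are 3 + 1 for [rho] and 4 + 1 for [sig], together below 10. *)
have h1 : `|rho 0%N x - rho 0%N (al 0%N)| <= 3 * D + D.
  apply: (@spread true) => // n nL; first by move=> e; have [] := rho_top nL e.
  by case e: (b n) => // _; have [] := rho_bot nL e.
have h2 : `|sig 0%N x - rho 0%N (al 0%N)| <= 4 * D + D.
  apply: (@spread false) => // [n a nL aw al'|n nL e|n nL].
  - by rewrite /sig rho_other // omo.
  - by have [h _] := rho_bot nL e; rewrite /sig oml h; ring.
  case e: (b n) => // _; have [h h'] := rho_top nL e.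
  rewrite /sig oml h; move: h'; rewrite !ler_norml; lra.
have -> : om 0%N x = sig 0%N x - rho 0%N x by rewrite /sig addrAC subrr add0r.
by move: h1 h2; rewrite !ler_norml; lra.
Qed.

End Rigidity.

(** * Hellinger distance of two divisions of an interval *)

Section Hellinger.
Variable R : realType.

(** If the root of [p] were less than half that of [q], the squared difference would exceed [q / 4],
    hence [2 * e]. So the quotient [z] of the roots is at least 1/2, where the logarithm is at most
    twice the distance from [z] to 1. *)
Lemma half_log (p q e dl : R) : 0 < p -> 0 < dl -> dl <= q -> (Num.sqrt p - Num.sqrt q) ^+ 2 <= 2 * e -> e <= dl / 8 ->
  Num.sqrt q / 2 <= Num.sqrt p /\ (ln (p / q)) ^+ 2 <= 32 * e / dl.
Proof.
move=> p0 dl0 dq h1 h2; have q0 : 0 < q by apply: lt_le_trans dq.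
have sp : 0 < Num.sqrt p by rewrite sqrtr_gt0.
have sq : 0 < Num.sqrt q by rewrite sqrtr_gt0.
have ep : p = Num.sqrt p ^+ 2 by rewrite sqr_sqrtr // ltW.
have eq : q = Num.sqrt q ^+ 2 by rewrite sqr_sqrtr // ltW.
set x := Num.sqrt p in h1 sp ep *; set y := Num.sqrt q in h1 sq eq *.
have xy : y / 2 <= x.
  rewrite leNgt; apply/negP => hxy.
  have : y ^+ 2 / 4 < (x - y) ^+ 2 by nra.
  rewrite -eq; lra.
split=> //; pose z := x / y.
have z0 : 0 < z by rewrite divr_gt0.
have z2 : 1 / 2 <= z by rewrite ler_pdivlMr // mul1r mulrC.
have -> : ln (p / q) = 2 * ln z.
  rewrite ep eq -expr_div_n -/z lnXn //; ring.
have hz : `|ln z| <= 2 * `|z - 1|.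
  have [z1|z1] := leP 1 z.
    rewrite ger0_norm ?ln_ge0 // ger0_norm ?subr_ge0 //.
    have := le_ln1Dx (x := z - 1); have -> : 1 + (z - 1) = z by ring.
    by move=> h; have : ln z <= z - 1 by [apply: h; lra]; lra.
  rewrite ler0_norm; last by apply: ln_le0; exact: ltW.
  rewrite ltr0_norm ?subr_lt0 // -lnV ?posrE //.
  have hv : ln z^-1 <= z^-1 - 1.
    have := le_ln1Dx (x := z^-1 - 1); have -> : 1 + (z^-1 - 1) = z^-1 by ring.
    apply.
    have : 0 < z^-1 by rewrite invr_gt0.
    lra.
  apply: le_trans hv _; rewrite -(ler_pM2r z0) mulrBl mulVf ?gt_eqF // mul1r.
  nra.
rewrite exprMn -(real_normK (num_real (ln z))).
apply: (@le_trans _ _ (2 ^+ 2 * (2 * `|z - 1|) ^+ 2)).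
  by rewrite ler_pM2l ?exprn_gt0 // ler_sqr ?nnegrE ?mulr_ge0.
rewrite exprMn (real_normK (num_real (z - 1))); have -> : z - 1 = (x - y) / y by rewrite mulrBl divff // gt_eqF.
rewrite expr_div_n -eq.
have -> : 2 ^+ 2 * (2 ^+ 2 * ((x - y) ^+ 2 / q)) = 16 * (x - y) ^+ 2 / q by ring.
apply: (@le_trans _ _ (16 * (x - y) ^+ 2 / dl)).
  apply: ler_wpM2l; first by rewrite mulr_ge0 ?sqr_ge0.
  by rewrite lef_pV2 ?posrE.
rewrite ler_pM2r ?invr_gt0 //; lra.
Qed.

(** The squared Hellinger distance of the two divisions, seen as probabilities on two points, is
    twice 1 minus their affinity. *)
Lemma hellinger_loss (X X1 X2 Y Y1 Y2 : R) : 0 < X1 -> 0 < X2 -> 0 < Y1 -> 0 < Y2 ->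
  X = X1 + X2 -> Y = Y1 + Y2 ->
  (Num.sqrt (X1 / X) - Num.sqrt (Y1 / Y)) ^+ 2 + (Num.sqrt (X2 / X) - Num.sqrt (Y2 / Y)) ^+ 2 =
  2 * (1 - (Num.sqrt (X1 * Y1) + Num.sqrt (X2 * Y2)) / Num.sqrt (X * Y)).
Proof.
move=> h1 h2 h3 h4 eX eY; have X0 : 0 < X by rewrite eX addr_gt0.
have Y0 : 0 < Y by rewrite eY addr_gt0.
have ge x y : 0 < x -> 0 < y -> 0 <= x / y by move=> *; rewrite divr_ge0 // ltW.
have sq x y : 0 < x -> 0 < y -> Num.sqrt (x / y) ^+ 2 = x / y by move=> *; rewrite sqr_sqrtr // ge.
have pr x y : 0 < x -> 0 < y -> Num.sqrt (x / X) * Num.sqrt (y / Y) = Num.sqrt (x * y) / Num.sqrt (X * Y).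
  move=> x_gt y_gt; rewrite -sqrtrM ?ge // -sqrtrV ?mulr_ge0 ?(ltW X0) ?(ltW Y0) // -sqrtrM ?mulr_ge0 ?ltW //.
  by rewrite invfM mulrACA.
have e1 : X1 / X + X2 / X = 1 by rewrite -mulrDl -eX divff // gt_eqF.
have e2 : Y1 / Y + Y2 / Y = 1 by rewrite -mulrDl -eY divff // gt_eqF.
rewrite !sqrrB !sq // !pr //.
have -> : (Num.sqrt (X1 * Y1) + Num.sqrt (X2 * Y2)) / Num.sqrt (X * Y) =
  Num.sqrt (X1 * Y1) / Num.sqrt (X * Y) + Num.sqrt (X2 * Y2) / Num.sqrt (X * Y) by rewrite mulrDl.
move: e1 e2; move: (X1 / X) (X2 / X) (Y1 / Y) (Y2 / Y) (_ / Num.sqrt (X * Y)) (_ / Num.sqrt (X * Y)) => a b c d u v e1 e2.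
have -> : b = 1 - a by rewrite -e1; ring.
have -> : d = 1 - c by rewrite -e2; ring.
by rewrite !mulr2n; ring.
Qed.

End Hellinger.

(** * Decay of the Hellinger affinity *)

Section Affinity.
Variables (R : realType) (A : finType) (x0 : A).
Hypothesis hA : (2 <= #|A|)%N.
Notation pair := (seq A * seq A)%type.
Notation win := (win x0).
Notation los := (los x0).
Notation rz := (rz x0).
Notation rzw := (rzw x0).
Notation sqrt := Num.sqrt.
Variables (p : nat -> pair) (b : nat -> bool).
Hypothesis okp_ : forall n, okp (p n).
Hypothesis pS : forall n, p n.+1 = rz (p n) (b n).
Let w n := win (p n) (b n).
Let l n := los (p n) (b n).
Variables len lam sl S : nat -> A -> R.
Hypothesis len_gt0 : forall n a, 0 < len n a.
Hypothesis lam_gt0 : forall n a, 0 < lam n a.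
Hypothesis sl_gt0 : forall n a, 0 < sl n a.
Hypothesis S_ge0 : forall n a, 0 <= S n a.
Hypothesis lenO : forall n a, a != w n -> a != l n -> len n.+1 a = len n a.
Hypothesis lenT : forall n, b n = true -> len n.+1 (l n) = len n (l n) /\
  len n (w n) = len n.+1 (w n) + sl n (l n) * len n (l n).
Hypothesis lenB : forall n, b n = false -> len n (l n) = sl n (w n) * len n.+1 (l n) /\
  len n (w n) = len n.+1 (w n) + len n.+1 (l n).
Hypothesis slO : forall n a, a != l n -> sl n.+1 a = sl n a.
Hypothesis slL : forall n, sl n.+1 (l n) = sl n (l n) * sl n (w n).
Hypothesis lamS : forall n, lam n = bstep x0 (p n) (b n) (lam n.+1).
Hypothesis SO : forall n a, a != l n -> S n.+1 a = S n a.
Hypothesis ST : forall n, b n = true -> S n.+1 (l n) = S n (l n) + sqrt (sl n (l n)) * S n (w n).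
Hypothesis SB : forall n, b n = false -> S n.+1 (l n) = S n (w n) + sqrt (sl n (w n)) * S n (l n).

Let wl n : w n != l n. Proof. exact: win_los. Qed.
Let lw n : l n != w n. Proof. by rewrite eq_sym. Qed.

Definition share n a := S n a * sqrt (len n a * lam n a).
(** The sum H_n, with [S n a] standing for the sum of the square roots of the scales of the floors
    over [a]. *)
Definition affinity n := \sum_a share n a.
(** Length of the piece cut from the winner's interval: the old image of the loser in the top case,
    its new interval in the bottom case. *)
Let X2 n := if b n then sl n (l n) * len n (l n) else len n.+1 (l n).
Definition loss n := 1 - (sqrt (len n.+1 (w n) * lam n.+1 (w n)) + sqrt (X2 n * lam n.+1 (l n))) /
  sqrt (len n (w n) * lam n (w n)).

Let lenW n : len n (w n) = len n.+1 (w n) + X2 n.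
Proof. by rewrite /X2; case e : (b n); [case: (lenT e)|case: (lenB e)]. Qed.
Let X2_gt0 n : 0 < X2 n. Proof. by rewrite /X2; case: ifP => // _; rewrite mulr_gt0. Qed.
Let lamW n : lam n (w n) = lam n.+1 (w n) + lam n.+1 (l n).
Proof. by rewrite lamS /bstep -/(w n) -/(l n) eqxx. Qed.
Let lamO n a : a != w n -> lam n a = lam n.+1 a.
Proof. by rewrite [LHS](congr1 (@^~ a) (lamS n)) /bstep -/(w n) => /negPf ->; rewrite addr0. Qed.

Lemma share_ge0 n a : 0 <= share n a.
Proof. by rewrite mulr_ge0 // sqrtr_ge0. Qed.

Lemma share_other n a : a != w n -> a != l n -> share n.+1 a = share n a.
Proof. by move=> aw al; rewrite /share SO // lenO // -lamO. Qed.

Lemma share_winner n : share n.+1 (w n) = S n (w n) * sqrt (len n.+1 (w n) * lam n.+1 (w n)).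
Proof. by rewrite /share SO. Qed.

Lemma share_loser n : share n.+1 (l n) = share n (l n) + S n (w n) * sqrt (X2 n * lam n.+1 (l n)).
Proof.
have e0 := lamO (lw n); have l0 := lam_gt0 n.+1 (l n).
rewrite /share /X2 e0; case e : (b n).
  have [-> _] := lenT e; rewrite ST // mulrDl; congr (_ + _).
  by rewrite -[sl n (l n) * _ * _]mulrA [sqrt (_ * (_ * _))]sqrtrM ?(ltW (sl_gt0 _ _)) // mulrA (mulrC (S _ _)).
have [-> _] := lenB e; rewrite SB // mulrDl addrC; congr (_ + _).
by rewrite -[sl n (w n) * _ * _]mulrA [sqrt (_ * (_ * _))]sqrtrM ?(ltW (sl_gt0 _ _)) // mulrA (mulrC (S _ _)).
Qed.

(** Only the winner's floors are cut, and the Cauchy-Schwarz inequality for the two pieces is the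
    sole loss. *)
Lemma affinity_step n : affinity n = affinity n.+1 + share n (w n) * loss n.
Proof.
rewrite /affinity (bigD1 (w n)) //= (bigD1 (l n)) //= [in RHS](bigD1 (w n)) //= [in RHS](bigD1 (l n)) //=.
rewrite share_winner share_loser [in RHS](eq_bigr (share n)); last first.
  by move=> a /andP[aw al]; exact: share_other.
have s0 : sqrt (len n (w n) * lam n (w n)) != 0 by rewrite gt_eqF // sqrtr_gt0 mulr_gt0.
have -> : share n (w n) * loss n = share n (w n) - S n (w n) *
    (sqrt (len n.+1 (w n) * lam n.+1 (w n)) + sqrt (X2 n * lam n.+1 (l n))).
  rewrite /share /loss mulrBr mulr1; congr (_ - _).
  by rewrite -[LHS]mulrA; congr (_ * _); rewrite mulrC divfK.
ring.
Qed.

Lemma loss_sq n : (sqrt (len n.+1 (w n) / len n (w n)) - sqrt (lam n.+1 (w n) / lam n (w n))) ^+ 2 +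
  (sqrt (X2 n / len n (w n)) - sqrt (lam n.+1 (l n) / lam n (w n))) ^+ 2 = 2 * loss n.
Proof. by apply: hellinger_loss. Qed.

Lemma loss_ge0 n : 0 <= loss n.
Proof.
have h : 0 <= 2 * loss n by rewrite -loss_sq addr_ge0 // sqr_ge0.
by rewrite pmulr_rge0 in h.
Qed.

Lemma affinity_le m n : (m <= n)%N -> affinity n <= affinity m.
Proof.
move=> /subnKC <-; elim: (n - m)%N => [|k IH]; first by rewrite addn0.
apply: le_trans IH; rewrite addnS [leRHS]affinity_step lerDl.
by rewrite mulr_ge0 ?share_ge0 ?loss_ge0.
Qed.

Lemma affinity_drop n m : affinity n - affinity (n + m) = \sum_(0 <= i < m) share (n + i) (w (n + i)) * loss (n + i).
Proof.
elim: m => [|m IH]; first by rewrite addn0 subrr big_geq.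
rewrite big_nat_recr //= -IH addnS [affinity (n + m)]affinity_step; ring.
Qed.

Section Step.
Variables (n : nat) (dl : R).
Hypothesis dl_gt0 : 0 < dl.
Hypothesis dlw : dl * lam n (w n) <= lam n.+1 (w n).
Hypothesis dll : dl * lam n (w n) <= lam n.+1 (l n).
Hypothesis small_loss : loss n <= dl / 8.

Let half (x y : R) : 0 < x -> 0 < y -> dl * lam n (w n) <= y ->
  (sqrt (x / len n (w n)) - sqrt (y / lam n (w n))) ^+ 2 <= 2 * loss n ->
  dl / 2 * sqrt (len n (w n) * lam n (w n)) <= sqrt (x * y) /\
  (ln (x / y) - ln (len n (w n) / lam n (w n))) ^+ 2 <= 32 * loss n / dl.
Proof.
move=> x_gt y_gt hy hs; set X := len n (w n) in hs *; set Y := lam n (w n) in hy hs *.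
have Y0 : 0 < Y by exact: lam_gt0.
have X0 : 0 < X by exact: len_gt0.
have dq : dl <= y / Y by rewrite ler_pdivlMr.
have [h1 h2] := @half_log R (x / X) (y / Y) (loss n) dl (divr_gt0 x_gt X0) dl_gt0 dq hs small_loss.
split; last first.
  apply: le_trans h2; rewrite le_eqVlt; apply/orP; left; apply/eqP; congr (_ ^+ 2).
  have -> : x / X / (y / Y) = (x / y) / (X / Y).
    by field; rewrite !gt_eqF.
  by rewrite [RHS]ln_div ?posrE ?divr_gt0.
have -> : x * y = (x / X) * (y / Y) * (X * Y) by field; rewrite !gt_eqF.
have a0 : 0 <= x / X by apply: divr_ge0; exact: ltW.
have b0 : 0 <= y / Y by apply: divr_ge0; exact: ltW.
rewrite [leRHS](sqrtrM _ (mulr_ge0 a0 b0)) ler_wpM2r ?sqrtr_ge0 // (sqrtrM _ a0).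
set s := sqrt (y / Y) in h1 *.
have es : s * s = y / Y by rewrite -expr2 sqr_sqrtr.
have s0 : 0 <= s by exact: sqrtr_ge0.

apply: (@le_trans _ _ (s / 2 * s)); last by rewrite ler_wpM2r.
by rewrite mulrAC es ler_wpM2r ?invr_ge0.
Qed.

Let hw := half (len_gt0 n.+1 (w n)) (lam_gt0 n.+1 (w n)) dlw.
Let hl := half (X2_gt0 n) (lam_gt0 n.+1 (l n)) dll.
Let sw : (sqrt (len n.+1 (w n) / len n (w n)) - sqrt (lam n.+1 (w n) / lam n (w n))) ^+ 2 <= 2 * loss n.
Proof. by rewrite -loss_sq lerDl sqr_ge0. Qed.
Let sl_ : (sqrt (X2 n / len n (w n)) - sqrt (lam n.+1 (l n) / lam n (w n))) ^+ 2 <= 2 * loss n.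
Proof. by rewrite -loss_sq lerDr sqr_ge0. Qed.

(** When the loss is small, both pieces of the winner's interval carry a definite part of its share.
    A lower bound thus passes from winner to loser, as supports do in [sstep]. *)
Lemma share_keep eta : 0 <= eta -> eta <= share n (w n) ->
  dl / 2 * eta <= share n.+1 (w n) /\ dl / 2 * eta <= share n.+1 (l n).
Proof.
move=> eta0 he; have d0 : 0 <= dl / 2 by rewrite divr_ge0 // ltW.
have key x : dl / 2 * sqrt (len n (w n) * lam n (w n)) <= x -> dl / 2 * eta <= S n (w n) * x.
  move=> hx; apply: (@le_trans _ _ (dl / 2 * share n (w n))); first by rewrite ler_wpM2l.
  by rewrite /share mulrCA ler_wpM2l.
have [h1 _] := hw sw; have [h2 _] := hl sl_.
split; first by rewrite share_winner; exact: key.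
by rewrite share_loser; apply: le_trans (key _ h2) _; rewrite lerDr share_ge0.
Qed.

Definition rho n a := ln (len n a / lam n a).
Definition omega n a := ln (sl n a).
Definition dev n := sqrt (32 * loss n / dl).

Lemma dev_norm x : x ^+ 2 <= 32 * loss n / dl -> `|x| <= dev n.
Proof. by move=> h; rewrite -sqrtr_sqr ler_sqrt // (le_trans (sqr_ge0 x) h). Qed.

Lemma rho_winner : `|rho n.+1 (w n) - rho n (w n)| <= dev n.
Proof. by have [_ h] := hw sw; exact: dev_norm. Qed.

Lemma rho_top_loser : b n = true ->
  rho n.+1 (l n) = rho n (l n) /\ `|rho n (l n) + omega n (l n) - rho n (w n)| <= dev n.
Proof.
move=> e; have [e1 _] := lenT e; split; first by rewrite /rho e1 -lamO.
have [_ h] := hl sl_; apply: dev_norm; move: h.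
rewrite /X2 e /rho /omega -mulrA [ln (sl n (l n) * _)]lnM ?posrE ?divr_gt0 //.
by rewrite -lamO // [ln (sl _ _) + _]addrC.
Qed.

Lemma rho_bottom_loser : b n = false ->
  rho n.+1 (l n) = rho n (l n) - omega n (w n) /\ `|rho n.+1 (l n) - rho n (w n)| <= dev n.
Proof.
move=> e; have [e1 _] := lenB e; split.
  rewrite /rho /omega e1 -lamO // -mulrA [ln (sl n (w n) * _)]lnM ?posrE ?divr_gt0 //; ring.
by have [_ h] := hl sl_; apply: dev_norm; move: h; rewrite /X2 e.
Qed.

End Step.

Section Segment.
Variables (N0 L : nat) (dl c : R).
Notation N := (N0 + L)%N.
Hypothesis L_gt0 : (0 < L)%N.
Hypothesis dl_gt0 : 0 < dl.
Hypothesis dl_le1 : dl <= 1.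
Hypothesis balanced : forall n a, (n < N)%N -> dl * lam n (w n) <= lam n.+1 a.
Hypothesis c_gt0 : 0 < c.
Hypothesis affinity_ge : c <= affinity 0.
Hypothesis positive_start : posw x0 (p 0) (mkseq b N0).
Hypothesis many_wins : forall x, (#|A| <= \sum_(0 <= n < L) (w (N0 + n) == x))%N.

Lemma large_share : exists a, c / #|A|%:R <= share 0 a.
Proof.
have A0 : (0 < #|A|)%N by exact: leq_trans hA.
pose a := [arg max_(i > x0) share 0 i]%O; exists a.
rewrite ler_pdivrMr ?ltr0n //; apply: le_trans affinity_ge _.
rewrite mulr_natr -sumr_const; apply: ler_sum => i _.
by rewrite /a; case: Order.TotalTheory.arg_maxP => // j _; apply.
Qed.

Let p_at n : p n = rzw (p 0) (mkseq b n).
Proof. by elim: n => // n IH; rewrite mkseqS rzw_rcons -IH pS. Qed.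

Let et i := (dl / 2) ^+ i * (c / #|A|%:R).
Let d2 : 0 < dl / 2. Proof. by rewrite divr_gt0. Qed.
Let et_gt0 i : 0 < et i.
Proof. by rewrite mulr_gt0 ?exprn_gt0 // divr_gt0 // ltr0n (leq_trans _ hA). Qed.
Let et_mono i j : (i <= j)%N -> et j <= et i.
Proof.
move=> ij; rewrite ler_wpM2r ?divr_ge0 ?ler0n ?(ltW c_gt0) //.
apply: ler_wiXn2l => //; first exact: ltW.
by rewrite ler_pdivrMr // mul1r; apply: le_trans dl_le1 _; rewrite ler1n.
Qed.

(** So small that, at a winner with share at least [et N], the relative loss stays below the
    threshold [dl / 8] of [half_log]. *)
Definition drop_bound := dl * et N / 8.

Lemma drop_bound_gt0 : 0 < drop_bound.
Proof. by rewrite divr_gt0 // mulr_gt0. Qed.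

Hypothesis small_drop : affinity 0 - affinity N <= drop_bound.

Let loss_le n : (n < N)%N -> share n (w n) * loss n <= affinity 0 - affinity N.
Proof.
move=> nN; have -> : share n (w n) * loss n = affinity n - affinity n.+1 by rewrite [affinity n]affinity_step addrC addKr.
by apply: lerB; exact: affinity_le.
Qed.

Let loss_small n : (n < N)%N -> et n <= share n (w n) -> loss n <= dl / 8.
Proof.
move=> nN hs; have h := le_trans (loss_le nN) small_drop.
have h' : et N * loss n <= drop_bound.
  by apply: le_trans h; rewrite ler_wpM2r ?loss_ge0 //; apply: le_trans hs; apply: et_mono; exact: ltnW.
by move: h'; rewrite /drop_bound -mulrA mulrCA ler_pM2l.
Qed.

(** A large share spreads along [sword] like a support, losing at most the factor [dl / 2] per
    move. *)
Lemma shares_grow : exists a, forall n, (n <= N)%N ->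
  {in sword x0 (p 0) (mkseq b n) [set a]%SET, forall x, et n <= share n x}.
Proof.
have [a ha] := large_share; exists a; elim=> [|n IH] nN x.
  by rewrite /= finset.in_set1 => /eqP ->; rewrite /et expr0 mul1r.
have {}IH := IH (ltnW nN); rewrite mkseqS -cats1 sword_cat /= -p_at.
set B := sword _ _ _ _ in IH *; rewrite /sstep -/(w n) -/(l n).
have keep : x \in B -> x != w n -> et n.+1 <= share n.+1 x.
  move=> xB xw; apply: le_trans (et_mono (leqnSn n)) (le_trans (IH x xB) _).
  have [->|xl] := eqVneq x (l n); last by rewrite share_other.
  by rewrite share_loser lerDl mulr_ge0 // sqrtr_ge0.
case: ifP => wB; last first.
  by move=> xB; apply: keep => //; apply: contraFN wB => /eqP <-.
have [h1 h2] := share_keep dl_gt0 (balanced (w n) nN) (balanced (l n) nN)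
  (loss_small nN (IH _ wB)) (ltW (et_gt0 n)) (IH _ wB).
rewrite finset.in_setU1.
have eE : et n.+1 = dl / 2 * et n by rewrite /et exprS -[LHS]mulrA.
have [-> _|xl /=] := eqVneq x (l n); first by rewrite eE.
have [-> _|xw xB] := eqVneq x (w n); first by rewrite eE.
exact: keep.
Qed.

Let shares_large n x : (N0 <= n)%N -> (n <= N)%N -> et n <= share n x.
Proof.
move=> n0 nN; have [a h] := shares_grow; apply: (h n nN).
have -> : mkseq b n = mkseq b N0 ++ drop N0 (mkseq b n).
  by rewrite -{1}(cat_take_drop N0 (mkseq b n)) /mkseq -map_take take_iota (minn_idPl n0).
by rewrite (eqP (forallP (posw_catr _ positive_start) a)) finset.in_setT.
Qed.

Lemma omega_step n : omega n.+1 = hstep x0 (p n) (b n) (omega n).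
Proof.
apply/funext => a; rewrite /omega /hstep -/(w n) -/(l n).
have [->|al] := eqVneq a (l n); first by rewrite slL lnM ?posrE.
by rewrite addr0 slO.
Qed.

(** The constant 3200 is 100 times 32: the square of the 10 in [rigidity] and the 32 in [half_log].
    The factor [L] comes from Cauchy-Schwarz, [#|A|] from the sum over letters, and [et N] from
    dividing the drop by the shares. *)
Lemma omega_small : \sum_x omega N0 x ^+ 2 <= 3200 * L%:R * #|A|%:R / (dl * et N) * (affinity 0 - affinity N).
Proof.
have pN n : (n < L)%N -> (N0 + n < N)%N by rewrite ltn_add2l.
have sm n : (n < L)%N -> loss (N0 + n) <= dl / 8.
  by move=> nL; apply: loss_small (pN n nL) _; apply: shares_large; [exact: leq_addr|apply: ltnW; exact: pN].
have main x : `|omega N0 x| <= 10 * \sum_(0 <= i < L) dev dl (N0 + i).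
  have := @rigidity R A x0 hA (fun n => p (N0 + n)%N) (fun n => b (N0 + n)%N) L (fun n => dev dl (N0 + n))
    _ _ _ many_wins (fun n => rho (N0 + n)) (fun n => omega (N0 + n)).
  rewrite addn0 /=; apply => //.
  - by move=> n; rewrite addnS pS.
  - by move=> n; exact: sqrtr_ge0.
  - by move=> n; rewrite addnS omega_step.
  - by move=> n a nL aw al; rewrite addnS /rho lenO // -lamO.
  - move=> n nL; rewrite addnS; exact: (rho_winner dl_gt0 (balanced _ (pN n nL)) (sm n nL)).
  - move=> n nL e; rewrite addnS; exact: (rho_top_loser dl_gt0 (balanced _ (pN n nL)) (sm n nL) e).
  - move=> n nL e; rewrite addnS; exact: (rho_bottom_loser dl_gt0 (balanced _ (pN n nL)) (sm n nL) e).
have sq x : omega N0 x ^+ 2 <= 3200 * L%:R / (dl * et N) * (affinity 0 - affinity N).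
  rewrite -(real_normK (num_real (omega N0 x))).
  apply: (@le_trans _ _ (100 * (\sum_(i < L) dev dl (N0 + i)) ^+ 2)).
    have -> : 100 * (\sum_(i < L) dev dl (N0 + i)) ^+ 2 = (10 * \sum_(i < L) dev dl (N0 + i)) ^+ 2 by ring.
    have h := main x; rewrite big_mkord in h.
    by rewrite ler_sqr // nnegrE ?normr_ge0 // (le_trans (normr_ge0 _) h).
  apply: (@le_trans _ _ (100 * (L%:R * \sum_(i < L) dev dl (N0 + i) ^+ 2))).
    by rewrite ler_pM2l ?ltr0n //; have := sqr_sum_le (fun i : 'I_L => dev dl (N0 + i)); rewrite card_ord.
  have drop : \sum_(i < L) loss (N0 + i) <= (affinity 0 - affinity N) / et N.
    rewrite ler_pdivlMr // mulrC mulr_sumr.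
    apply: (@le_trans _ _ (affinity N0 - affinity N)); last first.
      by rewrite lerD2r; exact: affinity_le.
    rewrite affinity_drop big_mkord; apply: ler_sum => i _.
    rewrite ler_wpM2r ?loss_ge0 //; have iN := pN i (ltn_ord i).
    by apply: le_trans (shares_large _ (leq_addr _ _) (ltnW iN)); apply: et_mono; exact: ltnW.
  have -> : \sum_(i < L) dev dl (N0 + i) ^+ 2 = 32 / dl * \sum_(i < L) loss (N0 + i).
    rewrite mulr_sumr; apply: eq_bigr => i _; rewrite /dev sqr_sqrtr; first by rewrite mulrAC.
    by rewrite divr_ge0 ?mulr_ge0 ?loss_ge0 // ltW.
  have -> : 3200 * L%:R / (dl * et N) * (affinity 0 - affinity N) =
      100 * (L%:R * (32 / dl * ((affinity 0 - affinity N) / et N))).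
    by field; rewrite !gt_eqF.
  by rewrite !ler_wpM2l ?ler0n // divr_ge0 // ltW.
apply: (@le_trans _ _ (\sum_(x : A) 3200 * L%:R / (dl * et N) * (affinity 0 - affinity N))).
  by apply: ler_sum => x _; exact: sq.
rewrite sumr_const -mulr_natr le_eqVlt; apply/orP; left; apply/eqP; ring.
Qed.

End Segment.

End Affinity.

Lemma take_window ty m n k : (k <= n)%N -> take k (window ty m n) = window ty m k.
Proof. by move=> kn; rewrite /window /mkseq -map_take take_iota (minn_idPl kn). Qed.

Lemma drop_window ty m n i k : (i + k <= n)%N -> take k (drop i (window ty m n)) = window ty (m + i) k.
Proof.
move=> h; have kn : (k <= n - i)%N by lia.
rewrite /window /mkseq -map_drop -map_take drop_iota take_iota (minn_idPl kn) addnC iotaDl -map_comp.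
by apply: eq_map => j /=; rewrite addnA.
Qed.

(** * The affinity along strong words of an affine exchange *)

Section AffinityDecay.
Variables (R : realType) (A : finType) (x0 : A).
Hypothesis hA : (2 <= #|A|)%N.
Notation pair := (seq A * seq A)%type.
Notation win := (win x0).
Notation los := (los x0).
Notation rz := (rz x0).
Notation rzw := (rzw x0).
Notation posw := (posw x0).
Notation sqrt := Num.sqrt.
Variable T : aiet R A.
Hypothesis aT : admissible T.
Hypothesis kT : keane T.
Notation Tn n := (rv_iter n T).
Notation tower := (tower x0 T).
Notation b := (rv_type T).
Notation p := (pair_at x0 (rows T) b).
Notation w n := (win (p n) (b n)).
Notation l n := (los (p n) (b n)).
Variable lam : nat -> A -> R.
Hypothesis lam_back : backward x0 (rows T) b lam.
Hypothesis lam_gt0 : forall n a, 0 < lam n a.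

Let aTn n : admissible (Tn n). Proof. exact: (keane_admissible x0 hA). Qed.
Let pE n : p n = rows (Tn n).
Proof. by rewrite /pair_at (rows_iter x0 hA) //; case: aT. Qed.
Let okp_ n : okp (p n). Proof. by rewrite pE; case: (aTn n). Qed.
Let pS n : p n.+1 = rz (p n) (b n).
Proof. by rewrite /pair_at mkseqS rzw_rcons. Qed.
Let bE n : b n = top_wins x0 (Tn n).
Proof. by apply: (rv_typeE x0 hA); case: (aTn n). Qed.
Let wE n : w n = winner x0 (Tn n). Proof. by rewrite pE bE. Qed.
Let lE n : l n = loser x0 (Tn n). Proof. by rewrite pE bE. Qed.

Let len n := alen (Tn n).
Let sl n := slope (Tn n).
Let S n a := \sum_(f <- tower n a) sqrt f.2.

Let len_gt0 n a : 0 < len n a. Proof. by rewrite /len; have [_ []] := aTn n. Qed.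
Let sl_gt0 n a : 0 < sl n a. Proof. by apply: slope_gt0; case: (aTn n). Qed.
Let S_ge0 n a : 0 <= S n a. Proof. by apply: sumr_ge0 => f _; exact: sqrtr_ge0. Qed.
Let lenO n a : a != w n -> a != l n -> len n.+1 a = len n a.
Proof. by rewrite wE lE; exact: (alen_step hA (aTn n)). Qed.
Let lenT n : b n = true -> len n.+1 (l n) = len n (l n) /\
  len n (w n) = len n.+1 (w n) + sl n (l n) * len n (l n).
Proof. by rewrite wE lE bE; exact: (alen_top hA (aTn n)). Qed.
Let lenB n : b n = false -> len n (l n) = sl n (w n) * len n.+1 (l n) /\
  len n (w n) = len n.+1 (w n) + len n.+1 (l n).
Proof. by rewrite wE lE bE; exact: (alen_bottom hA (aTn n)). Qed.
Let slO n a : a != l n -> sl n.+1 a = sl n a.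
Proof. by rewrite lE => al; exact: (slope_other hA (aTn n) (kT n) al). Qed.
Let slL n : sl n.+1 (l n) = sl n (l n) * sl n (w n).
Proof. by rewrite lE wE; exact: (slope_loser x0 hA (aTn n) (kT n)). Qed.
Let SO n a : a != l n -> S n.+1 a = S n a.
Proof. by rewrite lE /S /= /tower_step => /negPf ->. Qed.
Let floor_sqrt n a (k c : R) : 0 < k ->
  \sum_(f <- map (reparam c k) (tower n a)) sqrt f.2 = sqrt k * S n a.
Proof.
move=> k0; rewrite big_map mulr_sumr; apply: eq_big_seq => f fa /=.
by rewrite mulrC sqrtrM // ltW.
Qed.
Let ST n : b n = true -> S n.+1 (l n) = S n (l n) + sqrt (sl n (l n)) * S n (w n).
Proof.
rewrite lE wE bE /S /= /tower_step eqxx => ->; rewrite big_cat /=; congr (_ + _).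
by rewrite floor_sqrt //; exact: (sl_gt0 n).
Qed.
Let SB n : b n = false -> S n.+1 (l n) = S n (w n) + sqrt (sl n (w n)) * S n (l n).
Proof.
rewrite lE wE bE /S /= /tower_step eqxx => ->; rewrite big_cat /=.
by rewrite !floor_sqrt ?sqrtr1 ?mul1r //; exact: (sl_gt0 n).
Qed.

Definition aff n := \sum_a \sum_(f <- tower n a) sqrt (f.2 * len n a * lam n a).

Let affE n : aff n = affinity len lam S n.
Proof.
apply: eq_bigr => a _; rewrite /share /S mulr_suml; apply: eq_bigr => f _.
have h : 0 <= len n a * lam n a by apply: mulr_ge0; exact: ltW.
by rewrite -mulrA [f.2 * _]mulrC sqrtrM // mulrC.
Qed.

Lemma aff_le m n : (m <= n)%N -> aff n <= aff m.
Proof. by move=> mn; rewrite !affE; exact: (affinity_le hA okp_ len_gt0 lam_gt0 sl_gt0 S_ge0 lenO lenT lenB lam_back SO ST SB). Qed.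

Lemma lam_window n k : lam n = bword x0 (p n) (window b n k) (lam (n + k)%N).
Proof. exact: backward_window. Qed.

Lemma lam_le n k a : lam (n + k)%N a <= lam n a.
Proof. elim: k => [|k IH]; first by rewrite addn0.
apply: le_trans IH; rewrite addnS [leRHS](congr1 (@^~ a) (lam_back (n + k))) /bstep lerDl.
by case: ifP => // _; exact: ltW. Qed.

Variable l0 : nat.
Hypothesis l0_gt0 : (0 < l0)%N.
Notation SL := (strong_len A l0).
Notation N := (l0 + #|A| * l0)%N.

Lemma window_chunk m i : chunks x0 l0 (nchunks A) (p m) (window b m SL) -> (i < nchunks A)%N ->
  posw (p (m + i * l0)) (window b (m + i * l0) l0).
Proof.
move=> ch iN; have iS : (i * l0 + l0 <= SL)%N by rewrite -mulSnr leq_mul2r iN orbT.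
have := chunk_at ch iN; rewrite drop_window // take_window; last exact: leq_trans (leq_addr _ _) iS.
by rewrite /pair_at mkseq_window rzw_cat.
Qed.

Section Segment.
Variable m : nat.
Hypothesis ch : chunks x0 l0 (nchunks A) (p m) (window b m SL).
Let dl : R := (2 ^+ SL)^-1.
Let dl_gt0 : 0 < dl. Proof. by rewrite invr_gt0 exprn_gt0. Qed.
Let dl_le1 : dl <= 1. Proof. by rewrite invf_le1 ?exprn_gt0 // exprn_ege1 // ler1n. Qed.

(** The last chunk is positive, so every length up to its start is at least the total [s] at its
    end, while going back at most [SL] moves multiplies by at most [2 ^+ SL]. *)
Lemma lam_balanced n a : (n < N)%N -> dl * lam (m + n)%N (w (m + n)) <= lam (m + n.+1)%N a.
Proof.
move=> nN; set s := \sum_c lam (m + SL)%N c.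
have eSL : SL = (N + l0)%N by rewrite /strong_len /nchunks; lia.
have h1 : s <= lam (m + n.+1)%N a.
  apply: (@le_trans _ _ (lam (m + N)%N a)); last first.
    by rewrite -(subnKC nN) addnA; exact: lam_le.
  have := window_chunk ch (i := #|A|.+1); rewrite mulSn /nchunks addn2 => /(_ (leqnn _)) pz.
  rewrite [leRHS](congr1 (@^~ a) (lam_window (m + N) l0)) /s eSL addnA.
  by apply: posw_bword => // c; exact: ltW.
apply: le_trans h1; rewrite mulrC ler_pdivrMr ?exprn_gt0 // mulrC.
have nSL : (n <= SL)%N by rewrite eSL; lia.
rewrite [leLHS](congr1 (@^~ (w (m + n))) (lam_window (m + n) (SL - n))) -addnA subnKC //.
apply: le_trans (bword_le _ _ _ _ _) _ => [c|]; first exact: ltW.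
rewrite size_mkseq ler_wpM2r ?sumr_ge0 // => [c _|]; first exact: ltW.
by rewrite ler_weXn2l ?ler1n // leq_subr.
Qed.

Lemma segment_wins x : (#|A| <= \sum_(0 <= n < #|A| * l0) (w (m + (l0 + n)) == x))%N.
Proof.
have key k : (k <= #|A|)%N -> (k <= \sum_(0 <= n < k * l0) (w (m + (l0 + n)) == x))%N.
  elim: k => // k IH kA; rewrite mulSnr.
  have -> := @big_cat_nat _ _ _ (k * l0)%N 0 (k * l0 + l0)%N xpredT (fun n => w (m + (l0 + n)) == x : nat) (leq0n _) (leq_addr _ _).
  rewrite -[X in (X <= _)%N]addn1 leq_add ?IH ?(ltnW kA) //.
  have kN : (k.+1 < nchunks A)%N by rewrite /nchunks; lia.
  have [i] := posw_wins hA x (window_chunk ch kN).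
  rewrite size_mkseq => il; rewrite mulSn => e.
  rewrite (bigD1_seq (k * l0 + i)%N) ?iota_uniq ?mem_index_iota ?leq_addr ?ltn_add2l //=.
  move: e; rewrite take_window ?(ltnW il) // nth_mkseq // /pair_at -rzw_cat -mkseq_window => e.
  by rewrite -!addnA in e; rewrite e eqxx.
exact: key.
Qed.

Lemma segment_dichotomy c : 0 < c -> c <= aff m ->
  aff m - aff (m + N) <= drop_bound A l0 (#|A| * l0) dl c ->
  \sum_x logslope (Tn (m + l0)) x ^+ 2 <= 3200 * (#|A| * l0)%:R * #|A|%:R /
    (dl * ((dl / 2) ^+ N * (c / #|A|%:R))) * (aff m - aff (m + N)).
Proof.
move=> c0 hc hd; rewrite !affE in hc hd *.
have e1 : affinity len lam S m = affinity (fun n => len (m + n)) (fun n => lam (m + n)) (fun n => S (m + n)) 0.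
  by rewrite /affinity /share addn0.
have e2 : affinity len lam S (m + N) = affinity (fun n => len (m + n)) (fun n => lam (m + n)) (fun n => S (m + n)) N by [].
rewrite e1 e2 in hc hd *.
have -> : logslope (Tn (m + l0)) = omega (fun n => sl (m + n)) l0 by [].
apply: (@omega_small R A x0 hA (fun n => p (m + n)) (fun n => b (m + n)) _ _
  (fun n => len (m + n)) (fun n => lam (m + n)) (fun n => sl (m + n)) (fun n => S (m + n))
  _ _ _ _ _ _ _ _ _ _ _ _ _ l0 (#|A| * l0) dl c) => //; try by [move=> n|move=> n a].
- by move=> n; rewrite addnS pS.
- by move=> n a; rewrite addnS; exact: lenO.
- by move=> n; rewrite addnS; exact: lenT.
- by move=> n; rewrite addnS; exact: lenB.
- by move=> n a; rewrite addnS; exact: slO.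
- by move=> n; rewrite addnS; exact: slL.
- by move=> n; rewrite addnS; exact: lam_back.
- by move=> n a; rewrite addnS; exact: SO.
- by move=> n; rewrite addnS; exact: ST.
- by move=> n; rewrite addnS; exact: SB.
- by rewrite muln_gt0 l0_gt0 andbT (leq_trans _ hA).
- by move=> n a nN; exact: lam_balanced.
- have h := window_chunk ch (i := 0%N); rewrite mul0n addn0 in h; rewrite addn0; apply: h; rewrite /nchunks; lia.
- exact: segment_wins.
Qed.

End Segment.

Variables tm sm : nat -> nat.
Hypothesis tm0 : tm 0%N = 0%N.
Hypothesis tm_sm : forall k, (tm k <= sm k)%N.
Hypothesis tmS : forall k, tm k.+1 = (sm k + SL)%N.
Hypothesis sm_ch : forall k, chunks x0 l0 (nchunks A) (p (sm k)) (window b (sm k) SL).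

Lemma hword_sq q u (v : A -> R) :
  \sum_a hword x0 q u v a ^+ 2 <= #|A|%:R ^+ 2 * (2 ^+ size u) ^+ 2 * \sum_a v a ^+ 2.
Proof.
have key a : hword x0 q u v a ^+ 2 <= #|A|%:R * (2 ^+ size u) ^+ 2 * \sum_a v a ^+ 2.
  rewrite -(real_normK (num_real _)).
  have h : `|hword x0 q u v a| <= 2 ^+ size u * \sum_c `|v c|.
    apply: (le_trans (hword_norm _ _ _ _ _)); apply: hword_le => c; rewrite normr_ge0 /=.
    by rewrite (bigD1 c) //= lerDl sumr_ge0.
  apply: (@le_trans _ _ ((2 ^+ size u * \sum_c `|v c|) ^+ 2)).
    by rewrite ler_sqr // nnegrE ?normr_ge0 // (le_trans (normr_ge0 _) h).
  have s1 : (\sum_c `|v c|) ^+ 2 <= #|A|%:R * \sum_c v c ^+ 2.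
    apply: le_trans (sqr_sum_le _) _; rewrite ler_wpM2l ?ler0n // ler_sum // => c _.
    by rewrite real_normK ?num_real.
  move: s1; move: (\sum_c `|v c|) (\sum_c v c ^+ 2) (2 ^+ size u) => s1 s2 P hs.
  have -> : (P * s1) ^+ 2 = P ^+ 2 * s1 ^+ 2 by ring.
  have -> : #|A|%:R * P ^+ 2 * s2 = P ^+ 2 * (#|A|%:R * s2) by ring.
  by rewrite ler_wpM2l ?sqr_ge0.
apply: (@le_trans _ _ (\sum_(a : A) #|A|%:R * (2 ^+ size u) ^+ 2 * \sum_a v a ^+ 2)).
  by apply: ler_sum => a _.
rewrite sumr_const -mulr_natr le_eqVlt; apply/orP; left; apply/eqP; ring.
Qed.

(** The affinity decreases and stays above [c], so from some return [K] on every drop is below the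
    threshold of [segment_dichotomy] and the bounds telescope. The [SL - l0] moves left until the
    end of the strong word cost a constant factor. *)
Lemma energy_bounded c : 0 < c -> (forall n, c <= aff n) -> exists B,
  forall n, \sum_(0 <= k < n) \sum_a logslope (Tn (tm k)) a ^+ 2 <= B.
Proof.
move=> c0 hc; set dl : R := (2 ^+ SL)^-1; set kap := drop_bound A l0 (#|A| * l0) dl c.
have dl0 : 0 < dl by rewrite invr_gt0 exprn_gt0.
have kap0 : 0 < kap by exact: drop_bound_gt0.
set C := 3200 * (#|A| * l0)%:R * #|A|%:R / (dl * ((dl / 2) ^+ N * (c / #|A|%:R))).
have C0 : 0 <= C.
  have k0 : 0 <= dl * ((dl / 2) ^+ N * (c / #|A|%:R)).
    apply: mulr_ge0; first exact: ltW.
    by apply: mulr_ge0; [apply: exprn_ge0; apply: divr_ge0; rewrite ?ltW|apply: divr_ge0; rewrite ?ler0n ?ltW].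
  by apply: divr_ge0 k0; rewrite -!natrM ler0n.
set C' := #|A|%:R ^+ 2 * (2 ^+ (SL - l0)) ^+ 2 * C.
have C'0 : 0 <= C' by apply: mulr_ge0 C0; apply: mulr_ge0; exact: sqr_ge0.
pose D := [set aff (tm k) | k in setT].
have hD : has_inf D by split; [exists (aff (tm 0)), 0%N|exists c => _ [k _ <-]].
have [_ [K _ <-] hK] := inf_adherent kap0 hD.
have eSL : SL = (N + l0)%N by rewrite /strong_len /nchunks; lia.
have step k : (K <= k)%N -> \sum_a logslope (Tn (tm k.+1)) a ^+ 2 <= C' * (aff (tm k) - aff (tm k.+1)).
  move=> Kk.
  have d1 : aff (sm k) - aff (sm k + N) <= aff (tm k) - aff (tm k.+1).
    by apply: lerB; apply: aff_le => //; rewrite tmS eSL; lia.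
  have d2 : aff (tm k) - aff (tm k.+1) <= kap.
    have h1 : inf D <= aff (tm k.+1) by apply: ge_inf; [exists c => _ [j _ <-]|exists k.+1].
    have h2 : aff (tm k) <= aff (tm K).
      apply: aff_le; rewrite -(subnKC Kk); elim: (k - K)%N => [|j IH]; first by rewrite addn0.
      apply: leq_trans IH _; rewrite addnS tmS; apply: leq_trans (tm_sm _) (leq_addr _ _).
    lra.
  have h := segment_dichotomy (sm_ch k) c0 (hc _) (le_trans d1 d2).
  have -> : logslope (Tn (tm k.+1)) = hword x0 (p (sm k + l0)) (window b (sm k + l0) (SL - l0)) (logslope (Tn (sm k + l0))).
    rewrite !(logslope_iter x0 hA _ aT kT) /pair_at -hword_cat -mkseq_window tmS.
    have -> : (sm k + l0 + (SL - l0) = sm k + SL)%N by rewrite -addnA subnKC // eSL leq_addl.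
    by [].
  apply: (le_trans (hword_sq _ _ _)); rewrite size_mkseq /C' -[leRHS]mulrA.
  apply: ler_wpM2l; first by apply: mulr_ge0; exact: sqr_ge0.
  by apply: le_trans h _; rewrite ler_wpM2l.
exists (\sum_(0 <= k < K.+1) \sum_a logslope (Tn (tm k)) a ^+ 2 + C' * aff (tm K)) => n.
have ge0 k : 0 <= \sum_a logslope (Tn (tm k)) a ^+ 2 by apply: sumr_ge0 => a _; exact: sqr_ge0.
have affp k : 0 <= aff k by apply: le_trans (ltW c0) (hc k).
have key j : \sum_(0 <= k < K.+1 + j) \sum_a logslope (Tn (tm k)) a ^+ 2 <=
    \sum_(0 <= k < K.+1) \sum_a logslope (Tn (tm k)) a ^+ 2 + C' * (aff (tm K) - aff (tm (K + j))).
  elim: j => [|j IH]; first by rewrite !addn0 subrr mulr0 addr0.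
  rewrite addnS big_nat_recr //= addSn.
  have := step (K + j)%N (leq_addr _ _); rewrite addnS => h.
  apply: le_trans (lerD IH h) _; rewrite -addrA lerD2l -mulrDr ler_wpM2l //; lra.
have [nK|Kn] := leqP n K.+1.
  rewrite (_ : \sum_(0 <= k < K.+1) _ = \sum_(0 <= k < n) \sum_a logslope (Tn (tm k)) a ^+ 2 +
    \sum_(n <= k < K.+1) \sum_a logslope (Tn (tm k)) a ^+ 2); last exact: big_cat_nat.
  rewrite -addrA lerDl; apply: addr_ge0; first by apply: sumr_ge0 => k _.
  exact: mulr_ge0.
have := key (n - K.+1)%N; rewrite subnKC ?(ltnW Kn) // => h; apply: le_trans h _.
by rewrite lerD2l ler_wpM2l // gerBl.
Qed.

End AffinityDecay.

(** * Singularity *)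

Section Singular.
Variable R : realType.

Lemma measure_bigsetU_le (mu : {measure set (measurableTypeR R) -> \bar R}) (I : eqType) (s : seq I)
  (c : pred I) (F : I -> set (measurableTypeR R)) (f : I -> R) :
  (forall i, measurable (F i)) -> (forall i, i \in s -> c i -> (mu (F i) <= (f i)%:E)%E) ->
  (mu (\big[setU/set0]_(i <- s | c i) F i) <= (\sum_(i <- s | c i) f i)%:E)%E.
Proof.
move=> mF; elim: s => [|i s IH] h; first by rewrite !big_nil measure0.
have {}IH : (mu (\big[setU/set0]_(i <- s | c i) F i) <= (\sum_(i <- s | c i) f i)%:E)%E.
  by apply: IH => j js; apply: h; rewrite inE js orbT.
rewrite !big_cons; case: ifP => // ci; rewrite EFinD.
apply: le_trans (measureU2 _ _ _) _ => //; first exact: bigsetU_measurable.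
by apply: leeD => //; apply: h; rewrite ?mem_head.
Qed.

Lemma mem_bigsetU (T : Type) (I : eqType) (s : seq I) (c : pred I) (F : I -> set T) i x :
  i \in s -> c i -> F i x -> (\big[setU/set0]_(i <- s | c i) F i) x.
Proof.
elim: s => // j s IH; rewrite inE big_cons => /orP[/eqP <- ci Fx|si ci Fx]; first by rewrite ci; left.
by case: ifP => _; [right|]; exact: IH.
Qed.

(** Borel-Cantelli: with errors halved at each step, the limit superior of the sets is null for [mu]
    and its complement is null for [P]. *)
Lemma singular_of_small (mu : {measure set (measurableTypeR R) -> \bar R}) (P : probability (measurableTypeR R) R) :
  (forall e : R, 0 < e -> exists B : set (measurableTypeR R),
     [/\ measurable B, (mu B <= e%:E)%E & (P (~` B) <= e%:E)%E]) ->
  exists B : set (measurableTypeR R), measurable B /\ P B = 1%E /\ mu B = 0%E.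
Proof.
move=> h; have e0 n : 0 < 1 / (2 ^ n.+1)%:R :> R by rewrite divr_gt0 // ltr0n expn_gt0.
have /choice[F hF] : forall n, exists B : set (measurableTypeR R),
     [/\ measurable B, (mu B <= (1 / (2 ^ n.+1)%:R)%:E)%E & (P (~` B) <= (1 / (2 ^ n.+1)%:R)%:E)%E].
  by move=> n; exact: h.
have mF n : measurable (F n) by case: (hF n).
have mB : measurable (lim_sup_set F : set (measurableTypeR R)).
  by apply: bigcap_measurable => // n _; exact: bigcup_measurable.
exists (lim_sup_set F); split=> //; split; last first.
  apply: lim_sup_set_cvg0 => //.
  apply: (@le_lt_trans _ _ (\sum_(i <oo) (1 / (2 ^ i.+1)%:R)%:E)%E); last first.
    by apply: le_lt_trans (epsilon_trick0 xpredT ler01) _; rewrite ltry.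
  by apply: lee_nneseries => n // _; case: (hF n).
have PC : P (~` lim_sup_set F) = 0%E.
  apply: measure_negligible; first exact: measurableC.
  rewrite /lim_sup_set setC_bigcap; apply: negligible_bigcup => n.
  have mC : measurable (~` \bigcup_(j >= n) F j : set (measurableTypeR R)).
    by apply: measurableC; exact: bigcup_measurable.
  exists (~` \bigcup_(j >= n) F j); split=> //.
  apply/eqP; rewrite eq_le measure_ge0 andbT; apply/lee_addgt0Pr => e e_gt; rewrite add0e.
  pose k := maxn n (Num.bound e^-1).
  apply: (@le_trans _ _ (P (~` F k))).
    apply: le_measure; rewrite ?inE //; first exact: measurableC.
    by apply: subsetC => x Fx; exists k => //=; exact: leq_maxl.
  have [_ _ hk] := hF k; apply: le_trans hk _; rewrite lee_fin mul1r.
  rewrite invf_ple ?posrE ?ltr0n ?expn_gt0 //.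
  apply: le_trans (ltW (archi_boundP _)) _; first by rewrite invr_ge0 ltW.
  rewrite ler_nat; apply: leq_trans (leq_maxr n _) _; rewrite -/k; apply: ltnW; apply: ltnW.
  exact: ltn_expl.
by have := probability_setC P (measurableC mB); rewrite setCK PC sube0.
Qed.

End Singular.

Section SingularAIET.
Variables (R : realType) (A : finType) (x0 : A).
Hypothesis hA : (2 <= #|A|)%N.
Variable T : aiet R A.
Hypothesis aT : admissible T.
Hypothesis kT : keane T.
Hypothesis s1 : \sum_a alen T a = 1.
Hypothesis s2 : \sum_a aimg T a = 1.
Notation Tn n := (rv_iter n T).
Notation tower := (tower x0 T).
Notation flo := (flo T).
Variables (l0 : nat) (lam : nat -> A -> R).
Hypothesis recurrent : forall N, exists2 m, (N <= m)%N &
  posw x0 (pair_at x0 (rows T) (rv_type T) m) (window (rv_type T) m l0).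
Hypothesis lam_back : backward x0 (rows T) (rv_type T) lam.
Hypothesis lam_gt0 : forall n a, 0 < lam n a.
Hypothesis lam_sum : \sum_a lam 0%N a = 1.

(** The smaller of two positive numbers is at most the root of their product. So the floors that are
    lighter for Lebesgue measure have total length at most the affinity, and the others have total
    mass at most the affinity. *)
Theorem singular_of_affinity : (forall c, 0 < c -> exists n, aff x0 T lam n <= c) ->
  invariant_measure_singular T.
Proof.
move=> haff P hP; apply: (singular_of_small (mu := lebesgue_measure)) => e e0.
have [n hn] := haff e e0.
pose s := [seq (a, f) | a <- enum A, f <- tower n a].
have sP i : i \in s -> i.2 \in tower n i.1 by case/allpairsPdep => a [f [_ fa ->]].
pose F (i : A * (R * R)) : set (measurableTypeR R) := flo n i.1 i.2.
have mF i : measurable (F i) by exact: measurable_ico.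
pose c (i : A * (R * R)) := i.2.2 * alen (Tn n) i.1 <= lam n i.1.
pose g (i : A * (R * R)) := Num.sqrt (i.2.2 * alen (Tn n) i.1 * lam n i.1).
have eaff : \sum_(i <- s) g i = aff x0 T lam n.
  by rewrite big_allpairs_dep big_enum.
have g0 i : 0 <= g i by exact: sqrtr_ge0.
have lep (q : pred (A * (R * R))) : \sum_(i <- s | q i) g i <= e.
  by apply: le_trans hn; rewrite -eaff [leRHS](bigID q) /= lerDl sumr_ge0.
have len0 a : 0 < alen (Tn n) a by have [_ []] := keane_admissible x0 hA n aT kT.
have key (u v : R) : 0 < u -> u <= v -> u <= Num.sqrt (u * v).
  move=> u0 uv; rewrite -[leLHS](ger0_norm (ltW u0)) -sqrtr_sqr ler_sqrt; first by rewrite expr2 ler_pM2l.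
  by rewrite mulr_ge0 // ltW // (lt_le_trans u0).
have f0 i : i \in s -> 0 < i.2.2 * alen (Tn n) i.1.
  by move=> /sP /(floor_slope hA aT kT s1 s2) h; rewrite mulr_gt0.
exists (\big[setU/set0]_(i <- s | c i) F i); split; first exact: bigsetU_measurable.
  apply: (@le_trans _ _ (\sum_(i <- s | c i) g i)%:E); last by rewrite lee_fin.
  apply: measure_bigsetU_le => // i si ci.
  apply: (@le_trans _ _ (i.2.2 * alen (Tn n) i.1)%:E).
    rewrite le_eqVlt; apply/orP; left; apply/eqP.
    have -> : F i = [set` `[i.2.1, (i.2.1 + i.2.2 * alen (Tn n) i.1)[%R].
      by apply/seteqP; split=> x /=; rewrite in_itv.
    apply: etrans (@lebesgue_measure_itv R _) _.
    by rewrite /= lte_fin ltrDl f0 // -EFinB addrAC subrr add0r.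
  by rewrite lee_fin; apply: key => //; exact: f0.
have [hU _] := hP.
have mU : measurable (@unit_itv R) by exact: (measurable_ico 0 1).
have mG : measurable (\big[setU/set0]_(i <- s | ~~ c i) F i) by exact: bigsetU_measurable.
apply: (@le_trans _ _ (P (\big[setU/set0]_(i <- s | ~~ c i) F i `|` ~` @unit_itv R))).
  apply: le_measure; rewrite ?inE //.
  - by apply: measurableC; exact: bigsetU_measurable.
  - by apply: measurableU => //; exact: measurableC.
  move=> x hx; case: (pselect (unit_itv x)) => [ux|]; [left|by right].
  have [a [f [fa fx]]] := floor_cover x0 hA aT kT s1 s2 n ux.
  have ins : (a, f) \in s by apply/allpairsPdep; exists a, f; rewrite mem_enum.
  apply: (mem_bigsetU ins) => //; apply/negP => ci; apply: hx; exact: (mem_bigsetU ins).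
apply: le_trans (measureU2 _ _ _) _ => //; first exact: measurableC.
have PU : P (~` @unit_itv R) = 0%E.
  by apply: etrans (probability_setC P mU) _; rewrite hU subee.
apply: le_trans (leeD (lexx _) (_ : _ <= 0)%E) _; first by rewrite le_eqVlt; apply/orP; left; apply/eqP.
rewrite adde0.
apply: (@le_trans _ _ (\sum_(i <- s | ~~ c i) g i)%:E); last by rewrite lee_fin.
apply: measure_bigsetU_le => // i si ci.
rewrite -[leLHS]fineK ?fin_num_measure // lee_fin (invariant_floor hA aT kT s1 s2 recurrent lam_back lam_gt0 lam_sum hP (sP i si)).
rewrite /g mulrC; apply: key => //; apply: ltW; rewrite ltNge; exact: ci.
Qed.

End SingularAIET.

(** * Growth in Zorich time *)

Section Zorich.
Variables (R : realType) (A : finType) (x0 : A).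
Hypothesis hA : (2 <= #|A|)%N.
Notation pair := (seq A * seq A)%type.
Notation win := (win x0).
Notation los := (los x0).
Notation hword := (hword x0).
Variables (p : pair) (ty : nat -> bool).
Hypothesis okp_ : okp p.
Hypothesis alternating : forall n, exists k, (n < k)%N && (ty k != ty n).
Notation pn n := (pair_at x0 p ty n).
Notation q := (@height_at R A x0 p ty).

Fixpoint switch_time j := if j is j'.+1 then zorich_next ty (switch_time j') else 0%N.
Notation z := switch_time.

Lemma switchP j : [/\ (z j < z j.+1)%N, ty (z j.+1) = ~~ ty (z j) &
  forall i, (z j <= i < z j.+1)%N -> ty i = ty (z j)].
Proof.
rewrite /= /zorich_next; case: pselect => [h|/(_ (alternating _))] //.
case: ex_minnP => m /andP[zm tm] mmin; split=> // [|i /andP[zi im]].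
  by case: (ty m) tm; case: (ty (z j)).
apply/eqP; apply: contraT => hi; have [e|zi'] := eqVneq i (z j); first by rewrite e eqxx in hi.
by move: im; rewrite ltnNge mmin // hi andbT ltn_neqAle eq_sym zi' zi.
Qed.

Lemma switch_leq i j : (i <= j)%N -> (z i <= z j)%N.
Proof.
move=> /subnKC <-; elim: (j - i)%N => [|k IH]; first by rewrite addn0.
by rewrite addnS (leq_trans IH) //; case: (switchP (i + k)) => /ltnW.
Qed.

Lemma switch_ge j : (j <= z j)%N.
Proof. by elim: j => // j IH; apply: leq_ltn_trans IH _; case: (switchP j). Qed.

Let W j := win (pn (z j)) (ty (z j)).

Lemma pair_atS n : pn n.+1 = rz x0 (pn n) (ty n).
Proof. by rewrite /pair_at mkseqS rzw_rcons. Qed.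

Lemma height_atS n : q n.+1 = hstep x0 (pn n) (ty n) (q n).
Proof. by rewrite /height_at mkseqS hword_rcons. Qed.

Lemma height_leq m n a : (m <= n)%N -> q m a <= q n a.
Proof. by move=> /subnKC <-; exact: height_mono. Qed.

(* The winner of a Zorich block is the loser of the first step of the next block. *)
Lemma switch_height j : q (z j.+1).+1 (W j) = q (z j.+1) (W j) + q (z j.+1) (W j.+1).
Proof.
have [zz tz cz] := switchP j.
have cw i : (z j <= i)%N -> (i <= z j.+1)%N -> win (pn i) (ty (z j)) = W j.
  move=> /subnKC <-; elim: (i - z j)%N => [|k IH] h; first by rewrite addn0.
  rewrite addnS in h *; rewrite pair_atS (cz (z j + k)%N) ?leq_addr // win_rz IH //; exact: ltnW.
rewrite height_atS /hstep -/(W j.+1); have -> : los (pn (z j.+1)) (ty (z j.+1)) = W j.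
  by rewrite /los tz negbK cw // ltnW.
by rewrite eqxx.
Qed.

(** Two of the winners of [#|A|.+1] consecutive blocks coincide. Between them, cyclically, take the
    one of least height: the next block adds to it the height of its successor, which is no
    smaller. *)
Lemma vol_doubles j : 2 * vol (q (z j)) <= vol (q (z (j + #|A|.+1))).
Proof.
pose f (i : 'I_#|A|.+1) := W (j + i).
have [i1 [i2 [lt_i fi]]] : exists i1 i2 : 'I_#|A|.+1, (i1 < i2)%N /\ f i1 = f i2.
  apply: contrapT => h; have : injective f.
    move=> i k fik; apply: contrapT => ne; apply: h.
    case: (ltngtP i k) => ik; [by exists i, k|by exists k, i|].
    by case: ne; apply: val_inj.
  by move=> /leq_card; rewrite card_ord ltnn.
pose P (s : 'I_#|A|.+1) := (i1 <= s < i2)%N.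
have P1 : P i1 by rewrite /P leqnn.
have [s /andP[s1 s2] smin] : exists2 s, P s & forall s', P s' -> q (z j) (f s) <= q (z j) (f s').
  pose s := [arg min_(s < i1 | P s) q (z j) (f s)]%O; exists s; rewrite /s.
    by case: Order.TotalTheory.arg_minP.
  by case: Order.TotalTheory.arg_minP.
have sn : q (z j) (f s) <= q (z j) (W (j + s).+1).
  have s'A : (s.+1 < #|A|.+1)%N by apply: leq_ltn_trans (ltn_ord i2).
  rewrite -addnS -[W _]/(f (Ordinal s'A)).
  (* The successor of the last index is the winner at [i2], which is that at [i1]. *)
  have [e|ne] := eqVneq s.+1 i2; last by apply: smin; rewrite /P /= leqW //= ltn_neqAle ne.
  by rewrite (_ : f (Ordinal s'A) = f i1) ?smin // fi; congr f; apply: val_inj.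
have hs : 2 * q (z j) (f s) <= q (z (j + #|A|.+1)) (f s).
  apply: (@le_trans _ _ (q (z (j + s).+1).+1 (W (j + s)))); last first.
    apply: height_leq; have [h _ _] := switchP (j + s).+1; apply: leq_trans h _.
    by apply: switch_leq; have := ltn_ord i2; lia.
  rewrite switch_height mulrDl mul1r.
  have h : (z j <= z (j + s).+1)%N by apply: switch_leq; lia.
  by apply: lerD; [exact: height_leq|apply: le_trans sn (height_leq _ h)].
rewrite /vol (bigD1 (f s)) //= [leRHS](bigD1 (f s)) //= mulrA.
have q0 n a : 0 <= q n a by apply: ltW; exact: height_gt0.
apply: ler_pM => //; first by rewrite mulr_ge0.
  by apply: prodr_ge0.
by apply: ler_prod => a _; rewrite q0 height_leq // switch_leq // leq_addr.
Qed.

(** The product of the heights doubles every [#|A|.+1] blocks and is at most the power [#|A|] of the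
    total. *)
Lemma tot_switch j : #|A|%:R * ln (tot (q (z j))) >= (j %/ #|A|.+1)%:R * ln 2.
Proof.
have A0 : (0 < #|A|)%N by exact: leq_trans hA.
have h i : 2 ^+ i <= vol (q (z (i * #|A|.+1))).
  elim: i => [|i IH]; first by rewrite mul0n /vol /height_at big1.
  by rewrite exprS mulSnr; apply: le_trans (vol_doubles _); rewrite ler_pM2l.
have hj : 2 ^+ (j %/ #|A|.+1) <= tot (q (z j)) ^+ #|A|.
  apply: le_trans (h _) _; rewrite /vol -prodr_const; apply: ler_prod => a _.
  rewrite ltW ?height_gt0 //=; apply: le_trans (sumq_le a _) => [|c]; last by rewrite ltW // height_gt0.
  by apply: height_leq; apply: switch_leq; exact: leq_trunc_div.
have t0 : 0 < tot (q (z j)) by exact: tot_ones_gt0.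
have : ln (2 ^+ (j %/ #|A|.+1)) <= ln (tot (q (z j)) ^+ #|A|) by rewrite ler_ln // posrE exprn_gt0.
by rewrite (lnXn _ (ltr0n R 2)) (lnXn _ t0) mulr_natl mulr_natl.
Qed.

(** Injectivity keeps the norm of a nonzero vector positive, so that its logarithm can be
    estimated. *)
Lemma hword_eq0 r u (v : A -> R) : okp r -> hword r u v = (fun=> 0) -> v = (fun=> 0).
Proof.
elim: u r v => //= b u IH r v ok /IH h; have {}h := h (okp_rz x0 hA b ok).
have wl := win_los x0 hA b ok.
have e a : v a + (if a == los r b then v (win r b) else 0) = 0 by have := congr1 (@^~ a) h.
have vw : v (win r b) = 0 by have := e (win r b); rewrite (negPf wl) addr0.
by apply/funext => a; have := e a; rewrite vw if_same addr0.
Qed.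

Variables (t : nat -> nat) (M : R).
Hypothesis t0 : t 0%N = 0%N.
Hypothesis tS : forall k, (t k < t k.+1)%N.
Hypothesis balanced : forall k a c, (0 < k)%N -> q (t k) c <= M * q (t k) a.

Lemma t_leq i j : (i <= j)%N -> (t i <= t j)%N.
Proof.
move=> /subnKC <-; elim: (j - i)%N => [|k IH]; first by rewrite addn0.
by rewrite addnS (leq_trans IH) // ltnW.
Qed.

Lemma t_locate n : exists k, (t k <= n < t k.+1)%N.
Proof.
elim: n => [|n [k /andP[h1 h2]]]; first by exists 0%N; rewrite t0 /= -{1}t0.
have [h|h] := leqP (t k.+1) n.+1; last by exists k; rewrite h leqW.
by exists k.+1; rewrite h; have := tS k.+1; lia.
Qed.

Lemma norm_between v k n m : (0 < k)%N -> (t k <= n < t k.+1)%N ->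
  (forall a, `|hword p (mkseq ty (t k)) v a| <= m) ->
  l1norm (hword p (mkseq ty n) v) <= m * (#|A|%:R * M) * (tot (q (t k.+1)) / tot (q (t k))).
Proof.
move=> k0 /andP[kn nk] hm; set u := window ty (t k) (n - t k).
have en : mkseq ty n = mkseq ty (t k) ++ u by rewrite -mkseq_window subnKC.
have T0 : 0 < tot (q (t k)) by exact: tot_ones_gt0.
have m0 : 0 <= m by apply: le_trans (hm x0).
have hu a : tot (q (t k)) * hword (pn (t k)) u (fun=> 1) a <= #|A|%:R * M * q n a.
  have -> : q n = hword (pn (t k)) u (q (t k)) by rewrite /height_at en hword_cat.
  rewrite -!hword_scale; apply: hword_mono => c; rewrite mulr1.
  apply: (@le_trans _ _ (\sum_(a : A) M * q (t k) c)); last by rewrite sumr_const -[leLHS]mulr_natl mulrA.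
  by apply: ler_sum => e _; exact: balanced.
have ha a : `|hword p (mkseq ty n) v a| <= m * (#|A|%:R * M * q n a / tot (q (t k))).
  rewrite en hword_cat; apply: (le_trans (hword_norm _ _ _ _ _)).
  apply: (@le_trans _ _ (m * hword (pn (t k)) u (fun=> 1) a)).
    by rewrite -hword_scale; apply: hword_mono => c; rewrite mulr1.
  by rewrite ler_wpM2l // ler_pdivlMr // mulrC.
apply: (@le_trans _ _ (\sum_a m * (#|A|%:R * M * q n a / tot (q (t k))))); first by apply: ler_sum => a _.
have M0 : 0 <= M.
  have h := balanced x0 x0 k0; have q0 : 0 < q (t k) x0 by exact: height_gt0.
  by rewrite -(pmulr_lge0 _ q0) (le_trans _ h) // ltW.
rewrite -mulr_sumr -mulr_suml -mulr_sumr -[leRHS]mulrA ler_wpM2l // -[leLHS]mulrA.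
apply: ler_wpM2l; first by rewrite mulr_ge0.
rewrite ler_wpM2r ?invr_ge0 ?(ltW T0) //.
by apply: ler_sum => a _; apply: height_leq; exact: ltnW.
Qed.

Hypothesis growth : exists D, \forall k \near \oo, tot (q (t k)) <= expR (D * k%:R).
Hypothesis increments : forall e, 0 < e -> \forall k \near \oo, tot (q (t k.+1)) <= expR (e * k%:R) * tot (q (t k)).

(** Return index and Zorich index are compared through the total height, at most exponential in the
    former by [growth] and at least exponential in the latter by [tot_switch]. *)
Lemma energy_decay v : (exists c, 0 < c /\ \forall k \near \oo,
    \sum_a hword p (mkseq ty (t k)) v a ^+ 2 <= expR (- c * k%:R)) ->
  v = (fun=> 0) \/ exists c : R, c < 0 /\
    \forall j \near \oo, ln (l1norm (hword p (mkseq ty (z j)) v)) / j%:R <= c.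
Proof.
move=> [c [c0 [K1 _ hK1]]].
have [D [K2 _ hK2]] := growth.
(* The square root of the energy decays at the rate [c / 2]; the growth between two returns is
   allowed to consume half of it. *)
have [K3 _ hK3] := increments (divr_gt0 c0 (ltr0n _ 4)).
have [->|v0] := pselect (v = (fun=> 0)); [by left|right].
pose D' := Num.max D 1.
have D'0 : 0 < D' by rewrite lt_max ltr01 orbT.
have A0 : 0 < #|A|%:R :> R by rewrite ltr0n; exact: leq_trans hA.
have l20 : 0 < ln 2 :> R by rewrite ln_gt0 // ltr1n.
pose al := ln 2 / (#|A|%:R * D').
have al0 : 0 < al by rewrite divr_gt0 // mulr_gt0.
pose K := (maxn K1 (maxn K2 K3)).+1.
have key j : (t K <= j)%N -> exists k, [/\ ln (l1norm (hword p (mkseq ty (z j)) v)) <= ln (#|A|%:R * M) - c / 4 * k%:R &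
    al * (j %/ #|A|.+1)%:R <= k.+1%:R].
  move=> Kj; have [k /andP[k1 k2]] := t_locate (z j).
  have Kk : (K <= k)%N.
    rewrite leqNgt; apply/negP => kK; have := t_leq kK; have := switch_ge j; lia.
  have k0 : (0 < k)%N by exact: leq_trans (ltn0Sn _) Kk.
  have [Kk1 Kk2 Kk3] : [/\ (K1 <= k)%N, (K2 <= k)%N & (K3 <= k)%N] 
    by have : (maxn K1 (maxn K2 K3) <= k)%N := ltnW Kk; rewrite !geq_max => /and3P[].
  have T0 i : 0 < tot (q i) by exact: tot_ones_gt0.
  exists k; split.
    have hm a : `|hword p (mkseq ty (t k)) v a| <= expR (- (c / 2) * k%:R).
      have h1 : hword p (mkseq ty (t k)) v a ^+ 2 <= expR (- (c / 2) * k%:R) ^+ 2.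
        rewrite -expRM_natl; have -> : 2%:R * (- (c / 2) * k%:R) = - c * k%:R by field.
        apply: le_trans (hK1 k Kk1); rewrite (bigD1 a) //= lerDl.
        by apply: sumr_ge0 => e _; exact: sqr_ge0.
      by move: h1; rewrite -(real_normK (num_real (hword _ _ _ _))) ler_sqr // nnegrE expR_ge0.
    have kz : (t k <= z j < t k.+1)%N by rewrite k1 k2.
    have h := norm_between k0 kz hm.
    have M0 : 0 < M.
      have q0 : 0 < q (t k) x0 by exact: height_gt0.
      by rewrite -(pmulr_lgt0 _ q0); apply: lt_le_trans q0 (balanced _ _ k0).
    have AM : 0 < #|A|%:R * M by rewrite mulr_gt0.
    have h2 : l1norm (hword p (mkseq ty (z j)) v) <= #|A|%:R * M * expR (- (c / 4 * k%:R)).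
      apply: le_trans h _; have e : - (c / 4 * k%:R) = - (c / 2) * k%:R + c / 4 * k%:R by field.
      rewrite e expRD mulrA [_ * expR (- (c / 2) * _)]mulrC; apply: ler_wpM2l.
        by rewrite mulr_ge0 ?expR_ge0 ?(ltW AM).
      by rewrite ler_pdivrMr //; exact: hK3.
    have l0 : 0 < l1norm (hword p (mkseq ty (z j)) v).
      rewrite lt_neqAle eq_sym; apply/andP; split; last by apply: sumr_ge0.
      apply/eqP => e; apply: v0; apply: (@hword_eq0 p (mkseq ty (z j))) => //.
      apply/funext => a; apply/eqP; rewrite -normr_eq0.
      by move/eqP: e; rewrite /l1norm psumr_eq0 // => /allP; apply; rewrite mem_index_enum.
    have := h2; rewrite -ler_ln ?posrE ?mulr_gt0 ?expR_gt0 // lnM ?posrE ?expR_gt0 //.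
    by rewrite expRK.
  have h1 := tot_switch j.
  have h2 : ln (tot (q (z j))) <= D' * k.+1%:R.
    apply: (@le_trans _ _ (ln (tot (q (t k.+1))))).
      by rewrite ler_ln ?posrE // ler_sum // => a _; apply: height_leq; exact: ltnW.
    apply: (@le_trans _ _ (D * k.+1%:R)); last by rewrite ler_wpM2r // le_max lexx.
    rewrite -[leRHS]expRK ler_ln ?posrE ?expR_gt0 //; apply: hK2; exact: leq_trans Kk2 (leqnSn _).
  rewrite /al mulrAC ler_pdivrMr ?mulr_gt0 // [leLHS]mulrC; apply: le_trans h1 _.
  by rewrite [leRHS]mulrC -mulrA ler_pM2l.
pose g := al / #|A|.+1%:R.
have g0 : 0 < g by rewrite divr_gt0.
have cg : 0 < c / 8 * g by rewrite mulr_gt0 // divr_gt0.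
(* Half of the remaining rate [c / 4] absorbs the additive constants collected in [be]. *)
exists (- (c / 8 * g)); split; first by rewrite oppr_lt0.
pose be := ln (#|A|%:R * M) + c / 4 * (1 + al).
exists (maxn (t K) (Num.bound `|be / (c / 8 * g)|)).+1 => // j /= hj.
have [k [h1 h2]] := key j (leq_trans (leq_maxl _ _) (ltnW hj)).
have j0 : 0 < j%:R :> R by rewrite ltr0n (leq_ltn_trans _ hj).
have hb : be <= c / 8 * g * j%:R.
  rewrite mulrC -ler_pdivrMr //; apply: le_trans (ler_norm _) _.
  apply: le_trans (ltW (archi_boundP (normr_ge0 _))) _; rewrite ler_nat.
  exact: leq_trans (leq_maxr _ _) (ltnW hj).
have hdiv : j%:R / #|A|.+1%:R <= (j %/ #|A|.+1)%:R + 1 :> R.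
  by rewrite natr1 ler_pdivrMr // -natrM ler_nat ltnW // ltn_ceil.
have hk : g * j%:R - al - 1 <= k%:R.
  have : al * (j%:R / #|A|.+1%:R) <= al * ((j %/ #|A|.+1)%:R + 1) by rewrite ler_pM2l.
  have -> : al * (j%:R / #|A|.+1%:R) = g * j%:R by rewrite /g [RHS]mulrAC [LHS]mulrA.
  by move: h2; rewrite mulrDr mulr1 -natr1; lra.
rewrite ler_pdivrMr // mulNr; apply: le_trans h1 _.
have : c / 4 * (g * j%:R - al - 1) <= c / 4 * k%:R by rewrite ler_pM2l // divr_gt0.
move: hb; rewrite /be; move: (ln _) => x.
have -> : c / 4 * (g * j%:R - al - 1) = 2 * (c / 8 * g * j%:R) - c / 4 * (1 + al) by field.
lra.
Qed.

End Zorich.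

(** * Almost every exchange *)

Section Coding.
Variables (A : finType) (x0 : A).
Hypothesis hA : (2 <= #|A|)%N.
Notation pair := (seq A * seq A)%type.
Variables (l0 : nat) (p : pair) (ty : nat -> bool) (y : nat -> pair * seq bool).
Hypothesis okp_ : okp p.
Hypothesis valid_y : forall k, valid x0 l0 p (mkseq y k).
Hypothesis coded : forall k, mkseq ty (size (flat (mkseq y k))) = flat (mkseq y k).
Notation SL := (strong_len A l0).
Notation pn n := (pair_at x0 p ty n).

Definition return_time k := size (flat (mkseq y k)).
Notation t := return_time.
Definition segment_start k := (t k.+1 - SL)%N.

Lemma return_timeS k : t k.+1 = (t k + size (y k).2)%N.
Proof. by rewrite /t mkseqS flat_rcons size_cat. Qed.

Lemma return_word k : (y k).2 = window ty (t k) (size (y k).2) /\ ends_strong x0 l0 (pn (t k)) (y k).2.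
Proof.
split.
  have := coded k.+1; rewrite -/(t k.+1) return_timeS mkseq_window mkseqS flat_rcons /t coded.
  by move/eqP; rewrite eqseq_cat // eqxx /= => /eqP.
have := valid_y k.+1; rewrite mkseqS valid_rcons => /and3P[_ _ /andP[]].
by rewrite /pair_at /t coded.
Qed.

Lemma return_long k : (SL <= size (y k).2)%N.
Proof. by have [_ /andP[]] := return_word k. Qed.

Lemma segment_startS k : t k.+1 = (segment_start k + SL)%N.
Proof. by rewrite /segment_start subnK // return_timeS (leq_trans (return_long k)) // leq_addl. Qed.

Lemma segment_start_ge k : (t k <= segment_start k)%N.
Proof. by have := segment_startS k; have := return_long k; rewrite return_timeS; lia. Qed.

Lemma segment_chunks k : chunks x0 l0 (nchunks A) (pn (segment_start k)) (window ty (segment_start k) SL).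
Proof.
have [e /andP[_ /andP[_]]] := return_word k; rewrite e size_mkseq; set s := (size _ - SL)%N.
have es : (t k + s = segment_start k)%N.
  by rewrite /segment_start return_timeS /s addnBA // return_long.
have -> : drop s (window ty (t k) (size (y k).2)) = window ty (segment_start k) SL.
  rewrite -es -(@drop_window _ _ (size (y k).2)); last by rewrite subnK // return_long.
  by rewrite take_oversize // size_drop size_mkseq subKn // return_long.
by rewrite take_window ?leq_subr // -es /pair_at mkseq_window rzw_cat.
Qed.

Hypothesis l0_gt0 : (0 < l0)%N.

Lemma return_time_lt k : (t k < t k.+1)%N.
Proof.
rewrite return_timeS -addn1 leq_add2l; apply: leq_trans (return_long k).
by rewrite muln_gt0 l0_gt0 andbT /nchunks addn2.
Qed.

Lemma return_time_ge k : (k <= t k)%N.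
Proof. by elim: k => // k IH; exact: leq_ltn_trans IH (return_time_lt k). Qed.

Lemma code_recurrent N : exists2 m, (N <= m)%N & posw x0 (pn m) (window ty m l0).
Proof.
exists (segment_start N); first exact: leq_trans (return_time_ge N) (segment_start_ge N).
have := segment_chunks N; rewrite {1}/nchunks addn2 /= => /andP[+ _]; rewrite take_window //.
by rewrite leq_pmull // /nchunks addn2.
Qed.

Lemma code_alternating n : exists k, (n < k)%N && (ty k != ty n).
Proof.
have [m nm /(posw_both_types hA (~~ ty n))] := code_recurrent n.+1.
move=> /mapP[i _ e]; exists (m + i)%N; rewrite (leq_trans nm) ?leq_addr //= -e.
by case: (ty n).
Qed.

End Coding.

(** * From a generic path to a good exchange *)

Section Final.
Variables (R : realType) (A : finType) (x0 : A).
Hypothesis hA : (2 <= #|A|)%N.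
Notation pair := (seq A * seq A)%type.

(** Cones are invariant under scaling, so a cover serves all positive multiples. *)
Lemma small_normalize (S : set (A -> R)) : small S ->
  small [set lam : A -> R | (forall a, 0 < lam a) /\ S (normalize lam)].
Proof.
move=> hS eps eps0; have [U [pU cU sU]] := hS eps eps0; exists U; split=> // lam [l0 /cU [e Ue [v [v0 ev]]]].
exists e => //; exists (fun a => (\sum_b lam b) * v a); split.
  by move=> a; rewrite mulr_ge0 // sumr_ge0 // => b _; exact: ltW.
have s0 : \sum_b lam b != 0.
  by rewrite gt_eqF // (bigD1 x0) //= ltr_wpDr // sumr_ge0 // => b _; exact: ltW.
have sc (c : R) : ebacks e (fun a => c * v a) = (fun a => c * ebacks e v a).
  rewrite /ebacks; elim: (e) => //= s e' ->; apply/funext => a; rewrite /eback mulrDr.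
  by case: ifP; rewrite ?mulr0.
rewrite sc -ev; apply/funext => a; rewrite /normalize mulrC divfK //.
Qed.

Lemma iet_backward (p : pair) (lam : A -> R) : okp p -> (forall a, 0 < lam a) -> keane (iet p lam) ->
  backward x0 p (rv_type (iet p lam)) (fun n => alen (rv_iter n (iet p lam))) /\
  forall n a, 0 < alen (rv_iter n (iet p lam)) a.
Proof.
move=> ok lp kT.
have it n := @iet_iter R A x0 hA p lam n ok lp (fun i _ => kT i).
split=> [n|n a]; last by have [l' [h _ ->]] := it n.
have [l' [h _ e]] := it n.
have ok' : okp (rzw x0 p (mkseq (rv_type (iet p lam)) n)) by exact: okp_rzw.
have k1 i : (i < 1)%N -> rv_defined (rv_iter i (iet (rzw x0 p (mkseq (rv_type (iet p lam)) n)) l')).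
  by rewrite ltnS leqn0 => /eqP ->; rewrite -e; exact: kT.
have [l'' [_ e1 e2]] := @iet_iter R A x0 hA _ l' 1 ok' h k1.
have e3 : rv_iter n.+1 (iet p lam) = rv_iter 1 (iet (rzw x0 p (mkseq (rv_type (iet p lam)) n)) l').
  by rewrite /= -e.
rewrite e3 e2 e /= [LHS]e1 /= /pair_at; congr (bstep _ _ _ _).
by rewrite /rv_type /= e.
Qed.

Lemma zorich_timeE (T : aiet R A) j : zorich_time T j = switch_time (rv_type T) j.
Proof. by elim: j => //= j ->. Qed.

Variable l0 : nat.
Hypothesis l0_gt0 : (0 < l0)%N.
Variables (p : pair) (okp_ : okp p) (lam : A -> R).
Hypothesis lam_gt0 : forall a, 0 < lam a.
Hypothesis lam_sum : \sum_a lam a = 1.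
Hypothesis keane_lam : keane (iet p lam).
Notation ty := (rv_type (iet p lam)).
Notation ones := ((fun=> 1) : A -> R).
Variable y : nat -> pair * seq bool.
Hypothesis valid_y : forall k, valid x0 l0 p (mkseq y k).
Hypothesis coded : forall k, mkseq ty (size (flat (mkseq y k))) = flat (mkseq y k).
Hypothesis decay : forall v : A -> R,
  (exists B, forall n, \sum_(0 <= k < n) \sum_a hword x0 p (flat (mkseq y k)) v a ^+ 2 <= B) ->
  exists c, 0 < c /\ \forall k \near \oo, \sum_a hword x0 p (flat (mkseq y k)) v a ^+ 2 <= expR (- c * k%:R).
Hypothesis growth : exists D, \forall k \near \oo, tot (hword x0 p (flat (mkseq y k)) ones) <= expR (D * k%:R).
Hypothesis increments : forall e, 0 < e -> \forall k \near \oo, tot (hword x0 p (flat (mkseq y k.+1)) ones) <=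
  expR (e * k%:R) * tot (hword x0 p (flat (mkseq y k)) ones).

(** Equal rotation numbers give equal rows and types, so the induced lengths of the isometric
    exchange serve as masses on the towers of [T]. Singularity is proved by contraposition, from
    [in_Es]. *)
Lemma coded_good : good_iet p lam.
Proof.
split=> // om _ nEs T [[pT [len0 [img0 [s1 s2]]]] [logT [kT gT]]].
have rT : rows T = p.
  by have := congr1 (fun g => (g 0%N).1) gT; rewrite /gamma /rows /=; case: (p).
have tT : rv_type T = ty by apply/funext => n; have := congr1 (fun g => (g n).2) gT.
have aT : admissible T by split; rewrite ?rT.
have [lb lp] := iet_backward okp_ lam_gt0 keane_lam.
pose L n := alen (rv_iter n (iet p lam)).
have lb' : backward x0 (rows T) (rv_type T) L by rewrite rT tT.
have rec : forall N, exists2 m, (N <= m)%N &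
    posw x0 (pair_at x0 (rows T) (rv_type T) m) (window (rv_type T) m l0).
  by rewrite rT tT; exact: (code_recurrent hA valid_y coded l0_gt0).
split; first exact: (aiet_uniquely_ergodic hA aT kT s1 s2 rec lb' lp lam_sum).
apply: (singular_of_affinity hA aT kT s1 s2 rec lb' lp lam_sum) => c c0.
apply: contrapT => hc; apply: nEs.
have hc' n : c <= aff x0 T L n by rewrite leNgt; apply/negP => h; apply: hc; exists n; exact: ltW.
have [||||B hB] := @energy_bounded R A x0 hA T aT kT L lb' lp l0 l0_gt0 (return_time y) (segment_start l0 y) _ _ _ _ c c0 hc'.
- by [].
- by move=> k; exact: (segment_start_ge hA valid_y coded).
- by move=> k; exact: (segment_startS valid_y coded).
- by move=> k; rewrite rT tT; exact: (segment_chunks valid_y coded).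
have logE : logslope T = om by apply/funext.
have [|c' [c'0 hc'0]] := decay (v := om).
  exists B => n; apply: le_trans (hB n); rewrite le_eqVlt; apply/orP; left; apply/eqP.
  apply: eq_bigr => k _; apply: eq_bigr => a _.
  by rewrite (logslope_iter x0 hA _ aT kT) rT tT logE /return_time coded.
have hE k : height_at R x0 p ty (return_time y k) = hword x0 p (flat (mkseq y k)) ones.
  by rewrite /height_at /return_time coded.
have := @energy_decay R A x0 hA p ty okp_ (code_alternating hA valid_y coded l0_gt0) (return_time y) (2 ^+ l0)
  (erefl _) (return_time_lt valid_y coded l0_gt0) _ _ _ om _.
case.
- by move=> k a c1 k0; rewrite hE; apply: (flat_balanced R (l0 := l0)) => //; case: k k0 => // k _; rewrite mkseqS; case: (mkseq y k).
- by have [D hD] := growth; exists D; apply: filterS hD => k; rewrite hE.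
- by move=> e e0; apply: filterS (increments e0) => k; rewrite !hE.
- by exists c'; split=> //; apply: filterS hc'0 => k; rewrite /return_time coded.
- by left.
move=> [c1 [c10 hc1]]; right; exists c1; split=> //; apply: filterS hc1 => j.
have rp : rows (iet p lam) = p by rewrite /rows /=; case: (p).
by rewrite /zorich_cocycle zorich_timeE (rv_cocycleE x0 hA) rp.
Qed.

End Final.

Theorem theorem3p2 (R : realType) (A : finType) (hA : (2 <= #|A|)%N)
    (p : seq A * seq A) (hp : is_pair p) (hirr : irreducible p) :
  lebesgue_null [set lam : A -> R |
    (forall a, 0 < lam a) /\ ~ good_iet p (normalize lam)].
Proof.
have /card_gt0P[x0 _] : (0 < #|A|)%N by exact: leq_trans hA.
have ok : okp p by [].
have [l0 [l0_gt0 l0_pos]] := uniform_positive x0 hA.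
have [th [C [th01 C1 moment]]] := moment_bound R hA l0_gt0 l0_pos.
have [E [E0 hE]] := generic_types hA l0_gt0 th01 C1 moment ok.
pose S1 : set (A -> R) := [set lam | (forall a, 0 < lam a) /\ ~ keane (iet p lam)].
pose S2 : set (A -> R) := [set lam | [/\ forall a, 0 < lam a, keane (iet p lam) & E (rv_type (iet p lam))]].
have sS : small (S1 `|` S2).
  apply: small_setU; first exact: small_not_keane.
  apply: (small_types hA ok E0) => lam [lam_gt0 kl El]; exists (rv_type (iet p lam)); split=> // n.
  have [v [v0 ev _]] := iet_iter x0 hA ok lam_gt0 (fun i (_ : (i < n)%N) => kl i).
  by exists v; split=> // a; exact: ltW.
apply: (small_null x0); apply: (small_sub _ (small_normalize x0 sS)) => lam [lam_gt0 bad]; split=> //.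
have s0 : 0 < \sum_b lam b.
  by rewrite (bigD1 x0) //= ltr_wpDr // sumr_ge0 // => b _; exact: ltW.
have n_gt0 a : 0 < normalize lam a by rewrite divr_gt0.
have n_sum : \sum_a normalize lam a = 1 by rewrite -mulr_suml divff // gt_eqF.
have [kl|nk] := pselect (keane (iet p (normalize lam))); [right|by left].
split=> //; apply: contrapT => /hE [y [vy cy dec gr inc]]; apply: bad.
exact: (coded_good hA l0_gt0 ok n_gt0 n_sum kl vy cy dec gr inc).
Qed.
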